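(* Let $f\colon\mathbb{N}\to\mathbb{R}$ be multiplicative and supported on squarefree integers. Suppose (a) there is $\theta\in(0,\tfrac12)$ with $f^2\in\mathbf{P}_\theta$; (b) there is $c>0$ with $\sum_p|f(p)|^3/p^{3/2-c}<\infty$. Then with $V^\beta_\infty:=\frac{1}{2\pi}\int_{\mathbb{R}}\frac{m^\beta_\infty(ds)}{|\frac12+is|^2}$, the random variable $V^\beta_\infty$ is almost surely finite and strictly positive and $$S^\beta_x\xrightarrow[x\to\infty]{d}\sqrt{V^\beta_\infty}\,G,$$ where $G\sim\mathcal{N}(0,1)$ is real standard Gaussian independent of $V^\beta_\infty$. Moreover the convergence is stable: for every bounded $\mathcal{F}^\beta_\infty$-measurable real $Y$ and bounded continuous $h\colon\mathbb{R}\to\mathbb{R}$, $\mathbb{E}[Yh(S^\beta_x)]\to\mathbb{E}[Yh(\sqrt{V^\beta_\infty}G)]$ with $G$ independent of $\mathcal{F}^\beta_\infty$.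
   Context: A function $f$ is multiplicative if $f(1)=1$ and $f(nm)=f(n)f(m)$ for coprime $n,m$. A Rademacher random multiplicative function $\beta$ is defined by taking $(\beta(p))_p$ i.i.d. with $\mathbb{P}(\beta(p)=1)=\mathbb{P}(\beta(p)=-1)=\tfrac12$, $\beta(n)=\prod_{p\mid n}\beta(p)$ for squarefree $n$ and $\beta(n)=0$ otherwise. $\mathcal{F}^\beta_\infty=\sigma(\beta(p):p\text{ prime})$. $S^\beta_x:=\big(\sum_{n\le x}f(n)^2\big)^{-1/2}\sum_{n\le x}\beta(n)f(n)$. For $\theta\in\mathbb{C}$, $\mathbf{P}_\theta$ is the class of $g\colon\mathbb{N}\to\mathbb{C}$ with $\sum_{p\le t}g(p)=\theta\frac{t}{\log t}+\mathcal{E}_g(t)$, $\mathcal{E}_g(t)=o(t/\log t)$, $\int_2^\infty t^{-2}|\mathcal{E}_g(t)|dt<\infty$. For $y\ge 2$, $m^\beta_{y,\infty}(ds):=\prod_{p\le y}\frac{|1+\beta(p)f(p)p^{-(1/2+is)}|^2}{1+f(p)^2/p}\,ds$. Under the hypotheses there is a random Radon measure $m^\beta_\infty$ on $\mathbb{R}$ such that for every bounded interval $I$ and continuous $h$ on $I$, $\int_I h\,dm^\beta_{y,\infty}\to\int_I h\,dm^\beta_\infty$ in $L^2$ as $y\to\infty$. *)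

(* Defs.v *)
From HB Require Import structures.
From mathcomp Require Import all_boot all_order all_algebra.
From mathcomp Require Import all_classical all_reals all_analysis.
From mathcomp Require Import measurable_realfun normal_distribution.

Set Implicit Arguments.
Unset Strict Implicit.
Unset Printing Implicit Defensive.

Import Order.TTheory GRing.Theory Num.Def Num.Theory.
Import numFieldNormedType.Exports.

Local Open Scope classical_set_scope.
Local Open Scope ring_scope.

Definition squarefree (n : nat) : bool :=
  (0 < n)%N && all (fun p => logn p n == 1)%N (primes n).

Definition multiplicative_arith {R : pzRingType} (f : nat -> R) : Prop :=
  f 1%N = 1 /\ forall m n : nat, coprime m n -> f (m * n)%N = f m * f n.

Definition supported_on_squarefree {R : pzRingType} (f : nat -> R) : Prop :=
  forall n : nat, ~~ squarefree n -> f n = 0.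

Definition prime_sum {R : realType} (g : nat -> R) (t : R) : R :=
  \sum_(p < (truncn t).+1 | prime p) g p.

Definition classP_err {R : realType} (g : nat -> R) (theta : R) (t : R) : R :=
  prime_sum g t - theta * (t / ln t).

Definition classP {R : realType} (g : nat -> R) (theta : R) : Prop :=
  (forall eps : R, 0 < eps ->
     \forall t \near +oo%R, `|classP_err g theta t| <= eps * `|t / ln t|)
  /\ (\int[lebesgue_measure]_(t in `[2%R, +oo[)
        ((t ^- 2 * `|classP_err g theta t|)%:E) < +oo)%E.

Definition mutually_independent {d} {T : measurableType d} {R : realType}
  (P : probability T R) (J : set nat) (X : nat -> T -> R) : Prop :=
  forall (s : seq nat) (B : nat -> set R),
    uniq s -> (forall i, i \in s -> J i) -> (forall i, measurable (B i)) ->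
    P (\big[setI/setT]_(i <- s) (X i @^-1` B i))
    = (\prod_(i <- s) P (X i @^-1` B i))%E.

Definition rademacher_family {d} {T : measurableType d} {R : realType}
  (P : probability T R) (b : nat -> T -> R) : Prop :=
  [/\ forall p, prime p -> measurable_fun setT (b p),
      forall p, prime p -> forall w, b p w = 1 \/ b p w = -1,
      forall p, prime p -> P [set w | b p w = 1] = (2^-1)%:E
    & mutually_independent P [set p | prime p] b].

Definition beta_n {T : Type} {R : realType} (b : nat -> T -> R) (n : nat) (w : T) : R :=
  if squarefree n then \prod_(p <- primes n) b p w else 0.

Definition S_beta {T : Type} {R : realType} (f : nat -> R) (b : nat -> T -> R)
  (x : nat) (w : T) : R :=
  (Num.sqrt (\sum_(1 <= n < x.+1) f n ^+ 2))^-1 * \sum_(1 <= n < x.+1) beta_n b n w * f n.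

(** density of m^beta_{y,infty}(ds) w.r.t. ds :
    prod_{p<=y} |1 + beta(p) f(p) p^{-(1/2+is)}|^2 / (1 + f(p)^2/p),
    with |1 + a p^{-1/2} e^{-is log p}|^2 written as Re^2 + Im^2 *)
Definition m_density {T : Type} {R : realType} (f : nat -> R) (b : nat -> T -> R)
  (y : nat) (w : T) (s : R) : R :=
  \prod_(p < y.+1 | prime p)
    (((1 + b p w * f p * (Num.sqrt p%:R)^-1 * cos (s * ln p%:R)) ^+ 2
      + (b p w * f p * (Num.sqrt p%:R)^-1 * sin (s * ln p%:R)) ^+ 2)
     / (1 + f p ^+ 2 / p%:R)).

Definition V_infty {d} {T : measurableType d} {R : realType}
  (m : T -> {measure set R -> \bar R}) (w : T) : \bar R :=
  (((2 * pi) ^-1)%:E * \int[m w]_(s in setT) (((4^-1 + s ^+ 2) ^-1)%:E))%E.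

Definition F_infty {d} {T : measurableType d} {R : realType} (b : nat -> T -> R) : set (set T) :=
  <<s [set A | exists p (B : set R), [/\ prime p, measurable B & A = b p @^-1` B]] >>.

Definition bounded_realfun {T : Type} {R : realType} (h : T -> R) : Prop :=
  exists M : R, forall x, `|h x| <= M.

(* Main.v *)
(** Expand everything in Walsh functions of the signs beta(p). Revealing the
    primes in increasing order makes S_x a martingale, whose increment at p is
    carried by the integers with largest prime factor p. Hypercontractivity and
    (b) bound the fourth moments of the increments, so the conditional
    characteristic function of S_x is Gaussian as soon as the bracket T_x of the
    martingale, restricted to the primes p > x^eps, is close to V in L^1.

    Let B(x) be the sum of f(n)^2 over n <= x. By (a) it is regularly varying of
    index one and B restricted to the integers prime to K is asymptotic to B/H_K,
    H_K being the Euler factor of K; hence the Walsh coefficient of T_x at K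
    tends to v_K = f(K)/H_K * D_K, where D_K is the sum of 1/max(U,W) over the
    factorisations K = UW. Since the Fourier transform of 1/(1/4+s^2) is
    2 pi exp(-|l|/2), these are the chaos coefficients of V. They are square
    summable: test the L^2 convergence of the hypothesis on m against
    (1-s)^2 on [0,1], whose cosine transform 2(l - sin l)/l^3 dominates
    exp(-|l|/2) up to a constant. Finally
    E|T_x - V| = E(V - T_x) + 2 E(T_x - V)_+; the first term is small because
    x^eps-smooth integers are negligible, the second by comparison of the Walsh
    coefficients.

    For positivity, let X = m(I), with I an interval near 0 on which no factor of
    the density vanishes. Changing the signs of finitely many primes changes X by
    a bounded factor, so the event {X = 0} satisfies E[Phi 1_{X=0}] <=
    E[Phi] P(X=0) for all nonnegative cylinder functions Phi. Applied to
    Phi = C - m_y(I) this gives |I| P(X=0) <= E[m_y(I) 1_{X=0}], which tends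
    to 0. *)
Require Import Defs.
From HB Require Import structures.
From mathcomp Require Import all_boot all_order all_algebra.
From mathcomp Require Import all_classical all_reals all_analysis.
From mathcomp Require Import measurable_realfun normal_distribution.
From mathcomp Require Import ring lra zify.

Set Implicit Arguments.
Unset Strict Implicit.
Unset Printing Implicit Defensive.

Import Order.TTheory GRing.Theory Num.Def Num.Theory.
Import numFieldNormedType.Exports.

Local Open Scope classical_set_scope.
Local Open Scope ring_scope.

(** The limit V depends on every prime, also on those still to be revealed, so it cannot compensate
    the martingale. It is replaced by its truncation [VV f (pr y.+1)] to the primes up to y, with y
    sent to infinity after n. The cut n^d serves two opposite purposes. A small d makes n^d-smooth
    integers negligible; a positive d forces the primes that carry increments above n^d, so that ln
    (n/max(U,W)) is comparable to ln n, and this dominates the coefficients of the bracket by those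
    of V. The constant blows up as d tends to 0, hence d is fixed before y and n. Each coefficient
    of the bracket falls short of its expected limit by a smooth part that is small only in mean.
    What survives is a one-sided bound, because that part is a conditional mean square; equality of
    the means turns it into L^1 convergence. The central limit argument is finite: [EE] averages
    over sign patterns, and [cyl_mean] transfers it to P. The continuity theorem is replaced by
    trigonometric polynomials bounded on the whole line, obtained from Bernstein polynomials in (1 +
    sin (a x))/2; with free phases, cosines suffice. *)

(* The sublists A of a list s of primes stand for the squarefree integers nn A
   all of whose prime factors belong to s. *)
Fixpoint subs (s : seq nat) : seq (seq nat) :=
  if s is p :: s' then subs s' ++ map (cons p) (subs s') else [:: [::]].

(** The ordered factorisations of [nn K] when K lists distinct primes: each prime goes to the left
    or to the right factor. *)
Fixpoint splits (K : seq nat) : seq (seq nat * seq nat) :=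
  if K is p :: K' then
    map (fun UW => (p :: UW.1, UW.2)) (splits K') ++
    map (fun UW => (UW.1, p :: UW.2)) (splits K')
  else [:: ([::], [::])].

Definition nn (A : seq nat) : nat := \prod_(p <- A) p.

(** * Sums over squarefree integers and products of Walsh expansions *)

Section subsets.
Context {R : realType}.
Implicit Types (s u v A K : seq nat) (F G : seq nat -> R) (w : nat -> R).

Definition pw w A : R := \prod_(p <- A) w p.

Lemma nn_nil : nn [::] = 1%N. Proof. by rewrite /nn big_nil. Qed.
Lemma nn_cons p A : nn (p :: A) = (p * nn A)%N.
Proof. by rewrite /nn big_cons. Qed.
Lemma nn_cat A A' : nn (A ++ A') = (nn A * nn A')%N.
Proof. by rewrite /nn big_cat. Qed.
Lemma pw_nil w : pw w [::] = 1. Proof. by rewrite /pw big_nil. Qed.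
Lemma pw_cons w p A : pw w (p :: A) = w p * pw w A.
Proof. by rewrite /pw big_cons. Qed.
Lemma pw_cat w A A' : pw w (A ++ A') = pw w A * pw w A'.
Proof. by rewrite /pw big_cat. Qed.
Lemma pw_ge0 w A : (forall p, 0 <= w p) -> 0 <= pw w A.
Proof. by move=> w0; rewrite /pw prodr_ge0. Qed.
Lemma pw_sqr w A : pw w A ^+ 2 = pw (fun p => w p ^+ 2) A.
Proof. by rewrite /pw -prodrXl. Qed.
Lemma pwM w w' A : pw (fun p => w p * w' p) A = pw w A * pw w' A.
Proof. by rewrite /pw -big_split. Qed.

Lemma sum_subs_nil F : \sum_(A <- subs [::]) F A = F [::].
Proof. by rewrite big_seq1. Qed.

Lemma sum_subs_cons p s F :
  \sum_(A <- subs (p :: s)) F A =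
  \sum_(A <- subs s) F A + \sum_(A <- subs s) F (p :: A).
Proof. by rewrite /= big_cat big_map. Qed.

Lemma sum_splits_cons p K (F : seq nat * seq nat -> R) :
  \sum_(UW <- splits (p :: K)) F UW =
  \sum_(UW <- splits K) F (p :: UW.1, UW.2) +
  \sum_(UW <- splits K) F (UW.1, p :: UW.2).
Proof. by rewrite /= big_cat !big_map. Qed.

Lemma sum_subs_cat u v F :
  \sum_(A <- subs (u ++ v)) F A =
  \sum_(D <- subs u) \sum_(C <- subs v) F (D ++ C).
Proof.
elim: u F => [|p u IH] F; first by rewrite sum_subs_nil.
by rewrite cat_cons !sum_subs_cons !IH.
Qed.

Lemma mem_subs s A : (A \in subs s) = subseq A s.
Proof.
elim: s A => [|p s IH] A; first by rewrite inE subseq0.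
rewrite /= mem_cat IH; case: A => [|q A]; first by rewrite sub0seq.
case: eqP => [->|/eqP qp].
  rewrite mem_map ?IH; last by move=> ? ? [].
  apply/idP/idP => [/orP[h|//]|->]; last by rewrite orbT.
  exact: subseq_trans (subseq_cons _ _) h.
by case: mapP => [[B _ e]|_]; rewrite ?orbF//; case: e qp => ->; rewrite eqxx.
Qed.

Lemma subs_sub s A p : A \in subs s -> p \in A -> p \in s.
Proof. by rewrite mem_subs => /mem_subseq; apply. Qed.

Lemma prod_subs w s :
  \sum_(A <- subs s) pw w A = \prod_(p <- s) (1 + w p).
Proof.
elim: s => [|p s IH]; first by rewrite sum_subs_nil pw_nil big_nil.
rewrite sum_subs_cons big_cons -IH mulrDl mul1r; congr (_ + _).
by rewrite big_distrr; apply: eq_bigr => A _; rewrite pw_cons.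
Qed.

(** The summand sees only the product of the chosen primes, not their order, so q can be extracted
    wherever it stands in the list. *)
Lemma sum_subs_split w q s (F : nat -> R) : q \in s -> uniq s ->
  \sum_(A <- subs s) pw w A * F (nn A) =
  \sum_(A <- subs (rem q s)) pw w A * F (nn A) +
  w q * \sum_(A <- subs (rem q s)) pw w A * F (q * nn A)%N.
Proof.
elim: s F => // p s IH F; rewrite inE /= => /orP[/eqP-> _|qs /andP[ps us]].
  rewrite eqxx sum_subs_cons; congr (_ + _); rewrite big_distrr.
  by apply: eq_bigr => A _; rewrite pw_cons nn_cons -mulrA.
have pq : (p == q) = false by apply: contraNF ps => /eqP->.
rewrite pq !sum_subs_cons.
under [X in _ + X]eq_bigr do rewrite pw_cons nn_cons -mulrA.
under [X in (_ + X) + _]eq_bigr do rewrite pw_cons nn_cons -mulrA.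
under [X in w q * (_ + X)]eq_bigr do rewrite pw_cons nn_cons mulnCA -mulrA.
by rewrite -!big_distrr /= (IH F) // (IH (fun n => F (p * n)%N)) //; ring.
Qed.

(** Exchange of summation: the prime is chosen before its cofactor. With h the logarithm this is the
    expansion of ln n over the primes dividing n. *)
Lemma sum_subs_pick w (h : nat -> R) s (F : nat -> R) : uniq s ->
  \sum_(A <- subs s) pw w A * (\sum_(p <- A) h p) * F (nn A) =
  \sum_(p <- s) h p * w p * \sum_(A <- subs (rem p s)) pw w A * F (p * nn A)%N.
Proof.
elim: s F => [|p s IH] F /=; first by rewrite big_seq1 !big_nil mulr0 mul0r.
move=> /andP[ps us]; rewrite -/(subs (p :: s)) sum_subs_cons big_cons eqxx.
under [X in _ + X]eq_bigr do rewrite pw_cons nn_cons big_cons.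
rewrite (IH F us).
have -> : \sum_(A <- subs s) w p * pw w A * (h p + \sum_(q <- A) h q) * F (p * nn A)%N
  = h p * w p * (\sum_(A <- subs s) pw w A * F (p * nn A)%N) +
    w p * \sum_(A <- subs s) pw w A * (\sum_(q <- A) h q) * F (p * nn A)%N.
  by rewrite !big_distrr -big_split /=; apply: eq_bigr => A _; ring.
rewrite (IH (fun n => F (p * n)%N) us) addrCA; congr (_ + _).
rewrite big_distrr -big_split /= big_seq [RHS]big_seq; apply: eq_bigr => q qs.
have pq : (p == q) = false by apply: contraNF ps => /eqP->.
rewrite pq -/(subs (p :: rem q s)) sum_subs_cons.
under [X in _ * (_ + X)]eq_bigr do rewrite pw_cons nn_cons mulnCA -mulrA.
by rewrite -big_distrr /=; ring.
Qed.

(* D is the common part of the two subsets, (U, W) splits their symmetric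
   difference K. *)
Lemma walsh_mul (f x : nat -> R) s (F G : nat -> R) : uniq s ->
  (forall p, p \in s -> x p ^+ 2 = 1) ->
  (\sum_(A <- subs s) pw f A * pw x A * F (nn A)) *
  (\sum_(A <- subs s) pw f A * pw x A * G (nn A)) =
  \sum_(K <- subs s) pw x K * (pw f K * \sum_(UW <- splits K)
    \sum_(D <- subs [seq p <- s | p \notin K])
      pw (fun p => f p ^+ 2) D * (F (nn UW.1 * nn D)%N * G (nn UW.2 * nn D)%N)).
Proof.
elim: s F G => [|p s IH] F G /=.
  move=> _ _; rewrite ?(big_seq1, pw_nil, nn_nil) /= ?(big_seq1, pw_nil, nn_nil) /=; ring.
move=> /andP[ps us] x1; rewrite -/(subs (p :: s)) !sum_subs_cons.
have x1' q : q \in s -> x q ^+ 2 = 1 by move=> qs; apply: x1; rewrite inE qs orbT.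
have xp : x p ^+ 2 = 1 by apply: x1; rewrite inE eqxx.
under [X in (_ + X) * _]eq_bigr do rewrite !pw_cons nn_cons mulrACA -(mulrA (f p * x p)).
under [X in _ * (_ + X)]eq_bigr do rewrite !pw_cons nn_cons mulrACA -(mulrA (f p * x p)).
rewrite -!big_distrr /=.
set SF := \sum_(A <- subs s) _ * F (nn A).
set SG := \sum_(A <- subs s) _ * G (nn A).
set SF' := \sum_(A <- subs s) _ * F (p * nn A)%N.
set SG' := \sum_(A <- subs s) _ * G (p * nn A)%N.
(* The prime p lies in both subsets, in neither, or in exactly one. Since the square of its sign is
   1, only the last case puts p into the symmetric difference. *)
have -> : (SF + f p * x p * SF') * (SG + f p * x p * SG') =
  (SF * SG + f p ^+ 2 * (SF' * SG')) + x p * f p * (SF' * SG + SF * SG').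
  transitivity ((SF * SG + f p ^+ 2 * (x p ^+ 2) * (SF' * SG')) +
     x p * f p * (SF' * SG + SF * SG')); first by ring.
  by rewrite xp mulr1.
rewrite (IH F G us x1') (IH (fun n => F (p * n)%N) (fun n => G (p * n)%N) us x1').
rewrite (IH (fun n => F (p * n)%N) G us x1') (IH F (fun n => G (p * n)%N) us x1').
congr (_ + _).
  rewrite big_distrr -big_split /= big_seq [RHS]big_seq; apply: eq_bigr => K Ks.
  have pK : p \notin K by apply: contra ps; apply: subs_sub.
  rewrite pK /= [X in _ = _ * (_ * X)](_ : _ =
    (\sum_(UW <- splits K) \sum_(D <- subs [seq p <- s | p \notin K])
      pw (fun p => f p ^+ 2) D * (F (nn UW.1 * nn D)%N * G (nn UW.2 * nn D)%N))
   + f p ^+ 2 * (\sum_(UW <- splits K) \sum_(D <- subs [seq p <- s | p \notin K])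
      pw (fun p => f p ^+ 2) D * (F (p * (nn UW.1 * nn D))%N
        * G (p * (nn UW.2 * nn D))%N))); first by ring.
  rewrite big_distrr -big_split; apply: eq_bigr => UW _.
  rewrite -/(subs (p :: _)) sum_subs_cons; congr (_ + _).
  rewrite big_distrr; apply: eq_bigr => D _.
  by rewrite /= pw_cons nn_cons (mulnCA (nn UW.1)) (mulnCA (nn UW.2)) -mulrA.
rewrite -big_split big_distrr /= big_seq [RHS]big_seq; apply: eq_bigr => K Ks.
have pK : p \notin K by apply: contra ps; apply: subs_sub.
rewrite -/(splits (p :: K)) sum_splits_cons /= !pw_cons inE eqxx /=.
rewrite (_ : [seq q <- s | q \notin p :: K] = [seq q <- s | q \notin K]); last first.
  apply: eq_in_filter => q qs; rewrite inE negb_or.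
  by have -> : q != p by apply: contraNneq ps => <-.
have e1 D UW : pw (fun p => f p ^+ 2) D * (F (nn (p :: UW) * nn D)%N) =
   pw (fun p => f p ^+ 2) D * F (p * (nn UW * nn D))%N by rewrite nn_cons mulnA.
have -> : \sum_(UW <- splits K) \sum_(D <- subs [seq q <- s | q \notin K])
   pw (fun p => f p ^+ 2) D * (F (nn (p :: UW.1) * nn D)%N * G (nn UW.2 * nn D)%N)
  = \sum_(UW <- splits K) \sum_(D <- subs [seq q <- s | q \notin K])
   pw (fun p => f p ^+ 2) D * (F (p * (nn UW.1 * nn D))%N * G (nn UW.2 * nn D)%N).
  by apply: eq_bigr => UW _; apply: eq_bigr => D _; rewrite nn_cons mulnA.
have -> : \sum_(UW <- splits K) \sum_(D <- subs [seq q <- s | q \notin K])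
   pw (fun p => f p ^+ 2) D * (F (nn UW.1 * nn D)%N * G (nn (p :: UW.2) * nn D)%N)
  = \sum_(UW <- splits K) \sum_(D <- subs [seq q <- s | q \notin K])
   pw (fun p => f p ^+ 2) D * (F (nn UW.1 * nn D)%N * G (p * (nn UW.2 * nn D))%N).
  by apply: eq_bigr => UW _; apply: eq_bigr => D _; rewrite nn_cons mulnA.
by ring.
Qed.

End subsets.

(** * Expectation over independent signs, Parseval and hypercontractivity *)

Section cube.
Context {R : realType}.
Implicit Types (s u v A K : seq nat) (x : nat -> R) (X Y : (nat -> R) -> R).

Definition sg A (p : nat) : R := if p \in A then -1 else 1.

Definition upd p (e : R) x (q : nat) : R := if q == p then e else x q.

Definition indep p X := forall e x, X (upd p e x) = X x.

(* Expectation under independent uniform signs x p for p in s; the coordinates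
   outside s are set to 1. *)
Definition EE s X : R := 2%:R ^- (size s) * \sum_(A <- subs s) X (sg A).

Lemma sg_sqr A p : sg A p ^+ 2 = 1.
Proof. by rewrite /sg; case: ifP => _; rewrite ?sqrrN expr1n. Qed.

Lemma EE_nil X : EE [::] X = X (fun=> 1).
Proof.
rewrite /EE /= big_seq1 expr0 invr1 mul1r; congr X; apply/funext => p.
Qed.

Lemma EE_cons p s X : p \notin s ->
  EE (p :: s) X = 2%:R^-1 * (EE s (fun x => X (upd p 1 x)) + EE s (fun x => X (upd p (-1) x))).
Proof.
move=> ps; rewrite /EE sum_subs_cons /= exprS invfM -mulrA -mulrDr; congr (_ * (_ * (_ + _))).
  rewrite big_seq [RHS]big_seq; apply: eq_bigr => A As; congr X; apply/funext => q.
  rewrite /sg /upd; case: eqP => // ->; case: ifP => // /(subs_sub As) h.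
  by rewrite h in ps.
apply: eq_bigr => A _; congr X; apply/funext => q.
by rewrite /sg /upd inE; case: eqP.
Qed.

Lemma eq_EE s X Y : (forall x, (forall p, x p ^+ 2 = 1) -> X x = Y x) -> EE s X = EE s Y.
Proof. by move=> h; congr (_ * _); apply: eq_bigr => A _; apply/h/sg_sqr. Qed.

Lemma le_EE s X Y : (forall x, (forall p, x p ^+ 2 = 1) -> X x <= Y x) -> EE s X <= EE s Y.
Proof.
move=> h; apply: ler_wpM2l; first by rewrite invr_ge0 exprn_ge0.
by apply: ler_sum => A _; apply/h/sg_sqr.
Qed.

Lemma EED s X Y : EE s (fun x => X x + Y x) = EE s X + EE s Y.
Proof. by rewrite /EE big_split mulrDr. Qed.

Lemma EEZ s a X : EE s (fun x => a * X x) = a * EE s X.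
Proof. by rewrite /EE -big_distrr /= mulrCA. Qed.

Lemma EEN s X : EE s (fun x => - X x) = - EE s X.
Proof. by rewrite /EE sumrN mulrN. Qed.

Lemma EEB s X Y : EE s (fun x => X x - Y x) = EE s X - EE s Y.
Proof. by rewrite EED EEN. Qed.

Lemma size_subs s : size (subs s) = (2 ^ size s)%N.
Proof. by elim: s => //= p s IH; rewrite size_cat size_map IH expnS mul2n addnn. Qed.

Lemma EE_cst s a : EE s (fun=> a) = a.
Proof.
rewrite /EE big_const_seq count_predT size_subs iter_addr_0.
by rewrite -(mulr_natl a) mulrA natrX mulVf ?mul1r// expf_neq0.
Qed.

Lemma EE_ge0 s X : (forall x, (forall p, x p ^+ 2 = 1) -> 0 <= X x) -> 0 <= EE s X.
Proof. by move=> h; rewrite -(EE_cst s 0); apply: le_EE. Qed.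

Lemma EE_norm s X : `|EE s X| <= EE s (fun x => `|X x|).
Proof.
rewrite ler_norml; apply/andP; split.
  by rewrite -EEN; apply: le_EE => x _; rewrite -normrN lerNl ler_norm.
by apply: le_EE => x _; rewrite ler_norm.
Qed.

(** The mean of (t X - r Y)^2 is nonnegative; t = b and r = c give b (a b - c^2) >= 0. When b = 0,
    the choice t = 1, r = (a + 1)/c shows that c cannot be nonzero. *)
Lemma EE_CS s X Y : EE s (fun x => X x * Y x) ^+ 2 <=
  EE s (fun x => X x ^+ 2) * EE s (fun x => Y x ^+ 2).
Proof.
set c := EE s (fun x => X x * Y x); set a := EE s (fun x => X x ^+ 2).
set b := EE s (fun x => Y x ^+ 2).
have H t r : 0 <= t ^+ 2 * a + r ^+ 2 * b - 2 * t * r * c.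
  rewrite -!EEZ -EED -EEB; apply: EE_ge0 => x _.
  by rewrite (_ : _ - _ = (t * X x - r * Y x) ^+ 2) ?sqr_ge0//; ring.
have b0 : 0 <= b by apply: EE_ge0 => x _; exact: sqr_ge0.
have [bE|b_neq] := eqVneq b 0; last first.
  have := H b c; have bp : 0 < b by rewrite lt_def b_neq.
  move=> h; have : 0 <= b * (a * b - c ^+ 2) by rewrite (le_trans h)// le_eqVlt; apply/orP; left; apply/eqP; ring.
  by rewrite pmulr_rge0// subr_ge0.
have [->|c0] := eqVneq c 0; first by rewrite bE mulr0 expr0n.
have := H 1 ((a + 1) / c); rewrite bE mulr0 addr0 expr1n mul1r mulr1 -mulrA divfK//.
have : 0 <= a by apply: EE_ge0 => x _; exact: sqr_ge0.
lra.
Qed.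

(* Cauchy-Schwarz in a form free of square roots. *)
Lemma EE_L1_L2 s X a e : 0 < e -> EE s (fun x => X x ^+ 2) <= a ->
  EE s (fun x => `|X x|) <= e + a / e.
Proof.
move=> e0 h; apply: (@le_trans _ _ (EE s (fun x => e + X x ^+ 2 / e))).
  apply: le_EE => x _; rewrite -(ler_pM2r e0) mulrDl divfK ?gt_eqF//.
  rewrite -[X x ^+ 2]real_normK ?num_real//; have := sqr_ge0 (e - `|X x|); nra.
rewrite EED EE_cst lerD2l (@eq_EE _ _ (fun x => e^-1 * X x ^+ 2)); last by move=> x _; rewrite mulrC.
by rewrite EEZ mulrC ler_wpM2r// invr_ge0 ltW.
Qed.

(** Averaging over the sign at p removes the part that is odd in it: the martingale property, and
    the engine of the inductions on the list of primes. *)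
Lemma EE_lin p s X Y : p \notin s -> indep p X -> indep p Y ->
  EE (p :: s) (fun x => X x + x p * Y x) = EE s X.
Proof.
move=> ps iX iY; rewrite EE_cons//.
rewrite (@eq_EE _ _ (fun x => X x + Y x)); last by move=> x _; rewrite iX iY /upd eqxx mul1r.
rewrite (@eq_EE _ (fun x => X (upd p (-1) x) + _) (fun x => X x - Y x)); last first.
  by move=> x _; rewrite iX iY /upd eqxx mulN1r.
by rewrite EED EEB; lra.
Qed.

Lemma EE_indep p s X : p \notin s -> indep p X -> EE (p :: s) X = EE s X.
Proof.
move=> ps iX; rewrite EE_cons// (@eq_EE _ _ X); last by move=> x _; rewrite iX.
by rewrite (@eq_EE _ (fun x => X (upd p (-1) x)) X); [lra | move=> x _; rewrite iX].
Qed.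

Lemma EE_cat u v X : uniq (u ++ v) -> (forall p, p \in u -> indep p X) ->
  EE (u ++ v) X = EE v X.
Proof.
elim: u => // p u IH /= /andP[puv uv] h; rewrite EE_indep ?IH//.
  by move=> q qu; apply: h; rewrite inE qu orbT.
by apply: h; rewrite inE eqxx.
Qed.

Lemma pw_upd p e x A : p \notin A -> pw (upd p e x) A = pw x A.
Proof.
move=> pA; rewrite /pw big_seq [RHS]big_seq; apply: eq_bigr => q qA.
by rewrite /upd; case: eqP => // qp; rewrite -qp qA in pA.
Qed.

Lemma indep_walsh p s (c : seq nat -> R) : p \notin s ->
  indep p (fun x => \sum_(A <- subs s) c A * pw x A).
Proof.
move=> ps e x; rewrite big_seq [RHS]big_seq; apply: eq_bigr => A As.
by rewrite pw_upd//; apply: contra ps; apply: subs_sub.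
Qed.

Lemma walsh_cons p s (c : seq nat -> R) x :
  \sum_(A <- subs (p :: s)) c A * pw x A =
  (\sum_(A <- subs s) c A * pw x A) + x p * \sum_(A <- subs s) c (p :: A) * pw x A.
Proof.
rewrite sum_subs_cons big_distrr; congr (_ + _).
by apply: eq_bigr => A _; rewrite pw_cons mulrCA.
Qed.

Lemma parseval s (c : seq nat -> R) : uniq s ->
  EE s (fun x => (\sum_(A <- subs s) c A * pw x A) ^+ 2) = \sum_(A <- subs s) c A ^+ 2.
Proof.
elim: s c => [|p s IH] c; first by rewrite EE_nil !big_seq1 pw_nil mulr1.
move=> /andP[ps us]; rewrite sum_subs_cons -(IH _ us) -(IH (fun A => c (p :: A)) us) -EED.
set U := (fun x => \sum_(A <- subs s) c A * pw x A).
set W := (fun x => \sum_(A <- subs s) c (p :: A) * pw x A).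
have iU : indep p U by apply: indep_walsh.
have iW : indep p W by apply: indep_walsh.
rewrite (@eq_EE _ _ (fun x => (U x ^+ 2 + W x ^+ 2) + x p * (2 * U x * W x))).
  by rewrite EE_lin// => e x; rewrite iU iW.
move=> x x1; rewrite walsh_cons -/(U x) -/(W x).
have -> : (U x + x p * W x) ^+ 2 =
    U x ^+ 2 + x p ^+ 2 * W x ^+ 2 + x p * (2 * U x * W x) by ring.
by rewrite x1 mul1r.
Qed.

Lemma EE_walsh s (c : seq nat -> R) : uniq s ->
  EE s (fun x => \sum_(A <- subs s) c A * pw x A) = c [::].
Proof.
elim: s => [|p s IH]; first by rewrite EE_nil big_seq1 pw_nil mulr1.
move=> /andP[ps us]; rewrite -(IH us).
under [X in EE _ X]funext do rewrite walsh_cons.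
by rewrite EE_lin//; apply: indep_walsh.
Qed.

(** Bonami's inequality for the fourth moment, one sign at a time. In (U + x_p W)^4 the odd powers
    of x_p average out, Cauchy-Schwarz bounds the mean of U^2 W^2 by a b, and a^2 + 6 a b + b^2 <=
    (a + 3 b)^2. *)
Lemma hypercontractive s (c : seq nat -> R) : uniq s ->
  EE s (fun x => (\sum_(A <- subs s) c A * pw x A) ^+ 4) <=
  (\sum_(A <- subs s) 3 ^+ size A * c A ^+ 2) ^+ 2.
Proof.
elim: s c => [|p s IH] c.
  by rewrite EE_nil !big_seq1 pw_nil mulr1 /= expr0 mul1r -exprM.
move=> /andP[ps us]; rewrite sum_subs_cons.
set U := (fun x => \sum_(A <- subs s) c A * pw x A).
set W := (fun x => \sum_(A <- subs s) c (p :: A) * pw x A).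
have iU : indep p U by apply: indep_walsh.
have iW : indep p W by apply: indep_walsh.
have hU : EE s (fun x => U x ^+ 4) <= _ := IH c us.
have hW : EE s (fun x => W x ^+ 4) <= _ := IH (fun A => c (p :: A)) us.
have -> : \sum_(A <- subs s) 3 ^+ size (p :: A) * c (p :: A) ^+ 2 =
   3 * \sum_(A <- subs s) 3 ^+ size A * c (p :: A) ^+ 2.
  by rewrite big_distrr; apply: eq_bigr => A _; rewrite /= exprS mulrA.
move: hU hW; set a := \sum_(A <- _) _ * c A ^+ 2.
set b := \sum_(A <- _) _ * c (p :: A) ^+ 2 => hU hW.
have a0 : 0 <= a by apply: sumr_ge0 => A _; rewrite mulr_ge0 ?sqr_ge0 ?exprn_ge0.
have b0 : 0 <= b by apply: sumr_ge0 => A _; rewrite mulr_ge0 ?sqr_ge0 ?exprn_ge0.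
rewrite (@eq_EE _ _ (fun x => ((U x ^+ 4 + 6 * (U x ^+ 2 * W x ^+ 2)) + W x ^+ 4) +
   x p * (4 * U x ^+ 3 * W x + 4 * U x * W x ^+ 3))); last first.
  move=> x x1; rewrite walsh_cons -/(U x) -/(W x).
  have -> : (U x + x p * W x) ^+ 4 = U x ^+ 4 + 6 * (U x ^+ 2 * W x ^+ 2) * x p ^+ 2 +
     W x ^+ 4 * x p ^+ 2 * x p ^+ 2 + x p * (4 * U x ^+ 3 * W x + 4 * U x * W x ^+ 3 * x p ^+ 2).
    by ring.
  by rewrite x1 !mulr1.
rewrite EE_lin//; [| by move=> e x; rewrite iU iW | by move=> e x; rewrite iU iW].
rewrite !EED EEZ.
have hUW : EE s (fun x => U x ^+ 2 * W x ^+ 2) <= a * b.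
  have E0 : 0 <= EE s (fun x => U x ^+ 2 * W x ^+ 2).
    by apply: EE_ge0 => x _; rewrite mulr_ge0 ?sqr_ge0.
  have ab0 : 0 <= a * b by rewrite mulr_ge0.
  rewrite -ler_sqr ?nnegrE//.
  apply: (le_trans (EE_CS _ _ _)); rewrite exprMn.
  under [X in EE s X * _]funext do rewrite -exprM.
  under [X in _ * EE s X]funext do rewrite -exprM.
  have q4 (r : R) : 0 <= r ^+ 4 by rewrite (exprM _ 2 2) sqr_ge0.
  by apply: ler_pM => //; apply: EE_ge0 => x _; exact: q4.
nra.
Qed.

End cube.

(** * Cosine against the Gaussian: Taylor bounds and the one-step estimate *)

Section trig_bounds.
Context {R : realType}.
Implicit Types (x y t a b z D : R).

(** Integrating an inequality between derivatives; applied repeatedly, it yields the alternating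
    Taylor bounds for sine and cosine. *)
Lemma ge0_of_derive (F f : R -> R) : (forall x, is_derive x (1 : R) F (f x)) ->
  (forall x, 0 <= x -> 0 <= f x) -> F 0 = 0 -> forall x, 0 <= x -> 0 <= F x.
Proof.
move=> dF f0 F0 x x0.
have cF : {within `[0, x], continuous F}.
  by apply: continuous_subspaceT => y; apply/differentiable_continuous/derivable1_diffP; case: (dF y).
have [c + E] := MVT_segment x0 (fun y _ => dF y) cF.
rewrite in_itv /= => /andP[c0 _].
have -> : F x = f c * (x - 0) by rewrite -E F0 subr0.
by rewrite mulr_ge0 ?f0 ?subr0.
Qed.

Lemma sin_le_id x : 0 <= x -> sin x <= x.
Proof.
move=> x0; rewrite -subr_ge0.
apply: (@ge0_of_derive (id - sin) (fun x => 1 - cos x)) => //.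
by rewrite [LHS](_ : _ = 0 - sin 0)// sin0 subr0.
Qed.

Lemma cos_ge_quad x : 1 - x ^+ 2 / 2 <= cos x.
Proof.
wlog x0 : x / 0 <= x.
  by move=> h; case: (leP 0 x) => [/h//|/ltW x0]; rewrite -cosN -[x ^+ 2]sqrrN h// oppr_ge0.
suff : 0 <= cos x + 2^-1 * x ^+ 2 - 1 by lra.
apply: (@ge0_of_derive (fun x => cos x + 2^-1 * x ^+ 2 - 1) (fun x => x - sin x)) x0.
- move=> y; have h : is_derive y (1 : R) (cos + (2^-1 \*: (fun x : R => x ^+ 2)) - cst 1) (y - sin y).
    by apply: is_derive_eq; rewrite /GRing.scale /=; lra.
  exact: h.
- by move=> y y0; rewrite subr_ge0 sin_le_id.
- by rewrite cos0; lra.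
Qed.

Lemma sin_ge_cubic x : 0 <= x -> x - x ^+ 3 / 6 <= sin x.
Proof.
move=> x0; suff : 0 <= sin x + 6^-1 * x ^+ 3 - x by lra.
apply: (@ge0_of_derive (fun x => sin x + 6^-1 * x ^+ 3 - x) (fun x => cos x + x ^+ 2 / 2 - 1)) x0.
- move=> y; have h : is_derive y (1 : R) (sin + (6^-1 \*: (fun x : R => x ^+ 3)) - id) (cos y + y ^+ 2 / 2 - 1).
    by apply: is_derive_eq; rewrite /GRing.scale /=; lra.
  exact: h.
- by move=> y y0; have := cos_ge_quad y; lra.
- by rewrite sin0; lra.
Qed.

Lemma cos_le_quartic x : cos x <= 1 - x ^+ 2 / 2 + x ^+ 4 / 24.
Proof.
wlog x0 : x / 0 <= x.
  move=> h; case: (leP 0 x) => [/h//|/ltW x0].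
  have x4 : (- x) ^+ 4 = x ^+ 4 by ring.
  by rewrite -cosN -[x ^+ 2]sqrrN -x4 h// oppr_ge0.
suff : 0 <= 1 + 24^-1 * x ^+ 4 - 2^-1 * x ^+ 2 - cos x by lra.
apply: (@ge0_of_derive (fun x => 1 + 24^-1 * x ^+ 4 - 2^-1 * x ^+ 2 - cos x) (fun x => sin x + x ^+ 3 / 6 - x)) x0.
- move=> y; have h : is_derive y (1 : R) (cst 1 + (24^-1 \*: (fun x : R => x ^+ 4)) - (2^-1 \*: (fun x : R => x ^+ 2)) - cos)
      (sin y + y ^+ 3 / 6 - y).
    by apply: is_derive_eq; rewrite /GRing.scale /=; lra.
  exact: h.
- by move=> y y0; have := sin_ge_cubic y0; lra.
- by rewrite cos0; lra.
Qed.

Lemma expRN_le_quad w : 0 <= w -> expR (- w) <= 1 - w + w ^+ 2 :> R.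
Proof.
move=> w0; rewrite expRN; have h := expR_ge1Dx w.
rewrite -(ler_pM2r (expR_gt0 w)) mulVf ?gt_eqF ?expR_gt0//.
have : 0 <= 1 - w + w ^+ 2 by nra.
move=> h1; have : (1 - w + w ^+ 2) * (1 + w) <= (1 - w + w ^+ 2) * expR w by exact: ler_wpM2l.
apply: le_trans; have := exprn_ge0 3 w0; nra.
Qed.

(** The two functions agree to second order: cosine lies between consecutive Taylor polynomials, and
    exp (-w) between 1 - w and 1 - w + w^2 at w = y^2/2. *)
Lemma cos_sub_gauss y : `|cos y - expR (- (y ^+ 2 / 2))| <= y ^+ 4.
Proof.
have := cos_ge_quad y; have := cos_le_quartic y.
have w0 : 0 <= y ^+ 2 / 2 by rewrite divr_ge0 ?sqr_ge0.
have := expRN_le_quad w0; have := expR_ge1Dx (- (y ^+ 2 / 2)).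
have : 0 <= y ^+ 4 by rewrite (exprM _ 2 2) sqr_ge0.
rewrite ler_norml; have -> : (y ^+ 2 / 2) ^+ 2 = y ^+ 4 / 4 by field.
lra.
Qed.

Lemma expRN_lip a b : 0 <= a -> a <= b -> 0 <= expR (- a) - expR (- b) <= b - a.
Proof.
move=> a0 ab; rewrite subr_ge0 ler_expR lerN2 ab /=.
have -> : expR (- b) = expR (- a) * expR (- (b - a)) :> R by rewrite -expRD; congr expR; lra.
have h := expR_ge1Dx (- (b - a)).
have e1 : expR (- a) <= 1 by rewrite expR_le1 oppr_le0.
have e0 := expR_ge0 (- a).
have : expR (- (b - a)) <= 1 by rewrite expR_le1 oppr_le0 subr_ge0.
nra.
Qed.

Definition pp x : R := Num.max x 0.

Lemma pp_ge0 x : 0 <= pp x. Proof. by rewrite /pp le_max lexx orbT. Qed.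
Lemma ppE x : x = pp x - pp (- x).
Proof. by rewrite /pp; case: (leP x 0); case: (leP (-x) 0); lra. Qed.
Lemma pp_le x y : x <= y -> pp x <= pp y.
Proof. by rewrite /pp => h; case: (leP x 0); case: (leP y 0); lra. Qed.

(* z is a martingale increment and D the conditional variance still to come. *)
Lemma gauss_step t z D :
  `|cos (t * z) * expR (- (t ^+ 2 / 2 * pp (D - z ^+ 2))) - expR (- (t ^+ 2 / 2 * pp D))|
  <= t ^+ 4 * z ^+ 4 + t ^+ 2 / 2 * (pp (z ^+ 2 - D) - pp (- D)).
Proof.
set a := pp (D - z ^+ 2); set b := pp D.
have a0 : 0 <= a by exact: pp_ge0.
have t0 : 0 <= t ^+ 2 / 2 by rewrite divr_ge0 ?sqr_ge0.
have z0 : 0 <= z ^+ 2 := sqr_ge0 z.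
have ab : a <= b by apply: pp_le; rewrite lerBlDr lerDl.
have bz : b - a <= z ^+ 2.
  have := ppE D; have := ppE (D - z ^+ 2); rewrite -/a -/b.
  have : pp (- D) <= pp (- (D - z ^+ 2)) by apply: pp_le; lra.
  lra.
(* The part of z^2 that exceeds the variance still available. Written as an increment of a positive
   part, it telescopes over the primes. *)
have vE : pp (z ^+ 2 - D) - pp (- D) = z ^+ 2 - (b - a).
  have := ppE D; have := ppE (D - z ^+ 2); rewrite -/a -/b.
  by rewrite opprB; lra.
rewrite vE.
have E1 : expR (- (t ^+ 2 / 2 * b)) = expR (- (t ^+ 2 / 2 * a)) * expR (- (t ^+ 2 / 2 * (b - a))).
  by rewrite -expRD; congr expR; lra.
rewrite E1 mulrC -mulrBr normrM (ger0_norm (expR_ge0 _)).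
have e1 : expR (- (t ^+ 2 / 2 * a)) <= 1 by rewrite expR_le1 oppr_le0 mulr_ge0.
apply: (@le_trans _ _ `|cos (t * z) - expR (- (t ^+ 2 / 2 * (b - a)))|).
  by rewrite ler_piMl.
have h1 := cos_sub_gauss (t * z).
have ba0 : 0 <= t ^+ 2 / 2 * (b - a) by rewrite mulr_ge0// subr_ge0.
have ba1 : t ^+ 2 / 2 * (b - a) <= (t * z) ^+ 2 / 2.
  by rewrite exprMn; nra.
have h2 := expRN_lip ba0 ba1.
rewrite -(subrKA (expR (- ((t * z) ^+ 2 / 2)))) (le_trans (ler_normD _ _))//.
apply: lerD; first by rewrite -exprMn.
rewrite distrC ger0_norm; last by case/andP: h2.
case/andP: h2 => _ h2; apply: (le_trans h2).
by rewrite exprMn; lra.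
Qed.

End trig_bounds.

(** * Gaussian replacement of the martingale increments *)

Section martingale.
Context {R : realType}.
Implicit Types (s u v A K : seq nat) (x : nat -> R).
Variables (f : nat -> R) (n : nat) (k : R).

(* The unnormalised partial sum up to n, over the integers composed of primes of
   s, with beta replaced by x; zz p s is the coefficient of x p, so that XX is a
   martingale when the primes are revealed in increasing order. *)
Definition XX s x : R := \sum_(A <- subs s) pw f A * pw x A * (nn A <= n)%:R.

Definition zz p s x : R :=
  f p * \sum_(A <- subs s) pw f A * pw x A * (p * nn A <= n)%:R.

(* The primes of u are the ones whose increments are recorded, those of v are
   smaller; both lists are decreasing, so that u ++ v lists all primes. *)
Fixpoint TT u v x : R :=
  if u is p :: u' then TT u' v x + (k * zz p (u' ++ v) x) ^+ 2 else 0.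

Fixpoint QQ u v x : R :=
  if u is p :: u' then QQ u' v x + (k * zz p (u' ++ v) x) ^+ 4 else 0.

Lemma XX_cons p s x : XX (p :: s) x = XX s x + x p * zz p s x.
Proof.
rewrite /XX /zz sum_subs_cons mulrA big_distrr /=; congr (_ + _).
by apply: eq_bigr => A _; rewrite !pw_cons nn_cons; ring.
Qed.

Lemma indep_XX p s : p \notin s -> indep p (XX s).
Proof.
move=> ps e x; rewrite /XX big_seq [RHS]big_seq; apply: eq_bigr => A As.
by rewrite pw_upd//; apply: contra ps; apply: subs_sub.
Qed.

Lemma indep_zz p q s : p \notin s -> indep p (zz q s).
Proof.
move=> ps e x; rewrite /zz; congr (_ * _); rewrite big_seq [RHS]big_seq; apply: eq_bigr => A As.
by rewrite pw_upd//; apply: contra ps; apply: subs_sub.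
Qed.

Lemma indep_TT p u v : p \notin u ++ v -> indep p (TT u v).
Proof.
elim: u => //= q u IH; rewrite inE negb_or => /andP[_ h] e x.
by rewrite IH// indep_zz.
Qed.

Lemma indep_QQ p u v : p \notin u ++ v -> indep p (QQ u v).
Proof.
elim: u => //= q u IH; rewrite inE negb_or => /andP[_ h] e x.
by rewrite IH// indep_zz.
Qed.

Lemma cosDsign (a b e : R) : e ^+ 2 = 1 ->
  cos (a + e * b) = cos a * cos b + e * - (sin a * sin b).
Proof.
move/eqP; rewrite sqrf_eq1 => /orP[] /eqP->; rewrite cosD; first by rewrite !mul1r.
by rewrite !mulN1r cosN sinN opprK mulrN opprK.
Qed.

Section clt.
Variables (u0 v : seq nat) (Y V : (nat -> R) -> R) (t phi M : R).
Hypothesis uni : uniq (u0 ++ v).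
Hypothesis iY : forall p, p \in u0 -> indep p Y.
Hypothesis iV : forall p, p \in u0 -> indep p V.
Hypothesis YM : forall x, (forall p, x p ^+ 2 = 1) -> `|Y x| <= M.
Hypothesis V0 : forall x, (forall p, x p ^+ 2 = 1) -> 0 <= V x.

Let S u x := k * (XX (u ++ v) x - XX v x).
Let G u x := expR (- (t ^+ 2 / 2 * pp (V x - TT u v x))).

(** The exponential [G] stands for a Gaussian carrying the variance not yet revealed, so that
    increments are replaced one at a time at the cost given by [gauss_step]. The positive part keeps
    [G] at most 1 where the bracket overshoots V. [Y] and [V] must not involve the primes being
    revealed, or they could not be held fixed while averaging over x p. *)
Lemma clt_step u : uniq (u ++ v) -> (forall p, p \in u -> p \in u0) ->
  `| EE (u ++ v) (fun x => Y x * cos (t * S u x + phi) * G u x)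
     - EE (u ++ v) (fun x => Y x * cos phi * expR (- (t ^+ 2 / 2 * pp (V x)))) | <=
  M * EE (u ++ v) (fun x => t ^+ 4 * QQ u v x + t ^+ 2 / 2 * pp (TT u v x - V x)).
Proof.
elim: u => [|p u IH].
  move=> _ _; rewrite -EEB (@eq_EE _ _ _ (fun=> 0)); last first.
    by move=> x _; rewrite /S /G /= subrr mulr0 mulr0 add0r subr0 subrr.
  rewrite EE_cst normr0 mulr_ge0//.
    by apply: le_trans (YM (x := fun=> 1) _) => // p; rewrite expr1n.
  apply: EE_ge0 => x _ /=; rewrite mulr0 add0r mulr_ge0 ?pp_ge0//.
  by rewrite divr_ge0 ?sqr_ge0.
rewrite cat_cons => /= /andP[pu uu] sub.
have pu0 : p \in u0 by apply: sub; rewrite inE eqxx.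
have pv : p \notin v by move: pu; rewrite mem_cat negb_or => /andP[].
have {}IH := IH uu (fun q qu => sub q (mem_behead (s := p :: u) qu)).
set s := u ++ v in pu uu IH *.
have iS : indep p (S u) by move=> e x; rewrite /S !indep_XX.
have iz : indep p (zz p s) by apply: indep_zz.
have iT : indep p (TT u v) by apply: indep_TT.
have iQ : indep p (QQ u v) by apply: indep_QQ.
pose z x := k * zz p s x.
have izz : indep p z by move=> e x; rewrite /z iz.
pose G' x := expR (- (t ^+ 2 / 2 * pp (V x - (TT u v x + z x ^+ 2)))).
have iG' : indep p G' by move=> e x; rewrite /G' izz iT iV.
(* The addition formula separates the part even in x p, which keeps a factor cos (t z), from the odd
   part, which [EE_lin] removes. *)
rewrite (@eq_EE _ (p :: s) (fun x => Y x * cos (t * S (p :: u) x + phi) * G (p :: u) x)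
  (fun x => Y x * cos (t * S u x + phi) * cos (t * z x) * G' x +
   x p * (- (Y x * sin (t * S u x + phi) * sin (t * z x) * G' x)))); last first.
  move=> x x1; rewrite (_ : t * S (p :: u) x + phi = (t * S u x + phi) + x p * (t * z x)).
    by rewrite cosDsign// /G /= -/(z x) -/(G' x); ring.
  by rewrite /S cat_cons XX_cons /z; ring.
rewrite EE_lin//; first last.
- by move=> e x; rewrite iY// iS izz iG'.
- by move=> e x; rewrite iY// iS izz iG'.
rewrite (@EE_indep _ _ _ (fun x => Y x * cos phi * _))//; last by move=> e x; rewrite iY// iV.
rewrite EE_indep//; last by move=> e x; rewrite /= iT iz iV// iQ.
set E1 := EE s _; set E0 := EE s _ in IH *; set E2 := EE s _ in IH *.
have step : `|E1 - E0| <= M * EE s (fun x => t ^+ 4 * z x ^+ 4 +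
     t ^+ 2 / 2 * (pp (TT u v x + z x ^+ 2 - V x) - pp (TT u v x - V x))).
  rewrite /E1 /E0 -EEB -EEZ (le_trans (EE_norm _ _))//; apply: le_EE => x x1.
  have -> : Y x * cos (t * S u x + phi) * cos (t * z x) * G' x - Y x * cos (t * S u x + phi) * G u x
    = Y x * cos (t * S u x + phi) * (cos (t * z x) * G' x - G u x) by ring.
  rewrite normrM; apply: ler_pM => //.
    rewrite normrM; apply: le_trans (YM x1); rewrite ler_piMr//; exact: cos_max.
  have := gauss_step t (z x) (V x - TT u v x).
  by rewrite opprB addrA (addrC (z x ^+ 2)) -/(G u x) -(addrA (V x)) -opprD -/(G' x).
rewrite -(subrKA E0) (le_trans (ler_normD _ _))// (le_trans (lerD step IH))//.
rewrite -mulrDr -EED le_eqVlt; apply/orP; left; apply/eqP; congr (_ * _).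
by apply: eq_EE => x _ /=; rewrite -/(z x); ring.
Qed.

(** Removing [G] costs the mean of (V - T)_+, and [clt_step] has left the mean of (T - V)_+;
    together they form the L^1 distance between the bracket and V. *)
Lemma clt_bound :
  `| EE (u0 ++ v) (fun x => Y x * cos (t * S u0 x + phi))
     - EE (u0 ++ v) (fun x => Y x * cos phi * expR (- (t ^+ 2 / 2 * V x))) | <=
  M * (t ^+ 4 * EE (u0 ++ v) (QQ u0 v) +
       t ^+ 2 / 2 * EE (u0 ++ v) (fun x => `|TT u0 v x - V x|)).
Proof.
have t0 : 0 <= t ^+ 2 / 2 by rewrite divr_ge0 ?sqr_ge0.
have := clt_step uni (fun _ h => h).
set E1 := EE _ _; set E0 := EE _ (fun x => _ * expR _); set E2 := EE _ (fun x => _ + _ * pp _) => h.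
have -> : EE (u0 ++ v) (fun x => Y x * cos phi * expR (- (t ^+ 2 / 2 * V x))) = E0.
  apply: eq_EE => x x1; rewrite [in RHS]/pp; case: (leP (V x) 0) => // Vx.
  by have -> : V x = 0 by apply/eqP; rewrite eq_le Vx V0.
set E3 := EE _ _.
have h3 : `|E3 - E1| <= M * EE (u0 ++ v) (fun x => t ^+ 2 / 2 * pp (V x - TT u0 v x)).
  rewrite /E3 /E1 -EEB -EEZ (le_trans (EE_norm _ _))//; apply: le_EE => x x1.
  rewrite -{1}[Y x * cos _]mulr1 -mulrBr normrM; apply: ler_pM => //.
    rewrite normrM; apply: le_trans (YM x1); rewrite ler_piMr//; exact: cos_max.
  rewrite /G; set w := t ^+ 2 / 2 * _.
  have w0 : 0 <= w by rewrite mulr_ge0 ?pp_ge0.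
  have := expRN_lip (lexx 0) w0; rewrite oppr0 expR0 addr0 => /andP[h1 h2].
  by rewrite ger0_norm.
rewrite -(subrKA E1) (le_trans (ler_normD _ _))// (le_trans (lerD h3 h))//.
rewrite -mulrDr -!EEZ -!EED le_eqVlt; apply/orP; left; apply/eqP; congr (_ * _).
apply: eq_EE => x _.
suff -> : `|TT u0 v x - V x| = pp (V x - TT u0 v x) + pp (TT u0 v x - V x) by ring.
rewrite /pp; case: (leP (V x - TT u0 v x) 0) => h1; case: (leP (TT u0 v x - V x) 0) => h2.
- have : TT u0 v x - V x = 0 by lra.
  by move->; rewrite normr0 addr0.
- by rewrite add0r gtr0_norm.
- by rewrite addr0 ler0_norm ?opprB.
- by lra.
Qed.

End clt.
End martingale.

(** In decreasing order: the head is the last prime to be revealed, and the coefficient of its sign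
    depends on the tail only. *)
Fixpoint pr (N : nat) : seq nat :=
  if N is n.+1 then (if prime n then n :: pr n else pr n) else [::].

Lemma mem_pr N p : (p \in pr N) = prime p && (p < N)%N.
Proof.
elim: N => [|N IH] /=; first by rewrite ltn0 andbF.
have [pN|pN] := ifPn; rewrite ?inE IH ltnS [in RHS]leq_eqVlt andb_orr.
  by case: eqP => [->|]; rewrite ?pN ?andbF.
by case: eqP => [->|]; rewrite ?(negbTE pN) ?andbF.
Qed.

Lemma pr_uniq N : uniq (pr N).
Proof.
elim: N => //= N IH; case: ifP => //= _; by rewrite IH mem_pr ltnn andbF.
Qed.

Lemma pr_prime N p : p \in pr N -> prime p.
Proof. by rewrite mem_pr => /andP[]. Qed.

(** * Summatory functions of a nonnegative weight over squarefree integers *)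

Section weights.
Context {R : realType}.
Variable g : nat -> R.
Hypothesis g0 : forall p, 0 <= g p.
Implicit Types (s A : seq nat) (t n : nat).

(* Over the integers n composed of primes of s, Bs and Ls are the sums over
   n <= t of g(n) and g(n)/n, and Es is the sum over all n of g(n)/n. *)
Definition Bs s t : R := \sum_(A <- subs s) pw g A * (nn A <= t)%:R.
Definition Ls s t : R := \sum_(A <- subs s) pw g A * ((nn A <= t)%:R / (nn A)%:R).
Definition Es s : R := \prod_(p <- s) (1 + g p / p%:R).
Definition psi s n : R := \sum_(p <- s | (p <= n)%N) g p * ln p%:R.

Let pw0 A : 0 <= pw g A. Proof. exact: pw_ge0. Qed.

Lemma Bs_ge0 s t : 0 <= Bs s t.
Proof. by apply: sumr_ge0 => A _; rewrite mulr_ge0. Qed.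
Lemma Ls_ge0 s t : 0 <= Ls s t.
Proof. by apply: sumr_ge0 => A _; rewrite mulr_ge0// divr_ge0. Qed.
Lemma Es_ge1 s : 1 <= Es s.
Proof.
rewrite /Es; elim/big_ind: _ => // [a b a1 b1|p _]; first by rewrite mulr_ege1.
by rewrite lerDl divr_ge0.
Qed.
Lemma Es_gt0 s : 0 < Es s.
Proof. exact: lt_le_trans ltr01 (Es_ge1 s). Qed.

Lemma le_natr_bool (a b : bool) : (a -> b) -> (a%:R <= b%:R :> R).
Proof. by case: a; case: b => // /(_ isT). Qed.

Lemma subs_filter (a : pred nat) s (F : seq nat -> R) : (forall A, 0 <= F A) ->
  \sum_(A <- subs [seq p <- s | a p]) F A <= \sum_(A <- subs s) F A.
Proof.
elim: s F => [|p s IH] F F0; first by [].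
rewrite sum_subs_cons /=; case: ifP => _.
  by rewrite sum_subs_cons lerD ?IH.
by rewrite ler_wpDr ?IH// sumr_ge0.
Qed.

Lemma Ls_filter a s t : Ls [seq p <- s | a p] t <= Ls s t.
Proof. by apply: subs_filter => A; rewrite mulr_ge0// divr_ge0. Qed.

Lemma psi_filter a s n : psi [seq p <- s | a p] n <= psi s n.
Proof.
rewrite /psi big_filter_cond big_mkcond [leRHS]big_mkcond /=; apply: ler_sum => p _.
case: (a p) => //=; case: ifP => // _; rewrite mulr_ge0//.
by case: p => [|p]; [rewrite ln0 | rewrite ln_ge0// ler1n].
Qed.

Lemma pw_div A : pw (fun p => g p / p%:R) A = pw g A / (nn A)%:R.
Proof.
rewrite /pw prodf_div; congr (_ / _); rewrite /nn.
by rewrite (big_morph (fun n => n%:R : R) (natrM R) (erefl _)).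
Qed.

Lemma Ls_le_Es s t : Ls s t <= Es s.
Proof.
rewrite /Es -prod_subs; apply: ler_sum => A _.
by rewrite pw_div ler_wpM2l// ler_piMl ?invr_ge0// lern1 leq_b1.
Qed.

Section primes.
Variable s : seq nat.
Hypothesis us : uniq s.
Hypothesis ps : forall p, p \in s -> prime p.

Lemma nn_gt0 A : A \in subs s -> (0 < nn A)%N.
Proof.
move=> As; rewrite /nn big_seq; elim/big_ind: _ => //.
- by move=> a b a0 b0; rewrite muln_gt0 a0.
- by move=> p /(subs_sub As)/ps/prime_gt0.
Qed.

Lemma Bs_ge1 t : (0 < t)%N -> 1 <= Bs s t.
Proof.
move=> t0; rewrite /Bs (big_rem [::]) /=; last by rewrite mem_subs sub0seq.
rewrite pw_nil nn_nil t0 mulr1 lerDl; apply: sumr_ge0 => A _; exact: mulr_ge0.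
Qed.

Lemma ln_nn A : A \in subs s -> ln (nn A)%:R = \sum_(p <- A) ln p%:R :> R.
Proof.
move=> As; have : all (fun p => 0 < p)%N A.
  by apply/allP => p /(subs_sub As)/ps/prime_gt0.
elim: A {As} => [|p A IH]; first by rewrite nn_nil big_nil ln1.
rewrite nn_cons big_cons => /andP[p0 A0].
have nA : (0 < nn A)%N.
  rewrite /nn; elim: (A) A0 => [|q B IHB /andP[q0 /IHB B0]]; first by rewrite big_nil.
  by rewrite big_cons muln_gt0 q0.
by rewrite natrM lnM ?posrE ?ltr0n// IH.
Qed.

Lemma ln_prime_ge0 p : p \in s -> 0 <= ln (p%:R : R).
Proof. by move=> /ps/prime_gt0 h; rewrite ln_ge0// ler1n. Qed.

Lemma sum_rem_le p (F : nat -> R) : p \in s -> (forall n, 0 <= F n) ->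
  \sum_(A <- subs (rem p s)) pw g A * F (nn A) <= \sum_(A <- subs s) pw g A * F (nn A).
Proof.
move=> p_s F0; rewrite (sum_subs_split g F p_s us) lerDl mulr_ge0// sumr_ge0// => A _.
exact: mulr_ge0.
Qed.

(* Writing ln t = ln n + ln (t/n) for n <= t, and ln n as a sum over the primes
   dividing n. *)
Lemma Bs_ln t : (0 < t)%N -> Bs s t * ln t%:R =
  \sum_(A <- subs s) pw g A * ((nn A <= t)%:R * ln (t%:R / (nn A)%:R)) +
  (\sum_(A <- subs s) pw g A * ((nn A <= t)%:R * psi s (t %/ nn A)) -
   \sum_(p <- s) ln p%:R * g p ^+ 2 * \sum_(A <- subs (rem p s)) pw g A * (p * (p * nn A) <= t)%:R).
Proof.
move=> t0.
have -> : Bs s t * ln t%:R =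
  \sum_(A <- subs s) pw g A * ((nn A <= t)%:R * ln (t%:R / (nn A)%:R)) +
  \sum_(A <- subs s) pw g A * (\sum_(p <- A) ln p%:R) * (nn A <= t)%:R.
  rewrite -big_split /= /Bs big_distrl /= big_seq [RHS]big_seq; apply: eq_bigr => A As.
  have n0 := nn_gt0 As.
  by rewrite ln_div ?posrE ?ltr0n// -ln_nn//; ring.
congr (_ + _).
rewrite (sum_subs_pick g (fun p => ln p%:R) (fun n => (n <= t)%:R) us).
have -> : \sum_(A <- subs s) pw g A * ((nn A <= t)%:R * psi s (t %/ nn A)) =
  \sum_(p <- s) ln p%:R * g p * \sum_(A <- subs s) pw g A * (p * nn A <= t)%:R.
  under [RHS]eq_bigr do rewrite big_distrr /=.
  rewrite exchange_big /= big_seq [RHS]big_seq; apply: eq_bigr => A As.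
  have n0 := nn_gt0 As.
  rewrite /psi big_mkcond /= !big_distrr /= big_seq [RHS]big_seq; apply: eq_bigr => p p_s.
  rewrite leq_divRL//; case: (leqP (p * nn A) t) => h; last by rewrite /= !mulr0.
  have -> : (nn A <= t)%N.
    by apply: leq_trans h; rewrite leq_pmull// prime_gt0// ps.
  by rewrite /=; ring.
rewrite -sumrB big_seq [RHS]big_seq; apply: eq_bigr => p p_s.
by rewrite (sum_subs_split g (fun n => (p * n <= t)%:R) p_s us); ring.
Qed.

Lemma ln_div_le t A : A \in subs s -> (nn A <= t)%N -> 0 <= ln (t%:R / (nn A)%:R : R) <= t%:R / (nn A)%:R.
Proof.
move=> As h; have n0 := nn_gt0 As.
have r1 : 1 <= t%:R / (nn A)%:R :> R.
  by rewrite ler_pdivlMr ?ltr0n// mul1r ler_nat.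
by rewrite ln_ge0// ltW// ln_sublinear// (lt_le_trans ltr01).
Qed.

Lemma rem_sum_ge0 t :
  0 <= \sum_(p <- s) ln p%:R * g p ^+ 2 * \sum_(A <- subs (rem p s)) pw g A * (p * (p * nn A) <= t)%:R.
Proof.
rewrite big_seq; apply: sumr_ge0 => p p_s; rewrite mulr_ge0//.
  by rewrite mulr_ge0 ?sqr_ge0// ln_prime_ge0.
by apply: sumr_ge0 => A _; rewrite mulr_ge0.
Qed.

(** In [Bs_ln], ln (t/n) is at most t/n, psi (t/n) is at most C t/n, and the subtracted sum is
    nonnegative. *)
Lemma Bs_upper C t : (0 < t)%N -> (forall n, psi s n <= C * n%:R) ->
  Bs s t * ln t%:R <= (C + 1) * t%:R * Ls s t.
Proof.
move=> t0 hC; rewrite Bs_ln//.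
apply: (@le_trans _ _ (\sum_(A <- subs s) pw g A * ((nn A <= t)%:R * ln (t%:R / (nn A)%:R)) +
  \sum_(A <- subs s) pw g A * ((nn A <= t)%:R * psi s (t %/ nn A)))).
  by rewrite lerD2l gerBl rem_sum_ge0.
rewrite -big_split /= /Ls big_distrr /= big_seq [leRHS]big_seq; apply: ler_sum => A As.
rewrite -mulrDr mulrCA ler_wpM2l//; have n0 := nn_gt0 As.
case: leqP => h; last by rewrite !(mul0r, mulr0) addr0.
rewrite !mul1r addrC (mulrDl C) mulrDl mul1r; apply: lerD; last by case/andP: (ln_div_le As h).
have C0 : 0 <= C.
  rewrite -[C]mulr1 (le_trans _ (hC 1%N))// /psi big_seq_cond sumr_ge0// => p /andP[p_s _].
  by rewrite mulr_ge0// ln_prime_ge0.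
rewrite (le_trans (hC _))// -mulrA ler_wpM2l// ler_pdivlMr ?ltr0n// -natrM ler_nat.
exact: leq_trunc_div.
Qed.

(** In [Bs_ln], psi (t/n) becomes theta t/n and everything else is an error, either small against t
    L or bounded by a multiple of B. In the sum correcting for repeated primes, p > P0 is charged to
    t L through p^2 n <= t, and p <= P0 is charged to B. *)
Lemma Bs_asymp theta e C P0 t : (0 < t)%N -> 0 < e -> 0 <= theta -> 
  - ln e <= C -> 0 <= C ->
  (forall n, (n <= t)%N -> `|psi s n - theta * n%:R| <= e * n%:R + C) ->
  \sum_(p <- s | (P0 < p)%N) ln p%:R * g p ^+ 2 / p%:R ^+ 2 <= e ->
  \sum_(p <- s | (p <= P0)%N) ln p%:R * g p ^+ 2 <= C ->
  `|Bs s t * ln t%:R - theta * (t%:R * Ls s t)| <=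
   3 * e * (t%:R * Ls s t) + (3 * C + theta) * Bs s t.
Proof.
move=> t0 e0 th0 Ce C0 hpsi htail hhead; rewrite Bs_ln//.
set T1 := \sum_(A <- subs s) _ * (_ * ln _).
set T2 := \sum_(A <- subs s) _; set T3 := \sum_(p <- s) _.
have h1 : 0 <= T1 <= e * (t%:R * Ls s t) + C * Bs s t.
  apply/andP; split.
    rewrite /T1 big_seq; apply: sumr_ge0 => A As; rewrite mulr_ge0//.
    case: leqP => h; last by rewrite mul0r.
    by rewrite mul1r; case/andP: (ln_div_le As h).
  rewrite /Ls /Bs !big_distrr -big_split /= /T1 big_seq [leRHS]big_seq; apply: ler_sum => A As.
  rewrite [leRHS](_ : _ = pw g A * ((nn A <= t)%:R * (e * (t%:R / (nn A)%:R) + C))); last by ring.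
  rewrite ler_wpM2l// ler_wpM2l//; have n0 := nn_gt0 As.
  have r0 : 0 < t%:R / (nn A)%:R :> R by rewrite divr_gt0 ?ltr0n.
  (* This gives ln r <= e r - ln e, the reason for the hypothesis - ln e <= C. *)
  have := @ln_sublinear R (e * (t%:R / (nn A)%:R)) (mulr_gt0 e0 r0).
  rewrite lnM ?posrE//; lra.
have h2 : `|T2 - theta * (t%:R * Ls s t)| <= e * (t%:R * Ls s t) + (C + theta) * Bs s t.
  rewrite /Ls /Bs !big_distrr -sumrB -big_split /=.
  rewrite (le_trans (ler_norm_sum _ _ _))// big_seq [leRHS]big_seq; apply: ler_sum => A As.
  have n0 := nn_gt0 As.
  rewrite [X in `|X|](_ : _ = pw g A * ((nn A <= t)%:R * (psi s (t %/ nn A) - theta * (t%:R / (nn A)%:R)))); last by ring.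
  rewrite [leRHS](_ : _ = pw g A * ((nn A <= t)%:R * (e * (t%:R / (nn A)%:R) + C + theta))); last by ring.
  rewrite !normrM (ger0_norm (pw0 A)) ler_wpM2l// ger0_norm// ler_wpM2l//.
  have q1 : (t %/ nn A)%:R <= t%:R / (nn A)%:R :> R.
    by rewrite ler_pdivlMr ?ltr0n// -natrM ler_nat leq_trunc_div.
  (* Rounding the quotient down loses at most 1, which accounts for the extra theta in front of
     B. *)
  have q2 : t%:R / (nn A)%:R <= (t %/ nn A)%:R + 1 :> R.
    by rewrite ler_pdivrMr ?ltr0n// -[1]/(1%:R) -natrD -natrM ler_nat addn1 ltnW// ltn_ceil.
  have := hpsi _ (leq_div t (nn A)); rewrite !ler_norml; nra.
have h3 : 0 <= T3 <= e * (t%:R * Ls s t) + C * Bs s t.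
  rewrite rem_sum_ge0 /=.
  have L0 := Ls_ge0 s t; have B0 := Bs_ge0 s t.
  apply: (@le_trans _ _ ((\sum_(p <- s | (P0 < p)%N) ln p%:R * g p ^+ 2 / p%:R ^+ 2) * (t%:R * Ls s t) +
     (\sum_(p <- s | (p <= P0)%N) ln p%:R * g p ^+ 2) * Bs s t)); last first.
    by rewrite lerD// ler_wpM2r// mulr_ge0.
  rewrite /T3 (bigID (fun p => (P0 < p)%N)) /=; apply: lerD.
    rewrite big_distrl /= big_seq_cond [leRHS]big_seq_cond; apply: ler_sum => p /andP[p_s _].
    have p0 : (0 < p)%N by apply/prime_gt0/ps.
    rewrite -[leRHS]mulrA ler_wpM2l ?mulr_ge0 ?sqr_ge0 ?ln_prime_ge0//.
    have := @sum_rem_le p (fun n => (p * (p * n) <= t)%:R) p_s (fun _ => ler0n _ _).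
    move=> h; apply: (le_trans h); rewrite /Ls !big_distrr /= big_seq [leRHS]big_seq.
    apply: ler_sum => A As; have n0 := nn_gt0 As.
    rewrite [leRHS](_ : _ = pw g A * ((nn A <= t)%:R * (t%:R / (p%:R ^+ 2 * (nn A)%:R)))); last first.
      by field; rewrite !pnatr_eq0 -!lt0n p0 n0.
    rewrite ler_wpM2l//; case: leqP => h'; last by rewrite mulr_ge0// divr_ge0// mulr_ge0 ?sqr_ge0.
    have -> : (nn A <= t)%N.
      apply: leq_trans h'; rewrite mulnA leq_pmull// muln_gt0 p0//.
    rewrite mul1r ler_pdivlMr ?mul1r; last by rewrite mulr_gt0 ?exprn_gt0 ?ltr0n.
    by rewrite -natrX -natrM ler_nat expnS expn1 -mulnA.
  under [X in X <= _]eq_bigl do rewrite -leqNgt.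
  rewrite big_distrl /= big_seq_cond [leRHS]big_seq_cond; apply: ler_sum => p /andP[p_s _].
  rewrite ler_wpM2l ?mulr_ge0 ?sqr_ge0 ?ln_prime_ge0//.
  have := @sum_rem_le p (fun n => (p * (p * n) <= t)%:R) p_s (fun _ => ler0n _ _).
  move=> h; apply: (le_trans h); apply: ler_sum => A _; rewrite ler_wpM2l//.
  apply: le_natr_bool; apply: leq_trans; rewrite mulnA leq_pmull// muln_gt0.
  by rewrite prime_gt0 ?ps.
move: h1 h2 h3; rewrite !ler_norml; have L0 := Ls_ge0 s t; have B0 := Bs_ge0 s t; nra.
Qed.

End primes.
End weights.

(** * Regular variation of the summatory function *)

Section asymptotics.
Context {R : realType}.
Variables (g : nat -> R) (theta : R).
Hypothesis g0 : forall p, 0 <= g p.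
Hypothesis theta0 : 0 < theta.
Hypothesis psi_asymp : forall e : R, 0 < e -> exists C : R, forall n,
  `|psi g (pr n.+1) n - theta * n%:R| <= e * n%:R + C.
Hypothesis sqr_tail : forall e : R, 0 < e -> exists P0, forall N,
  \sum_(p <- pr N | (P0 < p)%N) ln p%:R * g p ^+ 2 / p%:R ^+ 2 <= e.
Implicit Types (s A K : seq nat) (t n N : nat).

Lemma cvgn_eps (u : nat -> R) l :
  (forall e : R, 0 < e -> exists x0, forall x, (x0 <= x)%N -> `|u x - l| <= e) ->
  u @ \oo --> l.
Proof.
move=> h; apply/cvgrPdist_le => e e0; have [x0 hx] := h _ e0.
by exists x0 => // x /= /hx; rewrite distrC.
Qed.

Lemma cvgn_epsP (u : nat -> R) l : u @ \oo --> l ->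
  forall e : R, 0 < e -> exists x0, forall x, (x0 <= x)%N -> `|u x - l| <= e.
Proof.
move=> /cvgrPdist_le h e e0; have [x0 _ hx] := h _ e0.
by exists x0 => x /hx /=; rewrite distrC.
Qed.

Lemma ratio_near1 (a b e : R) : 0 < b -> `|a - b| <= e * b -> `|a / b - 1| <= e.
Proof.
move=> b0 h; have -> : a / b - 1 = (a - b) / b by field; rewrite gt_eqF.
by rewrite normrM normfV (gtr0_norm b0) ler_pdivrMr.
Qed.

Lemma ln_nat_ge (M : R) k : (0 < k)%N ->
  exists x0, forall x, (x0 <= x)%N -> M <= ln (x %/ k)%:R.
Proof.
move=> k0; exists (k * (truncn (expR M)).+1)%N => x xx.
have h : expR M <= (x %/ k)%:R.
  rewrite ltW// (lt_le_trans (truncnS_gt _))// ler_nat leq_divRL//.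
  by rewrite mulnC.
by rewrite -[M]expRK ler_ln ?posrE ?expR_gt0// (lt_le_trans (expR_gt0 _) h).
Qed.

Lemma sum_sub_le (r1 r2 : seq nat) (F : nat -> R) : uniq r1 -> {subset r1 <= r2} ->
  (forall p, p \in r2 -> 0 <= F p) -> \sum_(p <- r1) F p <= \sum_(p <- r2) F p.
Proof.
elim: r1 r2 => [|p r1 IH] r2 /=.
  by move=> _ _ F0; rewrite big_nil big_seq sumr_ge0.
move=> /andP[pr1 ur1] sub F0; have pr2 : p \in r2 by apply: sub; rewrite inE eqxx.
rewrite big_cons (big_rem p pr2) lerD2l IH//.
- move=> q q1; have : q \in r2 by apply: sub; rewrite inE q1 orbT.
  have qp : q != p by apply: contraNneq pr1 => <-.
  by rewrite (perm_mem (perm_to_rem pr2)) inE (negbTE qp).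
- by move=> q /mem_rem; apply: F0.
Qed.

Definition sK K N := [seq p <- pr N | p \notin K].

Lemma sK_uniq K N : uniq (sK K N). Proof. by rewrite filter_uniq// pr_uniq. Qed.
Lemma sK_prime K N p : p \in sK K N -> prime p.
Proof. by rewrite mem_filter => /andP[_ /pr_prime]. Qed.

Lemma psi_pr N n : (n < N)%N -> psi g (pr N) n = psi g (pr n.+1) n.
Proof.
elim: N => // N IH; rewrite ltnS leq_eqVlt => /orP[/eqP->//|nN].
by rewrite /=; case: ifP => _; rewrite -IH// /psi big_cons leqNgt nN.
Qed.

Lemma psi_pr_le N n : psi g (pr N) n <= psi g (pr n.+1) n.
Proof.
have [nN|Nn] := ltnP n N; first by rewrite psi_pr.
have -> : n.+1 = ((n - N).+1 + N)%N by lia.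
elim: (n - N).+1 => [//|m IH]; rewrite addSn /=; case: ifP => // _.
apply: (le_trans IH); rewrite /psi big_cons; case: ifP => // _.
rewrite lerDr mulr_ge0//; case: (m + N)%N => [|q]; first by rewrite ln0.
by rewrite ln_ge0// ler1n.
Qed.

Lemma psi_ub : exists2 C : R, 0 <= C & forall a N n, psi g [seq p <- pr N | a p] n <= C * n%:R.
Proof.
have [C hC] := psi_asymp ltr01.
exists (theta + 1 + `|C|) => [|a N n].
  by rewrite !addr_ge0// ltW.
apply: (le_trans (psi_filter g0 _ _ _)); apply: (le_trans (psi_pr_le _ _)).
case: n => [|n].
  by rewrite mulr0 /psi big_seq_cond big1// => -[|p]; rewrite mem_pr ?andbF.
have := hC n.+1; rewrite ler_norml => /andP[_ h].
have := ler_norm C; have : 1 <= n.+1%:R :> R by rewrite ler1n.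
have := normr_ge0 C; nra.
Qed.

(** The primes of K change psi by a bounded amount, which goes into the constant. *)
Lemma psi_sK K (e : R) : 0 < e -> exists C : R, forall N n, (n < N)%N ->
  `|psi g (sK K N) n - theta * n%:R| <= e * n%:R + C.
Proof.
move=> e0; have [C hC] := psi_asymp e0.
pose mK := \max_(p <- K) p.
exists (C + psi g (pr mK.+1) mK) => N n nN.
have : `|psi g (pr N) n - psi g (sK K N) n| <= psi g (pr mK.+1) mK.
  have E : psi g (pr N) n = psi g (sK K N) n + \sum_(p <- pr N | (p \in K) && (p <= n)%N) g p * ln p%:R.
    rewrite /psi (bigID (fun p => p \in K)) /= addrC big_filter_cond; congr (_ + _).
      by apply: eq_bigl => p; rewrite andbC.
    by apply: eq_bigl => p; rewrite andbC.
  rewrite E addrC addKr ger0_norm.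
    apply: le_trans (psi_pr_le N mK).
    rewrite /psi big_mkcond [leRHS]big_mkcond /= big_seq [leRHS]big_seq.
    apply: ler_sum => p pN; case: ifP => [/andP[pK _]|_]; first by rewrite /mK leq_bigmax_seq.
    case: ifP => // _; rewrite mulr_ge0// ln_ge0// ler1n.
    by rewrite prime_gt0// (pr_prime pN).
  rewrite big_seq_cond sumr_ge0// => p /andP[pN _].
  by rewrite mulr_ge0// ln_ge0// ler1n prime_gt0// (pr_prime pN).
by have := hC n; rewrite -(psi_pr nN) !ler_norml; lra.
Qed.

Lemma Ls_ge1 s t : (0 < t)%N -> 1 <= Ls g s t.
Proof.
move=> t0; rewrite /Ls (big_rem [::]) /=; last by rewrite mem_subs sub0seq.
rewrite pw_nil nn_nil t0 mul1r divr1 lerDl; apply: sumr_ge0 => A _.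
by rewrite mulr_ge0 ?pw_ge0// divr_ge0.
Qed.

(** The error in [Bs_asymp] that is proportional to B is absorbed with the help of [Bs_upper]: B is
    at most a constant times t L / ln t, hence o (t L). Three quarters of e pay for the main error
    and one quarter for this one. *)
Lemma Bs_Ls K (e : R) : 0 < e -> exists t0, forall N t, (t0 <= t)%N -> (t < N)%N ->
  `|Bs g (sK K N) t * ln t%:R / (t%:R * Ls g (sK K N) t) - theta| <= e.
Proof.
move=> e0; pose e' := e / 4; have e'0 : 0 < e' by rewrite divr_gt0.
have [C1 hC1] := psi_sK K e'0.
have [P0 hP0] := sqr_tail e'0.
have [C2 C20 hC2] := psi_ub.
pose C3 := \sum_(p <- pr P0.+1) ln p%:R * g p ^+ 2.
pose C := `|C1| + `|C3| + `|ln e'|.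
have lnp p N : p \in pr N -> 0 <= ln (p%:R : R).
  by move=> /pr_prime/prime_gt0 h; rewrite ln_ge0// ler1n.
have [t0 ht0] := ln_nat_ge ((3 * C + theta) * (C2 + 1) / e' + 1) (ltn0Sn 0).
exists (maxn t0 1) => N t; rewrite geq_max => /andP[t0t t_gt0] tN.
have {ht0} := ht0 _ t0t; rewrite divn1 => ht0.
have tp : 0 < t%:R :> R by rewrite ltr0n.
have L1 := Ls_ge1 (sK K N) t_gt0.
have C0 : 0 <= C by rewrite !addr_ge0.
have H := @Bs_asymp R g g0 (sK K N) (sK_uniq K N) (@sK_prime K N) theta e' C P0 t t_gt0 e'0 (ltW theta0).
have H1 : - ln e' <= C.
  rewrite (@le_trans _ _ `|ln e'|)//; last by rewrite /C lerDr addr_ge0.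
  by rewrite -normrN ler_norm.
have {H H1} := H H1 C0.
have h1 n : (n <= t)%N -> `|psi g (sK K N) n - theta * n%:R| <= e' * n%:R + C.
  move=> nt; apply: (le_trans (hC1 _ _ (leq_ltn_trans nt tN))); rewrite lerD2l.
  by rewrite (le_trans (ler_norm _))// /C -addrA lerDl addr_ge0.
have h2 : \sum_(p <- sK K N | (P0 < p)%N) ln p%:R * g p ^+ 2 / p%:R ^+ 2 <= e'.
  apply: le_trans (hP0 N); rewrite /sK big_filter_cond big_mkcond [leRHS]big_mkcond /=.
  rewrite big_seq [leRHS]big_seq; apply: ler_sum => p pN; case: (p \notin K) => //=.
  by case: ifP => // _; rewrite divr_ge0 ?sqr_ge0// mulr_ge0 ?sqr_ge0// (lnp _ _ pN).
have h3 : \sum_(p <- sK K N | (p <= P0)%N) ln p%:R * g p ^+ 2 <= C.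
  apply: (@le_trans _ _ C3); last first.
    by rewrite (le_trans (ler_norm _))// /C addrAC lerDr addr_ge0.
  rewrite -big_filter; apply: sum_sub_le; first by rewrite filter_uniq// sK_uniq.
      by move=> p; rewrite !mem_filter !mem_pr ltnS => /and4P[-> _ ->].
    by move=> p pP; rewrite mulr_ge0 ?sqr_ge0// (lnp _ _ pP).
move=> /(_ h1 h2 h3) {h1 h2 h3}.
have hB := @Bs_upper R g g0 (sK K N) (sK_uniq K N) (@sK_prime K N) C2 t t_gt0 (hC2 _ N).
set B := Bs _ _ _ in hB *; set L := Ls _ _ _ in hB L1 *; set lt := ln _ in hB ht0 *.
have B0 : 0 <= B by exact: Bs_ge0.
set D := (3 * C + theta) in ht0 *.
have D0 : 0 <= D by rewrite /D addr_ge0 ?mulr_ge0// ltW.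
move=> H.
have hl : D * (C2 + 1) <= e' * lt.
  by rewrite [leRHS]mulrC -ler_pdivrMr//; lra.
have lt0 : 0 < lt.
  have c1 : 0 <= C2 + 1 by rewrite addr_ge0.
  have := divr_ge0 (mulr_ge0 D0 c1) (ltW e'0); lra.
have h4 : D * B <= e' * (t%:R * L).
  have tL0 : 0 <= t%:R * L by rewrite mulr_ge0// (le_trans ler01).
  rewrite -(ler_pM2r lt0).
  have q1 : D * B * lt <= D * ((C2 + 1) * t%:R * L) by rewrite -mulrA ler_wpM2l.
  apply: (le_trans q1).
  have -> : D * ((C2 + 1) * t%:R * L) = D * (C2 + 1) * (t%:R * L) by ring.
  have -> : e' * (t%:R * L) * lt = e' * lt * (t%:R * L) by ring.
  by rewrite ler_wpM2r.
have tL : 0 < t%:R * L by rewrite mulr_gt0// (lt_le_trans ltr01).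
rewrite -[theta](mulfK (lt0r_neq0 tL)) -mulrBl normrM normfV (gtr0_norm tL).
rewrite ler_pdivrMr// (le_trans H)//.
have -> : e * (t%:R * L) = 3 * e' * (t%:R * L) + e' * (t%:R * L) by rewrite /e'; field.
by rewrite lerD2l.
Qed.

(** The integers lost exceed x/k, so each weight 1/n among them is at most k/x. As B is o (x L),
    this makes L slowly varying. *)
Lemma Ls_diff s x k : (forall p, p \in s -> prime p) -> (0 < k)%N -> (0 < x)%N ->
  0 <= Ls g s x - Ls g s (x %/ k) <= k%:R / x%:R * Bs g s x.
Proof.
move=> ps k0 x0; rewrite /Ls -sumrB; apply/andP; split.
  apply: sumr_ge0 => A _; rewrite -mulrBr -mulrBl mulr_ge0 ?pw_ge0// mulr_ge0 ?invr_ge0//.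
  by rewrite subr_ge0 le_natr_bool// => /leq_trans; apply; exact: leq_div.
rewrite big_distrr /= big_seq [leRHS]big_seq; apply: ler_sum => A As.
have n0 := nn_gt0 ps As.
rewrite -mulrBr -mulrBl [leRHS]mulrCA ler_wpM2l ?pw_ge0//.
case: (leqP (nn A) x) => h1; last first.
  have -> : (nn A <= x %/ k)%N = false.
    by apply/negbTE; rewrite -ltnNge (leq_ltn_trans (leq_div _ _)).
  by rewrite subrr mul0r mulr0.
case: (leqP (nn A) (x %/ k)) => h2.
  by rewrite subrr mul0r mulr1 divr_ge0.
rewrite subr0 mul1r mulr1 ler_pdivlMr ?ltr0n// ler_pdivrMl ?ltr0n// mulrC.
rewrite -natrM ler_nat mulnC ltnW//; apply: leq_trans (ltn_ceil _ k0) _.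
by rewrite leq_mul2r h2 orbT.
Qed.

(* Regular variation of index one, from B(t) log t ~ theta t L(t). *)
Lemma Bs_ratio K k : (0 < k)%N ->
  (fun x => Bs g (sK K x.+1) (x %/ k) / Bs g (sK K x.+1) x) @ \oo --> (k%:R^-1 : R).
Proof.
move=> k0.
pose B x t := Bs g (sK K x.+1) t; pose L x t := Ls g (sK K x.+1) t.
pose r (j x : nat) : R := B x (x %/ j)%N * ln (x %/ j)%:R / ((x %/ j)%:R * L x (x %/ j)%N).
have r_lim j : (0 < j)%N -> r j @ \oo --> theta.
  move=> j0; apply: cvgn_eps => e /Bs_Ls-/(_ K)[t0 ht0].
  exists (t0 * j)%N => x xx; apply: ht0; first by rewrite leq_divRL.
  by rewrite ltnS leq_div.
have [C C0 hC] := psi_ub.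
have lnx_lim : (fun x => ln (x : nat)%:R / ln (x %/ k)%:R) @ \oo --> (1 : R).
  apply: cvgn_eps => e e0.
  have [x0 hx0] := ln_nat_ge (ln (2 * k)%:R / e + 1) k0; exists (maxn x0 k) => x.
  rewrite geq_max => /andP[xx kx]; have {hx0} := hx0 _ xx.
  have q0 : (0 < x %/ k)%N by rewrite divn_gt0.
  have k2 : 0 <= ln (2 * k)%:R :> R by rewrite ln_ge0// ler1n muln_gt0.
  move=> h; have lq : 0 < ln (x %/ k)%:R :> R.
    by rewrite (lt_le_trans _ h)// ltr_wpDl// divr_ge0// ltW.
  apply: ratio_near1 => //.
  have q1 : ln (x %/ k)%:R <= ln x%:R :> R.
    by rewrite ler_ln ?posrE ?ltr0n ?(leq_trans _ kx)// ler_nat leq_div.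
  (* With floor division, x is less than (x/k + 1) k, hence at most 2 k (x/k) as soon as x/k is
     positive. *)
  have q2 : ln x%:R <= ln (2 * k)%:R + ln (x %/ k)%:R :> R.
    rewrite -lnM ?posrE ?ltr0n ?muln_gt0 ?k0// ler_ln ?posrE ?mulr_gt0 ?ltr0n ?muln_gt0 ?k0 ?(leq_trans _ kx)//.
    rewrite -natrM ler_nat; apply: leq_trans (ltnW (ltn_ceil x k0)) _.
    by rewrite mulnAC leq_mul2r mul2n -addnn -addn1 leq_add2l q0 orbT.
  rewrite ger0_norm ?subr_ge0//.
  have : ln (2 * k)%:R <= e * ln (x %/ k)%:R :> R by rewrite mulrC -ler_pdivrMr//; lra.
  lra.
have L_lim : (fun x => L x (x %/ k)%N / L x x) @ \oo --> (1 : R).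
  apply: cvgn_eps => e e0.
  have [x0 hx0] := ln_nat_ge (k%:R * (C + 1) / e + 1) (ltn0Sn 0); exists (maxn x0 k) => x.
  rewrite geq_max => /andP[xx kx]; have {hx0} := hx0 _ xx; rewrite divn1 => hl.
  have x_gt0 : (0 < x)%N by apply: leq_trans kx.
  have xp : 0 < x%:R :> R by rewrite ltr0n.
  have := Ls_diff (@sK_prime K x.+1) k0 x_gt0; rewrite -/(L x x) -/(L x (x %/ k)%N) -/(B x x).
  have := @Bs_upper R g g0 (sK K x.+1) (sK_uniq K _) (@sK_prime K _) C x x_gt0 (hC _ _).
  rewrite -/(L x x) -/(B x x) => hB /andP[d0 d1].
  have L0 : 0 < L x x by rewrite (lt_le_trans ltr01)// Ls_ge1.
  have kC : 0 <= k%:R * (C + 1) / e by rewrite divr_ge0 ?mulr_ge0 ?addr_ge0// ltW.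
  have l0 : 0 < ln x%:R :> R by rewrite (lt_le_trans _ hl)// ltr_wpDl.
  apply: ratio_near1 => //; rewrite distrC ger0_norm// (le_trans d1)// -(ler_pM2r l0).
  have -> : k%:R / x%:R * B x x * ln x%:R = k%:R / x%:R * (B x x * ln x%:R) by ring.
  apply: (@le_trans _ _ (k%:R / x%:R * ((C + 1) * x%:R * L x x))).
    by rewrite ler_wpM2l// divr_ge0// ltW.
  have -> : k%:R / x%:R * ((C + 1) * x%:R * L x x) = k%:R * (C + 1) * L x x.
    by field; rewrite gt_eqF.
  rewrite [leRHS]mulrAC ler_wpM2r ?(ltW L0)// [leRHS]mulrC -ler_pdivrMr//; lra.
have q_lim : (fun x => (x %/ k)%:R / (x : nat)%:R) @ \oo --> (k%:R^-1 : R).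
  apply: cvgn_eps => e e0; exists (truncn (e^-1)).+1 => x xx.
  have ex : e^-1 <= x%:R by rewrite ltW// (lt_le_trans (truncnS_gt _))// ler_nat.
  have xp : 0 < x%:R :> R by rewrite (lt_le_trans _ ex)// invr_gt0.
  have kp : 0 < k%:R :> R by rewrite ltr0n.
  have h1 : (x %/ k)%:R * k%:R <= x%:R :> R by rewrite -natrM ler_nat leq_trunc_div.
  have h2 : x%:R <= (x %/ k)%:R * k%:R + k%:R :> R.
    by rewrite -natrM -natrD ler_nat addnC -mulSn ltnW// ltn_ceil.
  have e1 : 1 <= e * x%:R by rewrite mulrC -ler_pdivrMr// mul1r.
  rewrite -(ler_pM2r (mulr_gt0 xp kp)) -{1}(gtr0_norm (mulr_gt0 xp kp)) -normrM mulrBl.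
  have -> : (x %/ k)%:R / x%:R * (x%:R * k%:R) = (x %/ k)%:R * k%:R :> R.
    by field; rewrite gt_eqF.
  have -> : k%:R^-1 * (x%:R * k%:R) = x%:R :> R by field; rewrite gt_eqF.
  rewrite ler_norml; nra.
have r1 := r_lim 1%N isT; have rk := r_lim k k0.
have -> : k%:R^-1 = theta / theta * k%:R^-1 * 1 * 1 :> R.
  by rewrite divff ?gt_eqF// mul1r !mulr1.
(* The quotient of the two values of B factors into four ratios; all of them tend to 1 except that
   of the rounded arguments, which tends to 1/k. *)
have main : (fun x : nat => r k x / r 1%N x * ((x %/ k)%:R / x%:R) *
    (L x (x %/ k)%N / L x x) * (ln x%:R / ln (x %/ k)%:R)) @ \oo -->
    theta / theta * k%:R^-1 * 1 * 1.
  exact: (cvgM (cvgM (cvgM (cvgM rk (cvgV (lt0r_neq0 theta0) r1)) q_lim) L_lim) lnx_lim).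
refine (cvg_trans (near_eq_cvg _) main); near=> x.
have xk : (2 * k <= x)%N by near: x; exists (2 * k)%N.
have q1 : (1 < x %/ k)%N by rewrite leq_divRL.
have x1 : (1 < x)%N by apply: leq_trans q1 (leq_div _ _).
have lq : 0 < ln (x %/ k)%:R :> R by rewrite ln_gt0// ltr1n.
have lx : 0 < ln x%:R :> R by rewrite ln_gt0// ltr1n.
have Lq : 0 < L x (x %/ k)%N by rewrite (lt_le_trans ltr01)// Ls_ge1// (leq_trans _ q1).
have Lx : 0 < L x x by rewrite (lt_le_trans ltr01)// Ls_ge1// (leq_trans _ x1).
have Bx : 0 < B x x by rewrite (lt_le_trans ltr01)// Bs_ge1// (leq_trans _ x1).
have qn : 0 < (x %/ k)%:R :> R by rewrite ltr0n (leq_trans _ q1).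
have xn : 0 < x%:R :> R by rewrite ltr0n (leq_trans _ x1).
rewrite /r -/(B x (x %/ k)%N) -/(B x x) divn1.
by field; rewrite !gt_eqF.
Unshelve. all: by end_near.
Qed.

End asymptotics.

(** * Coprimality conditions and Mertens sums *)

Section mertens.
Context {R : realType}.
Variables (g : nat -> R) (theta : R).
Hypothesis g0 : forall p, 0 <= g p.
Hypothesis theta0 : 0 < theta.
Hypothesis psi_asymp : forall e : R, 0 < e -> exists C : R, forall n,
  `|psi g (pr n.+1) n - theta * n%:R| <= e * n%:R + C.
Hypothesis sqr_tail : forall e : R, 0 < e -> exists P0, forall N,
  \sum_(p <- pr N | (P0 < p)%N) ln p%:R * g p ^+ 2 / p%:R ^+ 2 <= e.
Implicit Types (s A K : seq nat) (t n N : nat).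

(** Induction on K. An integer prime to K either avoids p or is p times one that does, so B_K(x) =
    B_{pK}(x) + g(p) B_{pK}(x/p), and regular variation turns this into the factor 1 + g(p)/p. *)
Lemma Bs_off K k : uniq K -> (forall p, p \in K -> prime p) -> (0 < k)%N ->
  (fun x : nat => Bs g (sK K x.+1) (x %/ k) / Bs g (pr x.+1) x) @ \oo --> (k%:R * Es g K)^-1.
Proof.
elim: K k => [|p K IH] k.
  move=> _ _ k0; have := Bs_ratio g0 theta0 psi_asymp sqr_tail ([::]) k0.
  have -> : sK [::] = pr by apply/funext => N; apply/all_filterP/allP.
  by rewrite /Es big_nil mulr1.
move=> /= /andP[pK uK] pP k0.
have pp : prime p by apply: pP; rewrite inE eqxx.
have p0 := prime_gt0 pp.
have {}IH := IH 1%N uK (fun q qK => pP q (mem_behead (s := p :: K) qK)) isT.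
have split x : (p <= x)%N -> Bs g (sK K x.+1) x = Bs g (sK (p :: K) x.+1) x +
    g p * Bs g (sK (p :: K) x.+1) (x %/ p).
  move=> px; have pin : p \in sK K x.+1 by rewrite mem_filter pK mem_pr pp ltnS.
  have E : rem p (sK K x.+1) = sK (p :: K) x.+1.
    rewrite rem_filter ?sK_uniq// /sK -filter_predI; apply: eq_filter => q /=.
    by rewrite inE negb_or.
  rewrite /Bs (sum_subs_split g (fun n => (n <= x)%:R) pin (sK_uniq K _)) E.
  congr (_ + _ * _); apply: eq_bigr => A _; by rewrite leq_divRL// mulnC.
have r1 := Bs_ratio g0 theta0 psi_asymp sqr_tail (p :: K) k0.
have rp := Bs_ratio g0 theta0 psi_asymp sqr_tail (p :: K) p0.
have hp : 0 < 1 + g p / p%:R by rewrite ltr_wpDr// divr_ge0.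
have main : (fun x : nat => Bs g (sK (p :: K) x.+1) (x %/ k) / Bs g (sK (p :: K) x.+1) x *
    (1 + g p * (Bs g (sK (p :: K) x.+1) (x %/ p) / Bs g (sK (p :: K) x.+1) x))^-1 *
    (Bs g (sK K x.+1) (x %/ 1) / Bs g (pr x.+1) x)) @ \oo -->
    k%:R^-1 * (1 + g p * p%:R^-1)^-1 * (1%:R * Es g K)^-1.
  apply: cvgM; last exact: IH.
  apply: cvgM; first exact: r1.
  apply: cvgV; first by rewrite gt_eqF.
  by apply: cvgD; [exact: cvg_cst | apply: cvgM; [exact: cvg_cst | exact: rp]].
have -> : (k%:R * Es g (p :: K))^-1 = k%:R^-1 * (1 + g p * p%:R^-1)^-1 * (1%:R * Es g K)^-1.
  by rewrite /Es big_cons mul1r !invfM mulrA.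
refine (cvg_trans (near_eq_cvg _) main); near=> x.
have px : (p <= x)%N by near: x; exists p.
have x0 : (0 < x)%N by apply: leq_trans px.
have B1 : 0 < Bs g (sK (p :: K) x.+1) x by rewrite (lt_le_trans ltr01)// Bs_ge1.
have B2 : 0 < Bs g (pr x.+1) x by rewrite (lt_le_trans ltr01)// Bs_ge1.
have B3 : 0 <= g p * Bs g (sK (p :: K) x.+1) (x %/ p) by rewrite mulr_ge0 ?Bs_ge0.
rewrite divn1 split//; field; rewrite !gt_eqF// ltr_wpDr//.
Unshelve. all: by end_near.
Qed.

Definition Mr s : R := \sum_(p <- s) g p * ln p%:R / p%:R.

Let harm n : R := \sum_(m < n) m.+1%:R^-1.

Lemma harm_bounds n : (0 < n)%N -> ln n%:R <= harm n <= 1 + ln n%:R.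
Proof.
move=> n0; suff : ln n.+1%:R <= harm n <= 1 + ln n%:R.
  move=> /andP[h ->]; rewrite andbT (le_trans _ h)// ler_ln ?posrE ?ltr0n//.
  by rewrite ler_nat.
case: n n0 => // n _; elim: n => [|n IH].
  rewrite /harm big_ord1 ln1 invr1 addr0 lexx andbT.
  exact: (le_ln1Dx (lt_trans (ltrN10 R) ltr01)).
have E : harm n.+2 = harm n.+1 + n.+2%:R^-1 by rewrite /harm big_ord_recr.
have n2 : 0 < n.+2%:R :> R by rewrite ltr0n.
have n1 : 0 < n.+1%:R :> R by rewrite ltr0n.
have n3 : 0 < n.+3%:R :> R by rewrite ltr0n.
have a1 : ln n.+3%:R <= ln n.+2%:R + n.+2%:R^-1 :> R.
  have -> : n.+3%:R = n.+2%:R * (1 + n.+2%:R^-1) :> R.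
    by rewrite mulrDr mulr1 mulfV ?gt_eqF// -[in RHS](natrD _ _ 1) addn1.
  rewrite lnM ?posrE ?addr_gt0 ?invr_gt0// lerD2l le_ln1Dx//.
  by rewrite (lt_trans (ltrN10 _))// invr_gt0.
have a2 : ln n.+1%:R <= ln n.+2%:R - n.+2%:R^-1 :> R.
  have i1 : n.+2%:R^-1 < 1 :> R by rewrite invf_lt1// ltr1n.
  have -> : n.+1%:R = n.+2%:R * (1 - n.+2%:R^-1) :> R.
    by rewrite mulrBr mulr1 mulfV ?gt_eqF// -[n.+2]addn1 natrD addrK.
  by rewrite lnM ?posrE ?subr_gt0// lerD2l le_ln1Dx// ltrN2.
move: IH a1 a2; rewrite E; move: (ln _) (ln _) (ln _) (n.+2%:R^-1) (harm n.+1) => a b c' i h.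
move=> /andP[? ?] ? ?; apply/andP; split; lra.
Qed.

Lemma sum_pr_le N n (F : nat -> R) : (n < N)%N ->
  \sum_(p <- pr N | (p <= n)%N) F p = \sum_(p <- pr n.+1) F p.
Proof.
elim: N => // N IH; rewrite ltnS leq_eqVlt => /orP[/eqP->|nN].
  rewrite big_mkcond big_seq [RHS]big_seq; apply: eq_bigr => p.
  by rewrite mem_pr ltnS => /andP[_ ->].
by rewrite /=; case: ifP => _; rewrite -IH// big_cons leqNgt nN.
Qed.

(** Partial summation from psi, whose increments divided by n are the increments of [Mr]. *)
Lemma Mr_asymp (e : R) : 0 < e -> exists2 C : R, 0 <= C & forall n, (0 < n)%N ->
  `|Mr (pr n.+1) - theta * ln n%:R| <= e * ln n%:R + C.
Proof.
move=> e0; have [C hC] := psi_asymp e0.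
have C0 : 0 <= C.
  by have := le_trans (normr_ge0 _) (hC 0%N); rewrite mulr0 add0r.
pose P n := psi g (pr n.+1) n.
have PE n : P n = \sum_(p <- pr n.+1) g p * ln p%:R by rewrite /P /psi sum_pr_le.
have step n : Mr (pr n.+2) - Mr (pr n.+1) = (P n.+1 - P n) / n.+1%:R.
  rewrite !PE /Mr [pr n.+2]/=; case: ifP => _; last by rewrite !subrr mul0r.
  by rewrite !big_cons !addrK.
(* Abel summation as an induction, with the boundary term kept on the left. The error (e n + C)/(n
   (n + 1)) of each step splits into a harmonic term and C (1/n - 1/(n + 1)), which telescopes. *)
have claim n : `|Mr (pr n.+2) - theta * harm n.+1 - (P n.+1 - theta * n.+1%:R) / n.+1%:R|
    <= e * harm n.+1 + C * (1 - n.+1%:R^-1).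
  elim: n => [|n IH].
    rewrite PE /Mr /= !big_nil /harm big_ord1 invr1; apply: ltW.
    rewrite (_ : _ - _ = 0) ?normr0; last by ring.
    by rewrite subrr mulr0 addr0 mulr1.
  have E : harm n.+2 = harm n.+1 + n.+2%:R^-1 by rewrite /harm big_ord_recr.
  have n2 : 0 < n.+2%:R :> R by rewrite ltr0n.
  have n1 : 0 < n.+1%:R :> R by rewrite ltr0n.
  have nE : n.+2%:R = n.+1%:R + 1 :> R by rewrite -[n.+2]addn1 natrD.
  have -> : Mr (pr n.+3) - theta * harm n.+2 - (P n.+2 - theta * n.+2%:R) / n.+2%:R =
    (Mr (pr n.+2) - theta * harm n.+1 - (P n.+1 - theta * n.+1%:R) / n.+1%:R) +
    (P n.+1 - theta * n.+1%:R) / (n.+1%:R * n.+2%:R).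
    rewrite E -[Mr (pr n.+3)](subrK (Mr (pr n.+2))) step nE.
    by move: n1 n2; rewrite nE; move: (n.+1%:R : R) => a a0 a1; field; rewrite !gt_eqF.
  rewrite (le_trans (ler_normD _ _))// (le_trans (lerD IH (lexx _)))//.
  have d0 : 0 < n.+1%:R * n.+2%:R :> R by rewrite mulr_gt0.
  rewrite normrM normfV (gtr0_norm d0).
  have := hC n.+1; rewrite -/(P n.+1) => h.
  have h' : `|P n.+1 - theta * n.+1%:R| / (n.+1%:R * n.+2%:R) <=
     (e * n.+1%:R + C) / (n.+1%:R * n.+2%:R).
    by rewrite ler_wpM2r// invr_ge0 ltW.
  apply: (le_trans (lerD (lexx _) h')); rewrite E le_eqVlt; apply/orP; left; apply/eqP.
  by move: n1 n2; rewrite nE; move: (n.+1%:R : R) => a a0 a1; field; rewrite !gt_eqF.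
exists (theta + 2 * e + 2 * C) => [|n n0].
  by rewrite !addr_ge0// ?mulr_ge0// ltW.
case: n n0 => // n n0; have := claim n; have := harm_bounds n0.
have n1 : 0 < n.+1%:R :> R by rewrite ltr0n.
have i0 : 0 < n.+1%:R^-1 :> R by rewrite invr_gt0.
have i1 : n.+1%:R^-1 <= 1 :> R by rewrite invf_le1// ler1n.
have d1 : `|(P n.+1 - theta * n.+1%:R) / n.+1%:R| <= e + C.
  rewrite normrM normfV (gtr0_norm n1) ler_pdivrMr// (le_trans (hC n.+1))//.
  by rewrite mulrDl lerD2l ler_peMr// ler1n.
have l0 : 0 <= ln n.+1%:R :> R by rewrite ln_ge0// ler1n.
move: d1; rewrite !ler_norml; set h := harm _; set l := ln _ in l0 *; set i := _^-1 in i0 i1 *.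
move=> /andP[d1 d2] /andP[h1 h2] /andP[c1 c2].
have th : theta * l <= theta * h by rewrite ler_wpM2l// ltW.
have th2 : theta * h <= theta * (1 + l) by rewrite ler_wpM2l// ltW.
have eh : e * h <= e * (1 + l) by rewrite ler_wpM2l// ltW.
have Ci : 0 <= C * i by rewrite mulr_ge0// ltW.
rewrite mulrBr mulr1 in c1 c2.
lra.
Qed.

End mertens.

(** * Rankin's bound, rough primes and negligibility of smooth integers *)

Section bounds.
Context {R : realType}.
Variables (g : nat -> R) (theta : R).
Hypothesis g0 : forall p, 0 <= g p.
Hypothesis theta0 : 0 < theta.
Hypothesis psi_asymp : forall e : R, 0 < e -> exists C : R, forall n,
  `|psi g (pr n.+1) n - theta * n%:R| <= e * n%:R + C.
Hypothesis sqr_tail : forall e : R, 0 < e -> exists P0, forall N,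
  \sum_(p <- pr N | (P0 < p)%N) ln p%:R * g p ^+ 2 / p%:R ^+ 2 <= e.
Implicit Types (s A K : seq nat) (t n N x p : nat) (d : R).

Definition small d x p : bool := ln p%:R <= d * ln x%:R :> R.
Definition sm d x := [seq p <- pr x.+1 | small d x p].
Definition bg d x := [seq p <- pr x.+1 | ~~ small d x p].

Lemma ln_ge0_nat n : 0 <= ln n%:R :> R.
Proof. by case: n => [|n]; [rewrite ln0 | rewrite ln_ge0// ler1n]. Qed.

(** The condition ln p <= d ln x means p <= n with n the integer part of x^d, and ln n differs from
    d ln x by at most 1. The constant is uniform in d. *)
Lemma Mr_small (e : R) : 0 < e -> exists2 C : R, 0 <= C & forall x d, (0 < x)%N ->
  0 <= d -> d <= 1 -> `|Mr g (sm d x) - theta * (d * ln x%:R)| <= e * (d * ln x%:R) + C.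
Proof.
move=> e0; have [C C0 hC] := Mr_asymp theta0 psi_asymp e0.
exists (C + theta) => [|x d x0 d0 d1]; first by rewrite addr_ge0// ltW.
set y := d * ln x%:R; have y0 : 0 <= y by rewrite mulr_ge0// ln_ge0_nat.
have ey1 : 1 <= expR y by rewrite -expR0 ler_expR.
have eyx : expR y <= x%:R.
  rewrite -[leRHS]lnK ?posrE ?ltr0n// ler_expR ler_piMl//; exact: ln_ge0_nat.
pose n := truncn (expR y).
have n0 : (0 < n)%N by rewrite truncn_gt_nat.
have /andP[n1 n2] := truncn_itv (expR_ge0 y); rewrite -/n in n1 n2.
have nx : (n <= x)%N by rewrite -(ler_nat R) (le_trans n1).
have E : Mr g (sm d x) = Mr g (pr n.+1).
  rewrite /Mr /sm big_filter -(@sum_pr_le _ x.+1 n) ?ltnS//.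
  rewrite big_seq_cond [RHS]big_seq_cond; apply: eq_bigl => p.
  case: (boolP (p \in pr x.+1)) => [pin|//]; rewrite !andTb /small -/y /n truncn_ge_nat ?expR_ge0//.
  have p0 : 0 < p%:R :> R by rewrite ltr0n prime_gt0// (pr_prime pin).
  by rewrite -ler_expR lnK.
have l1 : ln n%:R <= y by rewrite -ler_expR lnK ?posrE ?ltr0n.
have l2 : y <= ln n%:R + 1.
  rewrite -ler_expR; apply: (le_trans (ltW n2)).
  rewrite expRD lnK ?posrE ?ltr0n// (@le_trans _ _ (n%:R * (1 + 1)))//.
    by rewrite mulrDr mulr1 -natrD ler_nat -addn1 leq_add2l.
  by rewrite ler_wpM2l// expR_ge1Dx.
have l0 := ln_ge0_nat n.
have := hC n n0; rewrite -E; set M := Mr _ _; set l := ln n%:R in l1 l2 l0 *.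
rewrite !ler_norml => /andP[h1 h2].
have t1 : theta * l <= theta * y by rewrite ler_wpM2l// ltW.
have t2 : theta * y <= theta * (l + 1) by rewrite ler_wpM2l// ltW.
have t3 : e * l <= e * y by rewrite ler_wpM2l// ltW.
by rewrite mulrDr mulr1 in t2; apply/andP; split; lra.
Qed.

Lemma Es_split d x : Es g (pr x.+1) = Es g (sm d x) * Es g (bg d x).
Proof. by rewrite /Es /sm /bg !big_filter (bigID (small d x)). Qed.

Lemma Es_le_exp s : Es g s <= expR (\sum_(p <- s) g p / p%:R).
Proof.
rewrite expR_sum /Es; apply: ler_prod => p _.
by rewrite addr_ge0 ?divr_ge0//= expR_ge1Dx.
Qed.

Lemma Es_ge_sum s : 1 + \sum_(p <- s) g p / p%:R <= Es g s.
Proof.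
elim: s => [|p s IH]; first by rewrite /Es !big_nil addr0.
have a0 : 0 <= g p / p%:R by rewrite divr_ge0.
have s0 : 0 <= \sum_(p <- s) g p / p%:R by apply: sumr_ge0 => q _; rewrite divr_ge0.
rewrite /Es !big_cons -/(Es g s); move: IH; nra.
Qed.

Lemma exp_le_lin (u : R) : 0 <= u <= 1 -> expR u <= 1 + expR 1 * u.
Proof.
move=> /andP[u0 u1].
have [c] := @MVT_segment R expR expR 0 u u0 (fun y _ => is_derive_expR y)
  (continuous_subspaceT (@continuous_expR R)).
rewrite in_itv /= => /andP[c0 cu]; rewrite expR0 subr0 => E.
have : expR c * u <= expR 1 * u by rewrite ler_wpM2r// ler_expR (le_trans cu).
by rewrite -E lerBlDl.
Qed.

Lemma Mr_filter a s : (forall p, p \in s -> prime p) -> Mr g [seq p <- s | a p] <= Mr g s.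
Proof.
move=> _; rewrite /Mr big_filter big_mkcond; apply: ler_sum => p _; case: ifP => // _.
by rewrite divr_ge0// mulr_ge0// ln_ge0_nat.
Qed.

(* Rankin's trick. *)
Lemma Ls_ge_Es : exists2 c : R, 0 < c & exists x0, forall x, (x0 <= x)%N ->
  c * Es g (pr x.+1) <= Ls g (pr x.+1) x.
Proof.
have [C C0 hC] := Mr_small ltr01.
pose k := expR 1 : R; have k0 : 0 < k := expR_gt0 _.
pose C1 := theta + 1; have C10 : 0 < C1 by rewrite addr_gt0.
(* With [sg] = 1/(d ln x), the gain is sg ln x = 1/d = k C1 + 2, while the tilted product grows by
   at most exp (k C1 + 1). The net factor exp (-1) is below 1/2. *)
pose d := (k * C1 + 2)^-1.
have dp : 0 < k * C1 + 2 by rewrite addr_gt0// mulr_gt0.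
have d0 : 0 < d by rewrite invr_gt0.
have d1 : d <= 1.
  by rewrite invf_le1//; have := mulr_gt0 k0 C10; lra.
have [x0 hx0] := ln_nat_ge (k * C / d + C + 1) (ltn0Sn 0).
exists (expR (- ((C1 + 1) / d)) / 2); first by rewrite divr_gt0 ?expR_gt0.
exists (maxn x0 1) => x; rewrite geq_max => /andP[/hx0 + x_gt0]; rewrite divn1 => lx.
have kCd : 0 <= k * C / d by rewrite divr_ge0 ?mulr_ge0// ltW.
set l := ln x%:R in lx; have l0 : 0 < l by lra.
pose y := d * l; have y0 : 0 < y by rewrite mulr_gt0.
pose sg := y^-1; have sg0 : 0 < sg by rewrite invr_gt0.
have ps p : p \in sm d x -> prime p by rewrite mem_filter => /andP[_ /pr_prime].
have us : uniq (sm d x) by rewrite filter_uniq// pr_uniq.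
have hM : Mr g (sm d x) <= C1 * y + C.
  have := hC x d x_gt0 (ltW d0) d1; rewrite -/l -/y ler_norml => /andP[_].
  by rewrite /C1; lra.
have rankin : Es g (sm d x) - Ls g (sm d x) x <= expR (- sg * l) *
   \prod_(p <- sm d x) (1 + g p / p%:R * expR (sg * ln p%:R)).
  rewrite -(prod_subs (fun p => g p / p%:R * expR (sg * ln p%:R))) /Es -(prod_subs (fun p => g p / p%:R)).
  rewrite /Ls -sumrB big_distrr /= big_seq [leRHS]big_seq; apply: ler_sum => A As.
  have n0 := nn_gt0 ps As.
  rewrite (pwM (fun p => g p / p%:R) (fun p => expR (sg * ln p%:R))) !pw_div.
  have -> : pw (fun p => expR (sg * ln p%:R)) A = expR (sg * ln (nn A)%:R) :> R.
    by rewrite (ln_nn ps As) big_distrr expR_sum.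
  have -> : pw g A / (nn A)%:R - pw g A * ((nn A <= x)%:R / (nn A)%:R) =
    pw g A / (nn A)%:R * (1 - (nn A <= x)%:R) by ring.
  rewrite mulrCA ler_wpM2l ?divr_ge0 ?pw_ge0// -expRD.
  case: leqP => h; first by rewrite subrr expR_ge0.
  rewrite subr0 -[leLHS]expR0 ler_expR mulNr addrC -mulrBr mulr_ge0 ?(ltW sg0)//.
  by rewrite subr_ge0 /l ler_ln ?posrE ?ltr0n// ler_nat ltnW.
(* The tilt satisfies sg ln p <= 1 on the small primes, where exp u <= 1 + e u by convexity; the
   surplus is a Mertens sum. *)
have prod_le : \prod_(p <- sm d x) (1 + g p / p%:R * expR (sg * ln p%:R)) <=
   Es g (sm d x) * expR (k * sg * Mr g (sm d x)).
  rewrite /Mr big_distrr expR_sum /Es -big_split /= big_seq [leRHS]big_seq.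
  apply: ler_prod => p pin; have a0 : 0 <= g p / p%:R by rewrite divr_ge0.
  rewrite addr_ge0 ?mulr_ge0 ?expR_ge0//=.
  have u0 : 0 <= sg * ln p%:R by rewrite mulr_ge0 ?(ltW sg0)// ln_ge0_nat.
  have u1 : sg * ln p%:R <= 1.
    rewrite /sg mulrC ler_pdivrMr// mul1r.
    by move: pin; rewrite mem_filter => /andP[].
  have := @exp_le_lin (sg * ln p%:R); rewrite u0 u1 => /(_ isT) h.
  have h2 := expR_ge1Dx (k * sg * (g p * ln p%:R / p%:R)).
  apply: (@le_trans _ _ ((1 + g p / p%:R) * (1 + k * sg * (g p * ln p%:R / p%:R)))); last first.
    by rewrite ler_wpM2l// addr_ge0.
  have -> : k * sg * (g p * ln p%:R / p%:R) = g p / p%:R * (k * (sg * ln p%:R)) by ring.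
  move: h a0; rewrite -/k; set a := g p / p%:R; set u := sg * _ in u0 u1 *; set ev := expR _ => h a0.
  have q1 : a * ev <= a * (1 + k * u) by rewrite ler_wpM2l.
  have q2 : 0 <= a * (a * (k * u)) := mulr_ge0 a0 (mulr_ge0 a0 (mulr_ge0 (ltW k0) u0)).
  nra.
have expo : - sg * l + k * sg * Mr g (sm d x) <= - 1.
  have h1 : sg * l = k * C1 + 2.
    by rewrite /sg /y /d invfM invrK mulfVK// gt_eqF.
  have h2 : k * sg * Mr g (sm d x) <= k * sg * (C1 * y + C).
    by rewrite ler_wpM2l// mulr_ge0 ?ltW.
  have h3 : k * sg * (C1 * y + C) = k * C1 + k * C * sg.
    by rewrite mulrDr /sg; field; rewrite gt_eqF.
  have h4 : k * C * sg <= 1.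
    rewrite /sg ler_pdivrMr// mul1r /y [leRHS]mulrC -ler_pdivrMr//.
    apply: le_trans lx; lra.
  rewrite mulNr h1; lra.
have half : Es g (sm d x) / 2 <= Ls g (sm d x) x.
  have E0 := Es_gt0 g0 (sm d x).
  have q : expR (- sg * l) * (Es g (sm d x) * expR (k * sg * Mr g (sm d x))) <= Es g (sm d x) / 2.
    rewrite mulrCA -expRD ler_wpM2l ?(ltW E0)//.
    apply: (@le_trans _ _ (expR (-1))); first by rewrite ler_expR.
    rewrite expRN lef_pV2 ?posrE ?expR_gt0//; have := expR_ge1Dx (1 : R); lra.
  have q2 := le_trans rankin (ler_wpM2l (expR_ge0 _) prod_le).
  have := le_trans q2 q; lra.
(* On the remaining primes ln p > d ln x, so the sum of g(p)/p is at most a Mertens sum divided by d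
   ln x, which is bounded. *)
have big : Es g (bg d x) <= expR ((C1 + 1) / d).
  apply: (le_trans (Es_le_exp _)); rewrite ler_expR.
  apply: (@le_trans _ _ (sg * Mr g (bg d x))).
    rewrite /Mr big_distrr /= big_seq [leRHS]big_seq; apply: ler_sum => p.
    rewrite mem_filter /small -ltNge => /andP[h _].
    rewrite [leRHS](_ : _ = sg * ln p%:R * (g p / p%:R)); last by ring.
    rewrite ler_peMl ?divr_ge0//.
    by rewrite /sg mulrC ler_pdivlMr// mul1r ltW.
  have h1 : Mr g (bg d x) <= C1 * l + C.
    have := hC x 1 x_gt0 ler01 (lexx _); rewrite mul1r -/l ler_norml => /andP[_].
    have -> : sm 1 x = pr x.+1.
      apply/all_filterP/allP => p; rewrite mem_pr ltnS /small mul1r => /andP[pp px].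
      by rewrite ler_ln ?posrE ?ltr0n ?(prime_gt0 pp)// ler_nat.
    have := @Mr_filter (fun p => ~~ small d x p) (pr x.+1) (@pr_prime _).
    rewrite -/(bg d x) /C1; lra.
  apply: (@le_trans _ _ (sg * ((C1 + 1) * l))).
    rewrite ler_wpM2l ?(ltW sg0)// (le_trans h1)//.
    have -> : (C1 + 1) * l = C1 * l + l by ring.
    rewrite lerD2l; apply: le_trans lx; lra.
  by rewrite /sg /y le_eqVlt; apply/orP; left; apply/eqP; field; rewrite !gt_eqF.
rewrite (Es_split d).
have LL : Ls g (sm d x) x <= Ls g (pr x.+1) x by exact: Ls_filter.
apply: le_trans LL; apply: le_trans half.
have q : expR (- ((C1 + 1) / d)) * Es g (bg d x) <= 1.
  by rewrite expRN mulrC ler_pdivrMr ?expR_gt0// mul1r.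
rewrite [leLHS](_ : _ = Es g (sm d x) / 2 * (expR (- ((C1 + 1) / d)) * Es g (bg d x))); last by ring.
by rewrite ler_piMr// divr_ge0// ltW// Es_gt0.
Qed.

(** B ln x ~ theta x L combined with Rankin's L >= c E. It is the counterpart of [Bs_upper], so that
    quotients of B reduce to quotients of Euler products. *)
Lemma Bs_lower : exists2 c : R, 0 < c & exists x0, forall x, (x0 <= x)%N ->
  c * (x%:R * Es g (pr x.+1)) <= Bs g (pr x.+1) x * ln x%:R.
Proof.
have [c c0 [x1 hc]] := Ls_ge_Es.
have h2 : 0 < theta / 2 by rewrite divr_gt0.
have [x2 hB] := Bs_Ls g0 theta0 psi_asymp sqr_tail [::] h2.
exists (theta / 2 * c); first by rewrite mulr_gt0.
exists (maxn (maxn x1 x2) 1) => x; rewrite !geq_max => /andP[/andP[/hc{}hc x2x] x0].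
have := hB x.+1 x x2x (ltnSn _).
have -> : sK [::] x.+1 = pr x.+1 by apply/all_filterP/allP.
have xL : 0 < x%:R * Ls g (pr x.+1) x.
  by rewrite mulr_gt0 ?ltr0n// (lt_le_trans ltr01)// Ls_ge1.
rewrite ler_norml => /andP[h _].
have {}h : theta / 2 <= Bs g (pr x.+1) x * ln x%:R / (x%:R * Ls g (pr x.+1) x) by lra.
rewrite ler_pdivlMr// in h; apply: le_trans h.
rewrite -mulrA ler_wpM2l ?(ltW h2)// mulrCA ler_wpM2l//.
Qed.

(** Each range x^(2^-(J+1)) < p <= x^(2^-J) contributes at least theta/4: with y = 2^-J ln x its
    Mertens sum is about theta y/2, and ln p <= y there. *)
Lemma big_sum J : exists x0, forall x, (x0 <= x)%N ->
  J%:R * (theta / 4) <= \sum_(p <- bg (2 ^- J) x) g p / p%:R.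
Proof.
elim: J => [|J [x1 IH]].
  by exists 0%N => x _; rewrite mul0r sumr_ge0// => p _; rewrite divr_ge0.
(* The two Mertens estimates, at y and y/2, lose theta y/8 through theta/12 and another theta y/8
   through 2 C once 16 C <= theta y; of theta y/2 there remains theta y/4. *)
have e0 : 0 < theta / 12 by rewrite divr_gt0.
have [C C0 hC] := Mr_small e0.
have [x2 hx2] := ln_nat_ge (2 ^+ J * (16 * C / theta) + 1) (ltn0Sn 0).
exists (maxn (maxn x1 x2) 1) => x; rewrite !geq_max => /andP[/andP[/IH{}IH /hx2 + x0]].
rewrite divn1 => lx; set l := ln x%:R in lx.
have a0 : 0 < 2 ^- J :> R by rewrite invr_gt0 exprn_gt0.
have a1 : 2 ^- J <= 1 :> R by rewrite invf_le1 ?exprn_gt0// exprn_ege1// ler1n.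
have b0 : 2 ^- J.+1 = 2 ^- J / 2 :> R by rewrite exprS invfM mulrC.
have C16 : 0 <= 16 * C / theta by rewrite divr_ge0 ?mulr_ge0// ltW.
have l0 : 0 < l.
  by rewrite (lt_le_trans _ lx)// ltr_wpDl// mulr_ge0// exprn_ge0.
pose y := 2 ^- J * l; have y0 : 0 < y by rewrite mulr_gt0.
have yC : 16 * C <= theta * y.
  rewrite [leRHS]mulrC -ler_pdivrMr// -[leLHS](mulKf (lt0r_neq0 (exprn_gt0 J (ltr0Sn R 1)))).
  rewrite /y ler_wpM2l ?(ltW a0)//; lra.
have h1 := hC x (2 ^- J) x0 (ltW a0) a1.
have h2 := hC x (2 ^- J.+1) x0.
rewrite b0 in h2; have {h2} := h2 (divr_ge0 (ltW a0) (ler0n _ _)).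
have -> : 2 ^- J / 2 <= 1 :> R by lra.
move=> /(_ isT); rewrite -/l mulrAC -/y => h2.
move: h1; rewrite -/l -/y => h1.
pose seg := [seq p <- bg (2 ^- J / 2) x | small (2 ^- J) x p].
have E1 : \sum_(p <- bg (2 ^- J / 2) x) g p / p%:R =
   \sum_(p <- bg (2 ^- J) x) g p / p%:R + \sum_(p <- seg) g p / p%:R.
  rewrite /seg /bg [in LHS]big_filter (bigID (small (2 ^- J) x)) /= addrC.
  congr (_ + _); last by rewrite big_filter big_filter_cond.
  rewrite big_filter; apply: eq_bigl => p.
  rewrite andbC; case: (boolP (small (2 ^- J) x p)) => //= h.
  apply/negP => h'; case/negP: h; rewrite /small in h' *; apply: (le_trans h').
  by rewrite ler_wpM2r ?ln_ge0_nat//; lra.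
have E2 : Mr g (sm (2 ^- J) x) = Mr g (sm (2 ^- J / 2) x) + Mr g seg.
  rewrite /Mr /seg /sm /bg [in LHS]big_filter (bigID (small (2 ^- J / 2) x)) /=.
  congr (_ + _); last first.
    by rewrite big_filter big_filter_cond; apply: eq_bigl => p; rewrite andbC.
  rewrite big_filter; apply: eq_bigl => p.
    rewrite andbC; case: (boolP (small (2 ^- J / 2) x p)) => //= h.
    rewrite /small in h *; apply: (le_trans h).
    by rewrite ler_wpM2r ?ln_ge0_nat//; lra.
rewrite b0 E1 -natr1 mulrDl mul1r lerD//.
have segle : Mr g seg <= y * \sum_(p <- seg) g p / p%:R.
  rewrite /Mr big_distrr /= big_seq [leRHS]big_seq; apply: ler_sum => p.
  rewrite mem_filter /small -/l -/y => /andP[h _].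
  by rewrite mulrAC [leLHS]mulrC ler_wpM2r// divr_ge0.
rewrite -(ler_pM2l y0); apply: le_trans segle.
have -> : Mr g seg = Mr g (sm (2 ^- J) x) - Mr g (sm (2 ^- J / 2) x) by rewrite E2 addrC addKr.
move: h1 h2; rewrite !ler_norml => /andP[h1 _] /andP[_ h2]; lra.
Qed.

(** The upper bound for the smooth sum contains the Euler product over small primes only, the lower
    bound for B contains all of it. The quotient is a constant over the product on the large primes,
    which [big_sum] makes as large as needed. *)
Lemma smooth_negligible (eta : R) : 0 < eta -> exists2 d : R, 0 < d <= 1 &
  exists x0, forall x, (x0 <= x)%N -> Bs g (sm d x) x <= eta * Bs g (pr x.+1) x.
Proof.
move=> eta0; have [c c0 [x1 hc]] := Bs_lower.
have [C C0 hC] := psi_ub g0 theta0 psi_asymp.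
pose J := (truncn ((C + 1) / (c * eta) / (theta / 4))).+1.
have t4 : 0 < theta / 4 by rewrite divr_gt0.
have hJ : (C + 1) / (c * eta) <= J%:R * (theta / 4).
  by rewrite -ler_pdivrMr// ltW// truncnS_gt.
have [x2 hJ2] := big_sum J.
exists (2 ^- J); first by rewrite invr_gt0 exprn_gt0//= invf_le1 ?exprn_gt0// exprn_ege1// ler1n.
exists (maxn (maxn x1 x2) 2) => x; rewrite !geq_max => /andP[/andP[/hc{}hc /hJ2{}hJ2] x0].
have xp : 0 < x%:R :> R by rewrite ltr0n (leq_trans _ x0).
have lx : 0 < ln x%:R :> R by rewrite ln_gt0// ltr1n.
have ps p : p \in sm (2 ^- J) x -> prime p by rewrite mem_filter => /andP[_ /pr_prime].
have us : uniq (sm (2 ^- J) x) by rewrite filter_uniq// pr_uniq.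
have up := @Bs_upper R g g0 _ us ps C x (leq_trans (isT : 0 < 2)%N x0) (hC _ _).
have Lsm := Ls_le_Es g0 (sm (2 ^- J) x) x.
have Ebg := Es_ge_sum (bg (2 ^- J) x).
rewrite -(ler_pM2r lx); apply: (le_trans up).
rewrite -mulrA -mulrA; apply: le_trans (ler_wpM2l (ltW eta0) hc).
rewrite (Es_split (2 ^- J)).
set Lm := Ls _ _ _ in Lsm *; set Em := Es g (sm _ _) in Lsm *; set Eb := Es g _ in Ebg *.
have Em0 : 0 < Em by exact: Es_gt0.
apply: (@le_trans _ _ ((C + 1) * (x%:R * Em))).
  by rewrite ler_wpM2l ?addr_ge0// ler_wpM2l// ltW.
have k0 : 0 < c * eta by rewrite mulr_gt0.
have h : C + 1 <= c * eta * Eb by rewrite mulrC -ler_pdivrMr//; lra.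
have -> : eta * (c * (x%:R * (Em * Eb))) = c * eta * Eb * (x%:R * Em) by ring.
by rewrite ler_wpM2r// mulr_ge0// ltW.
Qed.

(** For p > M one has 1 <= d' ln p, so the exponent is a constant plus d' times a Mertens sum; d' =
    d/(theta + 1) makes the latter at most d ln x up to a constant. *)
Lemma Es_subpoly (d : R) : 0 < d -> exists C : R, forall x, (0 < x)%N ->
  Es g (pr x.+1) <= expR (C + d * ln x%:R).
Proof.
move=> d0; have [C C0 hC] := Mr_asymp theta0 psi_asymp ltr01.
pose d' := d / (theta + 1); have t1 : 0 < theta + 1 by rewrite addr_gt0.
have d'0 : 0 < d' by rewrite divr_gt0.
pose M := truncn (expR d'^-1).
exists (\sum_(p <- pr M.+1) g p / p%:R + d' * C) => x x0.
apply: (le_trans (Es_le_exp _)); rewrite ler_expR.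
rewrite (bigID (fun p => (p <= M)%N)) /= -/(pr x.+1) -/(pr M.+1) -addrA; apply: lerD.
  rewrite -big_filter; apply: sum_sub_le; first by rewrite filter_uniq// pr_uniq.
    by move=> p; rewrite mem_filter mem_pr => /and3P[h1 h2 _]; rewrite mem_pr h2 ltnS.
  by move=> p _; rewrite divr_ge0.
apply: (@le_trans _ _ (d' * Mr g (pr x.+1))).
  rewrite /Mr big_distrr big_mkcond /= -/(pr x.+1) big_seq [leRHS]big_seq; apply: ler_sum => p pin.
  have p0 : 0 < p%:R :> R by rewrite ltr0n prime_gt0// (pr_prime pin).
  case: ifP => h; last by rewrite mulr_ge0 ?(ltW d'0)// divr_ge0// mulr_ge0// ln_ge0_nat.
  rewrite [leRHS](_ : _ = d' * ln p%:R * (g p / p%:R)); last by ring.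
  rewrite ler_peMl ?divr_ge0//.
  rewrite -ler_pdivrMl// mulr1 -ler_expR lnK ?posrE//.
  by move: h; rewrite -ltnNge /M truncn_lt_nat ?expR_ge0// => /ltW.
have := hC x x0; rewrite ler_norml mul1r => /andP[_ h].
have {}h : Mr g (pr x.+1) <= (theta + 1) * ln x%:R + C by lra.
apply: (le_trans (ler_wpM2l (ltW d'0) h)); rewrite mulrDr mulrA.
have -> : d' * (theta + 1) = d by rewrite /d' mulfVK// gt_eqF.
by rewrite addrC.
Qed.

End bounds.

Lemma pr_cat (a : pred nat) N : (forall p q, (q <= p)%N -> a p -> a q) ->
  pr N = [seq p <- pr N | ~~ a p] ++ [seq p <- pr N | a p].
Proof.
move=> ha; elim: N => //= N IH; case: ifP => // pN /=.
case: (boolP (a N)) => aN /=; last by rewrite -IH.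
have allN p : p \in pr N -> a p by rewrite mem_pr => /andP[_ /ltnW pN']; apply: ha aN.
rewrite (_ : [seq p <- pr N | ~~ a p] = [::]) /=.
  by congr (_ :: _); symmetry; apply/all_filterP/allP => p /allN.
by rewrite -(filter_pred0 (pr N)); apply: eq_in_filter => p /allN ->.
Qed.

Lemma pr_restrict N n : (n <= N)%N -> [seq p <- pr N | (p < n)%N] = pr n.
Proof.
elim: N => [|N IH]; first by rewrite leqn0 => /eqP->.
rewrite leq_eqVlt => /orP[/eqP->|].
  apply/all_filterP/allP => p; by rewrite (mem_pr N.+1) => /andP[].
rewrite ltnS => nN /=; case: ifP => _ /=; last exact: IH.
by rewrite ltnNge nN /= IH.
Qed.

(** * Walsh coefficients of the bracket *)

Section conditional_variance.
Context {R : realType}.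
Variables (f : nat -> R) (n : nat) (k : R).
Implicit Types (s u v w A K : seq nat) (x : nat -> R).

Let g p := f p ^+ 2.
Let g0 p : 0 <= g p. Proof. exact: sqr_ge0. Qed.

Definition le2 (UW : seq nat * seq nat) (a : nat) : R :=
  (nn UW.1 * a <= n)%:R * (nn UW.2 * a <= n)%:R.

Lemma le2_ge0 UW a : 0 <= le2 UW a. Proof. by rewrite mulr_ge0. Qed.

Definition off K s := [seq p <- s | p \notin K].

(** By [walsh_mul], [pw f K * ZZ s K] is the Walsh coefficient at K of the square of [XX f n s]. *)
Definition ZZ s K : R :=
  \sum_(UW <- splits K) \sum_(A <- subs (off K s)) pw g A * le2 UW (nn A).

(* k^2 f_K (Theta u v K) is the Walsh coefficient of TT at K. *)
Fixpoint Theta u v K : R :=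
  if u is p :: u' then
    if p \in K then 0 else Theta u' v K +
      g p * \sum_(UW <- splits K) \sum_(A <- subs (off K (u' ++ v))) pw g A * le2 UW (p * nn A)
  else 0.

Lemma ZZ_cons p s K : p \notin K -> ZZ (p :: s) K = ZZ s K +
  g p * \sum_(UW <- splits K) \sum_(A <- subs (off K s)) pw g A * le2 UW (p * nn A).
Proof.
move=> pK; rewrite /ZZ big_distrr -big_split /=; apply: eq_bigr => UW _.
rewrite /off /= pK sum_subs_cons; congr (_ + _); rewrite big_distrr /=.
by apply: eq_bigr => A _; rewrite pw_cons nn_cons mulrA.
Qed.

Lemma Theta_ge0 u v K : 0 <= Theta u v K.
Proof.
elim: u => //= p u IH; case: ifP => // _; rewrite addr_ge0// mulr_ge0//.
by do 2![apply: sumr_ge0 => ? _]; rewrite mulr_ge0 ?pw_ge0 ?le2_ge0.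
Qed.

(** Averaging (X + x_p z)^2 over x_p adds z^2 to X^2. Away from the primes of u the bracket thus
    telescopes to a difference of conditional mean squares. *)
Lemma Theta_small u v K : (forall p, p \in u -> p \notin K) ->
  Theta u v K = ZZ (u ++ v) K - ZZ v K.
Proof.
elim: u => [|p u IH] h; first by rewrite subrr.
have pK : p \notin K by apply: h; rewrite inE eqxx.
rewrite [LHS]/= (negbTE pK) IH => [|q qu]; last by apply: h; rewrite inE qu orbT.
by rewrite cat_cons ZZ_cons// addrAC.
Qed.

Lemma nn_ge1 A : all (fun p => 0 < p)%N A -> (0 < nn A)%N.
Proof.
elim: A => [|p A IH]; first by rewrite nn_nil.
by rewrite nn_cons muln_gt0 => /= /andP[-> /IH].
Qed.

Definition reach u (UW : seq nat * seq nat) :=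
  has (fun p => (nn UW.1 * p <= n)%N && (nn UW.2 * p <= n)%N) u.

(** Each common part is counted at most once, at its first prime in the list u. What must not be
    forgotten is that such a prime exists: a splitting (U, W) contributes only if U p <= n and W p
    <= n for some recorded p, and [coef_bound] rests on this. *)
Lemma Theta_le u v K : (forall p, p \in u ++ v -> (0 < p)%N) ->
  Theta u v K <= \sum_(UW <- splits K) (reach u UW)%:R *
    \sum_(A <- subs (off K (u ++ v))) pw g A * le2 UW (nn A).
Proof.
elim: u => [|p u IH] pos.
  by apply: sumr_ge0 => UW _; rewrite /reach mul0r.
rewrite [leLHS]/=; case: ifP => pK.
  apply: sumr_ge0 => UW _; rewrite mulr_ge0//.
  by apply: sumr_ge0 => A _; rewrite mulr_ge0 ?pw_ge0 ?le2_ge0.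
have pos' q : q \in u ++ v -> (0 < q)%N by move=> h; apply: pos; rewrite inE h orbT.
apply: (le_trans (lerD (IH pos') (lexx _))).
rewrite big_distrr -big_split /=; apply: ler_sum => UW _.
have S0 s' m : 0 <= \sum_(A <- subs s') pw g A * le2 UW (m * nn A).
  by apply: sumr_ge0 => A _; rewrite mulr_ge0 ?pw_ge0 ?le2_ge0.
have S1 s' : 0 <= \sum_(A <- subs s') pw g A * le2 UW (nn A).
  by apply: sumr_ge0 => A _; rewrite mulr_ge0 ?pw_ge0 ?le2_ge0.
rewrite /off /= pK sum_subs_cons mulrDr; apply: lerD.
  apply: ler_wpM2r; first exact: S1.
  by apply: le_natr_bool => h; rewrite /reach /= in h *; rewrite h orbT.
have -> : \sum_(A <- subs [seq q <- u ++ v | q \notin K]) pw g (p :: A) * le2 UW (nn (p :: A))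
  = g p * \sum_(A <- subs [seq q <- u ++ v | q \notin K]) pw g A * le2 UW (p * nn A).
  by rewrite big_distrr; apply: eq_bigr => A _; rewrite pw_cons nn_cons -mulrA.
rewrite mulrCA ler_wpM2l// /reach /=.
case: (boolP ((nn UW.1 * p <= n)%N && (nn UW.2 * p <= n)%N)) => h; first by rewrite mul1r.
apply: (@le_trans _ _ 0); last by rewrite mulr_ge0.
rewrite big_seq big1// => A As; rewrite /le2.
have A1 : (0 < nn A)%N.
  apply/nn_ge1/allP => q qA; apply: pos'.
  by move: (subs_sub As qA); rewrite mem_filter => /andP[].
have mono a : (a * (p * nn A) <= n)%N -> (a * p <= n)%N.
  by apply: leq_trans; rewrite mulnA leq_pmulr.
case: (boolP (nn UW.1 * (p * nn A) <= n)%N) => [/mono h1|_]; last by rewrite mul0r mulr0.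
case: (boolP (nn UW.2 * (p * nn A) <= n)%N) => [/mono h2|_]; last by rewrite mulr0 mulr0.
by rewrite h1 h2 in h.
Qed.

(** The increment at p involves only the primes after it in the list. A set K containing p therefore
    receives nothing from the increment at p or from any later in the list, whence the zero branch
    of [Theta]. *)
Lemma TT_walsh u v x : uniq (u ++ v) -> (forall p, x p ^+ 2 = 1) ->
  TT f n k u v x = \sum_(K <- subs (u ++ v)) k ^+ 2 * (pw f K * Theta u v K) * pw x K.
Proof.
move=> uu x1; elim: u uu => [|p u IH].
  by move=> _ /=; rewrite big1// => K _; rewrite !mulr0 mul0r.
rewrite cat_cons => /andP[pu uu]; rewrite sum_subs_cons [X in _ + X]big1 ?addr0; last first.
  by move=> K _; rewrite /= inE eqxx !mulr0 mul0r.
rewrite [LHS]/= IH// exprMn /zz exprMn -/(g p) [X in _ * (_ * X)]expr2.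
rewrite (walsh_mul f (fun m => (p * m <= n)%:R) (fun m => (p * m <= n)%:R) uu (fun q _ => x1 q)).
rewrite !big_distrr -big_split /= big_seq [RHS]big_seq; apply: eq_bigr => K Ks.
have pK : (p \in K) = false.
  by apply/negbTE; apply: contra pu; apply: subs_sub Ks.
rewrite pK [in RHS]mulrDr mulrDr mulrDl; congr (_ + _).
rewrite [in LHS](_ : \sum_(UW <- splits K) _ = \sum_(UW <- splits K)
   \sum_(A <- subs (off K (u ++ v))) pw g A * le2 UW (p * nn A)); first by ring.
apply: eq_bigr => UW _; apply: eq_bigr => A _; rewrite /le2.
by rewrite !(mulnCA p).
Qed.

Lemma off_cat K u v : off K (u ++ v) = off K u ++ off K v.
Proof. exact: filter_cat. Qed.

Lemma off_disj K u : (forall p, p \in u -> p \notin K) -> off K u = u.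
Proof. by move=> h; apply/all_filterP/allP. Qed.

(* Positivity of the conditional expectation of a square. *)
Lemma ZZ_walsh_ge0 w v x : uniq (w ++ v) -> (forall p, x p ^+ 2 = 1) ->
  0 <= \sum_(K <- subs v) pw x K * (pw f K * ZZ (w ++ v) K).
Proof.
rewrite cat_uniq => /and3P[uw /hasPn wv uv] x1.
(* Integers are sorted by their part D composed of primes of w. Averaging over those signs removes
   the cross terms between different D and leaves a weighted sum of squares. *)
have -> : \sum_(K <- subs v) pw x K * (pw f K * ZZ (w ++ v) K) =
  \sum_(D <- subs w) pw g D * (\sum_(A <- subs v) pw f A * pw x A * (nn A * nn D <= n)%:R) ^+ 2.
  under [RHS]eq_bigr => D _ do rewrite expr2
    (walsh_mul f (fun m => (m * nn D <= n)%:R) (fun m => (m * nn D <= n)%:R) uv (fun q _ => x1 q)).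
  under [RHS]eq_bigr do rewrite big_distrr /=.
  rewrite exchange_big /= big_seq [RHS]big_seq; apply: eq_bigr => K Ks.
  have wK p : p \in w -> p \notin K.
    move=> pw'; apply/negP => /(subs_sub Ks) /wv; by rewrite pw'.
  under [RHS]eq_bigr do rewrite mulrCA (mulrCA (pw g _)).
  rewrite -!big_distrr /=; congr (_ * (_ * _)).
  under [RHS]eq_bigr do rewrite big_distrr /=.
  rewrite exchange_big /=; apply: eq_bigr => UW _.
  rewrite off_cat (off_disj wK) sum_subs_cat; apply: eq_bigr => D _.
  rewrite big_distrr; apply: eq_bigr => C _ /=.
  by rewrite pw_cat nn_cat /le2 -mulrA (mulnC (nn D)) !mulnA.
by apply: sumr_ge0 => D _; rewrite mulr_ge0 ?pw_ge0 ?sqr_ge0.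
Qed.

Lemma splits_gt0 K UW : (forall p, p \in K -> (0 < p)%N) -> UW \in splits K ->
  (0 < nn UW.1)%N /\ (0 < nn UW.2)%N.
Proof.
move=> K0 UWK.
have pos : all (fun p => 0 < p)%N UW.1 && all (fun p => 0 < p)%N UW.2.
  elim: K K0 UW UWK => [|p K' IH] K0 UW /=; first by rewrite inE => /eqP->.
  have p0 : (0 < p)%N by apply: K0; rewrite inE eqxx.
  have {}IH := IH (fun q qK => K0 q (mem_behead (s := p :: K') qK)).
  by rewrite mem_cat => /orP[] /mapP[UW' /IH /andP[h1 h2] ->] /=; rewrite ?p0 h1 h2.
by case/andP: pos => /nn_ge1 a1 /nn_ge1 a2.
Qed.

(** The two constraints U a <= n and W a <= n amount to the single bound a <= n / max (U, W); this
    is where the maximum in the limiting coefficients comes from. *)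
Lemma sum_le2 s K UW : (forall p, p \in K -> (0 < p)%N) -> UW \in splits K ->
  \sum_(A <- subs s) pw g A * le2 UW (nn A) = Bs g s (n %/ maxn (nn UW.1) (nn UW.2)).
Proof.
move=> K0 UWK; apply: eq_bigr => A _; congr (_ * _).
have [a1 a2] := splits_gt0 K0 UWK.
rewrite /le2 leq_divRL; last by rewrite leq_max a1.
by rewrite maxnMr geq_max (mulnC (nn A)) (mulnC (nn A)) -natrM mulnb.
Qed.

Lemma ZZ_Bs s K : (forall p, p \in K -> (0 < p)%N) ->
  ZZ s K = \sum_(UW <- splits K) Bs g (off K s) (n %/ maxn (nn UW.1) (nn UW.2)).
Proof. by move=> K0; apply: eq_big_seq => UW UWK; apply: sum_le2 UWK. Qed.

End conditional_variance.

(** * Walsh coefficients of the limiting variance *)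

Section limit_coefficients.
Context {R : realType}.
Variable f : nat -> R.
Implicit Types (s u v K : seq nat).

Definition DD K : R := \sum_(UW <- splits K) (maxn (nn UW.1) (nn UW.2))%:R^-1.

(* Walsh coefficients of the limiting variance. *)
Definition vK K : R := pw f K / Es (fun p => f p ^+ 2) K * DD K.

Definition VV s (x : nat -> R) : R := \sum_(K <- subs s) vK K * pw x K.

Lemma DD_ge0 K : 0 <= DD K.
Proof. by apply: sumr_ge0 => UW _; rewrite invr_ge0. Qed.

Lemma vK_nil : vK [::] = 1.
Proof. by rewrite /vK /DD /= big_seq1 /= !nn_nil pw_nil /Es big_nil divr1 mul1r invr1. Qed.

Lemma Es_off (g : nat -> R) s K : (forall p, 0 <= g p) -> uniq s -> K \in subs s ->
  Es g s = Es g (off K s) * Es g K.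
Proof.
move=> g0; elim: s K => [|p s IH] K /=; first by rewrite inE => _ /eqP->; rewrite /Es !big_nil mulr1.
move=> /andP[ps us]; rewrite mem_cat => /orP[Ks|/mapP[K' Ks ->]].
  have pK : p \notin K by apply: contra ps; apply: subs_sub.
  by rewrite /off /= pK /Es !big_cons -mulrA; congr (_ * _); exact: IH.
rewrite /off /= inE eqxx /= /Es !big_cons mulrCA; congr (_ * _).
rewrite -/(Es g s) (IH K')//; congr (_ * _); rewrite /Es; congr bigop.
apply: eq_in_filter => q qs; rewrite inE negb_or.
by have -> : q != p by apply: contraNneq ps => <-.
Qed.

Lemma subs_cat_rest u v : exists2 r, subs (u ++ v) = subs v ++ r &
  forall K, K \in r -> has (mem u) K.
Proof.
elim: u => [|p u [r E h]]; first by exists [::]; rewrite ?cats0.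
exists (r ++ map (cons p) (subs (u ++ v))); first by rewrite /= E catA.
move=> K; rewrite mem_cat => /orP[/h/hasP[q qK qu]|/mapP[K' _ ->]].
  by apply/hasP; exists q => //; rewrite inE; apply/orP; right.
by rewrite /= inE eqxx.
Qed.

End limit_coefficients.

Lemma cvg_bigsum {R : realType} (I : Type) (r : seq I) (F : I -> nat -> R) (l : I -> R) :
  (forall i, F i @ \oo --> l i) ->
  (fun x => \sum_(i <- r) F i x) @ \oo --> \sum_(i <- r) l i.
Proof.
move=> h; elim: r => [|i r IH].
  rewrite big_nil; under eq_fun do rewrite big_nil; exact: cvg_cst.
rewrite big_cons; under eq_fun do rewrite big_cons; exact: cvgD.
Qed.

(** * Domination of the coefficients of the bracket *)

Section cube_limit.
Context {R : realType}.
Variables (f : nat -> R) (theta c4 K4 Q : R).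
Let g p := f p ^+ 2.
Hypothesis theta0 : 0 < theta.
Hypothesis psi_asymp : forall e : R, 0 < e -> exists C : R, forall n,
  `|psi g (pr n.+1) n - theta * n%:R| <= e * n%:R + C.
Hypothesis c40 : 0 < c4.
Hypothesis fourth : forall N, \sum_(p <- pr N) f p ^+ 4 / p%:R ^+ 2 * expR (c4 * ln p%:R) <= K4.
Hypothesis Qbound : forall N, \sum_(K <- subs (pr N)) vK f K ^+ 2 <= Q.
Implicit Types (s u v A K : seq nat) (n N y : nat).

Let g0 p : 0 <= g p. Proof. exact: sqr_ge0. Qed.

Lemma K4_ge0 : 0 <= K4.
Proof. by have := fourth 0; rewrite /= big_nil. Qed.

Lemma f4_ge0 p : 0 <= f p ^+ 4. Proof. by rewrite (exprM _ 2 2) sqr_ge0. Qed.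

(** Half of the power p^c4 in [fourth] absorbs ln p, by ln p <= (2/c4) p^(c4/2); the other half
    makes the tail small. *)
Lemma sqr_tail (e : R) : 0 < e -> exists P0, forall N,
  \sum_(p <- pr N | (P0 < p)%N) ln p%:R * g p ^+ 2 / p%:R ^+ 2 <= e.
Proof.
move=> e0; have K40 := K4_ge0.
have [P0 hP0] := ln_nat_ge (2 / c4 * (2 / c4 * K4 / e)) (ltn0Sn 0).
exists (maxn P0 1) => N.
pose E := 2 / c4 * expR (- (c4 / 2 * ln (maxn P0 1)%:R)).
have c2 : 0 < c4 / 2 by rewrite divr_gt0.
have c2' : 0 < 2 / c4 by rewrite divr_gt0.
have c22 : c4 / 2 * (2 / c4) = 1 by field; rewrite gt_eqF.
have c22' : 2 / c4 * (c4 / 2) = 1 by rewrite mulrC.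
apply: (@le_trans _ _ (E * K4)).
  apply: le_trans (ler_wpM2l (mulr_ge0 (ltW c2') (expR_ge0 _)) (fourth N)).
  rewrite big_distrr big_mkcond /= big_seq [leRHS]big_seq; apply: ler_sum => p pin.
  have p0 := prime_gt0 (pr_prime pin).
  have F0 : 0 <= f p ^+ 4 / p%:R ^+ 2 by rewrite divr_ge0 ?f4_ge0 ?sqr_ge0.
  case: ifP => h; last first.
    exact: mulr_ge0 (mulr_ge0 (ltW c2') (expR_ge0 _)) (mulr_ge0 F0 (expR_ge0 _)).
  have -> : ln p%:R * g p ^+ 2 / p%:R ^+ 2 = f p ^+ 4 / p%:R ^+ 2 * ln p%:R by rewrite /g; ring.
  rewrite mulrCA ler_wpM2l//.
  have h1 : ln p%:R <= 2 / c4 * expR (c4 / 2 * ln p%:R).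
    have := expR_ge1Dx (c4 / 2 * ln p%:R) => h2.
    have h3 : c4 / 2 * ln p%:R <= expR (c4 / 2 * ln p%:R) by lra.
    have := ler_wpM2l (ltW c2') h3; by rewrite (mulrA (2 / c4) (c4 / 2)) c22' mul1r.
  apply: (le_trans h1); rewrite /E -[leRHS]mulrA ler_wpM2l ?(ltW c2')//.
  rewrite -expRD ler_expR.
  have : ln (maxn P0 1)%:R <= ln p%:R :> R.
    by rewrite ler_ln ?posrE ?ltr0n// ?leq_max ?orbT// ler_nat ltnW.
  nra.
have := hP0 (maxn P0 1) (leq_maxl _ _); rewrite divn1 => h.
have h2 : 2 / c4 * K4 / e <= c4 / 2 * ln (maxn P0 1)%:R.
  by have := ler_wpM2l (ltW c2) h; rewrite (mulrA (c4 / 2) (2 / c4)) c22 mul1r.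
rewrite /E mulrAC expRN ler_pdivrMr ?expR_gt0// [leRHS]mulrC -ler_pdivrMr//.
apply: (le_trans h2); have := expR_ge1Dx (c4 / 2 * ln (maxn P0 1)%:R); lra.
Qed.

Definition BB n := Bs g (pr n.+1) n.
Definition kk n : R := (Num.sqrt (BB n))^-1.

Lemma BB_gt0 n : (0 < n)%N -> 0 < BB n.
Proof. by move=> n0; rewrite (lt_le_trans ltr01)// Bs_ge1. Qed.

Lemma kk_sqr n : kk n ^+ 2 = (BB n)^-1.
Proof. by rewrite /kk exprVn sqr_sqrtr// Bs_ge0. Qed.

Lemma primes_split (d : R) n : 0 <= d -> pr n.+1 = bg d n ++ sm d n.
Proof.
move=> d0; apply: (pr_cat (a := small d n)) => p q qp; rewrite /small => h; apply: le_trans h.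
case: q qp => [|q] qp; first by rewrite ln0// ln_ge0_nat.
by rewrite ler_ln ?posrE ?ltr0n ?(leq_trans _ qp)// ler_nat.
Qed.

(** A uniform bound by C times the limiting coefficient, after multiplication by f(K). A
    contributing splitting has a prime p > n^d with p <= t = n/max(U,W), so ln t >= d ln n and
    [Bs_upper] at t loses only 1/d. The Euler product off K, divided by the full product in
    [Bs_lower], leaves the factor 1/E_K. *)
Lemma coef_bound (d : R) : 0 < d -> exists2 C : R, 0 <= C & exists x0, forall n, (x0 <= n)%N ->
  forall K, K \in subs (pr n.+1) ->
  kk n ^+ 2 * Theta f n (bg d n) (sm d n) K <= C * (DD K / Es g K).
Proof.
move=> d0; have [c c0 [x0 hc]] := Bs_lower g0 theta0 psi_asymp sqr_tail.
have [C C0 hC] := psi_ub g0 theta0 psi_asymp.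
exists ((C + 1) / (c * d)); first by rewrite divr_ge0 ?addr_ge0// mulr_ge0// ltW.
exists (maxn x0 2) => n; rewrite geq_max => /andP[/hc{}hc n2] K Ks.
have n0 : (0 < n)%N by apply: leq_trans n2.
have ln0 : 0 < ln n%:R :> R by rewrite ln_gt0// ltr1n.
have np : 0 < n%:R :> R by rewrite ltr0n.
have usp : uniq (bg d n ++ sm d n) by rewrite -primes_split ?pr_uniq// ltW.
have pp p : p \in bg d n ++ sm d n -> prime p by rewrite -primes_split ?(ltW d0)// => /pr_prime.
have EK := Es_gt0 g0 K; have Es0 := Es_gt0 g0 (pr n.+1).
have BB0 := BB_gt0 n0.
have Kpos p : p \in K -> (0 < p)%N by move=> /(subs_sub Ks) /pr_prime /prime_gt0.
rewrite kk_sqr ler_pdivrMl//.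

have TL := @Theta_le R f n (bg d n) (sm d n) K (fun p h => prime_gt0 (pp p h)).

apply: (le_trans TL).
rewrite -(primes_split n (ltW d0)).
have -> : BB n * ((C + 1) / (c * d) * (DD K / Es g K)) =
  \sum_(UW <- splits K) (BB n * ((C + 1) / (c * d)) / Es g K) / (maxn (nn UW.1) (nn UW.2))%:R.
  by rewrite -big_distrr /= -/(DD K); ring.
rewrite big_seq [leRHS]big_seq; apply: ler_sum => UW UWK.
have RHS0 : 0 <= BB n * ((C + 1) / (c * d)) / Es g K / (maxn (nn UW.1) (nn UW.2))%:R.
  rewrite divr_ge0// divr_ge0 ?(ltW EK)// mulr_ge0 ?(ltW BB0)// divr_ge0 ?addr_ge0//.
  by rewrite mulr_ge0// ltW.
rewrite (sum_le2 f n (off K (pr n.+1)) Kpos UWK).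
case: (boolP (reach n (bg d n) UW)) => [/hasP[p pbg /andP[h1 h2]]|_]; last by rewrite mul0r.
rewrite mul1r.
set M := maxn _ _; set t := (n %/ M)%N.
have M0 : (0 < M)%N by have [h _] := splits_gt0 Kpos UWK; rewrite leq_max h.
have pt : (p <= t)%N.
  by rewrite leq_divRL// mulnC /M maxnMl geq_max h1 h2.
have pgt : d * ln n%:R < ln p%:R :> R.
  by move: pbg; rewrite mem_filter /small -ltNge => /andP[].
have p0 : (0 < p)%N by move: pbg; rewrite mem_filter => /andP[_ /pr_prime /prime_gt0].
have lt : d * ln n%:R <= ln t%:R.
  by rewrite (le_trans (ltW pgt))// ler_ln ?posrE ?ltr0n ?(leq_trans p0)// ler_nat.
have uo : uniq (off K (pr n.+1)) by rewrite filter_uniq// pr_uniq.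
have po q : q \in off K (pr n.+1) -> prime q by rewrite mem_filter => /andP[_ /pr_prime].
have := @Bs_upper R g g0 _ uo po C t (leq_trans p0 pt) (hC _ _).
have Le := Ls_le_Es g0 (off K (pr n.+1)) t.
have EE' := Es_off g0 (pr_uniq n.+1) Ks.
have tM : t%:R * M%:R <= n%:R :> R by rewrite -natrM ler_nat leq_trunc_div.
have Mp : 0 < M%:R :> R by rewrite ltr0n.
have dl : 0 < d * ln n%:R by rewrite mulr_gt0.
rewrite ler_pdivlMr//.
set B := Bs _ _ _; set L := Ls _ _ _ in Le *; set Eo := Es _ (off _ _) in Le EE' *.
have B0 : 0 <= B by exact: Bs_ge0.
move=> up; have Eo0 : 0 < Eo by exact: Es_gt0.
have C1 : 0 <= C + 1 by rewrite addr_ge0.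
have s1 : B * (d * ln n%:R) <= (C + 1) * (t%:R * Eo).
  apply: (le_trans (ler_wpM2l B0 lt)); apply: (le_trans up).
  by rewrite -mulrA ler_wpM2l// ler_wpM2l.
have s2 : B * M%:R * (d * ln n%:R) <= (C + 1) * (n%:R * Eo).
  rewrite mulrAC; apply: (le_trans (ler_wpM2r (ltW Mp) s1)).
  by rewrite -mulrA ler_wpM2l// mulrAC ler_wpM2r// ltW.
rewrite ler_pdivlMr// -(ler_pM2r dl).
have -> : B * M%:R * Es g K * (d * ln n%:R) = B * M%:R * (d * ln n%:R) * Es g K by ring.
apply: (le_trans (ler_wpM2r (ltW EK) s2)).
have -> : BB n * ((C + 1) / (c * d)) * (d * ln n%:R) = (C + 1) / c * (BB n * ln n%:R).
  by field; rewrite !gt_eqF.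
apply: le_trans (ler_wpM2l _ hc); last by rewrite divr_ge0// ltW.
rewrite EE' le_eqVlt; apply/orP; left; apply/eqP; field; rewrite gt_eqF//.
Qed.

End cube_limit.

(** * Convergence of the bracket and smallness of the fourth moments *)

Section cube_limit2.
Context {R : realType}.
Variables (f : nat -> R) (theta c4 K4 Q : R).
Let g p := f p ^+ 2.
Hypothesis theta0 : 0 < theta.
Hypothesis psi_asymp : forall e : R, 0 < e -> exists C : R, forall n,
  `|psi g (pr n.+1) n - theta * n%:R| <= e * n%:R + C.
Hypothesis c40 : 0 < c4.
Hypothesis fourth : forall N, \sum_(p <- pr N) f p ^+ 4 / p%:R ^+ 2 * expR (c4 * ln p%:R) <= K4.
Hypothesis Qbound : forall N, \sum_(K <- subs (pr N)) vK f K ^+ 2 <= Q.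
Implicit Types (s u v A K : seq nat) (n N y : nat).

Let g0 p : 0 <= g p. Proof. exact: sqr_ge0. Qed.
Let tail : forall e : R, 0 < e -> exists P0, forall N,
  \sum_(p <- pr N | (P0 < p)%N) ln p%:R * g p ^+ 2 / p%:R ^+ 2 <= e.
Proof. exact: sqr_tail c40 fourth. Qed.

Let q N : R := \sum_(K <- subs (pr N)) vK f K ^+ 2.

Lemma q_mono N M : (N <= M)%N -> q N <= q M.
Proof.
move=> /subnKC <-; elim: (M - N)%N => [|m IH]; first by rewrite addn0.
rewrite addnS; apply: (le_trans IH); rewrite /q /=; case: ifP => // _.
by rewrite sum_subs_cons lerDl sumr_ge0// => K _; rewrite sqr_ge0.
Qed.

Lemma q_cauchy (e : R) : 0 < e -> exists y0, forall y N, (y0 <= y)%N -> (y <= N)%N -> q N - q y <= e.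
Proof.
move=> e0; apply: contrapT => h.
have step y0 : exists N, (y0 <= N)%N && (q y0 + e <= q N).
  apply: contrapT => h'; apply: h; exists y0 => y N y0y yN.
  rewrite leNgt; apply/negP => hlt; apply: h'; exists N; rewrite (leq_trans y0y)//=.
  have := q_mono y0y; lra.
have big k : exists N, k%:R * e <= q N.
  elim: k => [|k [N IH]].
    by exists 0%N; rewrite mul0r sumr_ge0// => K _; rewrite sqr_ge0.
  have [N' /andP[_ hN']] := step N; exists N'; rewrite -natr1 mulrDl mul1r; lra.
have [N hN] := big (truncn (Q / e)).+1.
have := truncnS_gt (Q / e); rewrite ltr_pdivrMr// => h1.
have := Qbound N; rewrite -/(q N); lra.
Qed.

Lemma norm_pw (x : nat -> R) K : (forall p, x p ^+ 2 = 1) -> `|pw x K| = 1.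
Proof.
move=> x1; apply/eqP; rewrite -(@eqrXn2 _ 2)// expr1n real_normK ?num_real// pw_sqr.
by rewrite /pw big1.
Qed.

Lemma ZZ_cvg K : uniq K -> (forall p, p \in K -> prime p) ->
  (fun n => kk f n ^+ 2 * (pw f K * ZZ f n (pr n.+1) K)) @ \oo --> vK f K.
Proof.
move=> uK pK.
have Kpos p : p \in K -> (0 < p)%N by move=> /pK/prime_gt0.
(* The guard is there because [cvg_bigsum] asks for convergence at every index, whereas positivity
   of the factors is known for splittings of K only. *)
have main : (fun n => pw f K * \sum_(UW <- splits K)
    (if (0 < maxn (nn UW.1) (nn UW.2))%N then
    Bs g (sK K n.+1) (n %/ maxn (nn UW.1) (nn UW.2)) / Bs g (pr n.+1) n else 0)) @ \oo -->
  pw f K * \sum_(UW <- splits K) (if (0 < maxn (nn UW.1) (nn UW.2))%N then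
     ((maxn (nn UW.1) (nn UW.2))%:R * Es g K)^-1 else 0).
  apply: cvgM; first exact: cvg_cst.
  apply: cvg_bigsum => UW; case: ifP => M0; last exact: cvg_cst.
  by have := Bs_off g0 theta0 psi_asymp tail uK pK M0.
have posM UW : UW \in splits K -> (0 < maxn (nn UW.1) (nn UW.2))%N.
  by move=> /(splits_gt0 Kpos)[h _]; rewrite leq_max h.
have -> : vK f K = pw f K * \sum_(UW <- splits K) (if (0 < maxn (nn UW.1) (nn UW.2))%N then
     ((maxn (nn UW.1) (nn UW.2))%:R * Es g K)^-1 else 0).
  rewrite /vK /DD -mulrA big_distrr /=; congr (_ * _); apply: eq_big_seq => UW /posM ->.
  by rewrite invfM mulrC.
apply: cvg_trans main; apply: near_eq_cvg; apply: nearW => n; symmetry.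
rewrite kk_sqr (ZZ_Bs f n _ Kpos) mulrCA; congr (_ * _); rewrite big_distrr /=.
by apply: eq_big_seq => UW /posM ->; rewrite mulrC.
Qed.

(** Let Ty be the bracket T truncated to sets K of primes up to y, and Fy the same with the
    coefficients of the full square. T is L^2-close to Ty; Ty <= Fy, their difference being the
    conditional mean square of the smooth part; and Fy tends to the truncated V. Hence (T - V)_+ is
    small in mean. *)
Lemma var_limit (eta d : R) : 0 < d ->
  (exists x0, forall n, (x0 <= n)%N -> Bs g (sm d n) n <= eta * Bs g (pr n.+1) n) ->
  forall e : R, 0 < e -> exists y0, forall y, (y0 <= y)%N -> exists x0, forall n, (x0 <= n)%N ->
  EE (pr n.+1) (fun x => `|TT f n (kk f n) (bg d n) (sm d n) x - VV f (pr y.+1) x|) <= eta + e.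
Proof.
move=> d0 [n1 hsm] e e0.
have [C C0 [n2 hC]] := coef_bound theta0 psi_asymp c40 fourth d0.
pose e1 := e / 8; have e10 : 0 < e1 by rewrite divr_gt0.
have C1 : 0 < C ^+ 2 + 1 by rewrite ltr_wpDl ?sqr_ge0.
have [y0 hy0] := q_cauchy (divr_gt0 (exprn_gt0 2 e10) C1).
exists y0 => y y0y.
pose vy := pr y.+1.
have uvy : uniq vy := pr_uniq _.
have Kvy K : K \in subs vy -> uniq K /\ (forall p, p \in K -> prime p).
  move=> Ks; split; last by move=> p /(subs_sub Ks)/pr_prime.
  by apply: (subseq_uniq _ uvy); rewrite -mem_subs.
pose cf n K := kk f n ^+ 2 * (pw f K * ZZ f n (pr n.+1) K).
have full_lim : (fun n => \sum_(K <- subs vy) (if K \in subs vy then `|cf n K - vK f K| else 0)) @ \oo --> (0 : R).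
  suff : (fun n => \sum_(K <- subs vy) (if K \in subs vy then `|cf n K - vK f K| else 0)) @ \oo -->
      \sum_(K <- subs vy) (0 : R) by rewrite big1.
  apply: (@cvg_bigsum R _ _ (fun K n => if K \in subs vy then `|cf n K - vK f K| else 0) (fun=> 0)) => K.
  have := Kvy K; case: (K \in subs vy) => [/(_ isT) [uK pK]|_]; last exact: cvg_cst.
  have h : (fun n => cf n K - vK f K) @ \oo --> vK f K - vK f K.
    by apply: cvgB; [exact: ZZ_cvg | exact: cvg_cst].
  have := cvg_norm h; rewrite subrr normr0; apply.
have [n3 h3] := cvgn_epsP full_lim e10.
(* From here on y + 1 <= n^d, so none of the primes up to y is among the recorded ones. *)
have [n4 h4] := ln_nat_ge (ln (y.+1)%:R / d) (ltn0Sn 0).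
exists (maxn (maxn (maxn n1 n2) (maxn n3 n4)) y.+1) => n.
rewrite !geq_max => /andP[/andP[/andP[/hsm{}hsm /hC{}hC] /andP[/h3{}h3 /h4{}h4]] yn].
have n0 : (0 < n)%N by apply: leq_trans yn.
rewrite divn1 in h4.
have hsmall p : p \in vy -> small d n p.
  rewrite mem_pr ltnS /small => /andP[pp py].
  apply: (@le_trans _ _ (ln (y.+1)%:R)).
    by rewrite ler_ln ?posrE ?ltr0n ?(prime_gt0 pp)// ler_nat leqW.
  by rewrite mulrC -ler_pdivrMr.
pose w := [seq p <- sm d n | ~~ (p < y.+1)%N].
have smE : sm d n = w ++ vy.
  have E : pr n.+1 = [seq p <- pr n.+1 | ~~ (p < y.+1)%N] ++ vy.
    rewrite /vy -(@pr_restrict n.+1 y.+1) ?ltnS 1?ltnW//.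
    by apply: pr_cat => p p'; apply: leq_ltn_trans.
  have vyE : [seq p <- vy | small d n p] = vy by apply/all_filterP/allP.
  rewrite /w /sm [in LHS]E filter_cat vyE; congr (_ ++ _).
  by rewrite -!filter_predI; apply: eq_filter => p /=; rewrite andbC.
set u := bg d n; set v := sm d n; set s := pr n.+1.
have sE : s = u ++ v by rewrite -primes_split// ltW.
have us : uniq s := pr_uniq _.
have usE : uniq (u ++ v) by rewrite -sE.
have ups : s = (u ++ w) ++ vy by rewrite sE /v smE catA.
have B0 := BB_gt0 f n0.
pose k := kk f n; pose T := TT f n k u v.
pose ct K := k ^+ 2 * (pw f K * Theta f n u v K).
have TE (x : nat -> R) : (forall p, x p ^+ 2 = 1) -> T x = \sum_(K <- subs s) ct K * pw x K.
  by move=> x1; rewrite /T TT_walsh// -sE.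
have [r rE hr] := subs_cat_rest (u ++ w) vy.
pose Ty (x : nat -> R) := \sum_(K <- subs vy) ct K * pw x K.
pose Fy (x : nat -> R) := \sum_(K <- subs vy) cf n K * pw x K.
pose ct' K := if has (mem (u ++ w)) K then ct K else 0.
have novy K : K \in subs vy -> has (mem (u ++ w)) K = false.
  move=> Ks; apply/negbTE/hasPn => p pK; apply/negP => puw.
  move: us; rewrite ups cat_uniq => /and3P[_ /hasPn h _].
  by move: (h p (subs_sub Ks pK)) => /negP; apply.
have TTy (x : nat -> R) : (forall p, x p ^+ 2 = 1) -> T x - Ty x = \sum_(K <- subs s) ct' K * pw x K.
  move=> x1; rewrite TE// /Ty ups rE !big_cat /= [LHS]addrAC subrr add0r.
  rewrite [X in _ = X + _]big_seq [X in _ = X + _]big1 ?add0r; last first.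
    by move=> K /novy; rewrite /ct' => ->; rewrite mul0r.
  by apply: eq_big_seq => K /hr; rewrite /ct' => ->.
have ctv K : K \in subs s -> ct K ^+ 2 <= C ^+ 2 * vK f K ^+ 2.
  move=> Ks; have := hC K Ks; rewrite -/u -/v -/k => h.
  have Th0 := Theta_ge0 f n u v K.
  have -> : ct K = pw f K * (k ^+ 2 * Theta f n u v K) by rewrite /ct; ring.
  rewrite /vK exprMn -/(g _).
  have -> : C ^+ 2 * (pw f K / Es (fun p => f p ^+ 2) K * DD K) ^+ 2 = pw f K ^+ 2 * (C * (DD K / Es g K)) ^+ 2.
    by rewrite /g; ring.
  have R0 : 0 <= C * (DD K / Es g K).
    by rewrite mulr_ge0// divr_ge0 ?DD_ge0// ltW// Es_gt0.
  have L0 : 0 <= k ^+ 2 * Theta f n u v K by rewrite mulr_ge0 ?sqr_ge0.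
  by rewrite ler_wpM2l ?sqr_ge0// ler_sqr ?nnegrE.
(* By Parseval and domination, this is at most C^2 times the tail of the sum of squares of [vK]
   beyond y. *)
have var : EE s (fun x => (T x - Ty x) ^+ 2) <= e1 ^+ 2.
  rewrite (@eq_EE _ _ _ (fun x => (\sum_(K <- subs s) ct' K * pw x K) ^+ 2)); last first.
    by move=> x x1; rewrite TTy.
  rewrite parseval//.
  have : \sum_(K <- subs s) ct' K ^+ 2 <= C ^+ 2 * (q n.+1 - q y.+1).
    rewrite /q -/s -/vy ups rE !big_cat /= [X in _ <= _ * X]addrAC subrr add0r.
    rewrite [X in X + _]big_seq [X in X + _]big1 ?add0r; last first.
      by move=> K /novy; rewrite /ct' => ->; rewrite expr0n.
    rewrite big_distrr /= big_seq [leRHS]big_seq; apply: ler_sum => K Kr.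
    rewrite /ct' (hr K Kr) ctv// ups rE mem_cat Kr orbT//.
  have := hy0 y.+1 n.+1 (leqW y0y) (ltnW yn); rewrite ler_pdivlMr// => h5 h6.
  have q0 : 0 <= q n.+1 - q y.+1 by rewrite subr_ge0 q_mono// ltnW.
  apply: (le_trans h6); apply: le_trans h5; rewrite mulrC ler_wpM2l// lerDl//.
have L1 : EE s (fun x => `|T x - Ty x|) <= 2 * e1.
  apply: (le_trans (EE_L1_L2 e10 var)); rewrite expr2 mulfK ?gt_eqF//; lra.
have TyF (x : nat -> R) : (forall p, x p ^+ 2 = 1) -> Ty x <= Fy x.
  move=> x1; rewrite -subr_ge0 /Fy /Ty -sumrB.
  have -> : \sum_(K <- subs vy) (cf n K * pw x K - ct K * pw x K) =
     k ^+ 2 * \sum_(K <- subs vy) pw x K * (pw f K * ZZ f n (w ++ vy) K).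
    rewrite big_distrr; apply: eq_big_seq => K Ks.
    rewrite /cf /ct Theta_small; last first.
      move=> p pu; apply/negP => pK.
      have /hasPn/(_ p pK)/negP := negbT (novy _ Ks); apply.
      by change (p \in u ++ w); rewrite mem_cat pu.
    rewrite -sE -/s /v smE; rewrite -/k /=; ring.
  rewrite mulr_ge0 ?sqr_ge0// ZZ_walsh_ge0//.
  by move: us; rewrite ups -catA cat_uniq => /and3P[].
have FV (x : nat -> R) : (forall p, x p ^+ 2 = 1) -> `|Fy x - VV f vy x| <= e1.
  move=> x1; rewrite /Fy /VV -sumrB (le_trans (ler_norm_sum _ _ _))//.
  move: h3; rewrite subr0 ger0_norm.
    apply: le_trans; rewrite big_seq [leRHS]big_seq; apply: ler_sum => K Ks.
    by rewrite Ks -mulrBl normrM norm_pw// mulr1.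
  by apply: sumr_ge0 => K _; case: ifP.
have EV : EE s (VV f vy) = 1.
  rewrite ups EE_cat -?ups//; first by rewrite EE_walsh// vK_nil.
  move=> p puw; apply: indep_walsh; apply/negP => pvy.
  by move: us; rewrite ups cat_uniq => /and3P[_ /hasPn h _]; move: (h p pvy) => /negP; apply.
(* The mean of T is the share of B carried by the integers having a prime factor above n^d. *)
have ET : EE s T = 1 - Bs g v n / BB f n.
  rewrite (@eq_EE _ _ _ (fun x => \sum_(K <- subs s) ct K * pw x K)); last by move=> x /TE.
  rewrite EE_walsh// /ct pw_nil mul1r Theta_small// -sE !ZZ_Bs// /= !big_seq1 /= !nn_nil maxnn divn1.
  have offN z : off [::] z = z by apply/all_filterP/allP.
  by rewrite !offN /k kk_sqr -/(BB f n) mulrBr mulVf ?gt_eqF// mulrC.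
have eta_ge : Bs g v n / BB f n <= eta by rewrite ler_pdivrMr.
apply: (@le_trans _ _ (EE s (fun x => (VV f vy x - T x) + (2 * `|T x - Ty x| + 2 * e1)))).
  apply: le_EE => x x1; have := TyF x x1; have := FV x x1.
  rewrite -/s -/k -/u -/v -/(T x) -/vy.
  move: (T x) (Ty x) (Fy x) (VV f vy x) => a b c v' h bc.
  have h1 := ler_norm (c - v'); have h2 := ler_norm (a - b); have h3' := normr_ge0 (a - b).
  case: (lerP 0 (a - v')) => h5; first by rewrite ger0_norm//; lra.
  by rewrite ltr0_norm//; lra.
rewrite EED EEB EV ET EED (EEZ s 2 (fun x => `|T x - Ty x|)) EE_cst; have : e = 8 * e1 by rewrite /e1; field.
lra.
Qed.

(** Hypercontractivity puts weight 3 on each prime, and the cutoff p a <= n is bounded by n/(p a).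
    As 1 + 3 x <= (1 + x)^3, the second moment of an increment is at most n/p times the cube of the
    Euler product; squaring gives the sixth power. *)
Lemma QQ_le u v n (k : R) : uniq (u ++ v) -> (forall p, p \in u ++ v -> prime p) -> (0 < n)%N ->
  EE (u ++ v) (QQ f n k u v) <=
  k ^+ 4 * n%:R ^+ 2 * Es g (u ++ v) ^+ 6 * \sum_(p <- u) f p ^+ 4 / p%:R ^+ 2.
Proof.
move=> + + n0; elim: u => [|p u IH].
  by move=> _ _; rewrite big_nil mulr0 /= EE_cst.
rewrite cat_cons => /= /andP[pu uu] pp.
have pp' z : z \in u ++ v -> prime z by move=> h; apply: pp; rewrite inE h orbT.
have p_pr : prime p by apply: pp; rewrite inE eqxx.
have p0 : 0 < p%:R :> R by rewrite ltr0n prime_gt0.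
have {}IH := IH uu pp'; set s := u ++ v in pu uu pp' IH *.
have iz : indep p (zz f n p s) by apply: indep_zz.
have iQ : indep p (QQ f n k u v) by apply: indep_QQ.
rewrite EE_indep//; last by move=> e x; rewrite iz iQ.
have Es1 : 1 <= Es g s by exact: Es_ge1.
have Esp : Es g s <= Es g (p :: s).
  by rewrite /Es big_cons ler_peMl ?(le_trans ler01)// lerDl divr_ge0.
have f40 z : 0 <= f z ^+ 4 / z%:R ^+ 2 by rewrite divr_ge0 ?sqr_ge0// (exprM _ 2 2) sqr_ge0.
have k40 : 0 <= k ^+ 4 by rewrite (exprM _ 2 2) sqr_ge0.
have E6 : Es g s ^+ 6 <= Es g (p :: s) ^+ 6.
  by rewrite lerXn2r ?nnegrE ?(le_trans ler01 Es1) ?(le_trans (le_trans ler01 Es1) Esp).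
rewrite EED big_cons mulrDr addrC; apply: lerD; last first.
  apply: (le_trans IH); apply: ler_wpM2r; first exact: sumr_ge0.
  apply: ler_wpM2l; first by rewrite mulr_ge0 ?sqr_ge0.
  exact: E6.
rewrite (@eq_EE _ _ _ (fun x => (k * f p) ^+ 4 *
   (\sum_(A <- subs s) (pw f A * (p * nn A <= n)%:R) * pw x A) ^+ 4)); last first.
  move=> x _; rewrite /zz mulrA exprMn; congr (_ * _ ^+ 4); apply: eq_bigr => A _; ring.
rewrite EEZ exprMn.
have hyp := hypercontractive (fun A => pw f A * (p * nn A <= n)%:R) uu.
have np0 : 0 <= n%:R / p%:R :> R by rewrite divr_ge0// ltW.
have b1 : \sum_(A <- subs s) 3 ^+ size A * (pw f A * (p * nn A <= n)%:R) ^+ 2 <=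
   n%:R / p%:R * Es g s ^+ 3.
  apply: (@le_trans _ _ (n%:R / p%:R * \sum_(A <- subs s) pw (fun z => 3 * (g z / z%:R)) A)).
    rewrite big_distrr /= big_seq [leRHS]big_seq; apply: ler_sum => A As.
    have A0 := nn_gt0 pp' As.
    have -> : pw (fun z => 3 * (g z / z%:R)) A = 3 ^+ size A * (pw g A / (nn A)%:R).
      by rewrite (pwM (fun=> 3) (fun z => g z / z%:R)) pw_div /pw big_const_seq count_predT iter_mulr_1.
    rewrite [leRHS]mulrCA ler_wpM2l ?exprn_ge0// exprMn pw_sqr -/g.
    rewrite -natrX [((p * nn A <= n) ^ 2)%N](_ : _ = (p * nn A <= n)%N :> nat); last by case: (p * nn A <= n)%N.
    rewrite [leRHS]mulrCA ler_wpM2l ?pw_ge0//; case: leqP => h; last by rewrite mulr_ge0// invr_ge0.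
    by rewrite ler_pdivlMr ?ltr0n// mul1r ler_pdivlMr// -natrM ler_nat mulnC.
  rewrite ler_wpM2l// prod_subs /Es -prodrXl; apply: ler_prod => z _.
  have a0 : 0 <= g z / z%:R by rewrite divr_ge0.
  move: a0; set a := g z / _ => a0.
  have a2 := exprn_ge0 2 a0; have a3 := exprn_ge0 3 a0.
  have -> : (1 + a) ^+ 3 = 1 + 3 * a + 3 * a ^+ 2 + a ^+ 3 by ring.
  by apply/andP; split; lra.
have b0 : 0 <= \sum_(A <- subs s) 3 ^+ size A * (pw f A * (p * nn A <= n)%:R) ^+ 2.
  by apply: sumr_ge0 => A _; rewrite mulr_ge0 ?sqr_ge0 ?exprn_ge0.
have b2 := le_trans hyp (lerXn2r 2 (b0 : _ \in Num.nneg) (le_trans b0 b1 : _ \in Num.nneg) b1).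
have f4 : 0 <= f p ^+ 4 by rewrite (exprM _ 2 2) sqr_ge0.
apply: (le_trans (ler_wpM2l (mulr_ge0 k40 f4) b2)).
have -> : k ^+ 4 * f p ^+ 4 * (n%:R / p%:R * Es g s ^+ 3) ^+ 2 =
  k ^+ 4 * n%:R ^+ 2 * (f p ^+ 4 / p%:R ^+ 2) * Es g s ^+ 6 by field; rewrite gt_eqF.
have -> : k ^+ 4 * n%:R ^+ 2 * Es g (p :: s) ^+ 6 * (f p ^+ 4 / p%:R ^+ 2) =
  k ^+ 4 * n%:R ^+ 2 * (f p ^+ 4 / p%:R ^+ 2) * Es g (p :: s) ^+ 6 by field; rewrite gt_eqF.
apply: ler_wpM2l; last exact: E6.
by apply: mulr_ge0 => //; apply: mulr_ge0 => //; exact: sqr_ge0.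
Qed.

(** With the normalisation B >= c n E / ln n, what is left of [QQ_le] is a logarithm and an Euler
    product, both beaten by the power of n that (b) saves on primes above n^d. *)
Lemma QQ_limit (d e : R) : 0 < d -> 0 < e -> exists x0, forall n, (x0 <= n)%N ->
  EE (pr n.+1) (QQ f n (kk f n) (bg d n) (sm d n)) <= e.
Proof.
move=> d0 e0; have [c c0 [n1 hc]] := Bs_lower g0 theta0 psi_asymp tail.
(* Exponents of n in units of c4 d: -1 from the primes above n^d, 4/12 from E^4, 2/4 from the
   squared logarithm; the total is -1/6. *)
pose del := c4 * d / 12; have del0 : 0 < del by rewrite divr_gt0 ?mulr_gt0.
have [C hC] := Es_subpoly g0 theta0 psi_asymp del0.
have K40 := K4_ge0 fourth.
pose M := c ^- 2 * expR (4 * C) * K4 * (4 / (c4 * d)) ^+ 2.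
have [n2 h2] := ln_nat_ge (M / e * (12 / (c4 * d)) + 1) (ltn0Sn 0).
exists (maxn (maxn n1 n2) 2) => n; rewrite !geq_max => /andP[/andP[/hc{}hc /h2{}h2] nge2].
rewrite divn1 in h2.
have n0 : (0 < n)%N by apply: leq_trans nge2.
have np : 0 < n%:R :> R by rewrite ltr0n.
have B0 := BB_gt0 f n0.
have sE := primes_split n (ltW d0).
have us : uniq (bg d n ++ sm d n) by rewrite -sE pr_uniq.
have pp p : p \in bg d n ++ sm d n -> prime p by rewrite -sE => /pr_prime.
have := QQ_le (kk f n) us pp n0; rewrite -sE => h; apply: (le_trans h).
set E := Es g (pr n.+1) in hc *; set l := ln n%:R in hc h2 *.
have E1 : 1 <= E by exact: Es_ge1.
have E0 : 0 < E := lt_le_trans ltr01 E1.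
have cd : 0 < c4 * d by rewrite mulr_gt0.
have l0 : 0 < l by rewrite ln_gt0// ltr1n.
have kE : kk f n ^+ 4 * n%:R ^+ 2 * E ^+ 6 <= c ^- 2 * l ^+ 2 * E ^+ 4.
  have -> : kk f n ^+ 4 = BB f n ^- 2 by rewrite (exprM _ 2 2) kk_sqr exprVn.
  have h3 : (c * (n%:R * E)) ^+ 2 <= (BB f n * l) ^+ 2.
    have q1 : 0 <= c * (n%:R * E) by apply: mulr_ge0 (ltW c0) (mulr_ge0 (ltW np) (ltW E0)).
    exact: (lerXn2r 2 (q1 : _ \in Num.nneg) (le_trans q1 hc : _ \in Num.nneg) hc).
  have E40 : 0 <= E ^+ 4 / BB f n ^+ 2 / c ^+ 2.
    by rewrite divr_ge0 ?sqr_ge0// divr_ge0 ?sqr_ge0// exprn_ge0// ltW.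
  have := ler_wpM2l E40 h3.
  have -> : E ^+ 4 / BB f n ^+ 2 / c ^+ 2 * (c * (n%:R * E)) ^+ 2 = BB f n ^- 2 * n%:R ^+ 2 * E ^+ 6.
    by field; rewrite !gt_eqF.
  have -> : E ^+ 4 / BB f n ^+ 2 / c ^+ 2 * (BB f n * l) ^+ 2 = c ^- 2 * l ^+ 2 * E ^+ 4.
    by field; rewrite !gt_eqF.
  by [].
set S := \sum_(p <- bg d n) _.
have S0 : 0 <= S.
  by apply: sumr_ge0 => p _; rewrite divr_ge0 ?sqr_ge0// (exprM _ 2 2) sqr_ge0.
have hS : S <= K4 * expR (- (c4 * d * l)).
  rewrite expRN ler_pdivlMr ?expR_gt0//; apply: le_trans (fourth n.+1).
  rewrite /S big_filter big_distrl big_mkcond /= -/(pr n.+1) big_seq [leRHS]big_seq; apply: ler_sum => p pin.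
  have F0 : 0 <= f p ^+ 4 / p%:R ^+ 2 by rewrite divr_ge0 ?sqr_ge0// (exprM _ 2 2) sqr_ge0.
  case: ifP => [h'|_]; last by rewrite mulr_ge0 ?expR_ge0.
  rewrite ler_wpM2l// ler_expR -mulrA ler_wpM2l ?(ltW c40)//.
  by move: h'; rewrite /small -ltNge => /ltW.
have hE : E ^+ 4 <= expR (4 * (C + del * l)).
  rewrite expRM_natl lerXn2r ?nnegrE ?expR_ge0 ?(ltW E0)//.
  exact: hC n n0.
pose a := c4 * d / 4; have a0 : 0 < a by rewrite divr_gt0.
have hl : l ^+ 2 <= (4 / (c4 * d)) ^+ 2 * expR (2 * (a * l)).
  rewrite expRM_natl -exprMn.
  have h4 := expR_ge1Dx (a * l).
  have h5 : a * l <= expR (a * l) by lra.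
  have q0 : 0 <= 4 / (c4 * d) by rewrite divr_ge0// ltW.
  have e41 : 4 / (c4 * d) * a = 1 by rewrite /a; field; rewrite !gt_eqF.
  have h6 : l <= 4 / (c4 * d) * expR (a * l).
    by have := ler_wpM2l q0 h5; rewrite (mulrA (4 / (c4 * d)) a l) e41 mul1r.
  exact: (lerXn2r 2 (ltW l0 : _ \in Num.nneg) (le_trans (ltW l0) h6 : _ \in Num.nneg) h6).
have l20 : 0 <= l ^+ 2 by exact: sqr_ge0.
have c20 : 0 <= c ^- 2 by rewrite invr_ge0 sqr_ge0.
have E40 : 0 <= E ^+ 4 by rewrite exprn_ge0// ltW.
have k40 : 0 <= kk f n ^+ 4 by rewrite (exprM _ 2 2) sqr_ge0.
have P0 : 0 <= kk f n ^+ 4 * n%:R ^+ 2 * E ^+ 6.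
  exact: mulr_ge0 (mulr_ge0 k40 (sqr_ge0 _)) (exprn_ge0 6 (ltW E0)).
apply: (le_trans (ler_pM P0 S0 kE hS)).
have step : c ^- 2 * l ^+ 2 * E ^+ 4 <= c ^- 2 * ((4 / (c4 * d)) ^+ 2 * expR (2 * (a * l))) * expR (4 * (C + del * l)).
  by apply: ler_pM => //; [exact: mulr_ge0 | exact: ler_wpM2l].
apply: (le_trans (ler_wpM2r _ step)); first by rewrite mulr_ge0 ?expR_ge0.
have -> : c ^- 2 * ((4 / (c4 * d)) ^+ 2 * expR (2 * (a * l))) * expR (4 * (C + del * l)) *
   (K4 * expR (- (c4 * d * l))) = M * expR (- (c4 * d / 6 * l)).
  have -> : expR (- (c4 * d / 6 * l)) = expR (- (4 * C)) * (expR (2 * (a * l)) * expR (4 * (C + del * l)) * expR (- (c4 * d * l))).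
    by rewrite -!expRD; congr expR; rewrite /a /del; field.
  rewrite /M; have e4 : expR (4 * C) * expR (- (4 * C)) = 1 by rewrite -expRD subrr expR0.
  transitivity (c ^- 2 * ((4 / (c4 * d)) ^+ 2 * expR (2 * (a * l))) * expR (4 * (C + del * l)) *
   (K4 * expR (- (c4 * d * l))) * (expR (4 * C) * expR (- (4 * C)))); first by rewrite e4 mulr1.
  by ring.
have M0 : 0 <= M := mulr_ge0 (mulr_ge0 (mulr_ge0 c20 (expR_ge0 _)) K40) (sqr_ge0 _).
rewrite expRN ler_pdivrMr ?expR_gt0// [leRHS]mulrC -ler_pdivrMr//.
have h6 := expR_ge1Dx (c4 * d / 6 * l).
have cd6 : 0 < c4 * d / 6 by rewrite divr_gt0.
have h7 : M / e <= c4 * d / 6 * l.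
  have := ler_wpM2l (ltW cd6) (le_trans (ler_wpDr ler01 (lexx _)) h2).
  have -> : c4 * d / 6 * (M / e * (12 / (c4 * d))) = 2 * (M / e).
    by field; rewrite !gt_eqF.
  have := divr_ge0 M0 (ltW e0); lra.
lra.
Qed.

End cube_limit2.

(** * The central limit estimate for cylinder functions *)

Section cube_clt.
Context {R : realType}.
Variables (f : nat -> R) (theta c4 K4 Q : R).
Let g p := f p ^+ 2.
Hypothesis theta0 : 0 < theta.
Hypothesis psi_asymp : forall e : R, 0 < e -> exists C : R, forall n,
  `|psi g (pr n.+1) n - theta * n%:R| <= e * n%:R + C.
Hypothesis c40 : 0 < c4.
Hypothesis fourth : forall N, \sum_(p <- pr N) f p ^+ 4 / p%:R ^+ 2 * expR (c4 * ln p%:R) <= K4.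
Hypothesis Qbound : forall N, \sum_(K <- subs (pr N)) vK f K ^+ 2 <= Q.
Implicit Types (s u v A K : seq nat) (n N y : nat).

Let g0 p : 0 <= g p. Proof. exact: sqr_ge0. Qed.

(** The coefficients are limits of those of conditional mean squares, so nonnegativity holds at
    every sign pattern, as the Gaussian replacement requires. *)
Lemma VV_ge0 y (x : nat -> R) : (forall p, x p ^+ 2 = 1) -> 0 <= VV f (pr y.+1) x.
Proof.
move=> x1; rewrite leNgt; apply/negP => neg.
set vy := pr y.+1 in neg *.
have lim : (fun n => \sum_(K <- subs vy) (if K \in subs vy then
    kk f n ^+ 2 * (pw f K * ZZ f n (pr n.+1) K) * pw x K else 0)) @ \oo --> VV f vy x.
  have -> : VV f vy x = \sum_(K <- subs vy) (if K \in subs vy then vK f K * pw x K else 0).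
    by rewrite /VV; apply: eq_big_seq => K ->.
  apply: (@cvg_bigsum R _ _ (fun K n => if K \in subs vy then
    kk f n ^+ 2 * (pw f K * ZZ f n (pr n.+1) K) * pw x K else 0)
    (fun K => if K \in subs vy then vK f K * pw x K else 0)) => K.
  have H : K \in subs vy -> uniq K /\ (forall p, p \in K -> prime p).
    move=> Ks; split; last by move=> p /(subs_sub Ks)/pr_prime.
    by apply: (subseq_uniq _ (pr_uniq y.+1)); rewrite -mem_subs.
  move: H; case: (K \in subs vy) => [/(_ isT) [uK pK]|_]; last exact: cvg_cst.
  apply: cvgM; last exact: cvg_cst.
  exact: (ZZ_cvg theta0 psi_asymp c40 fourth uK pK).
have ne : 0 < - VV f vy x / 2 by rewrite divr_gt0// oppr_gt0.
have [n1 h] := cvgn_epsP lim ne.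
have := h (maxn n1 y) (leq_maxl _ _).
set n := maxn n1 y.
have yn : (y <= n)%N by rewrite leq_maxr.
have E : pr n.+1 = [seq p <- pr n.+1 | ~~ (p < y.+1)%N] ++ vy.
  rewrite /vy -(@pr_restrict n.+1 y.+1) ?ltnS//.
  by apply: pr_cat => p p'; apply: leq_ltn_trans.
set S := \sum_(K <- _) _.
have S0 : 0 <= S.
  have -> : S = kk f n ^+ 2 * \sum_(K <- subs vy) pw x K * (pw f K * ZZ f n (pr n.+1) K).
    by rewrite /S big_distrr; apply: eq_big_seq => K -> /=; ring.
  rewrite mulr_ge0 ?sqr_ge0// {1}E ZZ_walsh_ge0// -E pr_uniq//.
by rewrite ler_norml => /andP[_]; move: neg S0; lra.
Qed.

Lemma cos_lip (a b : R) : `|cos a - cos b| <= `|a - b|.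
Proof.
wlog ab : a b / a <= b.
  by move=> h; case: (leP a b) => [/h//|/ltW/h]; rewrite distrC (distrC b).
have [c _ E] := @MVT_segment R cos (fun z => - sin z) a b ab
  (fun z _ => is_derive_cos z) (continuous_subspaceT (@continuous_cos R)).
rewrite distrC E normrM normrN distrC ler_piMl//; exact: sin_max.
Qed.

(** The exponent d is taken from [smooth_negligible] with eta = e1^2. The n^d-smooth part of the sum
    then has mean square at most e1^2 and is dropped by Lipschitz continuity of cosine. For n large
    all primes on which [Y] or the truncated V depends lie below n^d. *)
Lemma clt_cube (Y : (nat -> R) -> R) (M t phi : R) NY :
  (forall p, (NY <= p)%N -> indep p Y) ->
  (forall x, (forall p, x p ^+ 2 = 1) -> `|Y x| <= M) ->
  forall e : R, 0 < e -> exists y0, forall y, (y0 <= y)%N -> exists x0, forall n, (x0 <= n)%N ->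
  `| EE (pr n.+1) (fun x => Y x * cos (t * (kk f n * XX f n (pr n.+1) x) + phi))
     - EE (pr n.+1) (fun x => Y x * cos phi * expR (- (t ^+ 2 / 2 * VV f (pr y.+1) x))) | <= e.
Proof.
move=> iY YM e e0.
have M0 : 0 <= M by apply: le_trans (YM (fun=> 1) _) => // p; rewrite expr1n.
have t40 : 0 <= t ^+ 4 by rewrite (exprM _ 2 2) sqr_ge0.
pose A := M * (1 + `|t| + t ^+ 2 + t ^+ 4) + 1.
have A1 : 0 <= M * (1 + `|t| + t ^+ 2 + t ^+ 4) by rewrite mulr_ge0// !addr_ge0 ?sqr_ge0.
have A0 : 0 < A by rewrite ltr_wpDl.
pose e1 := Num.min (e / (8 * A)) 1.
have e10 : 0 < e1 by rewrite lt_min ltr01 andbT divr_gt0// mulr_gt0.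
have e11 : e1 <= 1 by rewrite ge_min lexx orbT.
have e1e : 8 * A * e1 <= e.
  have : e1 <= e / (8 * A) by rewrite ge_min lexx.
  by rewrite ler_pdivlMr ?mulr_gt0// mulrC.
have tail := sqr_tail c40 fourth.
have [d /andP[d0 d1] hd] := smooth_negligible g0 theta0 psi_asymp tail (exprn_gt0 2 e10).
have [y0 hy0] := var_limit theta0 psi_asymp c40 fourth Qbound d0 hd e10.
exists y0 => y y0y.
have [n1 h1] := hy0 y y0y.
have [n2 h2] := QQ_limit theta0 psi_asymp c40 fourth d0 e10.
have [n3 h3] := hd.
have [n4 h4] := ln_nat_ge (ln (maxn y NY).+1%:R / d) (ltn0Sn 0).
exists (maxn (maxn n1 n2) (maxn (maxn n3 n4) 1)) => n.
rewrite !geq_max => /andP[/andP[/h1{}h1 /h2{}h2] /andP[/andP[/h3{}h3 /h4{}h4] n0]].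
rewrite divn1 in h4.
have sE := primes_split n (ltW d0).
set u := bg d n in sE h1 h2 *; set v := sm d n in sE h1 h2 h3 *.
have us : uniq (u ++ v) by rewrite -sE pr_uniq.
have ubig p : p \in u -> (maxn y NY < p)%N.
  rewrite mem_filter /small -ltNge => /andP[h pin].
  have p0 : (0 < p)%N by apply: prime_gt0 (pr_prime pin).
  have : ln (maxn y NY).+1%:R < ln p%:R :> R.
    by apply: le_lt_trans h; rewrite mulrC -ler_pdivrMr.
  by rewrite ltr_ln ?posrE ?ltr0n// ltr_nat => /ltnW.
have iYu p : p \in u -> indep p Y.
  by move=> /ubig; rewrite gtn_max => /andP[_ /ltnW /iY].
have iVu p : p \in u -> indep p (VV f (pr y.+1)).
  move=> /ubig; rewrite gtn_max => /andP[yp _]; apply: indep_walsh.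
  by rewrite mem_pr ltnS leqNgt yp andbF.
have CB := @clt_bound R f n (kk f n) u v Y (VV f (pr y.+1)) t phi M us iYu iVu YM
  (fun x x1 => VV_ge0 y x1).
rewrite -sE in CB h1 h2 *.
have B0 := BB_gt0 f n0.
have small_part : EE (pr n.+1) (fun x => (kk f n * XX f n v x) ^+ 2) <= e1 ^+ 2.
  rewrite sE EE_cat//; last first.
    move=> p pu x z; rewrite indep_XX//.
    by move: us; rewrite cat_uniq => /and3P[_ /hasPn h _]; apply/negP => /h /negP; apply.
  rewrite (@eq_EE _ _ _ (fun x => kk f n ^+ 2 *
    (\sum_(A <- subs v) (pw f A * (nn A <= n)%:R) * pw x A) ^+ 2)); last first.
    move=> x _; rewrite exprMn; congr (_ * _ ^+ 2); apply: eq_bigr => K _; ring.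
  rewrite EEZ parseval; last by move: us; rewrite cat_uniq => /and3P[].
  rewrite kk_sqr mulrC ler_pdivrMr//; apply: le_trans h3.
  rewrite /Bs; apply: ler_sum => K _; rewrite exprMn pw_sqr ler_wpM2l ?pw_ge0//.
  by case: (_ <= _)%N; rewrite ?expr1n ?expr0n.
have sp := EE_L1_L2 e10 small_part.
have diff : `| EE (pr n.+1) (fun x => Y x * cos (t * (kk f n * XX f n (pr n.+1) x) + phi)) -
   EE (pr n.+1) (fun x => Y x * cos (t * (kk f n * (XX f n (pr n.+1) x - XX f n v x)) + phi)) |
   <= M * (`|t| * (2 * e1)).
  rewrite -EEB; apply: (le_trans (EE_norm _ _)).
  apply: (@le_trans _ _ (EE (pr n.+1) (fun x => (M * `|t|) * `|kk f n * XX f n v x|))).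
    apply: le_EE => x x1; rewrite -mulrBr normrM -mulrA; apply: ler_pM => //; first exact: YM.
    apply: (le_trans (cos_lip _ _)); rewrite -normrM le_eqVlt; apply/orP; left; apply/eqP.
    by congr (`|_|); ring.
  rewrite EEZ -mulrA ler_wpM2l// ler_wpM2l//; apply: (le_trans sp).
  by rewrite expr2 mulfK ?gt_eqF//; lra.
have t20 : 0 <= t ^+ 2 by exact: sqr_ge0.
apply: (le_trans (ler_distD (EE (pr n.+1) (fun x => Y x * cos (t * (kk f n * (XX f n (pr n.+1) x - XX f n v x)) + phi))) _ _)).
apply: (le_trans (lerD diff CB)).
have b1 : t ^+ 4 * EE (pr n.+1) (QQ f n (kk f n) u v) <= t ^+ 4 * e1 by rewrite ler_wpM2l.
have b2 : t ^+ 2 / 2 * EE (pr n.+1) (fun x => `|TT f n (kk f n) u v x - VV f (pr y.+1) x|) <= t ^+ 2 * e1.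
  apply: (@le_trans _ _ (t ^+ 2 / 2 * (e1 ^+ 2 + e1))); first by rewrite ler_wpM2l// divr_ge0.
  have : e1 ^+ 2 <= e1 by rewrite expr2 ler_piMr// ltW.
  by nra.
have nt := normr_ge0 t.
apply: (@le_trans _ _ (M * ((2 * `|t| + t ^+ 4 + t ^+ 2) * e1))).
  rewrite -mulrDr ler_wpM2l//; lra.
apply: le_trans e1e; rewrite mulrA ler_wpM2r ?(ltW e10)// /A.
have : M * (2 * `|t| + t ^+ 4 + t ^+ 2) <= M * (2 * (1 + `|t| + t ^+ 2 + t ^+ 4)).
  by rewrite ler_wpM2l//; lra.
lra.
Qed.

End cube_clt.

(** * Integrals over the line as limits over windows *)

Section line_integrals.
Context {R : realType}.
Notation mu := (@lebesgue_measure R).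
Implicit Types (f F G : R -> R).

Lemma integrable_dom f G : continuous f -> mu.-integrable [set: R] (EFin \o G) ->
  (forall x, `|f x| <= G x) -> mu.-integrable [set: R] (EFin \o f).
Proof.
move=> cf iG fG; apply: le_integrable iG => //.
  by apply/measurable_EFinP; exact: continuous_measurable_fun.
by move=> x _ /=; rewrite lee_fin (le_trans (fG x))// ler_norm.
Qed.

Lemma Rintegral_window f : mu.-integrable [set: R] (EFin \o f) ->
  (fun n : nat => \int[mu]_(x in `[(- n%:R)%R, n%:R]) f x) @ \oo --> \int[mu]_x f x.
Proof.
move=> fi; have mf : measurable_fun [set: R] (EFin \o f) by case/integrableP: fi.
pose fn n := (EFin \o f) \_ `[(- n%:R : R)%R, n%:R].
have mfn n : measurable_fun [set: R] (fn n).
  by apply/(measurable_restrictT _ _).1 => //; exact: measurable_funTS.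
have cv : {ae mu, forall x, [set: R] x -> fn ^~ x @ \oo --> (EFin \o f) x}.
  apply: aeW => x _; apply: cvg_near_cst; exists (truncn `|x|).+1 => // n /= xn.
  rewrite /fn /restrict; case: ifPn => //; rewrite notin_setE /= in_itv /= => h; exfalso; apply: h.
  have : `|x| <= n%:R by rewrite ltW// (lt_le_trans (truncnS_gt _))// ler_nat.
  by rewrite ler_norml.
have dom : {ae mu, forall x n, [set: R] x -> (`|fn n x| <= (abse \o (EFin \o f)) x)%E}.
  apply: aeW => x n _; rewrite /fn /restrict; case: ifP => //= _.
  by rewrite normr0 lee_fin.
have ia : mu.-integrable [set: R] (abse \o (EFin \o f)) by exact: integrable_abse.
have [_ _ h] := @dominated_convergence _ _ _ mu _ measurableT fn (EFin \o f) (abse \o (EFin \o f)) mfn mf cv ia dom.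
have fin : (\int[mu]_x ((EFin \o f) x))%E \is a fin_num by exact: integrable_fin_num.
have h2 : (fun n : nat => \int[mu]_(x in `[(- n%:R)%R, n%:R]) (f x)%:E)%E @ \oo --> (fine (\int[mu]_x (f x)%:E)%E)%:E.
  rewrite fineK//; apply: cvg_trans h; apply: near_eq_cvg; apply: nearW => n /=.
  by rewrite [RHS]integral_mkcond.
exact: (fine_cvg h2).
Qed.

Lemma derive_continuous F f x : is_derive x (1 : R) F (f x) -> {for x, continuous F}.
Proof. by move=> dF; apply/differentiable_continuous/derivable1_diffP; case: dF. Qed.

Lemma FTC_is_derive F f a b : a <= b -> (forall x, is_derive x (1 : R) F (f x)) -> continuous f ->
  \int[mu]_(x in `[a, b]) f x = F b - F a.
Proof.
move=> ab dF cf; have [->|ab'] := eqVneq a b.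
  by rewrite set_itv1 Rintegral_set1 subrr.
have {ab ab'} ab : a < b by rewrite lt_neqAle ab'.
have cF : continuous F by move=> x; exact: derive_continuous (dF x).
rewrite /Rintegral (continuous_FTC2 (F := F))//.
- exact: continuous_subspaceT.
- split; first by move=> x _; case: (dF x).
  + by apply: cvg_at_right_filter; exact: cF.
  + by apply: cvg_at_left_filter; exact: cF.
- by move=> x _; rewrite derive1E; case: (dF x).
Qed.

Lemma int_derive F f (l1 l2 : R) : (forall x, is_derive x (1 : R) F (f x)) -> continuous f ->
  mu.-integrable [set: R] (EFin \o f) ->
  (fun n : nat => F n%:R) @ \oo --> l1 -> (fun n : nat => F (- n%:R)) @ \oo --> l2 ->
  \int[mu]_x f x = l1 - l2.
Proof.
move=> dF cf fi F1 F2; have h := Rintegral_window fi.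
have h2 : (fun n : nat => \int[mu]_(x in `[(- n%:R)%R, n%:R]) f x) @ \oo --> (l1 - l2 : R).
  have -> : (fun n : nat => \int[mu]_(x in `[(- n%:R)%R, n%:R]) f x) = (fun n : nat => F n%:R - F (- n%:R)).
    apply/funext => n; apply: FTC_is_derive => //.
    by rewrite (@le_trans _ _ 0) ?oppr_le0// ler0n.
  by apply: cvgB.
exact: cvg_unique h h2.
Qed.

Lemma int_derive0 F f : (forall x, is_derive x (1 : R) F (f x)) -> continuous f ->
  mu.-integrable [set: R] (EFin \o f) ->
  (fun n : nat => F n%:R) @ \oo --> 0 -> (fun n : nat => F (- n%:R)) @ \oo --> 0 ->
  \int[mu]_x f x = 0.
Proof. by move=> dF cf fi F1 F2; rewrite (int_derive dF cf fi F1 F2) subrr. Qed.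

Lemma cvg0_inv_dom (u : nat -> R) (C : R) : (forall n, `|u n| <= C / n.+1%:R) ->
  u @ \oo --> 0.
Proof.
move=> h; apply/cvgrPdist_le => e e0; exists (truncn (C / e)).+1 => // n /= nn'.
rewrite sub0r normrN (le_trans (h n))// ler_pdivrMr ?ltr0n// mulrC -ler_pdivrMr//.
by rewrite ltW// (lt_le_trans (truncnS_gt _))// ler_nat (leq_trans nn').
Qed.

End line_integrals.

(** * Characteristic function of the standard Gaussian *)

Section gauss_charfun.
Context {R : realType}.
Notation mu := (@lebesgue_measure R).

Let C := (normal_peak 1 : R).
Let p (x : R) := normal_pdf 0 1 x : R.

Lemma normal_pdf01E (x : R) : normal_pdf 0 1 x = C * expR (- (x ^+ 2 / 2)).
Proof. by rewrite normal_pdfE ?oner_neq0// /normal_fun subr0 expr1n mulNr -[1 *+ 2]/(2 : R). Qed.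

Lemma is_derive_pdf (x : R) : is_derive x (1 : R) p (- x * p x).
Proof.
have -> : p = fun x => C * expR (- (x ^+ 2 / 2)) by apply/funext => y; exact: normal_pdf01E.
have d1 : is_derive x (1 : R) (fun y : R => - (y ^+ 2 / 2)) (- x).
  have -> : (fun y : R => - (y ^+ 2 / 2)) = (- 2^-1) \*: (fun y : R => y ^+ 2).
    by apply/funext => y; rewrite /= /GRing.scale /=; lra.
  by apply: is_derive_eq; rewrite /GRing.scale /=; lra.
have d2 := @is_derive1_comp R expR (fun y : R => - (y ^+ 2 / 2)) x _ _ (is_derive_expR (- (x ^+ 2 / 2))) d1.
have -> : (fun y : R => C * expR (- (y ^+ 2 / 2))) = C \*: (expR \o (fun y : R => - (y ^+ 2 / 2))).
  by [].
apply: is_derive_eq; rewrite /GRing.scale /=; ring.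
Qed.

End gauss_charfun.

Section gauss_charfun2.
Context {R : realType}.
Notation mu := (@lebesgue_measure R).

(** The Radon-Nikodym derivative of the normal law equals its density almost everywhere, both having
    the same integral over every measurable set. *)
Lemma integral_normal01 (f : R -> \bar R) : measurable_fun [set: R] f ->
  (\int[normal_prob 0 1]_x `|f x| < +oo)%E ->
  (\int[normal_prob 0 1]_x f x = \int[mu]_x (f x * (normal_pdf 0 1 x)%:E))%E.
Proof.
move=> mf finf; have dom := @normal_prob_dominates R 0 1.
rewrite -(Radon_Nikodym_change_of_variables dom)//=; last by apply/integrableP; split.
apply: ae_eq_integral => //.
- apply: emeasurable_funM => //; apply: (measurable_int mu).
- apply: emeasurable_funM => //=; apply/measurableT_comp => //=.
  exact: measurable_normal_pdf.
- apply: ae_eqe_mul2l => /=.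
  rewrite Radon_NikodymE//=.
  case: cid => /= h [h1 h2 h3].
  apply: integral_ae_eq => //=.
  + by apply/measurable_EFinP; exact: measurable_normal_pdf.
  + by move=> E E01 mE; rewrite -h3.
Qed.

Let p (x : R) := normal_pdf 0 1 x : R.
(** An integrable majorant of |x| p(x): a multiple of exp (-x^2/4), since |x| <= exp (x^2/4). *)
Let G (x : R) := normal_peak 1 / normal_peak (Num.sqrt 2) * normal_pdf 0 (Num.sqrt 2) x : R.

Let sq2 : Num.sqrt (2 : R) != 0. Proof. by rewrite gt_eqF// sqrtr_gt0. Qed.

Lemma xpdf_le (x : R) : `|x * p x| <= G x.
Proof.
rewrite /G /p normal_pdf01E normal_pdfE// /normal_fun subr0 sqr_sqrtr// normrM.
rewrite mulrA mulfVK ?gt_eqF ?normal_peak_gt0//.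
rewrite normrM (ger0_norm (normal_peak_ge0 1)) (ger0_norm (expR_ge0 _)) mulrCA.
rewrite ler_wpM2l ?normal_peak_ge0//.
have h := expR_ge1Dx (x ^+ 2 / 4).
have xe : `|x| <= expR (x ^+ 2 / 4).
  apply: le_trans h; rewrite ler_norml; have := sqr_ge0 (x / 2 - 1); have := sqr_ge0 (x / 2 + 1); nra.
apply: (le_trans (ler_wpM2r (expR_ge0 _) xe)); rewrite -expRD ler_expR.
rewrite -mulr_natl; lra.
Qed.

Lemma integrable_G : mu.-integrable [set: R] (EFin \o G).
Proof.
rewrite (_ : EFin \o G = (fun x => (normal_peak 1 / normal_peak (Num.sqrt 2))%:E * (normal_pdf 0 (Num.sqrt 2) x)%:E)%E); last first.
  by apply/funext => x; rewrite /G /= EFinM.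
by apply: integrableZl => //; exact: integrable_normal_pdf.
Qed.

Lemma integrable_p : mu.-integrable [set: R] (EFin \o p).
Proof. exact: integrable_normal_pdf. Qed.

Lemma continuous_p : continuous p.
Proof. by apply: continuous_normal_pdf; exact: oner_neq0. Qed.

Lemma integrable_cosp (t : R) : mu.-integrable [set: R] (EFin \o (fun x => cos (t * x) * p x)).
Proof.
apply: (integrable_dom (G := p)) integrable_p _.
  move=> x; apply: cvgM; last exact: continuous_p.
  by apply: continuous_comp; [exact: mulrl_continuous | exact: continuous_cos].
move=> x; rewrite normrM (ger0_norm (normal_pdf_ge0 _ _ _)) ler_piMl ?normal_pdf_ge0//.
exact: cos_max.
Qed.

Lemma integrable_sinxp (t : R) : mu.-integrable [set: R] (EFin \o (fun x => sin (t * x) * (x * p x))).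
Proof.
apply: (integrable_dom (G := G)) integrable_G _.
  move=> x; apply: cvgM; last by apply: cvgM; [exact: cvg_id | exact: continuous_p].
  by apply: continuous_comp; [exact: mulrl_continuous | exact: continuous_sin].
move=> x; rewrite normrM (le_trans _ (xpdf_le x))// ler_piMl//.
exact: sin_max.
Qed.

Let phi (t : R) := \int[mu]_x (cos (t * x) * p x).

Lemma is_derive_cos_lin (t x : R) : is_derive t (1 : R) (fun t => cos (t * x)) (- sin (t * x) * x).
Proof.
have d1 : is_derive t (1 : R) (fun t => t * x) x.
  have -> : (fun t : R => t * x) = x \*: (@id R) by apply/funext => z; rewrite /= /GRing.scale /= mulrC.
  by apply: is_derive_eq; rewrite /GRing.scale /= mulr1.
exact: (@is_derive1_comp R cos (fun t : R => t * x) t _ _ (is_derive_cos (t * x)) d1).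
Qed.

Lemma is_derive_sin_lin (t x : R) : is_derive t (1 : R) (fun t => sin (t * x)) (cos (t * x) * x).
Proof.
have d1 : is_derive t (1 : R) (fun t => t * x) x.
  have -> : (fun t : R => t * x) = x \*: (@id R) by apply/funext => z; rewrite /= /GRing.scale /= mulrC.
  by apply: is_derive_eq; rewrite /GRing.scale /= mulr1.
exact: (@is_derive1_comp R sin (fun t : R => t * x) t _ _ (is_derive_sin (t * x)) d1).
Qed.

Lemma is_deriveZr (F : R -> R) (t dF c : R) : is_derive t (1 : R) F dF ->
  is_derive t (1 : R) (fun t => F t * c) (dF * c).
Proof.
move=> h; have -> : (fun t => F t * c) = c \*: F by apply/funext => z; rewrite /= /GRing.scale /= mulrC.
by apply: is_derive_eq; rewrite /GRing.scale /= mulrC.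
Qed.

Lemma pdf_decay (n : nat) : p n%:R <= 2 * normal_peak 1 / n.+1%:R.
Proof.
rewrite /p normal_pdf01E expRN ler_pdivlMr ?ltr0n// mulrAC ler_pdivrMr ?expR_gt0//.
rewrite -mulrA [leRHS]mulrCA ler_wpM2l ?normal_peak_ge0//.
have := expR_ge1Dx (n%:R ^+ 2 / 2 : R); have := sqr_ge0 (n%:R - 1 : R); rewrite -(natr1 n); nra.
Qed.

(** Integration of the derivative of sin (t x) p(x), a function vanishing at both ends, with p' = -
    x p. *)
Lemma phi_by_parts (t : R) : \int[mu]_x (sin (t * x) * (x * p x)) = t * phi t.
Proof.
pose F x := sin (t * x) * p x; pose f x := t * (cos (t * x) * p x) - sin (t * x) * (x * p x).
have dF x : is_derive x (1 : R) F (f x).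
  have d1 : is_derive x (1 : R) (fun x => sin (t * x)) (cos (t * x) * t).
    have := is_derive_sin_lin x t.
    have -> : (fun t0 => sin (t0 * t)) = (fun x0 : R => sin (t * x0)).
      by apply/funext => z; rewrite [z * t]mulrC.
    by rewrite [x * t]mulrC.
  have -> : F = (fun x => sin (t * x)) * p by [].
  have d2 : is_derive x (1 : R) p (- x * p x) by exact: is_derive_pdf.
  by apply: is_derive_eq; rewrite /f /GRing.scale /=; ring.
have i1 : mu.-integrable [set: R] (EFin \o (fun x => t * (cos (t * x) * p x))).
  rewrite (_ : EFin \o _ = (fun x => t%:E * (cos (t * x) * p x)%:E)%E); last first.
    by apply/funext => x; rewrite /= EFinM.
  by apply: integrableZl => //; exact: integrable_cosp.
have fi : mu.-integrable [set: R] (EFin \o f).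
  rewrite (_ : EFin \o f = (EFin \o (fun x => t * (cos (t * x) * p x))%R) \- (EFin \o (fun x => sin (t * x) * (x * p x))%R))%E; last first.
    by apply/funext => x; rewrite /= EFinB.
  by apply: integrableB => //; exact: integrable_sinxp.
have ct (h : R -> R) : continuous h -> continuous (fun x => h (t * x)).
  by move=> ch x; apply: continuous_comp; [exact: mulrl_continuous | exact: ch].
have cf : continuous f.
  move=> x; apply: cvgB; apply: cvgM.
  - exact: cvg_cst.
  - by apply: cvgM; [apply: ct; exact: continuous_cos | exact: continuous_p].
  - by apply: ct; exact: continuous_sin.
  - by apply: cvgM; [exact: cvg_id | exact: continuous_p].
have pb := pdf_decay.
have pN (x : R) : p (- x) = p x by rewrite /p !normal_pdf01E sqrrN.
have p0 (x : R) : 0 <= p x by exact: normal_pdf_ge0.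
have Fb (n : nat) (y : R) : `|y| <= 1 -> `|y * p n%:R| <= 2 * normal_peak 1 / n.+1%:R.
  by move=> y1; rewrite normrM (ger0_norm (p0 _)) (le_trans _ (pb n))// ler_piMl.
have z : \int[mu]_x f x = 0.
  apply: (int_derive0 dF cf fi); apply: cvg0_inv_dom => n.
    by apply: Fb; exact: sin_max.
  by rewrite /F pN; apply: Fb; exact: sin_max.
have : \int[mu]_x f x = t * phi t - \int[mu]_x (sin (t * x) * (x * p x)).
  rewrite /f RintegralB//; last exact: integrable_sinxp.
  by rewrite RintegralZl//; exact: integrable_cosp.
by rewrite z => /eqP; rewrite eq_sym subr_eq0 => /eqP.
Qed.

Lemma is_derive_phi (t : R) : is_derive t (1 : R) phi (- t * phi t).
Proof.
pose f (t x : R) := cos (t * x) * p x.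
have tI : (`](t - 1), (t + 1)[%classic : set R) t by rewrite /= in_itv /=; lra.
have df (s x : R) : is_derive s (1 : R) (f ^~ x) (- sin (s * x) * x * p x).
  exact: is_deriveZr (is_derive_cos_lin s x).
have pe (s x : R) : partial1of2 f s x = - (sin (s * x) * (x * p x)).
  by rewrite partial1of2E; have [_ ->] := df s x; ring.
have H1 (s : R) : (`](t - 1), (t + 1)[%classic : set R) s -> mu.-integrable [set: R] (EFin \o f s).
  by move=> _; exact: integrable_cosp.
have H2 (s x : R) : (`](t - 1), (t + 1)[%classic : set R) s -> [set: R] x -> derivable (f ^~ x) s 1.
  by move=> _ _; case: (df s x).
have G0 (x : R) : 0 <= G x by apply: le_trans (xpdf_le x).
have H3 (s x : R) : (`](t - 1), (t + 1)[%classic : set R) s -> [set: R] x -> `|partial1of2 f s x| <= G x.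
  move=> _ _; rewrite pe normrN normrM (le_trans _ (xpdf_le x))// ler_piMl//; exact: sin_max.
have D := @derivable_under_integral R _ _ mu f [set: R] measurableT t (t - 1) (t + 1) tI H1 H2 G G0 integrable_G H3.
have E := @differentiation_under_integral R _ _ mu f [set: R] measurableT t (t - 1) (t + 1) tI H1 H2 G G0 integrable_G H3.
apply: DeriveDef; first exact: D.
rewrite -derive1E [LHS]E; under eq_Rintegral do rewrite pe.
have -> : (fun x => - (sin (t * x) * (x * p x))) = (fun x => (-1) * (sin (t * x) * (x * p x))).
  by apply/funext => x; rewrite mulN1r.
by rewrite RintegralZl//; [rewrite phi_by_parts mulN1r mulNr | exact: integrable_sinxp].
Qed.

(** The transform solves phi' = - t phi, so phi(t) exp (t^2/2) keeps its value 1 at the origin. *)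
Lemma gauss_charfun (t : R) : \int[mu]_x (cos (t * x) * p x) = expR (- (t ^+ 2 / 2)).
Proof.
pose H t := phi t * expR (t ^+ 2 / 2).
have dH s : is_derive s (1 : R) H 0.
  have d1 : is_derive s (1 : R) (fun y : R => y ^+ 2 / 2) s.
    have -> : (fun y : R => y ^+ 2 / 2) = 2^-1 \*: (fun y : R => y ^+ 2).
      by apply/funext => y; rewrite /= /GRing.scale /=; lra.
    by apply: is_derive_eq; rewrite /GRing.scale /=; lra.
  have d2 := @is_derive1_comp R expR (fun y : R => y ^+ 2 / 2) s _ _ (is_derive_expR (s ^+ 2 / 2)) d1.
  have d3 := is_derive_phi s.
  have -> : H = phi * (expR \o (fun y : R => y ^+ 2 / 2)) by [].
  by apply: is_derive_eq; rewrite /GRing.scale /=; ring.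
have h := @is_derive_0_is_cst R H t 0 dH.
have phi0 : phi 0 = 1.
  rewrite /phi; under eq_Rintegral do rewrite mul0r cos0 mul1r.
  by rewrite /Rintegral integral_normal_pdf.
move: h; rewrite /H phi0 expr0n mul0r expR0 mulr1 => h.
by rewrite -/(phi t) -[LHS](mulfK (lt0r_neq0 (expR_gt0 (t ^+ 2 / 2)))) h mul1r expRN.
Qed.

End gauss_charfun2.

(** * Differentiation of cosine and sine transforms *)

Section fourier_derivatives.
Context {R : realType}.
Notation mu := (@lebesgue_measure R).
Implicit Types k G : R -> R.

Lemma continuous_cos_lin (t : R) : continuous (fun s : R => cos (t * s)).
Proof. by move=> s; apply: continuous_comp; [exact: mulrl_continuous | exact: continuous_cos]. Qed.

Lemma continuous_sin_lin (t : R) : continuous (fun s : R => sin (t * s)).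
Proof. by move=> s; apply: continuous_comp; [exact: mulrl_continuous | exact: continuous_sin]. Qed.

Lemma integrable_cos_mul k G (t : R) : continuous k -> mu.-integrable [set: R] (EFin \o G) ->
  (forall s, `|k s| <= G s) -> mu.-integrable [set: R] (EFin \o (fun s => cos (t * s) * k s)).
Proof.
move=> ck iG kG; apply: (integrable_dom (G := G)) iG _.
  by move=> x; apply: cvgM; [exact: continuous_cos_lin | exact: ck].
by move=> x; rewrite normrM (le_trans _ (kG x))// ler_piMl// cos_max.
Qed.

Lemma integrable_sin_mul k G (t : R) : continuous k -> mu.-integrable [set: R] (EFin \o G) ->
  (forall s, `|k s| <= G s) -> mu.-integrable [set: R] (EFin \o (fun s => sin (t * s) * k s)).
Proof.
move=> ck iG kG; apply: (integrable_dom (G := G)) iG _.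
  by move=> x; apply: cvgM; [exact: continuous_sin_lin | exact: ck].
by move=> x; rewrite normrM (le_trans _ (kG x))// ler_piMl// sin_max.
Qed.

Lemma is_derive_under_int (g dg : R -> R -> R) G (t : R) :
  (forall s, mu.-integrable [set: R] (EFin \o g s)) ->
  (forall s x, is_derive s (1 : R) (g ^~ x) (dg s x)) ->
  mu.-integrable [set: R] (EFin \o G) -> (forall s x, `|dg s x| <= G x) ->
  is_derive t (1 : R) (fun t => \int[mu]_s g t s) (\int[mu]_s dg t s).
Proof.
move=> ig dfg iG bG.
have tI : (`](t - 1), (t + 1)[%classic : set R) t by rewrite /= in_itv /=; lra.
have pe (s x : R) : partial1of2 g s x = dg s x by rewrite partial1of2E; have [_ ->] := dfg s x.
have H1 (s : R) : (`](t - 1), (t + 1)[%classic : set R) s -> mu.-integrable [set: R] (EFin \o g s).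
  by [].
have H2 (s x : R) : (`](t - 1), (t + 1)[%classic : set R) s -> [set: R] x -> derivable (g ^~ x) s 1.
  by move=> _ _; case: (dfg s x).
have G0 (x : R) : 0 <= G x by apply: le_trans (bG 0 x).
have H3 (s x : R) : (`](t - 1), (t + 1)[%classic : set R) s -> [set: R] x -> `|partial1of2 g s x| <= G x.
  by move=> _ _; rewrite pe.
have D := @derivable_under_integral R _ _ mu g [set: R] measurableT t (t - 1) (t + 1) tI H1 H2 G G0 iG H3.
have E := @differentiation_under_integral R _ _ mu g [set: R] measurableT t (t - 1) (t + 1) tI H1 H2 G G0 iG H3.
apply: DeriveDef; first exact: D.
by rewrite -derive1E [LHS]E; under eq_Rintegral do rewrite pe.
Qed.

Lemma is_derive_int_cos k G (t : R) : continuous k -> mu.-integrable [set: R] (EFin \o G) ->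
  (forall s, `|k s| <= G s) -> (forall s, `|s * k s| <= G s) ->
  is_derive t (1 : R) (fun t => \int[mu]_s (cos (t * s) * k s))
    (- (\int[mu]_s (sin (t * s) * (s * k s)))).
Proof.
move=> ck iG kG skG.
have csk : continuous (fun s : R => s * k s) by move=> x; apply: cvgM; [exact: cvg_id | exact: ck].
have -> : - (\int[mu]_s (sin (t * s) * (s * k s))) = \int[mu]_s (- sin (t * s) * s * k s).
  rewrite -mulN1r -RintegralZl//; last exact: integrable_sin_mul csk iG skG.
  by apply: eq_Rintegral => x _; rewrite mulN1r !mulNr mulrA.
refine (@is_derive_under_int (fun t s => cos (t * s) * k s) (fun t s => - sin (t * s) * s * k s) G t _ _ iG _).
- by move=> s; exact: integrable_cos_mul ck iG kG.
- by move=> s x; exact: is_deriveZr (is_derive_cos_lin s x).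
- by move=> s x; rewrite -mulrA normrM normrN (le_trans _ (skG x))// ler_piMl// sin_max.
Qed.

Lemma is_derive_int_sin k G (t : R) : continuous k -> mu.-integrable [set: R] (EFin \o G) ->
  (forall s, `|k s| <= G s) -> (forall s, `|s * k s| <= G s) ->
  is_derive t (1 : R) (fun t => \int[mu]_s (sin (t * s) * k s))
    (\int[mu]_s (cos (t * s) * (s * k s))).
Proof.
move=> ck iG kG skG.
have -> : \int[mu]_s (cos (t * s) * (s * k s)) = \int[mu]_s (cos (t * s) * s * k s).
  by apply: eq_Rintegral => x _; rewrite mulrA.
refine (@is_derive_under_int (fun t s => sin (t * s) * k s) (fun t s => cos (t * s) * s * k s) G t _ _ iG _).
- by move=> s; exact: integrable_sin_mul ck iG kG.
- by move=> s x; exact: is_deriveZr (is_derive_sin_lin s x).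
- by move=> s x; rewrite -mulrA normrM (le_trans _ (skG x))// ler_piMl// cos_max.
Qed.

End fourier_derivatives.

(** * The Fourier transform of the Cauchy kernel *)

Section cauchy_transform.
Context {R : realType}.
Notation mu := (@lebesgue_measure R).

Definition cauchy_w (s : R) : R := (4^-1 + s ^+ 2)^-1.
Local Notation w := cauchy_w.

Lemma cauchy_den_gt0 (s : R) : 0 < 4^-1 + s ^+ 2.
Proof. by have := sqr_ge0 s; lra. Qed.

Lemma cauchy_w_gt0 (s : R) : 0 < w s.
Proof. by rewrite invr_gt0 cauchy_den_gt0. Qed.

Lemma cauchy_wV (s : R) : (4^-1 + s ^+ 2) * w s = 1.
Proof. by rewrite mulfV// lt0r_neq0// cauchy_den_gt0. Qed.

Lemma cauchy_w_le4 (s : R) : w s <= 4.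
Proof.
have := cauchy_wV s; have := cauchy_w_gt0 s; have := sqr_ge0 s; nra.
Qed.

Lemma is_derive_sqr (s : R) : is_derive s (1 : R) (fun s => s ^+ 2) (2 * s).
Proof. by apply: is_derive_eq; rewrite /GRing.scale /=; lra. Qed.

Lemma is_derive_w (s : R) : is_derive s (1 : R) w (- (2 * s) * w s ^+ 2).
Proof.
have d1 : is_derive s (1 : R) (fun s => 4^-1 + s ^+ 2) (2 * s).
  have -> : (fun s : R => 4^-1 + s ^+ 2) = cst 4^-1 + (fun s => s ^+ 2) by [].
  have d2 := is_derive_sqr s.
  by apply: is_derive_eq; rewrite add0r.
have nz := lt0r_neq0 (cauchy_den_gt0 s).
have := @is_deriveV R (fun s => 4^-1 + s ^+ 2) s _ 1 nz d1.
have -> : (fun s => (4^-1 + s ^+ 2)^-1) = w by [].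
rewrite -exprVn -/(w s) => h.
by apply: (is_derive_eq h); rewrite /GRing.scale /=; ring.
Qed.

Lemma continuous_w : continuous w.
Proof. by move=> s; have := is_derive_w s; exact: (derive_continuous (f := fun s => - (2 * s) * w s ^+ 2)). Qed.

Lemma is_derive_atan2 (s : R) : is_derive s (1 : R) (fun s => 2 * atan (2 * s)) (w s).
Proof.
have d1 : is_derive s (1 : R) (fun s : R => 2 * s) 2.
  have -> : (fun s : R => 2 * s) = 2 \*: (@id R) by [].
  by apply: is_derive_eq; rewrite /GRing.scale /= mulr1.
have d2 := @is_derive1_comp R (@atan R) (fun s : R => 2 * s) s _ _ (is_derive1_atan (2 * s)) d1.
have -> : (fun s : R => 2 * atan (2 * s)) = 2 \*: ((@atan R) \o (fun s : R => 2 * s)) by [].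
apply: is_derive_eq; rewrite /GRing.scale /= /cauchy_w.
have := cauchy_den_gt0 s; rewrite exprMn => h.
have h2 : 1 + 2 ^+ 2 * s ^+ 2 = 4 * (4^-1 + s ^+ 2) by field.
by rewrite h2; have := lt0r_neq0 h; move: (4^-1 + s ^+ 2) => v v0; field.
Qed.

Lemma w_oneDsqr (s : R) : w s <= 4 * (oneDsqr s)^-1.
Proof.
have h1 := cauchy_den_gt0 s; have h2 := oneDsqr_ge1 s.
rewrite /cauchy_w ler_pdivlMr ?(lt_le_trans ltr01)// mulrC ler_pdivrMr// /oneDsqr.
by have := sqr_ge0 s; lra.
Qed.

Lemma integrable_oneDsqrV : mu.-integrable [set: R] (EFin \o (fun s : R => (oneDsqr s)^-1)).
Proof.
have mf : measurable_fun [set: R] (EFin \o (fun s : R => (oneDsqr s)^-1)).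
  by apply/measurable_EFinP; apply: continuous_measurable_fun; exact: continuous_oneDsqrV.
apply/integrableP; split => //=.
have -> : (\int[mu]_x `|((oneDsqr x)^-1)%:E| = \int[mu]_x ((oneDsqr x)^-1)%:E)%E.
  by apply: eq_integral => x _; rewrite /= ger0_norm// invr_ge0 (le_trans ler01)// oneDsqr_ge1.
rewrite ge0_symfun_integralT.
- have := @integral0y_oneDsqr R; rewrite set_itvcy => ->.
  by rewrite -EFinM ltry.
- by move=> x; rewrite invr_ge0 (le_trans ler01)// oneDsqr_ge1.
- exact: continuous_oneDsqrV.
- by move=> x /=; rewrite /oneDsqr sqrrN.
Qed.

Let G (s : R) := 4 * w s.

Lemma integrable_w : mu.-integrable [set: R] (EFin \o w).
Proof.
have iG : mu.-integrable [set: R] (EFin \o (fun s : R => 4 * (oneDsqr s)^-1)).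
  rewrite (_ : EFin \o _ = (fun x => 4%:E * ((oneDsqr x)^-1)%:E)%E); last first.
    by apply/funext => x; rewrite /= EFinM.
  by apply: integrableZl => //; exact: integrable_oneDsqrV.
apply: (integrable_dom continuous_w iG) => s.
by rewrite ger0_norm ?w_oneDsqr// ltW// cauchy_w_gt0.
Qed.

Let iG : mu.-integrable [set: R] (EFin \o G).
Proof.
rewrite (_ : EFin \o _ = (fun x => 4%:E * (w x)%:E)%E); last first.
  by apply/funext => x; rewrite /= EFinM.
by apply: integrableZl => //; exact: integrable_w.
Qed.

Lemma cvg_atan2 : (fun n : nat => 2 * atan (2 * n%:R) : R) @ \oo --> (pi : R).
Proof.
have h : (fun n : nat => atan (2 * n%:R) : R) @ \oo --> (pi / 2 : R).
  refine (cvg_comp (fun n : nat => 2 * n%:R : R) (@atan R) _ (@cvgy_atan R)).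
  apply/cvgryPge => A; exists (truncn `|A|).+1 => // n /= nA.
  have : `|A| <= n%:R by rewrite ltW// (lt_le_trans (truncnS_gt _))// ler_nat.
  by rewrite ler_norml => /andP[_ h]; have := ler0n R n; lra.
have -> : (pi : R) = 2 * (pi / 2) by field.
by apply: cvgM => //; exact: cvg_cst.
Qed.

Lemma int_cauchy_w : \int[mu]_s w s = 2 * pi.
Proof.
rewrite (_ : 2 * pi = pi - - pi); last by ring.
refine (@int_derive R (fun s => 2 * atan (2 * s)) w pi (- pi) _ _ _ _ _).
- exact: is_derive_atan2.
- exact: continuous_w.
- exact: integrable_w.
- exact: cvg_atan2.
- have -> : (fun n : nat => 2 * atan (2 * - n%:R) : R) = (fun n => - (2 * atan (2 * n%:R))).
    by apply/funext => n; rewrite mulrN atanN mulrN.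
  by apply: cvgN; exact: cvg_atan2.
Qed.

(** Since s w(s) is not integrable, the transform c of w cannot be differentiated under the integral
    sign. The transform a of w^2 can be, twice, and c returns in its second derivative through s^2
    w^2 = w - w^2/4. *)
Let w2 (s : R) := w s ^+ 2.

Let cw2 : continuous w2. Proof. by move=> s; apply: cvgM; exact: continuous_w. Qed.
Let csw2 : continuous (fun s : R => s * w2 s).
Proof. by move=> s; apply: cvgM; [exact: cvg_id | exact: cw2]. Qed.
Let w2G (s : R) : `|w2 s| <= G s.
Proof.
have w0 := cauchy_w_gt0 s; have w4 := cauchy_w_le4 s; rewrite /w2 /G ger0_norm ?sqr_ge0//; nra.
Qed.
Let sw2G (s : R) : `|s * w2 s| <= G s.
Proof.
rewrite normrM (ger0_norm (sqr_ge0 _)) /w2 /G.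
have s1 : `|s| <= 4^-1 + s ^+ 2.
  by rewrite ler_norml; have := sqr_ge0 (s - 2^-1); have := sqr_ge0 (s + 2^-1); nra.
have w0 := ltW (cauchy_w_gt0 s).
rewrite expr2 mulrA (@le_trans _ _ (cauchy_w s))//; last lra.
by rewrite ler_piMl// -(cauchy_wV s) ler_wpM2r.
Qed.
Let ssw2 (s : R) : s * (s * w2 s) = w s - 4^-1 * w2 s.
Proof. by have := cauchy_wV s; rewrite /w2 expr2; nra. Qed.
Let ssw2G (s : R) : `|s * (s * w2 s)| <= G s.
Proof.
have w0 := cauchy_w_gt0 s; have w4 := cauchy_w_le4 s.
rewrite ssw2 /w2 /G ger0_norm; nra.
Qed.

Let a (l : R) := \int[mu]_s (cos (l * s) * w2 s).
Let b (l : R) := - (\int[mu]_s (sin (l * s) * (s * w2 s))).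
Let c (l : R) := \int[mu]_s (cos (l * s) * w s).

Let wG (s : R) : `|w s| <= G s.
Proof. by have w0 := cauchy_w_gt0 s; rewrite /G ger0_norm ?ltW//; lra. Qed.

Let da (l : R) : is_derive l (1 : R) a (b l).
Proof. exact: is_derive_int_cos cw2 iG w2G sw2G. Qed.

Let db (l : R) : is_derive l (1 : R) b (a l / 4 - c l).
Proof.
have h := is_derive_int_sin l csw2 iG sw2G ssw2G.
have -> : a l / 4 - c l = - (\int[mu]_s (cos (l * s) * (s * (s * w2 s)))).
  have -> : \int[mu]_s (cos (l * s) * (s * (s * w2 s))) =
    \int[mu]_s (cos (l * s) * w s - 4^-1 * (cos (l * s) * w2 s)).
    by apply: eq_Rintegral => s _; rewrite ssw2; ring.
  rewrite RintegralB//; last 2 first.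
  - exact: integrable_cos_mul continuous_w iG wG.
  - rewrite (_ : EFin \o _ = (fun x => (4^-1)%:E * (cos (l * x) * w2 x)%:E)%E); last first.
      by apply/funext => x; rewrite /= EFinM.
    by apply: integrableZl => //; exact: integrable_cos_mul cw2 iG w2G.
  rewrite RintegralZl//; last exact: integrable_cos_mul cw2 iG w2G.
  by rewrite -/(c l) -/(a l); ring.
exact: is_deriveN.
Qed.

(** Integration by parts of sin (l s) w(s), with w' = - 2 s w^2. *)
Let bc (l : R) : b l = - (l * c l / 2).
Proof.
pose F s := sin (l * s) * w s.
pose f s := l * (cos (l * s) * w s) - 2 * (sin (l * s) * (s * w2 s)).
have dF s : is_derive s (1 : R) F (f s).
  have d1 : is_derive s (1 : R) (fun s => sin (l * s)) (cos (l * s) * l).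
    have h := is_derive_sin_lin s l.
    have -> : (fun s => sin (l * s)) = (fun s => sin (s * l)) by apply/funext => z; rewrite [l * z]mulrC.
    by rewrite [l * s]mulrC.
  have d2 := is_derive_w s.
  have -> : F = (fun s => sin (l * s)) * w by [].
  by apply: is_derive_eq; rewrite /f /w2 /GRing.scale /=; ring.
have i1 : mu.-integrable [set: R] (EFin \o (fun s => l * (cos (l * s) * w s))).
  rewrite (_ : EFin \o _ = (fun x => l%:E * (cos (l * x) * w x)%:E)%E); last first.
    by apply/funext => x; rewrite /= EFinM.
  by apply: integrableZl => //; exact: integrable_cos_mul continuous_w iG wG.
have i2 : mu.-integrable [set: R] (EFin \o (fun s => 2 * (sin (l * s) * (s * w2 s)))).
  rewrite (_ : EFin \o _ = (fun x => 2%:E * (sin (l * x) * (x * w2 x))%:E)%E); last first.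
    by apply/funext => x; rewrite /= EFinM.
  by apply: integrableZl => //; exact: integrable_sin_mul csw2 iG sw2G.
have fi : mu.-integrable [set: R] (EFin \o f).
  rewrite (_ : EFin \o f = (EFin \o (fun s => l * (cos (l * s) * w s))%R) \- (EFin \o (fun s => 2 * (sin (l * s) * (s * w2 s)))%R))%E; last first.
    by apply/funext => x; rewrite /= EFinB.
  exact: integrableB.
have cf : continuous f.
  move=> x; apply: cvgB; apply: cvgM.
  - exact: cvg_cst.
  - by apply: cvgM; [exact: continuous_cos_lin | exact: continuous_w].
  - exact: cvg_cst.
  - by apply: cvgM; [exact: continuous_sin_lin | exact: csw2].
have wb (n : nat) : w n%:R <= 8 / n.+1%:R.
  rewrite ler_pdivlMr ?ltr0n// -(natr1 n).
  have := cauchy_wV n%:R; have := cauchy_w_gt0 n%:R; have := cauchy_w_le4 n%:R.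
  move: (w n%:R) (n%:R : R) (ler0n R n) => v x x0 v4 v0 e.
  have h : x + 1 <= 8 * (4^-1 + x ^+ 2) by have := sqr_ge0 (x - 1); have := sqr_ge0 x; lra.
  by have := ler_wpM2r (ltW v0) h; rewrite -mulrA e; lra.
have wN x : w (- x) = w x by rewrite /cauchy_w sqrrN.
have Fb (n : nat) (y : R) : `|y| <= 1 -> `|y * w n%:R| <= 8 / n.+1%:R.
  move=> y1; rewrite normrM (ger0_norm (ltW (cauchy_w_gt0 _))) (le_trans _ (wb n))//.
  by rewrite ler_piMl// ltW// cauchy_w_gt0.
have z : \int[mu]_x f x = 0.
  apply: (int_derive0 dF cf fi); apply: cvg0_inv_dom => n.
    by apply: Fb; exact: sin_max.
  by rewrite /F wN; apply: Fb; exact: sin_max.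
have : \int[mu]_x f x = l * c l + 2 * b l.
  rewrite /f RintegralB// RintegralZl//; last exact: integrable_cos_mul continuous_w iG wG.
  by rewrite RintegralZl//; [rewrite /b mulrN | exact: integrable_sin_mul csw2 iG sw2G].
rewrite z; lra.
Qed.

(** The derivative of s w(s) is w^2/2 - w, so the integral of w^2 is twice that of w. *)
Let a0 : a 0 = 4 * pi.
Proof.
pose F s := s * w s; pose f s := 2^-1 * w2 s - w s.
have dF s : is_derive s (1 : R) F (f s).
  have d2 := is_derive_w s.
  have -> : F = (@id R) * w by [].
  apply: is_derive_eq; rewrite /f /GRing.scale /= mulr1.
  by have := ssw2 s; rewrite /w2; lra.
have iw2 : mu.-integrable [set: R] (EFin \o w2) by exact: integrable_dom cw2 iG w2G.
have i1 : mu.-integrable [set: R] (EFin \o (fun s => 2^-1 * w2 s)).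
  rewrite (_ : EFin \o _ = (fun x => (2^-1)%:E * (w2 x)%:E)%E); last first.
    by apply/funext => x; rewrite /= EFinM.
  by apply: integrableZl.
have fi : mu.-integrable [set: R] (EFin \o f).
  rewrite (_ : EFin \o f = (EFin \o (fun s => 2^-1 * w2 s)%R) \- (EFin \o w))%E; last first.
    by apply/funext => x; rewrite /= EFinB.
  by apply: integrableB => //; exact: integrable_w.
have cf : continuous f.
  move=> x; apply: cvgB; last exact: continuous_w.
  by apply: cvgM; [exact: cvg_cst | exact: cw2].
have wb (n : nat) : n%:R * w n%:R <= 8 / n.+1%:R.
  rewrite ler_pdivlMr ?ltr0n// -(natr1 n).
  have := cauchy_wV n%:R; have := cauchy_w_gt0 n%:R; have := cauchy_w_le4 n%:R.
  move: (w n%:R) (n%:R : R) (ler0n R n) => v x x0 v4 v0 e.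
  have h : x ^+ 2 + x <= 8 * (4^-1 + x ^+ 2) by have := sqr_ge0 (x - 1); have := sqr_ge0 x; lra.
  by have := ler_wpM2r (ltW v0) h; rewrite -mulrA e; lra.
have wN x : w (- x) = w x by rewrite /cauchy_w sqrrN.
have z : \int[mu]_x f x = 0.
  apply: (int_derive0 dF cf fi); apply: cvg0_inv_dom => n.
    by rewrite /F ger0_norm// mulr_ge0// ltW// cauchy_w_gt0.
  by rewrite /F wN mulNr normrN ger0_norm// mulr_ge0// ltW// cauchy_w_gt0.
have : \int[mu]_x f x = 2^-1 * a 0 - 2 * pi.
  rewrite /f RintegralB//; last exact: integrable_w.
  rewrite RintegralZl// int_cauchy_w /a; congr (_ * _ - _).
  by apply: eq_Rintegral => s _; rewrite mul0r cos0 mul1r.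
rewrite z; lra.
Qed.

Let bound_int (g : R -> R) (u : R -> R) : continuous g -> (forall s, `|g s| <= G s) ->
  continuous u -> (forall s, `|u s| <= 1) -> `|\int[mu]_s (u s * g s)| <= 8 * pi.
Proof.
move=> cg gG cu u1.
have ig : mu.-integrable [set: R] (EFin \o (fun s => u s * g s)).
  apply: (integrable_dom (G := G)) iG _.
    by move=> s; apply: cvgM; [exact: cu | exact: cg].
  by move=> s; rewrite normrM (le_trans _ (gG s))// ler_piMl.
apply: (le_trans (le_normr_Rintegral _ ig)) => //.
have -> : 8 * pi = \int[mu]_s G s.
  by rewrite /G RintegralZl// ?int_cauchy_w; [ring | exact: integrable_w].
apply: le_Rintegral => //.
  exact: (integrable_norm ig).
by move=> s _; rewrite normrM (le_trans _ (gG s))// ler_piMl.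
Qed.

(** Eliminating c leaves a'' = a/4 + 2 a'/l, of which (2 + l) exp (-l/2) is a solution. The
    expression is exp (l/2) times the Wronskian of a with it. That Wronskian is a constant multiple
    of l^2, and the constant is 0 because a and b are bounded. The variable x = ln l avoids the
    singularity at l = 0 and makes the domain the whole line. *)
Let ab_rel (t : R) : 0 < t -> (2 + t) * b t + t / 2 * a t = 0.
Proof.
pose N x := expR (- (expR x / 2)) * ((2 + expR x) * b (expR x) + expR x / 2 * a (expR x)) * expR (- (2 * x)).
have dN x : is_derive x (1 : R) N 0.
  have dE := is_derive_expR x.
  have d1 : is_derive x (1 : R) (fun x : R => - (expR x / 2)) (- (expR x / 2)).
    have -> : (fun x : R => - (expR x / 2)) = (- 2^-1) \*: (@expR R).
      by apply/funext => y; rewrite /= /GRing.scale /=; ring.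
    by apply: is_derive_eq; rewrite /GRing.scale /=; ring.
  have d2 := @is_derive1_comp R expR (fun x : R => - (expR x / 2)) x _ _ (is_derive_expR _) d1.
  have d3 : is_derive x (1 : R) (fun x : R => - (2 * x)) (- 2).
    have -> : (fun x : R => - (2 * x)) = (- 2) \*: (@id R).
      by apply/funext => y; rewrite /= /GRing.scale /=; ring.
    by apply: is_derive_eq; rewrite /GRing.scale /=; ring.
  have d4 := @is_derive1_comp R expR (fun x : R => - (2 * x)) x _ _ (is_derive_expR _) d3.
  have d5 := @is_derive1_comp R b expR x _ _ (db (expR x)) dE.
  have d6 := @is_derive1_comp R a expR x _ _ (da (expR x)) dE.
  have d7 : is_derive x (1 : R) (fun x : R => 2 + expR x) (expR x).
    have -> : (fun x : R => 2 + expR x) = cst 2 + expR by [].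
    by apply: is_derive_eq; rewrite add0r.
  have d8 : is_derive x (1 : R) (fun x : R => expR x / 2) (expR x / 2).
    have -> : (fun x : R => (expR x / 2)) = 2^-1 \*: (@expR R).
      by apply/funext => y; rewrite /= /GRing.scale /=; ring.
    by apply: is_derive_eq; rewrite /GRing.scale /=; ring.
  have d9 := is_deriveM d7 d5; have d10 := is_deriveM d8 d6.
  have d11 := is_deriveM (is_deriveM d2 (is_deriveD d9 d10)) d4.
  apply: (is_derive_eq d11); rewrite !fctE /GRing.scale /=.
  have := bc (expR x); move: (expR_gt0 x); move: (expR x) => l t0 bl.
  have -> : c l = - (2 * b l / l) by rewrite bl; field; rewrite gt_eqF.
  by field; rewrite gt_eqF.
(* With |a| and |b| at most 8 pi and l >= 1, 8 pi (2 + l) + 4 pi l is at most 28 pi l. *)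
have ub l1 : 1 <= l1 -> `|N (ln l1)| <= 28 * pi / l1.
  move=> l1g; have l0 : 0 < l1 by lra.
  have l2 : 0 < l1 ^+ 2 by rewrite exprn_gt0.
  have ab := bound_int cw2 w2G (@continuous_cos_lin R l1) (fun s => cos_max (l1 * s)).
  have bb := bound_int csw2 sw2G (@continuous_sin_lin R l1) (fun s => sin_max (l1 * s)).
  have {}bb : `|b l1| <= 8 * pi by rewrite normrN.
  have eE : expR (- (2 * ln l1)) = (l1 ^+ 2)^-1 by rewrite expRN expRM_natl lnK ?posrE.
  rewrite /N eE lnK ?posrE// normrM normfV (ger0_norm (ltW l2)).
  rewrite normrM (ger0_norm (expR_ge0 _)) ler_pdivrMr//.
  have -> : 28 * pi / l1 * l1 ^+ 2 = 28 * pi * l1 by field; rewrite gt_eqF.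
  have p0 := @pi_gt0 R.
  have e1 : expR (- (l1 / 2)) <= 1 by rewrite expR_le1; lra.
  have Zb : `|(2 + l1) * b l1 + l1 / 2 * a l1| <= 28 * pi * l1.
    apply: (le_trans (ler_normD _ _)); rewrite !normrM.
    rewrite [`|2 + l1|]ger0_norm ?addr_ge0 ?(ltW l0)// (ger0_norm (ltW l0)) [`|2^-1|]ger0_norm//.
    by move: ab bb; rewrite -/(a l1); move: (`|a l1|) (`|b l1|) => aa bbb; nra.
  by apply: le_trans Zb; rewrite ler_piMl.
move: t => l l0; have Nl : N (ln l) = 0.
  apply/eqP; rewrite -normr_le0; apply/ler_addgt0Pl => e e0; rewrite addr0.
  pose L := Num.max 1 (28 * pi / e).
  rewrite (is_derive_0_is_cst _ (ln L) dN) (le_trans (ub L _))// ?le_max ?lexx//.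
  have L0 : 0 < L by rewrite lt_max ltr01.
  by rewrite ler_pdivrMr// [e * L]mulrC -ler_pdivrMr// /L le_max lexx orbT.
apply: (mulfI (lt0r_neq0 (expR_gt0 (- (l / 2))))).
apply: (mulIf (lt0r_neq0 (expR_gt0 (- (2 * ln l))))).
by rewrite mulr0 mul0r -Nl /N lnK ?posrE.
Qed.

(** By [ab_rel], exp (l/2) a(l)/(2 + l) is constant on the half line; writing l = x^2 turns this
    into a zero derivative on the whole line. *)
Let a_eq (l : R) : 0 <= l -> a l = 2 * pi * (2 + l) * expR (- (l / 2)).
Proof.
move=> l0; pose H x := expR (x ^+ 2 / 2) * a (x ^+ 2) * (2 + x ^+ 2)^-1.
have dH x : is_derive x (1 : R) H 0.
  have dq := is_derive_sqr x.
  have d1 : is_derive x (1 : R) (fun x : R => x ^+ 2 / 2) x.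
    have -> : (fun x : R => x ^+ 2 / 2) = 2^-1 \*: (fun x : R => x ^+ 2).
      by apply/funext => y; rewrite /= /GRing.scale /=; ring.
    by apply: is_derive_eq; rewrite /GRing.scale /=; field.
  have d2 := @is_derive1_comp R expR (fun x : R => x ^+ 2 / 2) x _ _ (is_derive_expR _) d1.
  have d3 := @is_derive1_comp R a (fun x : R => x ^+ 2) x _ _ (da (x ^+ 2)) dq.
  have d4 : is_derive x (1 : R) (fun x : R => 2 + x ^+ 2) (2 * x).
    have -> : (fun x : R => 2 + x ^+ 2) = cst 2 + (fun x : R => x ^+ 2) by [].
    by apply: is_derive_eq; rewrite add0r.
  have g0 : 0 < 2 + x ^+ 2 by have := sqr_ge0 x; lra.
  have d5 := @is_deriveV R (fun s => 2 + s ^+ 2) x _ 1 (lt0r_neq0 g0) d4.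
  have d6 := is_deriveM (is_deriveM d2 d3) d5.
  apply: (is_derive_eq d6); rewrite !fctE /GRing.scale /=.
  have : (2 + x ^+ 2) * b (x ^+ 2) + x ^+ 2 / 2 * a (x ^+ 2) = 0.
    have [->|x0] := eqVneq x 0; last by apply: ab_rel; rewrite exprn_even_gt0.
    by rewrite expr0n /= bc; lra.
  move: (a _) (b _) (expR _) => A B E.
  move=> h; have -> : B = - (x ^+ 2 / 2 * A / (2 + x ^+ 2)).
    by apply: (mulfI (lt0r_neq0 g0)); rewrite mulrN [_ / (2 + _)]mulrC mulVKf ?lt0r_neq0//; lra.
  by field; rewrite gt_eqF.
have := is_derive_0_is_cst (Num.sqrt l) 0 dH.
rewrite /H sqr_sqrtr// expr0n /= mul0r expR0 a0 addr0 mul1r => h.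
have g0 : 2 + l != 0 by rewrite gt_eqF//; lra.
have e0 := lt0r_neq0 (expR_gt0 (l / 2)).
have -> : a l = (expR (l / 2) * a l * (2 + l)^-1) * ((2 + l) / expR (l / 2)) by field; apply/andP.
by rewrite h expRN; field.
Qed.

(** [a_eq] gives a, [ab_rel] then gives b, and [bc] gives c. The division by l excludes the origin,
    where the value is the total integral. *)
Lemma cauchy_transform (l : R) :
  \int[mu]_s (cos (s * l) * cauchy_w s) = 2 * pi * expR (- (`|l| / 2)).
Proof.
have -> : \int[mu]_s (cos (s * l) * w s) = c `|l|.
  apply: eq_Rintegral => s _; congr (_ * _); rewrite mulrC.
  by case: (ler0P l) => // _; rewrite mulNr cosN.
have [->|l0] := eqVneq l 0.
  rewrite normr0 mul0r oppr0 expR0 mulr1 -int_cauchy_w.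
  by apply: eq_Rintegral => s _; rewrite mul0r cos0 mul1r.
have {}l0 : 0 < `|l| by rewrite normr_gt0.
have := bc `|l|; have := ab_rel l0; have := a_eq (ltW l0).
move: `|l| l0 => x x0 -> h1 h2; apply: (mulfI (lt0r_neq0 x0)).
have h3 : b x = - (x / 2 * (2 * pi * expR (- (x / 2)))).
  have g0 : 2 + x != 0 by rewrite gt_eqF//; lra.
  by apply: (mulfI g0); lra.
by move: h2; rewrite h3; lra.
Qed.

End cauchy_transform.

(** * The parabola kernel, and the sine transform of the Gaussian *)

Section kernels.
Context {R : realType}.
Notation mu := (@lebesgue_measure R).

Lemma sin_le_quintic (x : R) : 0 <= x -> sin x <= x - x ^+ 3 / 6 + x ^+ 5 / 120.
Proof.
move=> x0; suff : 0 <= x - 6^-1 * x ^+ 3 + 120^-1 * x ^+ 5 - sin x by lra.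
apply: (@ge0_of_derive R (fun x => x - 6^-1 * x ^+ 3 + 120^-1 * x ^+ 5 - sin x)
   (fun x => 1 - x ^+ 2 / 2 + x ^+ 4 / 24 - cos x)) x0.
- move=> y; have h : is_derive y (1 : R) (id - (6^-1 \*: (fun x : R => x ^+ 3)) + (120^-1 \*: (fun x : R => x ^+ 5)) - sin)
      (1 - y ^+ 2 / 2 + y ^+ 4 / 24 - cos y).
    by apply: is_derive_eq; rewrite /GRing.scale /=; lra.
  exact: h.
- by move=> y y0; have := cos_le_quartic y; lra.
- by rewrite sin0; lra.
Qed.

(** The convergence to m is given on bounded intervals only, so the Cauchy kernel cannot be tested
    directly. This kernel has bounded support and a transform that is positive at every
    frequency. *)
Definition parabola_transform (l : R) := \int[mu]_(s in `[0, 1]) ((1 - s) ^+ 2 * cos (s * l)).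

Lemma parabola_transformE (l : R) : l != 0 ->
  parabola_transform l = 2 * (l - sin l) / l ^+ 3.
Proof.
move=> l0.
pose F (s : R) := (1 - s) ^+ 2 * sin (s * l) * l^-1 - 2 * (1 - s) * cos (s * l) * l^-2 - 2 * l^-3 * sin (s * l).
pose f (s : R) := (1 - s) ^+ 2 * cos (s * l).
have dF s : is_derive s (1 : R) F (f s).
  have d1 : is_derive s (1 : R) (fun s : R => 1 - s) (- 1).
    have -> : (fun s : R => 1 - s) = cst 1 - id by [].
    by apply: is_derive_eq; rewrite sub0r.
  have dc := is_derive_cos_lin s l; have ds := is_derive_sin_lin s l.
  have d2 := is_deriveM (is_deriveM d1 d1) ds.
  have d3 := is_deriveM d1 dc.
  have d4 := is_deriveZr l^-1 d2; have d5 := is_deriveZr (2 * l^-2) d3.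
  have d6 := is_deriveZr (2 * l^-3) ds.
  have d7 := is_deriveB (is_deriveB d4 d5) d6.
  have -> : F = (fun t => ((fun s : R => 1 - s) * (fun s : R => 1 - s) * (fun s : R => sin (s * l))) t * l^-1) -
     (fun t => ((fun s : R => 1 - s) * (fun s : R => cos (s * l))) t * (2 * l^-2)) -
     (fun t => sin (t * l) * (2 * l^-3)).
    by apply/funext => t; rewrite !fctE /F; ring.
  by apply: (is_derive_eq d7); rewrite !fctE /f /GRing.scale /=; field.
have cf : continuous f.
  move=> s; apply: cvgM.
    apply: cvgM; apply: cvgB; [exact: cvg_cst|exact: cvg_id|exact: cvg_cst|exact: cvg_id].
  by apply: continuous_comp; [exact: mulrr_continuous | exact: continuous_cos].
rewrite /parabola_transform (FTC_is_derive ler01 dF cf) /F !mul0r sin0 cos0 mul1r.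
by field.
Qed.

(** For 0 < |l| <= 2 the fifth-order bound on sine gives |l|^3 <= 16 (|l| - sin |l|); beyond, |l| -
    sin |l| >= |l|/2 and l^2/8 <= exp (|l|/2). The value at 0 is 1/3. *)
Lemma parabola_transform_ge (l : R) : expR (- (`|l| / 2)) / 8 <= parabola_transform l.
Proof.
have -> : parabola_transform l = parabola_transform `|l|.
  apply: eq_Rintegral => s _; congr (_ * _).
  by case: (ler0P l) => // _; rewrite mulrN cosN.
have [->|l0] := eqVneq l 0.
  rewrite normr0 mul0r oppr0 expR0 /parabola_transform.
  have dF (s : R) : is_derive s (1 : R) (fun s : R => - ((1 - s) ^+ 3 / 3)) ((1 - s) ^+ 2).
    have d1 : is_derive s (1 : R) (fun s : R => 1 - s) (- 1).
      have -> : (fun s : R => 1 - s) = cst 1 - id by [].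
      by apply: is_derive_eq; rewrite sub0r.
    have d2 := is_deriveZr (- 3^-1) (is_deriveM (is_deriveM d1 d1) d1).
    have -> : (fun s : R => - ((1 - s) ^+ 3 / 3)) = (fun t => ((fun s : R => 1 - s) * (fun s : R => 1 - s) * (fun s : R => 1 - s)) t * - 3^-1).
      by apply/funext => t; rewrite !fctE; ring.
    by apply: (is_derive_eq d2); rewrite !fctE /GRing.scale /=; field.
  have cf : continuous (fun s : R => (1 - s) ^+ 2).
    by move=> s; apply: cvgM; apply: cvgB; [exact: cvg_cst|exact: cvg_id|exact: cvg_cst|exact: cvg_id].
  have -> : \int[mu]_(s in `[0, 1]) ((1 - s) ^+ 2 * cos (s * 0)) = \int[mu]_(s in `[0, 1]) ((1 - s) ^+ 2).
    by apply: eq_Rintegral => s _; rewrite mulr0 cos0 mulr1.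
  by rewrite (FTC_is_derive ler01 dF cf); lra.
have {}l0 : 0 < `|l| by rewrite normr_gt0.
rewrite parabola_transformE ?lt0r_neq0//.
move: `|l| l0 => x x0.
have e2 : x ^+ 2 / 8 <= expR (x / 2).
  pose z := x / 6; have z0 : 0 <= z by rewrite divr_ge0// ltW.
  have -> : x ^+ 2 / 8 = 9 / 2 * z ^+ 2 by rewrite /z; field.
  have -> : x / 2 = 3%:R * z by rewrite /z; field.
  rewrite expRM_natl; apply: (@le_trans _ _ ((1 + z) ^+ 3)).
    have : 0 <= z * (z - 3 / 4) ^+ 2 by rewrite mulr_ge0 ?sqr_ge0.
    by rewrite !exprS expr0; lra.
  by rewrite lerXn2r ?nnegrE ?expR_ge0 ?expR_ge1Dx// addr_ge0.
have x3 : 0 < x ^+ 3 by rewrite exprn_gt0.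
rewrite ler_pdivlMr// expRN mulrAC ler_pdivrMr// mulrC ler_pdivrMr ?expR_gt0//.
have [x2|x2] := leP x 2.
  have h1 := sin_le_quintic (ltW x0).
  have e1 := expR_ge1Dx (x / 2).
  have e1' : 1 <= expR (x / 2) by lra.
  have h2 : x ^+ 3 <= 2 * (x - sin x) * 8.
    have : x ^+ 5 <= 4 * x ^+ 3.
      have -> : x ^+ 5 = x ^+ 2 * x ^+ 3 by ring.
      by rewrite ler_wpM2r ?(ltW x3)// expr2; nra.
    lra.
  by apply: (le_trans h2); rewrite ler_peMr// (le_trans _ h2)// ltW.
have := sin_le1 x; move: (sin x) e2 => sx e2 sx1.
have h3 : x <= 2 * (x - sx) by lra.
move: (expR _) e2 => E e2.
have -> : x ^+ 3 = (x ^+ 2 / 8) * x * 8 by field.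
have E0 : 0 <= E by apply: le_trans e2; rewrite divr_ge0// sqr_ge0.
have h4 : x ^+ 2 / 8 * x <= E * (2 * (x - sx)).
  by apply: ler_pM => //; rewrite ?divr_ge0 ?sqr_ge0// ltW.
by lra.
Qed.

(** The same equation psi' = - t psi as for the cosine, now with psi(0) = 0. *)
Lemma sin_gauss_charfun (t : R) : \int[mu]_x (sin (t * x) * normal_pdf 0 1 x) = 0.
Proof.
pose p (x : R) := normal_pdf 0 1 x : R.
pose G (x : R) := p x + normal_peak 1 / normal_peak (Num.sqrt 2) * normal_pdf 0 (Num.sqrt 2) x : R.
have iG : mu.-integrable [set: R] (EFin \o G).
  rewrite (_ : EFin \o G = (EFin \o p) \+ (EFin \o (fun x => normal_peak 1 / normal_peak (Num.sqrt 2) * normal_pdf 0 (Num.sqrt 2) x)%R))%E; last first.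
    by apply/funext => x; rewrite /= EFinD.
  by apply: integrableD => //; [exact: integrable_p | exact: integrable_G].
have p0 (x : R) : 0 <= p x by exact: normal_pdf_ge0.
have pG (x : R) : `|p x| <= G x.
  by rewrite ger0_norm// /G lerDl (le_trans _ (xpdf_le x)).
have xpG (x : R) : `|x * p x| <= G x by rewrite (le_trans (xpdf_le x))// /G lerDr.
have cp : continuous p by exact: continuous_p.
pose psi t := \int[mu]_x (sin (t * x) * p x).
have psi' (u : R) : \int[mu]_x (cos (u * x) * (x * p x)) = - u * psi u.
  pose F x := cos (u * x) * p x; pose f x := (- u) * (sin (u * x) * p x) - cos (u * x) * (x * p x).
  have dF x : is_derive x (1 : R) F (f x).
    have d1 : is_derive x (1 : R) (fun x => cos (u * x)) (- sin (u * x) * u).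
      have h := is_derive_cos_lin x u.
      have -> : (fun s => cos (u * s)) = (fun s => cos (s * u)) by apply/funext => z; rewrite [u * z]mulrC.
      by rewrite [u * x]mulrC.
    have d2 : is_derive x (1 : R) p (- x * p x) by exact: is_derive_pdf.
    have -> : F = (fun x => cos (u * x)) * p by [].
    by apply: (is_derive_eq (is_deriveM d1 d2)); rewrite /f /GRing.scale /=; ring.
  have csp : continuous (fun x : R => x * p x) by move=> x; apply: cvgM; [exact: cvg_id | exact: cp].
  have i1 : mu.-integrable [set: R] (EFin \o (fun x => (- u) * (sin (u * x) * p x))).
    rewrite (_ : EFin \o _ = (fun x => (- u)%:E * (sin (u * x) * p x)%:E)%E); last first.
      by apply/funext => x; rewrite /= EFinM.
    by apply: integrableZl => //; exact: integrable_sin_mul cp iG pG.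
  have i2 : mu.-integrable [set: R] (EFin \o (fun x => cos (u * x) * (x * p x))).
    exact: integrable_cos_mul csp iG xpG.
  have fi : mu.-integrable [set: R] (EFin \o f).
    rewrite (_ : EFin \o f = (EFin \o (fun x => (- u) * (sin (u * x) * p x))%R) \- (EFin \o (fun x => cos (u * x) * (x * p x))%R))%E; last first.
      by apply/funext => x; rewrite /= EFinB.
    exact: integrableB.
  have cf : continuous f.
    move=> x; apply: cvgB; apply: cvgM.
    - exact: cvg_cst.
    - by apply: cvgM; [exact: continuous_sin_lin | exact: cp].
    - exact: continuous_cos_lin.
    - exact: csp.
  have z : \int[mu]_x f x = 0.
    have Fb (n : nat) (y : R) : `|y| <= 1 -> `|y * p n%:R| <= 2 * normal_peak 1 / n.+1%:R.
      move=> y1; rewrite normrM (ger0_norm (p0 _)) (le_trans _ (pdf_decay n))// ler_piMl//.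
    apply: (int_derive0 dF cf fi); apply: cvg0_inv_dom => n.
      by apply: Fb; exact: cos_max.
    by rewrite /F /p normal_pdf01E sqrrN -normal_pdf01E; apply: Fb; exact: cos_max.
  have : \int[mu]_x f x = - u * psi u - \int[mu]_x (cos (u * x) * (x * p x)).
    by rewrite /f RintegralB// RintegralZl//; exact: integrable_sin_mul cp iG pG.
  by rewrite z => /eqP; rewrite eq_sym subr_eq0 => /eqP.
pose H t := psi t * expR (t ^+ 2 / 2).
have dH s : is_derive s (1 : R) H 0.
  have dq := is_derive_sqr s.
  have d1 : is_derive s (1 : R) (fun y : R => y ^+ 2 / 2) s.
    by apply: (is_derive_eq (is_deriveZr 2^-1 dq)); field.
  have d2 := @is_derive1_comp R expR (fun y : R => y ^+ 2 / 2) s _ _ (is_derive_expR (s ^+ 2 / 2)) d1.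
  have d3 := is_derive_int_sin s cp iG pG xpG.
  have -> : H = psi * (expR \o (fun y : R => y ^+ 2 / 2)) by [].
  apply: (is_derive_eq (is_deriveM d3 d2)); rewrite /GRing.scale /= psi' -/(psi s); ring.
have h := @is_derive_0_is_cst R H t 0 dH.
have psi0 : psi 0 = 0.
  rewrite /psi (_ : (fun x => sin (0 * x) * p x) = cst 0); last first.
    by apply/funext => x; rewrite mul0r sin0 mul0r.
  by rewrite /Rintegral integral0.
move: h; rewrite /H psi0 mul0r => /eqP; rewrite mulf_eq0 (gt_eqF (expR_gt0 _)) orbF => /eqP.
exact.
Qed.

End kernels.

(** * Trigonometric polynomials through Bernstein approximation *)

Section trigonometric_approximation.
Context {R : realType}.
Implicit Types (g h : R -> R) (phi : nat -> R).

(** Heine's theorem: a sequence of counterexamples at distance 1/(n + 1) would have a convergent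
    subsequence, contradicting continuity at its limit. *)
Lemma unif_continuous_unit g (e : R) : continuous g -> 0 < e ->
  exists2 eta : R, 0 < eta & forall u v : R, 0 <= u <= 1 -> 0 <= v <= 1 -> `|u - v| <= eta ->
    `|g u - g v| <= e.
Proof.
move=> cg e0; apply: contrapT => H.
have h' (n : nat) : exists uv : R * R, [/\ 0 <= uv.1 <= 1, 0 <= uv.2 <= 1,
    `|uv.1 - uv.2| <= n.+1%:R^-1 & e < `|g uv.1 - g uv.2|].
  apply: contrapT => H2; apply: H; exists n.+1%:R^-1 => // u v u1 v1 uv.
  by rewrite leNgt; apply/negP => guv; apply: H2; exists (u, v).
have [uv uvP] := choice h'.
have bnd : bounded_fun (fun n => (uv n).1).
  exists 1; split; first exact: num_real.
  move=> x x1 n _ /=; have [/andP[a0 a1] _ _ _] := uvP n.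
  by rewrite ger0_norm// (le_trans a1)// ltW.
have [f fi fc] := bolzano_weierstrass bnd.
pose l := limn ((fun n => (uv n).1) \o f).
have fn (n : nat) : (n <= f n)%N.
  elim: n => // n IH; apply: (leq_ltn_trans IH).
  have := fi n.+1 n; rewrite ltnn => h; rewrite ltnNge; apply/negP => hh.
  by move: h; rewrite [(_ <= _)%O]hh.
have u1 : (fun n => (uv (f n)).1) @ \oo --> l by exact: fc.
have u2 : (fun n => (uv (f n)).2) @ \oo --> l.
  apply/cvgrPdist_le => eps eps0; have /cvgrPdist_le/(_ (eps / 2)) := u1.
  have e2 : 0 < eps / 2 by rewrite divr_gt0.
  move=> /(_ e2) [N _ HN]; exists (maxn N (truncn (2 / eps)).+1) => // n /=.
  rewrite geq_max => /andP[Nn en].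
  have [_ _ d _] := uvP (f n); have := HN n Nn; rewrite /=.
  have d2 : (f n).+1%:R^-1 <= eps / 2.
    rewrite -[eps / 2]invrK lef_pV2 ?posrE ?ltr0n ?invr_gt0// invf_div.
    rewrite ltW// (lt_le_trans (truncnS_gt _))// ler_nat (leq_trans en)// (leq_trans (fn n))//.
  move=> d3; have -> : l - (uv (f n)).2 = (l - (uv (f n)).1) + ((uv (f n)).1 - (uv (f n)).2) by ring.
  apply: (le_trans (ler_normD _ _)).
  have -> : eps = eps / 2 + eps / 2 by field.
  by apply: lerD => //; exact: le_trans d2.
have g1 : (fun n => g (uv (f n)).1) @ \oo --> g l by apply: cvg_comp u1 (cg l).
have g2 : (fun n => g (uv (f n)).2) @ \oo --> g l by apply: cvg_comp u2 (cg l).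
have : (fun n => `|g (uv (f n)).1 - g (uv (f n)).2|) @ \oo --> `|g l - g l|.
  by apply: cvg_norm; apply: cvgB.
rewrite subrr normr0 => /cvgrPdist_lt/(_ e e0) [N _ HN].
have := HN N (leqnn N) => /=; rewrite sub0r normrN normr_id.
by have [_ _ _ d] := uvP (f N); rewrite ltNge ltW.
Qed.

(* de Casteljau's recursion for the Bernstein polynomials. *)
Fixpoint bern (y : R) (n : nat) phi : R :=
  if n is n'.+1 then (1 - y) * bern y n' phi + y * bern y n' (fun k => phi k.+1) else phi 0%N.

Lemma bern_le (y : R) n phi psi : 0 <= y <= 1 -> (forall k, (k <= n)%N -> phi k <= psi k) ->
  bern y n phi <= bern y n psi.
Proof.
move=> /andP[y0 y1]; elim: n phi psi => [|n IH] phi psi h /=; first exact: h.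
apply: lerD; apply: ler_wpM2l => //; rewrite ?subr_ge0//; apply: IH => k kn; apply: h => //.
exact: leq_trans kn (leqnSn n).
Qed.

Lemma bern_affine (y : R) n phi (a b : R) : bern y n (fun k => a * phi k + b) = a * bern y n phi + b.
Proof. by elim: n phi => [|n IH] phi //=; rewrite (IH phi) (IH (fun k => phi k.+1)); ring. Qed.

(** The second moment of the binomial law about a: squared bias of the mean n y plus the variance n
    y (1 - y). *)
Lemma bern_var (y : R) n (a : R) :
  bern y n (fun k => (k%:R - a) ^+ 2) = (n%:R * y - a) ^+ 2 + n%:R * y * (1 - y).
Proof.
elim: n a => [|n IH] a /=; first by rewrite !mul0r addr0.
rewrite IH (_ : (fun k => (k.+1%:R - a) ^+ 2) = (fun k => (k%:R - (a - 1)) ^+ 2)).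
  by rewrite IH -natr1; ring.
by apply/funext => k; rewrite -natr1; congr (_ ^+ 2); ring.
Qed.

Lemma bern_bound (y M : R) n phi : 0 <= y <= 1 -> (forall k, `|phi k| <= M) -> `|bern y n phi| <= M.
Proof.
move=> y01 h; have cst (c : R) : bern y n (fun=> c) = c.
  by elim: n {h} => //= n ->; ring.
rewrite ler_norml -{1}(cst (- M)) -{2}(cst M); apply/andP; split; apply: bern_le => // k _.
  by have := h k; rewrite ler_norml => /andP[].
by have := h k; rewrite ler_norml => /andP[].
Qed.

(** Bernstein's proof: g(k/n) is within e/2 of g(y) when k/n is close to y, and otherwise within 2 M
    times (k/n - y)^2/eta^2, whose binomial mean is O(1/n). *)
Lemma bern_approx g (M e : R) : continuous g -> (forall x : R, `|g x| <= M) -> 0 < e ->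
  exists n, forall y : R, 0 <= y <= 1 -> `|bern y n.+1 (fun k => g (k%:R / n.+1%:R)) - g y| <= e.
Proof.
move=> cg gM e0; have e2 : 0 < e / 2 by rewrite divr_gt0.
have [eta eta0 H] := unif_continuous_unit cg e2.
have M0 : 0 <= M by apply: le_trans (gM 0).
have eta2 : 0 < eta ^+ 2 by rewrite exprn_gt0.
pose C := 2 * M / eta ^+ 2.
have C0 : 0 <= C by exact: divr_ge0 (mulr_ge0 (ler0n R 2) M0) (ltW eta2).
pose n := truncn (C / (e / 2)); exists n => y y01.
have n0 : 0 < n.+1%:R :> R by rewrite ltr0n.
have key k : (k <= n.+1)%N -> `|g (k%:R / n.+1%:R) - g y| <= C / n.+1%:R ^+ 2 * (k%:R - n.+1%:R * y) ^+ 2 + e / 2.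
  move=> kn; pose u : R := k%:R / n.+1%:R.
  have u01 : 0 <= u <= 1.
    by rewrite divr_ge0 ?ler0n//= ler_pdivrMr// mul1r ler_nat.
  have -> : C / n.+1%:R ^+ 2 * (k%:R - n.+1%:R * y) ^+ 2 = C * (u - y) ^+ 2.
    by rewrite /u; field; rewrite gt_eqF.
  have [d|d] := leP `|u - y| eta.
    by rewrite (le_trans (H _ _ u01 y01 d))// lerDr mulr_ge0 ?sqr_ge0.
  have h2 : 1 <= (u - y) ^+ 2 / eta ^+ 2.
    rewrite ler_pdivlMr// mul1r -[leRHS]real_normK ?num_real//.
    by rewrite lerXn2r ?nnegrE// ltW.
  have h3 : `|g u - g y| <= 2 * M.
    by rewrite (le_trans (ler_normB _ _))// -[2]/(1 + 1) mulrDl mul1r lerD.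
  apply: (le_trans h3); have -> : C * (u - y) ^+ 2 = 2 * M * ((u - y) ^+ 2 / eta ^+ 2).
    by rewrite /C; field; rewrite gt_eqF.
  by have := ler_wpM2l (mulr_ge0 (ler0n R 2) M0) h2; lra.
have var : bern y n.+1 (fun k => C / n.+1%:R ^+ 2 * (k%:R - n.+1%:R * y) ^+ 2 + e / 2) <= e.
  rewrite (bern_affine y n.+1 (fun k => (k%:R - n.+1%:R * y) ^+ 2)) bern_var subrr expr0n /= add0r.
  have -> : C / n.+1%:R ^+ 2 * (n.+1%:R * y * (1 - y)) = C / n.+1%:R * (y * (1 - y)).
    by field; rewrite gt_eqF.
  have h1 : C / n.+1%:R <= e / 2.
    rewrite ler_pdivrMr// mulrC -ler_pdivrMr// ltW// truncnS_gt//.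
  have h2 : y * (1 - y) <= 1 by move/andP: y01 => [y0 y1]; nra.
  have h3 : C / n.+1%:R * (y * (1 - y)) <= e / 2.
    by apply: le_trans h1; rewrite ler_piMr// divr_ge0.
  by rewrite -lerBrDr (le_trans h3)//; lra.
have -> : bern y n.+1 (fun k => g (k%:R / n.+1%:R)) - g y =
   bern y n.+1 (fun k => g (k%:R / n.+1%:R) - g y).
  have := bern_affine y n.+1 (fun k => g (k%:R / n.+1%:R)) 1 (- g y); rewrite mul1r => <-.
  by congr (bern y _ _); apply/funext => k; rewrite mul1r.
rewrite ler_norml; apply/andP; split; last first.
  by apply: le_trans var; apply: bern_le => // k kn; rewrite (le_trans (ler_norm _))// key.
rewrite lerNl; apply: le_trans var.
have -> : - bern y n.+1 (fun k => g (k%:R / n.+1%:R) - g y) =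
  bern y n.+1 (fun k => - 1 * (g (k%:R / n.+1%:R) - g y) + 0).
  by rewrite bern_affine; ring.
by apply: bern_le => // k kn; rewrite addr0 mulN1r (le_trans (ler_norm _))// normrN key.
Qed.

(** A triple is an amplitude, a frequency and a phase; free phases make sines and constants
    instances of cosines. *)
Definition trigp (f : R -> R) := exists s : seq (R * R * R),
  forall x, f x = \sum_(i <- s) i.1.1 * cos (i.1.2 * x + i.2).

Lemma trigp_cst (c : R) : trigp (fun=> c).
Proof. by exists [:: (c, 0, 0)] => x; rewrite big_seq1 /= mul0r addr0 cos0 mulr1. Qed.

Lemma trigpD f g : trigp f -> trigp g -> trigp (fun x => f x + g x).
Proof. by move=> [s sE] [t tE]; exists (s ++ t) => x; rewrite big_cat /= sE tE. Qed.

Lemma trigpZ (c : R) f : trigp f -> trigp (fun x => c * f x).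
Proof.
move=> [s sE]; exists [seq (c * i.1.1, i.1.2, i.2) | i <- s] => x.
by rewrite big_map sE mulr_sumr; apply: eq_bigr => i _ /=; rewrite mulrA.
Qed.

Lemma trigp_mulcos (a b : R) f : trigp f -> trigp (fun x => cos (a * x + b) * f x).
Proof.
move=> [s sE]; exists ([seq (i.1.1 / 2, i.1.2 + a, i.2 + b) | i <- s] ++ [seq (i.1.1 / 2, i.1.2 - a, i.2 - b) | i <- s]) => x.
rewrite big_cat !big_map sE mulr_sumr /= -big_split /=; apply: eq_bigr => i _.
have -> : (i.1.2 + a) * x + (i.2 + b) = (i.1.2 * x + i.2) + (a * x + b) by ring.
have -> : (i.1.2 - a) * x + (i.2 - b) = (i.1.2 * x + i.2) - (a * x + b) by ring.
rewrite [cos (_ + (a * x + b))]cosD [cos (_ - _)]cosB.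
by move: i.1.1 (cos _) (cos _) (sin _) (sin _) => p q r u v; field.
Qed.

Lemma trigp_bern (a : R) n phi : trigp (fun x => bern ((1 + sin (a * x)) / 2) n phi).
Proof.
elim: n phi => [|n IH] phi /=; first exact: trigp_cst.
have E f : trigp f -> trigp (fun x => sin (a * x) * f x).
  move=> tf; have := trigp_mulcos a (- (pi / 2)) tf; congr (trigp _); apply/funext => x.
  by rewrite cosB cos_pihalf sin_pihalf mulr0 mulr1 add0r.
pose p1 x := bern ((1 + sin (a * x)) / 2) n phi.
pose p2 x := bern ((1 + sin (a * x)) / 2) n (fun k => phi k.+1).
have -> : (fun x => (1 - (1 + sin (a * x)) / 2) * bern ((1 + sin (a * x)) / 2) n phi +
     (1 + sin (a * x)) / 2 * bern ((1 + sin (a * x)) / 2) n (fun k => phi k.+1)) =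
  (fun x => (2^-1 * p1 x + (- 2^-1) * (sin (a * x) * p1 x)) + (2^-1 * p2 x + 2^-1 * (sin (a * x) * p2 x))).
  by apply/funext => x; rewrite /p1 /p2; field.
apply: trigpD; apply: trigpD; apply: trigpZ; try apply: E; exact: IH.
Qed.

(** On [-L, L], h is a continuous function of y = (1 + sin (a x))/2, and polynomials in y are
    trigonometric in x. Bernstein polynomials are averages, so the bound M persists on the whole
    line and values beyond L stay harmless. *)
Lemma trigp_approx h (M L e : R) : continuous h -> (forall x : R, `|h x| <= M) -> 0 < L -> 0 < e ->
  exists T, [/\ trigp T, forall x : R, `|T x| <= M & forall x : R, `|x| <= L -> `|h x - T x| <= e].
Proof.
(* Then |a x| <= 1/2 for |x| <= L: sine is injective there and |sin (a x)| <= 1/2 is not touched by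
   the clamp at 3/4, whose purpose is to keep [asin] away from the ends of its domain. *)
move=> ch hM L0 e0; pose a := (2 * L)^-1.
have a0 : 0 < a by rewrite invr_gt0 mulr_gt0.
pose clamp (v : R) := Num.max (- (3 / 4)) (Num.min (3 / 4) (2 * v - 1)).
have cl v : -1 < clamp v < 1.
  rewrite /clamp lt_max gt_max lt_min gt_min.
  by apply/and3P; split; try (apply/orP; left); lra.
have ccl : continuous clamp.
  move=> v; refine (@continuous_max R R (cst (- (3 / 4))) (fun v => Num.min (3 / 4) (2 * v - 1)) v _ _).
    exact: cvg_cst.
  refine (@continuous_min R R (cst (3 / 4)) (fun v => 2 * v - 1) v _ _); first exact: cvg_cst.
  by apply: cvgB; [exact: mulrl_continuous | exact: cvg_cst].
pose g v := h (asin (clamp v) / a).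
have cg : continuous g.
  move=> v; apply: (@continuous_comp _ _ _ (fun v => asin (clamp v) / a) h); last exact: ch.
  apply: cvgM; last exact: cvg_cst.
  by apply: (@continuous_comp _ _ _ clamp asin); [exact: ccl | exact: continuous_asin].
have gM v : `|g v| <= M by exact: hM.
have [n Hn] := bern_approx cg gM e0.
pose y x := (1 + sin (a * x)) / 2.
have y01 x : 0 <= y x <= 1.
  by have := sin_max (a * x); rewrite ler_norml => /andP[h1 h2]; apply/andP; rewrite /y; lra.
exists (fun x => bern (y x) n.+1 (fun k => g (k%:R / n.+1%:R))); split.
- exact: trigp_bern.
- by move=> x; apply: bern_bound.
move=> x xL; rewrite distrC; have -> : h x = g (y x); last exact: Hn.
have ax : `|a * x| <= 2^-1.
  rewrite normrM (gtr0_norm a0) /a mulrC ler_pdivrMr ?mulr_gt0//; lra.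
have sx : `|sin (a * x)| <= 2^-1.
  apply: le_trans (ax); wlog x0 : x xL ax / 0 <= a * x.
    move=> W; have [|/ltW x0] := leP 0 (a * x); first exact: W.
    by have := W (- x); rewrite normrN mulrN sinN !normrN oppr_ge0; exact.
  rewrite (ger0_norm x0) ler_norml; apply/andP; split.
    have h3 := sin_ge_cubic x0; apply: le_trans h3.
    have ax2 : a * x <= 2^-1 by rewrite -(ger0_norm x0).
    move: (a * x) x0 ax2 => v v0 v2.
    have -> : v ^+ 3 = v * (v * v) by ring.
    have h1 : 0 <= v * v <= 1 by apply/andP; nra.
    by move/andP: h1 => [h1 h2]; have := ler_wpM2l v0 h2; lra.
  exact: sin_le_id.
rewrite /g /y /clamp; have -> : 2 * ((1 + sin (a * x)) / 2) - 1 = sin (a * x) by field.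
move: ax sx; rewrite !ler_norml => /andP[ax1 ax2] /andP[sx1 sx2].
rewrite min_r; last lra. rewrite max_r; last lra.
rewrite sinK; first by rewrite mulrAC mulfV ?mul1r// gt_eqF.
by have := @pi_ge2 R; rewrite in_itv /=; lra.
Qed.

End trigonometric_approximation.

(** * From hypotheses (a) and (b) to the estimates used above *)

Section arithmetic_input.
Context {R : realType}.
Implicit Types (f g : nat -> R).

Lemma sum_prE N (F : nat -> R) : \sum_(p <- pr N) F p = \sum_(p < N | prime p) F p.
Proof.
elim: N => [|N IH] /=; first by rewrite big_nil big_ord0.
by rewrite [RHS]big_mkcond big_ord_recr -big_mkcond /= -IH; case: ifP => _; rewrite ?big_cons ?addr0// addrC.
Qed.

Lemma prod_prE N (F : nat -> R) : \prod_(p <- pr N) F p = \prod_(p < N | prime p) F p.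
Proof.
elim: N => [|N IH] /=; first by rewrite big_nil big_ord0.
by rewrite [RHS]big_mkcond big_ord_recr -big_mkcond /= -IH; case: ifP => _; rewrite ?big_cons ?mulr1// mulrC.
Qed.

Lemma psi_prE g n : psi g (pr n.+1) n = \sum_(p <- pr n.+1) g p * ln p%:R.
Proof. by rewrite /psi sum_pr_le. Qed.

Lemma classP_nat g theta : (forall eps : R, 0 < eps ->
     \forall t \near +oo%R, `|classP_err g theta t| <= eps * `|t / ln t|) ->
  forall e : R, 0 < e -> exists N : nat, forall n : nat, (N <= n)%N ->
  `|\sum_(p <- pr n.+1) g p - theta * (n%:R / ln n%:R)| <= e * (n%:R / ln n%:R).
Proof.
move=> H e e0; have [A [_ hA]] := H e e0.
exists (maxn 2 (truncn `|A|).+1) => n; rewrite geq_max => /andP[n2 nA].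
have An : A < n%:R.
  by rewrite (le_lt_trans (ler_norm A))// (lt_le_trans (truncnS_gt _))// ler_nat.
have l0 : 0 <= ln n%:R :> R by rewrite ln_ge0// ler1n (leq_trans _ n2).
have := hA _ An; rewrite /classP_err /prime_sum natrK -sum_prE.
by rewrite [`|n%:R / _|]ger0_norm// divr_ge0.
Qed.

(** Above, ln p <= ln n. Below, only primes in (n/k, n] are kept, where ln p >= ln n - ln (2 k); for
    large n this difference costs at most 2 e1 n, and so do the discarded primes, as 1/k <= e1. *)
Lemma chebyshev_psi g theta : (forall p, 0 <= g p) -> 0 < theta <= 1 ->
  (forall eps : R, 0 < eps ->
     \forall t \near +oo%R, `|classP_err g theta t| <= eps * `|t / ln t|) ->
  forall e : R, 0 < e -> exists C : R, forall n,
  `|psi g (pr n.+1) n - theta * n%:R| <= e * n%:R + C.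
Proof.
move=> g0 /andP[th0 th1] H e e0; pose e1 := Num.min 1 (e / 6).
have e10 : 0 < e1 by rewrite lt_min ltr01 divr_gt0.
have e11 : e1 <= 1 by rewrite ge_min lexx.
have e1e : 6 * e1 <= e by rewrite -ler_pdivlMl// mulrC ge_min lexx orbT.
have [N HN] := classP_nat H e10.
pose k := (truncn (e1^-1)).+1; have k0 : (0 < k)%N by [].
have k1 : k%:R^-1 <= e1 by rewrite invf_ple ?posrE// ltW// truncnS_gt.
pose D : R := ln (2 * k)%:R; have D0 : 0 <= D by rewrite ln_ge0// ler1n muln_gt0 k0.
pose L := (truncn (expR (D / e1))).+1.
pose N1 := maxn (maxn 2 (k * N.+2)) L.
pose psi' n := psi g (pr n.+1) n - theta * n%:R.
suff big n : (N1 <= n)%N -> `|psi' n| <= e * n%:R.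
  exists (\sum_(j < N1) `|psi' j|) => n.
  have S0 : 0 <= \sum_(j < N1) `|psi' j| by apply: sumr_ge0.
  have [nN|nN] := leqP N1 n; first by rewrite (le_trans (big _ nN))// lerDl.
  have h1 : 0 <= e * n%:R by exact: mulr_ge0 (ltW e0) (ler0n R n).
  have h2 : `|psi' n| <= \sum_(j < N1) `|psi' j|.
    by rewrite (bigD1 (Ordinal nN))//= lerDl sumr_ge0.
  by rewrite (le_trans h2)// lerDr.
move=> nN1; rewrite /psi' psi_prE.
have [n2 nkN nL] : [/\ (2 <= n)%N, (k * N.+2 <= n)%N & (L <= n)%N].
  by move: nN1; rewrite !geq_max => /andP[/andP[]].
have nN : (N <= n)%N by apply: leq_trans nkN; rewrite (leq_trans (leqnSn _))// (leq_trans (leqnSn _))// leq_pmull.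
have n1 : 1 < n%:R :> R by rewrite ltr1n.
have ln0 : 0 < ln n%:R :> R by rewrite ln_gt0.
have n0 : 0 < n%:R :> R by lra.
have := HN n nN; set P := \sum_(p <- pr n.+1) g p; set q := n%:R / ln n%:R => hP.
have q0 : 0 <= q by rewrite divr_ge0 ?ltW.
have lnq : ln n%:R * q = n%:R by rewrite /q mulrCA mulfV ?mulr1 ?gt_eqF.
have DL : D * q <= e1 * n%:R.
  have : D <= e1 * ln n%:R.
    rewrite -ler_pdivrMl// mulrC -[leLHS]expRK ler_ln ?posrE ?expR_gt0//.
    by rewrite ltW// (lt_le_trans (truncnS_gt _))// ler_nat.
  by move=> h; have := ler_wpM2r q0 h; rewrite -mulrA lnq.
move: hP; rewrite ler_norml => /andP[hP1 hP2].
rewrite ler_norml; apply/andP; split; last first.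
  have h1 : \sum_(p <- pr n.+1) g p * ln p%:R <= P * ln n%:R.
    rewrite /P mulr_suml big_seq [leRHS]big_seq; apply: ler_sum => p.
    rewrite mem_pr ltnS => /andP[pp pn]; rewrite ler_wpM2l// ler_ln ?posrE ?ler_nat//.
    by rewrite ltr0n prime_gt0.
  have h2 : P * ln n%:R <= (theta + e1) * n%:R.
    have h : P <= (theta + e1) * q by lra.
    by have := ler_wpM2r (ltW ln0) h; rewrite -mulrA [q * _]mulrC lnq.
  by have := ler_wpM2r (ltW n0) e1e; have := mulr_ge0 (ltW e10) (ltW n0); lra.
pose m := (n %/ k)%N.
have mN : (N.+2 <= m)%N by rewrite leq_divRL// mulnC.
have m2 : (2 <= m)%N by apply: leq_trans mN.
have mn : (m <= n)%N by exact: leq_div.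
have m1 : 1 < m%:R :> R by rewrite ltr1n.
have lm0 : 0 < ln m%:R :> R by rewrite ln_gt0.
have mk : m%:R <= n%:R * e1.
  apply: (@le_trans _ _ (n%:R * k%:R^-1)); last by rewrite ler_wpM2l// ltW.
  by rewrite ler_pdivlMr ?ltr0n// -natrM ler_nat leq_trunc_div.
have lmn : ln n%:R - D <= ln m%:R.
  rewrite lerBlDr -lnM ?posrE ?ltr0n ?muln_gt0 ?(leq_trans _ m2)//.
  rewrite ler_ln ?posrE// ?mulr_gt0 ?ltr0n ?muln_gt0 ?(leq_trans _ m2)//.
  rewrite -natrM ler_nat.
  apply: leq_trans (ltnW (ltn_ceil n k0)) _; rewrite -/m mulnA leq_mul2r; apply/orP; right.
  by rewrite muln2 -addnn -addn1 leq_add2l ltnW.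
have mN' : (N <= m)%N by apply: leq_trans mN; rewrite (leq_trans (leqnSn _)).
have := HN m mN'; set Pm := \sum_(p <- pr m.+1) g p => hPm.
have hPm2 : Pm * ln m%:R <= (theta + e1) * m%:R.
  have h : Pm <= (theta + e1) * (m%:R / ln m%:R) by move: hPm; rewrite ler_norml => /andP[_]; lra.
  have := ler_wpM2r (ltW lm0) h; rewrite -mulrA mulfVK ?gt_eqF//.
have h1 : (P - Pm) * ln m%:R <= \sum_(p <- pr n.+1) g p * ln p%:R.
  have E : Pm = \sum_(p <- pr n.+1) (if (p <= m)%N then g p else 0).
    by rewrite -big_mkcond sum_pr_le.
  rewrite E /P -sumrB mulr_suml big_seq [leRHS]big_seq; apply: ler_sum => p.
  rewrite mem_pr => /andP[pp _]; have lp : 0 <= ln p%:R :> R by rewrite ln_ge0// ler1n prime_gt0.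
  case: leqP => pm; first by rewrite subrr mul0r mulr_ge0.
  rewrite subr0 ler_wpM2l// ler_ln ?posrE; last by rewrite ltr0n prime_gt0.
    by rewrite ler_nat ltnW.
  by rewrite ltr0n (leq_trans _ m2).
have P0 : 0 <= P by apply: sumr_ge0.
have h2 : P * ln n%:R - P * D <= P * ln m%:R by rewrite -mulrBr ler_wpM2l.
have h3 : (theta - e1) * n%:R <= P * ln n%:R.
  have h : (theta - e1) * q <= P by lra.
  by have := ler_wpM2r (ltW ln0) h; rewrite -mulrA [q * _]mulrC lnq.
have h4 : P * D <= 2 * (e1 * n%:R).
  have h : P <= 2 * q by have := ler_wpM2r q0 th1; have := ler_wpM2r q0 e11; lra.
  by have := ler_wpM2r D0 h; lra.
have h5 : (theta + e1) * m%:R <= 2 * (n%:R * e1).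
  apply: ler_pM => //; rewrite ?ler0n//; lra.
have := ler_wpM2r (ltW n0) e1e; have := mulr_ge0 (ltW e10) (ltW n0); lra.
Qed.

(** With x = |f(p)|/sqrt p, hypothesis (b) sums x^3 p^c. Each single term is at most K1, so x <= 1 +
    K1 and x^4 p^c <= (1 + K1) x^3 p^c. *)
Lemma fourth_moment f (c K1 : R) : 0 < c ->
  (forall N, \sum_(p <- pr N) `|f p| ^+ 3 / (p%:R `^ (3 / 2 - c)) <= K1) ->
  (forall p, prime p -> (`|f p| / Num.sqrt p%:R) ^+ 3 * expR (c * ln p%:R) <= K1) /\
  forall N, \sum_(p <- pr N) f p ^+ 4 / p%:R ^+ 2 * expR (c * ln p%:R) <= (1 + K1) * K1.
Proof.
move=> c0 H.
have term p : prime p -> `|f p| ^+ 3 / (p%:R `^ (3 / 2 - c)) =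
    (`|f p| / Num.sqrt p%:R) ^+ 3 * expR (c * ln p%:R).
  move=> pp; have p0 : 0 < p%:R :> R by rewrite ltr0n prime_gt0.
  have -> : p%:R `^ (3 / 2 - c) = Num.sqrt p%:R ^+ 3 / expR (c * ln p%:R).
    rewrite -powR12_sqrt ?ltW// /powR !gt_eqF// -expRM_natl -expRN -expRD; congr expR; by field.
  by rewrite expr_div_n invf_div mulrA mulrAC.
have tb p : prime p -> (`|f p| / Num.sqrt p%:R) ^+ 3 * expR (c * ln p%:R) <= K1.
  move=> pp; apply: le_trans (H p.+1); rewrite /= pp big_cons term// lerDl.
  by apply: sumr_ge0 => q _; rewrite divr_ge0 ?exprn_ge0 ?powR_ge0.
split=> // N.
have K10 : 0 <= K1 by have := H 0%N; rewrite big_nil.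
apply: (@le_trans _ _ (\sum_(p <- pr N) (1 + K1) * (`|f p| ^+ 3 / (p%:R `^ (3 / 2 - c))))); last first.
  by rewrite -mulr_sumr ler_wpM2l ?addr_ge0.
rewrite big_seq [leRHS]big_seq; apply: ler_sum => p /pr_prime pp.
have p0 : 0 < p%:R :> R by rewrite ltr0n prime_gt0.
have := tb p pp; rewrite term//.
have E1 : 1 <= expR (c * ln p%:R).
  have l0 : 0 <= ln p%:R :> R by rewrite ln_ge0// ler1n prime_gt0.
  by have := expR_ge1Dx (c * ln p%:R); have := mulr_ge0 (ltW c0) l0; lra.
have -> : f p ^+ 4 / p%:R ^+ 2 = (`|f p| / Num.sqrt p%:R) ^+ 4.
  have s4 : Num.sqrt p%:R ^+ 4 = p%:R ^+ 2 :> R by rewrite (exprM _ 2 2) sqr_sqrtr// ltW.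
  have f4 : `|f p| ^+ 4 = f p ^+ 4 by rewrite (exprM _ 2 2) real_normK ?num_real// -exprM.
  by rewrite expr_div_n s4 f4.
have : 0 <= `|f p| / Num.sqrt p%:R by rewrite divr_ge0 ?sqrtr_ge0.
move: (_ / Num.sqrt _) (expR _) E1 => x E E1 x0 xE.
have x3 : 0 <= x ^+ 3 by rewrite exprn_ge0.
have xK : x <= 1 + K1.
  have [x1|x1] := leP x 1; first by lra.
  have : x <= x ^+ 3 by rewrite exprS ler_peMr// expr2 mulr_ege1// ltW.
  have : x ^+ 3 <= x ^+ 3 * E by rewrite ler_peMr.
  lra.
by rewrite exprS -mulrA ler_wpM2r// mulr_ge0// (le_trans ler01).
Qed.

Lemma series_pr_bound (u : nat -> R) : (forall p, 0 <= u p) ->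
  cvgn (series (fun p => if prime p then u p else 0)) ->
  exists K1, forall N, \sum_(p <- pr N) u p <= K1.
Proof.
move=> u0 cv; pose v p := if prime p then u p else 0.
exists (limn (series v)) => N; rewrite sum_prE big_mkcond /=.
have -> : \sum_(i < N) (if prime i then u i else 0) = series v N by rewrite seriesEord.
apply: nondecreasing_cvgn_le => //; apply/nondecreasing_seqP => n.
by rewrite seriesSr lerDl /v; case: ifP.
Qed.

End arithmetic_input.

(** * Squarefree integers as sets of primes *)

Section squarefree_sums.
Context {R : realType}.
Implicit Types (f h x : nat -> R) (A K s : seq nat).

Lemma subs_uniq s : uniq s -> uniq (subs s).
Proof.
elim: s => //= p s IH /andP[ps us]; rewrite cat_uniq IH// map_inj_uniq ?IH// => [|a b []//].
rewrite andbT; apply/hasPn => A /mapP[B _ ->]; rewrite mem_subs.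
by apply/negP => /mem_subseq/(_ p); rewrite mem_head => /(_ isT); rewrite (negbTE ps).
Qed.

Lemma subs_filter_eq s A : uniq s -> A \in subs s -> A = [seq p <- s | p \in A].
Proof. by move=> us; rewrite mem_subs => /(subseq_uniqP us). Qed.

Lemma filter_subs s (a : pred nat) : [seq p <- s | a p] \in subs s.
Proof. by rewrite mem_subs filter_subseq. Qed.

Lemma subs_uniq_mem s A : uniq s -> A \in subs s -> uniq A.
Proof. by move=> us; rewrite mem_subs => /subseq_uniq; apply. Qed.

Lemma dvdn_nn N A p : A \in subs (pr N) -> prime p -> (p %| nn A)%N = (p \in A).
Proof.
move=> AN pp; have pA q : q \in A -> prime q by move/(subs_sub AN)/pr_prime.
elim: A pA {AN} => [|q A IH] pA.
  by rewrite nn_nil in_nil dvdn1; apply/eqP => p1; rewrite p1 in pp.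
rewrite nn_cons Euclid_dvdM// IH => [|r rA]; last by apply: pA; rewrite inE rA orbT.
by rewrite inE dvdn_prime2// pA// mem_head.
Qed.

Lemma nn_inj N : {in subs (pr N) &, injective nn}.
Proof.
move=> A B AN BN AB; rewrite (subs_filter_eq (pr_uniq N) AN) (subs_filter_eq (pr_uniq N) BN).
by apply: eq_in_filter => p /pr_prime pp; rewrite -(dvdn_nn AN pp) -(dvdn_nn BN pp) AB.
Qed.

Lemma primes_nn N A : A \in subs (pr N) -> perm_eq (primes (nn A)) A.
Proof.
move=> AN; apply: uniq_perm; [exact: primes_uniq | exact: subs_uniq_mem (pr_uniq N) AN |] => p.
rewrite mem_primes; have [pp|pp] := boolP (prime p); last first.
  by apply/esym/negP => /(subs_sub AN)/pr_prime; rewrite (negbTE pp).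
by rewrite (dvdn_nn AN pp) (nn_gt0 (s := pr N))// => q /pr_prime.
Qed.

Lemma squarefree_nn N A : A \in subs (pr N) -> squarefree (nn A).
Proof.
move=> AN; have pA q : q \in A -> prime q by move/(subs_sub AN)/pr_prime.
have n0 : (0 < nn A)%N by apply: (nn_gt0 (s := pr N)) AN => q /pr_prime.
rewrite /squarefree n0 /=; apply/allP => p; rewrite mem_primes => /and3P[pp _ pn].
have pinA : p \in A by rewrite -(dvdn_nn AN pp).
have uA := subs_uniq_mem (pr_uniq N) AN.
rewrite /nn (perm_big _ (perm_to_rem pinA)) big_cons lognM ?(prime_gt0 pp)//; last first.
  by move: n0; rewrite /nn (perm_big _ (perm_to_rem pinA)) big_cons muln_gt0 => /andP[].
have RN : rem p A \in subs (pr N).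
  by rewrite mem_subs (subseq_trans (rem_subseq p A))// -mem_subs.
rewrite (logn_prime _ pp) eqxx /= -/(nn (rem p A)) -[X in _ == X]addn0 eqn_add2l.
rewrite -leqn0 leqNgt logn_gt0 mem_primes pp (dvdn_nn RN pp) mem_rem_uniq// inE eqxx.
by rewrite !andbF.
Qed.

Lemma nn_filter n m : squarefree m -> (m <= n)%N -> nn [seq p <- pr n.+1 | (p %| m)%N] = m.
Proof.
move=> /andP[m0 /allP sf] mn.
have pe : perm_eq [seq p <- pr n.+1 | (p %| m)%N] (primes m).
  apply: uniq_perm; [by rewrite filter_uniq ?pr_uniq | exact: primes_uniq |] => p.
  rewrite mem_filter mem_pr mem_primes m0 ltnS; case: prime => //=; rewrite ?andbF//.
  by case pm: (p %| m)%N => //=; rewrite (leq_trans (dvdn_leq m0 pm)).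
rewrite /nn (perm_big _ pe) /= [RHS](prod_prime_decomp m0) prime_decompE big_map.
by rewrite big_seq [RHS]big_seq; apply: eq_bigr => p /sf/eqP /= ->.
Qed.

(** A squarefree m <= n is recovered from the set of primes below n + 1 that divide it; [nn_inj] and
    [nn_filter] make this a bijection. *)
Lemma sum_squarefree n h : (forall m, ~~ squarefree m -> h m = 0) ->
  \sum_(1 <= m < n.+1) h m = \sum_(A <- subs (pr n.+1)) h (nn A) * (nn A <= n)%:R.
Proof.
move=> h0; pose L := [seq nn A | A <- [seq A <- subs (pr n.+1) | (nn A <= n)%N]].
have pe : perm_eq L [seq m <- index_iota 1 n.+1 | squarefree m].
  apply: uniq_perm.
  - rewrite map_inj_in_uniq ?filter_uniq ?subs_uniq ?pr_uniq// => A B.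
    by rewrite !mem_filter => /andP[_ AN] /andP[_ BN]; exact: nn_inj AN BN.
  - by rewrite filter_uniq// iota_uniq.
  move=> m; rewrite mem_filter mem_index_iota ltnS; apply/mapP/idP.
    move=> [A]; rewrite mem_filter => /andP[An AN] ->.
    by rewrite (squarefree_nn AN) An andbT; apply: (nn_gt0 (s := pr n.+1)) AN => q /pr_prime.
  move=> /andP[sm /andP[m1 mn]]; exists [seq p <- pr n.+1 | (p %| m)%N]; last by rewrite nn_filter.
  by rewrite mem_filter nn_filter// mn filter_subs.
rewrite [LHS](bigID squarefree) /= [X in _ + X]big1 ?addr0// -big_filter -(perm_big _ pe) /L.
rewrite big_map big_filter big_mkcond /=; apply: eq_bigr => A _.
by case: ifP; rewrite ?mulr1 ?mulr0.
Qed.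

Lemma mult_nn N f A : multiplicative_arith f -> A \in subs (pr N) -> f (nn A) = pw f A.
Proof.
move=> [f1 fM] AN.
have : all prime A by apply/allP => q /(subs_sub AN)/pr_prime.
have := subs_uniq_mem (pr_uniq N) AN.
elim: A {AN} => [|p A IH] /=; first by rewrite nn_nil pw_nil.
move=> /andP[pA uA] /andP[pp /allP Ap]; rewrite nn_cons fM.
  by rewrite pw_cons IH//; apply/allP.
rewrite prime_coprime// /nn; apply/negP; rewrite big_seq.
elim/big_ind: _ => [|a b ha hb|q qA]; first by rewrite dvdn1; apply/negP; case: eqP pp => // ->.
  by rewrite Euclid_dvdM// => /orP[].
by rewrite dvdn_prime2// ?Ap// => /eqP pq; rewrite pq qA in pA.
Qed.

Lemma S_betaE (T : Type) (b : nat -> T -> R) f n w : multiplicative_arith f -> supported_on_squarefree f ->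
  S_beta f b n w = kk f n * XX f n (pr n.+1) (b^~ w).
Proof.
move=> fM fS; rewrite /S_beta /kk /BB /Bs /XX; congr ((Num.sqrt _)^-1 * _).
  rewrite (sum_squarefree n (h := fun m => f m ^+ 2)); last by move=> m /fS ->; rewrite expr0n.
  rewrite big_seq [RHS]big_seq; apply: eq_bigr => A AN; congr (_ * _).
  by rewrite (mult_nn fM AN) /pw prodrXl.
rewrite (sum_squarefree n (h := fun m => beta_n b m w * f m)); last by move=> m /fS ->; rewrite mulr0.
rewrite big_seq [RHS]big_seq; apply: eq_bigr => A AN; congr (_ * _).
rewrite (mult_nn fM AN) mulrC; congr (_ * _).
by rewrite /beta_n (squarefree_nn AN) (perm_big _ (primes_nn AN)).
Qed.

End squarefree_sums.

(** * Means of bounded random variables *)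

Section bounded_variables.
Context {d : measure_display} {T : measurableType d} {R : realType} (P : probability T R).
Implicit Types X Y : T -> R.

Definition bmeas X := measurable_fun [set: T] X /\ exists M : R, forall w, `|X w| <= M.

Lemma bmeas_integrable X : bmeas X -> P.-integrable [set: T] (EFin \o X).
Proof.
move=> [mX [M XM]]; apply: measurable_bounded_integrable => //.
  by rewrite [X in (X < _)%E](probability_setT P) ltry.
exists M; split; first exact: num_real.
by move=> y My w _ /=; rewrite (le_trans (XM w))// ltW.
Qed.

Lemma bmeas_cst (c : R) : bmeas (fun=> c).
Proof. by split; [exact: measurable_cst | exists `|c|]. Qed.

Lemma bmeasD X Y : bmeas X -> bmeas Y -> bmeas (fun w => X w + Y w).
Proof.
move=> [mX [M XM]] [mY [N YN]]; split; first exact: measurable_funD.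
by exists (M + N) => w; rewrite (le_trans (ler_normD _ _))// lerD.
Qed.

Lemma bmeasM X Y : bmeas X -> bmeas Y -> bmeas (fun w => X w * Y w).
Proof.
move=> [mX [M XM]] [mY [N YN]]; split; first exact: measurable_funM.
by exists (M * N) => w; rewrite normrM ler_pM.
Qed.

Lemma bmeasZ (c : R) X : bmeas X -> bmeas (fun w => c * X w).
Proof. exact: bmeasM (bmeas_cst c). Qed.

Lemma bmeasB X Y : bmeas X -> bmeas Y -> bmeas (fun w => X w - Y w).
Proof.
move=> hX hY; have := bmeasD hX (bmeasZ (-1) hY).
by congr bmeas; apply/funext => w; rewrite mulN1r.
Qed.

Lemma bmeas_sum (I : Type) (r : seq I) (X : I -> T -> R) :
  (forall i, bmeas (X i)) -> bmeas (fun w => \sum_(i <- r) X i w).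
Proof.
move=> h; elim: r => [|i r IH].
  by rewrite (_ : (fun _ => _) = (fun=> 0)); [exact: bmeas_cst | apply/funext => w; rewrite big_nil].
rewrite (_ : (fun _ => _) = (fun w => X i w + \sum_(j <- r) X j w)); first exact: bmeasD.
by apply/funext => w; rewrite big_cons.
Qed.

Lemma bmeas_norm X : bmeas X -> bmeas (fun w => `|X w|).
Proof.
move=> [mX [M XM]]; split; first exact: measurableT_comp.
by exists M => w; rewrite normr_id.
Qed.

Lemma mean_cst (c : R) : \int[P]_w c = c.
Proof. by rewrite Rintegral_cst// [X in c * fine X](probability_setT P) mulr1. Qed.

Lemma meanD X Y : P.-integrable [set: T] (EFin \o X) -> P.-integrable [set: T] (EFin \o Y) ->
  \int[P]_w (X w + Y w) = \int[P]_w X w + \int[P]_w Y w.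
Proof. by move=> iX iY; rewrite RintegralD. Qed.

Lemma mean_sum (I : Type) (r : seq I) (X : I -> T -> R) : (forall i, bmeas (X i)) ->
  \int[P]_w (\sum_(i <- r) X i w) = \sum_(i <- r) \int[P]_w X i w.
Proof.
move=> h; elim: r => [|i r IH].
  by rewrite big_nil -[RHS](mean_cst 0); apply: eq_Rintegral => w _; rewrite big_nil.
rewrite big_cons -IH -meanD; last 2 first.
- exact: bmeas_integrable.
- exact/bmeas_integrable/bmeas_sum.
by apply: eq_Rintegral => w _; rewrite big_cons.
Qed.

Lemma le_mean X Y : P.-integrable [set: T] (EFin \o X) -> P.-integrable [set: T] (EFin \o Y) ->
  (forall w, X w <= Y w) -> \int[P]_w X w <= \int[P]_w Y w.
Proof. by move=> iX iY XY; apply: le_Rintegral. Qed.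

Lemma norm_mean X : P.-integrable [set: T] (EFin \o X) -> `|\int[P]_w X w| <= \int[P]_w `|X w|.
Proof. by move=> iX; apply: le_normr_Rintegral. Qed.

End bounded_variables.

(** * Transfer from the sign cube to the probability space *)

Section rademacher_link.
Context {d : measure_display} {T : measurableType d} {R : realType} (P : probability T R).
Variable b : nat -> T -> R.
Hypothesis hb : rademacher_family P b.
Implicit Types (Phi : (nat -> R) -> R) (s A : seq nat).

Definition deps s Phi := forall x y, (forall p, p \in s -> x p = y p) -> Phi x = Phi y.

Let pat s A (w : T) : R := \prod_(p <- s) (b p w == sg A p)%:R.

Let sg01 A p : (sg A p = 1 :> R) \/ (sg A p = -1 :> R).
Proof. by rewrite /sg; case: ifP; [right | left]. Qed.

Let prob_sg A p : prime p -> P (b p @^-1` [set sg A p]) = (2^-1)%:E.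
Proof.
have n11 : (-1 : R) <> 1 by move=> h; lra.
case: hb => mb b1 b2 _ pp; have h1 : P (b p @^-1` [set 1]) = (2^-1)%:E := b2 p pp.
have [->|->] := sg01 A p; first exact: h1.
have -> : b p @^-1` [set (-1 : R)] = ~` (b p @^-1` [set (1 : R)]).
  apply/seteqP; split => w /=; first by move=> ->.
  by case: (b1 p pp w) => -> // [].
rewrite probability_setC; last first.
  by rewrite -[X in measurable X]setTI; apply: mb.
by rewrite h1 -EFinB; congr (_%:E); field.
Qed.

Let patE s A w : pat s A w = \1_(\big[setI/setT]_(p <- s) (b p @^-1` [set sg A p])) w.
Proof.
rewrite /pat; elim: s => [|p s IH]; first by rewrite !big_nil indicT.
rewrite !big_cons indicI IH /=; congr (_ * _).
by rewrite indicE; case: eqP => h; [rewrite mem_set | rewrite memNset].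
Qed.

Let mpat s A : (forall p, p \in s -> prime p) ->
  measurable (\big[setI/setT]_(p <- s) (b p @^-1` [set sg A p])).
Proof.
move=> ps; rewrite big_seq; apply: big_ind => //; first exact: measurableI.
move=> p /ps pp; rewrite -[X in measurable X]setTI.
by case: hb => mb _ _ _; apply: mb.
Qed.

Let pat_bmeas s A : (forall p, p \in s -> prime p) -> bmeas (pat s A).
Proof.
move=> ps; rewrite (_ : pat s A = \1_(\big[setI/setT]_(p <- s) (b p @^-1` [set sg A p]))).
  split; first exact: measurable_indic (mpat A ps).
  by exists 1 => w; rewrite indicE; case: (_ \in _); rewrite ?normr1 ?normr0.
by apply/funext => w; exact: patE.
Qed.

Let pat_mean s A : uniq s -> (forall p, p \in s -> prime p) ->
  \int[P]_w pat s A w = 2%:R ^- size s.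
Proof.
move=> us ps; rewrite (_ : \int[P]_w _ = \int[P]_w (\1_(\big[setI/setT]_(p <- s) (b p @^-1` [set sg A p])) w)).
  rewrite /Rintegral integral_indic ?setIT//; last exact: mpat.
  have hP : P (\big[setI/setT]_(p <- s) (b p @^-1` [set sg A p])) =
      (\prod_(p <- s) P (b p @^-1` [set sg A p]))%E.
    by case: hb => _ _ _; apply=> // p; exact: measurable_set1.
  transitivity (fine (\prod_(p <- s) P (b p @^-1` [set sg A p]))%E); first by rewrite -hP.
  rewrite big_seq (eq_bigr (fun=> (2^-1)%:E)); last by move=> p /ps; exact: prob_sg.
  rewrite -big_seq; elim: s {us ps hP} => [|p s IH]; first by rewrite big_nil /= expr0 invr1.
  have fin : (\prod_(p0 <- s) (2^-1)%:E)%E \is a @fin_num R.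
    by elim: s {IH} => [|q s IH]; rewrite ?big_nil// big_cons fin_numM.
  by rewrite big_cons fineM// IH /= exprS invfM.
by apply: eq_Rintegral => w _; exact: patE.
Qed.

(** Exactly one sign pattern on s occurs at w, namely that of the primes whose sign is -1. *)
Lemma cylE s Phi w : uniq s -> (forall p, p \in s -> prime p) -> deps s Phi ->
  Phi (b^~ w) = \sum_(A <- subs s) Phi (sg A) * pat s A w.
Proof.
move=> us ps dP; case: hb => _ b1 _ _; pose A0 := [seq p <- s | b p w == -1].
have sgA0 p : p \in s -> b p w = sg A0 p.
  move=> pS; rewrite /sg mem_filter pS andbT; case: eqP => // h.
  by have [|] := b1 p (ps p pS) w.
rewrite (bigD1_seq A0) ?filter_subs ?subs_uniq//= big_seq_cond big1 ?addr0.
  rewrite (dP _ _ sgA0) /pat big_seq big1 ?mulr1// => p pS.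
  by rewrite (sgA0 p pS) eqxx.
move=> A /andP[AS AA0]; have [p pS pA] : exists2 p, p \in s & b p w != sg A p.
  apply: contrapT => h; move/eqP: AA0; apply.
  rewrite (subs_filter_eq us AS); apply: eq_in_filter => p pS.
  have e : b p w = sg A p by apply: contrapT => e; apply: h; exists p => //; exact/eqP.
  rewrite e /sg; case: ifP => _; first by rewrite eqxx.
  by apply/esym/negbTE; rewrite -subr_eq0 opprK gt_eqF//; lra.
by rewrite /pat (bigD1_seq p)//= (negbTE pA) mul0r mulr0.
Qed.

Lemma cyl_bmeas s Phi : uniq s -> (forall p, p \in s -> prime p) -> deps s Phi ->
  bmeas (fun w => Phi (b^~ w)).
Proof.
move=> us ps dP; rewrite (_ : (fun _ => _) = (fun w => \sum_(A <- subs s) Phi (sg A) * pat s A w)).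
  by apply: bmeas_sum => A; apply: bmeasZ; exact: pat_bmeas.
by apply/funext => w; exact: cylE.
Qed.

(** By independence every sign pattern on s has probability 2^-(size s). All estimates proved for
    [EE] reach P through this identity. *)
Lemma cyl_mean s Phi : uniq s -> (forall p, p \in s -> prime p) -> deps s Phi ->
  \int[P]_w Phi (b^~ w) = EE s Phi.
Proof.
move=> us ps dP; rewrite (_ : \int[P]_w _ = \int[P]_w (\sum_(A <- subs s) Phi (sg A) * pat s A w)).
  rewrite mean_sum; last by move=> A; apply: bmeasZ; exact: pat_bmeas.
  rewrite /EE mulr_sumr; apply: eq_bigr => A _.
  rewrite RintegralZl//; last exact/bmeas_integrable/pat_bmeas.
  by rewrite pat_mean// mulrC.
by apply: eq_Rintegral => w _; exact: cylE.
Qed.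

End rademacher_link.

(** * Walsh expansion of the density *)

Section density_expansion.
Context {R : realType}.
Notation mu := (@lebesgue_measure R).
Variable f : nat -> R.
Implicit Types (K : seq nat).

Definition amp (p : nat) : R := f p / Num.sqrt p%:R.
(* The factor of the density at p is 1 + x p * osc t p when x p is a sign. *)
Definition osc (t : R) (p : nat) : R := 2 * amp p * cos (t * ln p%:R) / (1 + f p ^+ 2 / p%:R).
Definition freq (UW : seq nat * seq nat) : R := ln (nn UW.1)%:R - ln (nn UW.2)%:R.
Definition cK K : R := pw f K / Es (fun p => f p ^+ 2) K / Num.sqrt (nn K)%:R.

Lemma amp_sqr p : prime p -> amp p ^+ 2 = f p ^+ 2 / p%:R.
Proof. by move=> pp; rewrite /amp expr_div_n sqr_sqrtr. Qed.

Lemma m_densityE (T : Type) (b : nat -> T -> R) y w t :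
  (forall p, prime p -> b p w = 1 \/ b p w = -1) ->
  m_density f b y w t = \prod_(p <- pr y.+1) (1 + b p w * osc t p).
Proof.
move=> b1; rewrite prod_prE /m_density; apply: eq_bigr => p pp.
have p0 : (0 : R) < p%:R by rewrite ltr0n prime_gt0.
have H0 : 1 + f p ^+ 2 / p%:R != 0.
  by rewrite lt0r_neq0// ltr_wpDr// divr_ge0 ?sqr_ge0// ltW.
rewrite /osc -[f p ^+ 2 / p%:R]amp_sqr// in H0 *; rewrite /amp.
have := sin2cos2 (t * ln p%:R); set a := f p / _ in H0 *; move: (cos _) (sin _) => co si h.
have -> : b p w * f p * (Num.sqrt p%:R)^-1 = b p w * a by rewrite mulrA.
have b2 : b p w ^+ 2 = 1 by have [->|->] := b1 p pp; rewrite ?sqrrN expr1n.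
have -> : (1 + b p w * a * co) ^+ 2 + (b p w * a * si) ^+ 2 =
   1 + 2 * b p w * a * co + b p w ^+ 2 * a ^+ 2 * (co ^+ 2 + si ^+ 2) by ring.
by rewrite h b2; field.
Qed.

Lemma m_density_walsh (T : Type) (b : nat -> T -> R) y w t :
  (forall p, prime p -> b p w = 1 \/ b p w = -1) ->
  m_density f b y w t = \sum_(K <- subs (pr y.+1)) pw (osc t) K * pw (b^~ w) K.
Proof.
move=> b1; rewrite m_densityE// -(prod_subs (fun p => b p w * osc t p)).
by apply: eq_bigr => K _; rewrite -big_split /=; apply: eq_bigr => p _; rewrite mulrC.
Qed.

(** Product-to-sum formula: expanding gives one cosine for each choice of signs of the ln p, and the
    primes with plus and minus signs form U and W. *)
Lemma prod_cos K t : (forall p, p \in K -> (0 < p)%N) ->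
  \prod_(p <- K) (2 * cos (t * ln p%:R)) = \sum_(UW <- splits K) cos (t * freq UW).
Proof.
elim: K => [|p K IH] K0.
  by rewrite big_nil big_seq1 /freq /= !nn_nil subrr mulr0 cos0.
have K0' q : q \in K -> (0 < q)%N by move=> qK; apply: K0; rewrite inE qK orbT.
have p0 : (0 < p)%N by apply: K0; rewrite mem_head.
rewrite big_cons IH//= big_cat !big_map /= -big_split /= mulr_sumr.
rewrite big_seq [RHS]big_seq; apply: eq_bigr => UW UWK.
have [U0 W0] := splits_gt0 K0' UWK.
rewrite /freq /= !nn_cons !natrM !lnM ?posrE ?ltr0n//.
set u := ln (nn UW.1)%:R; set v := ln (nn UW.2)%:R; set l := ln p%:R.
have -> : t * (l + u - v) = t * (u - v) + t * l by ring.
have -> : t * (u - (l + v)) = t * (u - v) - t * l by ring.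
by rewrite cosD cosB; ring.
Qed.

Lemma sqrt_nn K : \prod_(p <- K) Num.sqrt p%:R = Num.sqrt (nn K)%:R :> R.
Proof.
elim: K => [|p K IH]; first by rewrite big_nil nn_nil sqrtr1.
by rewrite big_cons IH nn_cons natrM sqrtrM.
Qed.

Lemma pw_osc K t : (forall p, p \in K -> (0 < p)%N) ->
  pw (osc t) K = cK K * \sum_(UW <- splits K) cos (t * freq UW).
Proof.
move=> K0; rewrite -prod_cos// /pw /cK /Es /pw -sqrt_nn.
rewrite -!prodf_div -big_split /=; apply: eq_bigr => p _.
by rewrite /osc /amp; ring.
Qed.

(** The left side is the square root of min(U,W)/max(U,W), that is sqrt (U W)/max (U, W). Here the
    arithmetic coefficients of the bracket meet the analytic ones of V. *)
Lemma exp_freq K UW : (forall p, p \in K -> (0 < p)%N) -> UW \in splits K ->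
  expR (- (`|freq UW| / 2)) = Num.sqrt (nn K)%:R / (maxn (nn UW.1) (nn UW.2))%:R.
Proof.
move=> K0 UWK; have [U0 W0] := splits_gt0 K0 UWK.
have -> : nn K = (nn UW.1 * nn UW.2)%N.
  elim: K UW UWK {K0 U0 W0} => [|p K IH] UW /=.
    by rewrite inE => /eqP ->; rewrite nn_nil.
  rewrite mem_cat => /orP[] /mapP[UW' /IH E] -> /=; rewrite !nn_cons E;
      [by rewrite mulnA | by rewrite mulnCA].
have key (a b : nat) : (0 < a)%N -> (0 < b)%N -> (b <= a)%N ->
    expR (- (`|ln a%:R - ln b%:R| / 2)) = Num.sqrt (a * b)%:R / (maxn a b)%:R :> R.
  move=> a0 b0 ba; rewrite (maxn_idPl ba).
  have a0' : (0 : R) < a%:R by rewrite ltr0n.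
  have b0' : (0 : R) < b%:R by rewrite ltr0n.
  rewrite ger0_norm ?subr_ge0 ?ler_ln ?posrE ?ler_nat//.
  have sa : Num.sqrt a%:R = expR (ln a%:R / 2) :> R.
    by rewrite -powR12_sqrt ?ltW// /powR gt_eqF// mulrC.
  have sb : Num.sqrt b%:R = expR (ln b%:R / 2) :> R.
    by rewrite -powR12_sqrt ?ltW// /powR gt_eqF// mulrC.
  have ea : a%:R = expR (ln a%:R) :> R by rewrite lnK ?posrE.
  rewrite natrM sqrtrM ?ltW// sa sb [X in _ = _ / X]ea.
  by rewrite -expRN -!expRD; congr expR; field.
case/orP: (leq_total (nn UW.2) (nn UW.1)) => h; first by rewrite /freq key.
by rewrite /freq -normrN opprB key// maxnC mulnC.
Qed.

Lemma vK_freq K : (forall p, p \in K -> (0 < p)%N) ->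
  vK f K = cK K * \sum_(UW <- splits K) expR (- (`|freq UW| / 2)).
Proof.
move=> K0; rewrite (eq_big_seq (fun UW => Num.sqrt (nn K)%:R * (maxn (nn UW.1) (nn UW.2))%:R^-1)); last first.
  by move=> UW UWK; rewrite (exp_freq K0 UWK).
rewrite -mulr_sumr mulrA /vK /cK mulfVK//.
have : (0 < nn K)%N.
  by rewrite /nn big_seq; elim/big_ind: _ => // a b a0 b0; rewrite muln_gt0 a0.
by move=> n0; rewrite lt0r_neq0// sqrtr_gt0 ltr0n.
Qed.

Variables (D : set R) (hh : R -> R).
Hypotheses (mD : measurable D) (ch : continuous hh) (ih : mu.-integrable D (EFin \o hh)).

(** The Walsh coefficient at K of the integral of [hh] against the density, by [int_density]. *)
Definition trans K : R := cK K * \sum_(UW <- splits K) \int[mu]_(s in D) (hh s * cos (s * freq UW)).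

Lemma integrable_hcos (l : R) : mu.-integrable D (EFin \o (fun s => hh s * cos (s * l))).
Proof.
apply: le_integrable ih => //.
  apply/measurable_EFinP; apply: measurable_funTS; apply: continuous_measurable_fun => s.
  by apply: cvgM; [exact: ch | apply: continuous_comp; [exact: mulrr_continuous | exact: continuous_cos]].
by move=> s _ /=; rewrite lee_fin normrM ler_piMr// cos_max.
Qed.

Lemma Rintegral_lsum (I : Type) (r : seq I) (F : I -> R -> R) :
  (forall i, mu.-integrable D (EFin \o F i)) ->
  mu.-integrable D (EFin \o (fun s => \sum_(i <- r) F i s)) /\
  \int[mu]_(s in D) (\sum_(i <- r) F i s) = \sum_(i <- r) \int[mu]_(s in D) F i s.
Proof.
move=> h; elim: r => [|i r [IH1 IH2]].
  rewrite (_ : (fun s => \sum_(i <- [::]) F i s) = (fun=> 0)); last by apply/funext => s; rewrite big_nil.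
  split; first exact: integrable0.
  by rewrite big_nil /Rintegral integral0.
rewrite (_ : (fun s => \sum_(i <- i :: r) F i s) = (fun s => F i s + \sum_(j <- r) F j s)); last first.
  by apply/funext => s; rewrite big_cons.
split; last by rewrite big_cons -IH2 RintegralD.
rewrite (_ : EFin \o _ = (EFin \o F i) \+ (EFin \o (fun s => (\sum_(j <- r) F j s)%R)))%E; last first.
  by apply/funext => s; rewrite /= EFinD.
exact: integrableD.
Qed.

Lemma integrable_RZ (c : R) (F : R -> R) : mu.-integrable D (EFin \o F) ->
  mu.-integrable D (EFin \o (fun s => c * F s)).
Proof.
move=> iF; rewrite (_ : EFin \o _ = (fun s => c%:E * (EFin \o F) s)%E); last first.
  by apply/funext => s; rewrite /= EFinM.
exact: integrableZl.
Qed.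

Lemma int_density (T : Type) (b : nat -> T -> R) y w :
  (forall p, prime p -> b p w = 1 \/ b p w = -1) ->
  mu.-integrable D (EFin \o (fun s => hh s * m_density f b y w s)) /\
  \int[mu]_(s in D) (hh s * m_density f b y w s) =
    \sum_(K <- subs (pr y.+1)) trans K * pw (b^~ w) K.
Proof.
move=> b1.
pose G K s := if K \in subs (pr y.+1) then
   cK K * pw (b^~ w) K * \sum_(UW <- splits K) hh s * cos (s * freq UW) else 0.
have iG0 K := Rintegral_lsum (splits K) (fun UW => integrable_hcos (freq UW)).
have iG K : mu.-integrable D (EFin \o G K).
  rewrite /G; case: (K \in subs (pr y.+1)); last exact: integrable0.
  by apply: integrable_RZ; have [] := iG0 K.
have E : (fun s => hh s * m_density f b y w s) = (fun s => \sum_(K <- subs (pr y.+1)) G K s).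
  apply/funext => s; rewrite m_density_walsh// mulr_sumr big_seq [RHS]big_seq.
  apply: eq_bigr => K KN; rewrite /G KN pw_osc; last by move=> p /(subs_sub KN)/pr_prime/prime_gt0.
  by rewrite -mulr_sumr; ring.
rewrite E; have [i1 i2] := Rintegral_lsum (subs (pr y.+1)) iG; split => //.
rewrite i2 big_seq [RHS]big_seq; apply: eq_bigr => K KN.
rewrite /G KN RintegralZl//; last by have [] := iG0 K.
by have [_ ->] := iG0 K; rewrite /trans; ring.
Qed.

End density_expansion.

Section two_transforms.
Context {R : realType}.
Notation mu := (@lebesgue_measure R).
Variable f : nat -> R.

Lemma trans_cauchy K : (forall p, p \in K -> (0 < p)%N) ->
  trans f [set: R] (@cauchy_w R) K = 2 * pi * vK f K.
Proof.
move=> K0; rewrite vK_freq// /trans mulrCA; congr (_ * _); rewrite mulr_sumr.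
apply: eq_bigr => UW _; rewrite -cauchy_transform.
by apply: eq_Rintegral => s _; rewrite mulrC.
Qed.

(** The two sums over splittings have the same prefactor and nonnegative terms, so the termwise
    bound on transforms survives squaring; 64 is the square of the 8 in [parabola_transform_ge]. *)
Lemma trans_parabola K : (forall p, p \in K -> (0 < p)%N) ->
  vK f K ^+ 2 <= 64 * trans f `[0, 1] (fun s : R => (1 - s) ^+ 2) K ^+ 2.
Proof.
move=> K0; rewrite vK_freq// /trans; set u := \sum_(UW <- _) _; set v := \sum_(UW <- _) _.
rewrite [(cK f K * u) ^+ 2]exprMn [(cK f K * v) ^+ 2]exprMn [leRHS]mulrCA ler_wpM2l ?sqr_ge0//.
have -> : 64 * v ^+ 2 = (8 * v) ^+ 2 by ring.
rewrite lerXn2r ?nnegrE//.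
- by apply: sumr_ge0 => UW _; exact: expR_ge0.
- rewrite mulr_ge0// sumr_ge0// => UW _.
  by apply: le_trans (parabola_transform_ge _); rewrite divr_ge0// expR_ge0.
rewrite mulr_sumr; apply: ler_sum => UW _.
have h := @parabola_transform_ge R (freq UW); rewrite /parabola_transform in h.
by rewrite [leRHS]mulrC; move: h; rewrite ler_pdivrMr.
Qed.

End two_transforms.

(** * Integrals against the limiting measure, and square summability *)

Section chaos_limit.
Context {R : realType} {d : measure_display} {T : measurableType d} (P : probability T R).
Notation mu := (@lebesgue_measure R).
Variables (b : nat -> T -> R) (f : nat -> R) (m : T -> {measure set R -> \bar R}).
Hypothesis hb : rademacher_family P b.
Hypothesis mm : forall A : set R, measurable A -> measurable_fun [set: T] (fun w : T => (m w A : \bar R)).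
Hypothesis mfin : forall w (a1 a2 : R), (m w `[a1, a2]%classic < +oo)%E.
Hypothesis mlim : forall (a1 a2 : R) (h : R -> R), {within `[a1, a2], continuous h} ->
     (fun y : nat =>
        (\int[P]_w
           ((\int[lebesgue_measure]_(s in `[a1, a2]) (h s * m_density f b y w s)
             - \int[m w]_(s in `[a1, a2]) h s) ^+ 2)%:E)%E)
     @ \oo --> 0%:E.

Implicit Types (h : R -> R) (y : nat) (w : T).

Lemma b_pm p : prime p -> forall w, b p w = 1 \/ b p w = -1.
Proof. by case: hb => _ h _ _; exact: h. Qed.

Definition XD (h : R -> R) (a1 a2 : R) y w : R :=
  \int[mu]_(s in `[a1, a2]) (h s * m_density f b y w s).
Definition XM (h : R -> R) (a1 a2 : R) w : R := \int[m w]_(s in `[a1, a2]) h s.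

Lemma integrable_itv (nu : {measure set R -> \bar R}) (h : R -> R) (a1 a2 : R) : continuous h ->
  (nu `[a1, a2]%classic < +oo)%E -> nu.-integrable `[a1, a2] (EFin \o h).
Proof.
move=> ch fin; apply: measurable_bounded_integrable => //.
  by apply: measurable_funTS; exact: continuous_measurable_fun.
have [a12|a12] := leP a1 a2; last first.
  exists 0; split; first exact: num_real.
  by move=> M M0 x /=; rewrite in_itv /= => /andP[x1 x2]; have := le_trans x1 x2; rewrite leNgt a12.
have cabs : {within `[a1, a2], continuous (fun x => `|h x|)}.
  by apply: continuous_subspaceT => x; apply: cvg_norm; exact: ch.
have [c _ hc] := EVT_max a12 cabs.
exists `|h c|; split; first exact: num_real.
by move=> M M0 x /= xI; rewrite (le_trans (hc x xI))// ltW.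
Qed.

Lemma integrable_h (h : R -> R) (a1 a2 : R) : continuous h -> mu.-integrable `[a1, a2] (EFin \o h).
Proof.
by move=> ch; apply: continuous_compact_integrable; [exact: segment_compact | exact: continuous_subspaceT].
Qed.

Let deps_walsh y (c : seq nat -> R) :
  deps (pr y.+1) (fun x => \sum_(K <- subs (pr y.+1)) c K * pw x K).
Proof.
move=> x x' xx; rewrite big_seq [RHS]big_seq; apply: eq_bigr => K KN; congr (_ * _).
by rewrite /pw big_seq [RHS]big_seq; apply: eq_bigr => p pK; apply/xx/(subs_sub KN).
Qed.

Lemma XDE h (a1 a2 : R) y w : continuous h ->
  XD h a1 a2 y w = \sum_(K <- subs (pr y.+1)) trans f `[a1, a2] h K * pw (b^~ w) K.
Proof.
move=> ch; have mI : measurable (`[a1, a2]%classic : set R) by [].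
have b1 p : prime p -> b p w = 1 \/ b p w = -1 by move=> pp; exact: b_pm.
by have [_ E] := int_density f mI ch (integrable_h a1 a2 ch) y b1; exact: E.
Qed.

Lemma XD_bmeas h (a1 a2 : R) y : continuous h -> bmeas (XD h a1 a2 y).
Proof.
move=> ch; rewrite (_ : XD h a1 a2 y = (fun w => \sum_(K <- subs (pr y.+1)) trans f `[a1, a2] h K * pw (b^~ w) K)).
  apply: (cyl_bmeas hb (s := pr y.+1) (Phi := fun x => \sum_(K <- subs (pr y.+1)) trans f `[a1, a2] h K * pw x K)).
  - exact: pr_uniq.
  - by move=> p /pr_prime.
  - exact: deps_walsh.
by apply/funext => w; exact: XDE.
Qed.

Lemma XD_mean h (a1 a2 : R) y : continuous h -> \int[P]_w XD h a1 a2 y w = \int[mu]_(s in `[a1, a2]) h s.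
Proof.
move=> ch; transitivity (\int[P]_w (\sum_(K <- subs (pr y.+1)) trans f `[a1, a2] h K * pw (b^~ w) K)).
  by apply: eq_Rintegral => w _; exact: XDE.
rewrite (cyl_mean hb (s := pr y.+1) (Phi := fun x => \sum_(K <- subs (pr y.+1)) trans f `[a1, a2] h K * pw x K)).
- rewrite EE_walsh ?pr_uniq// /trans /cK pw_nil /Es big_nil /= big_seq1 nn_nil sqrtr1 !divr1 mul1r.
  by apply: eq_Rintegral => s _; rewrite /freq /= !nn_nil subrr mulr0 cos0 mulr1.
- exact: pr_uniq.
- by move=> p /pr_prime.
- exact: deps_walsh.
Qed.

Lemma XD_sqr h (a1 a2 : R) y : continuous h ->
  \int[P]_w (XD h a1 a2 y w ^+ 2) = \sum_(K <- subs (pr y.+1)) trans f `[a1, a2] h K ^+ 2.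
Proof.
move=> ch; transitivity (\int[P]_w ((\sum_(K <- subs (pr y.+1)) trans f `[a1, a2] h K * pw (b^~ w) K) ^+ 2)).
  by apply: eq_Rintegral => w _; rewrite XDE.
rewrite (cyl_mean hb (s := pr y.+1) (Phi := fun x => (\sum_(K <- subs (pr y.+1)) trans f `[a1, a2] h K * pw x K) ^+ 2)).
- by rewrite parseval ?pr_uniq.
- exact: pr_uniq.
- by move=> p /pr_prime.
- by move=> x x' xx; rewrite (@deps_walsh y (trans f `[a1, a2] h) _ _ xx).
Qed.

Lemma XM_int h (a1 a2 : R) w : continuous h -> (m w).-integrable `[a1, a2] (EFin \o h).
Proof. by move=> ch; exact: integrable_itv. Qed.

Lemma XM_meas h (a1 a2 : R) : continuous h -> (forall s, 0 <= h s) -> measurable_fun [set: T] (XM h a1 a2).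
Proof.
move=> ch h0; rewrite /XM /Rintegral; apply: (measurableT_comp (f := fine)) => //.
rewrite (_ : (fun _ => _) = (fun w => (\int[m w]_s ((EFin \o h) \_ `[a1, a2]) s)%E)); last first.
  by apply/funext => w; rewrite [LHS]integral_mkcond.
apply: measurable_fun_integral_kernel => //.
- by move=> s; rewrite /restrict; case: ifP => //= _; rewrite lee_fin.
- apply/(measurable_restrictT _ _).1 => //; apply/measurable_EFinP; apply: measurable_funTS.
  exact: continuous_measurable_fun.
Qed.

Lemma L2_lim h (a1 a2 : R) : continuous h -> forall e : R, 0 < e -> exists y0, forall y, (y0 <= y)%N ->
  (\int[P]_w ((XD h a1 a2 y w - XM h a1 a2 w) ^+ 2)%:E <= e%:E)%E.
Proof.
move=> ch e e0; have cv := mlim (continuous_subspaceT ch : {within `[a1, a2], continuous h}).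
move/fine_cvgP: cv => [[N1 _ H1] /cvgrPdist_lt/(_ e e0) [N2 _ H2]].
exists (maxn N1 N2) => y; rewrite geq_max => /andP[y1 y2].
have f1 := H1 y y1; have := H2 y y2; rewrite /= sub0r normrN => lt.
by rewrite -(fineK f1) lee_fin (le_trans (ler_norm _))// ltW.
Qed.

Let D h (a1 a2 : R) y w := XD h a1 a2 y w - XM h a1 a2 w.

Let D_meas h (a1 a2 : R) y : continuous h -> (forall s : R, 0 <= h s) -> measurable_fun [set: T] (D h a1 a2 y).
Proof.
by move=> ch h0; apply: measurable_funB; [case: (XD_bmeas a1 a2 y ch) | exact: XM_meas].
Qed.

Let D2_int h (a1 a2 : R) y : continuous h -> (forall s : R, 0 <= h s) ->
  (\int[P]_w ((XD h a1 a2 y w - XM h a1 a2 w) ^+ 2)%:E < +oo)%E ->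
  P.-integrable [set: T] (EFin \o (fun w => D h a1 a2 y w ^+ 2)).
Proof.
move=> ch h0 fin; apply/integrableP; split.
  by apply/measurable_EFinP; apply: measurable_funX; exact: D_meas.
apply: le_lt_trans fin; apply: ge0_le_integral => //.
- by apply: measurableT_comp => //; apply/measurable_EFinP; apply: measurable_funX; exact: D_meas.
- by apply/measurable_EFinP; apply: measurable_funX; exact: D_meas.
- by move=> w _; rewrite /= lee_fin ger0_norm ?sqr_ge0.
Qed.

Lemma L2_lim_R h (a1 a2 : R) : continuous h -> (forall s : R, 0 <= h s) -> forall e : R, 0 < e ->
  exists y0, forall y, (y0 <= y)%N ->
  P.-integrable [set: T] (EFin \o (fun w => (XD h a1 a2 y w - XM h a1 a2 w) ^+ 2)) /\
  \int[P]_w ((XD h a1 a2 y w - XM h a1 a2 w) ^+ 2) <= e.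
Proof.
move=> ch h0 e e0; have [y0 H] := L2_lim a1 a2 ch e0; exists y0 => y yy; have le := H y yy.
have iD : P.-integrable [set: T] (EFin \o (fun w => (XD h a1 a2 y w - XM h a1 a2 w) ^+ 2)).
  by apply: D2_int => //; apply: le_lt_trans le _; rewrite ltry.
by split=> //; rewrite -lee_fin fineK//; exact: (integrable_fin_num _ iD).
Qed.

(** From L^2 through |z| <= dl + z^2/dl, with dl = e/2 and a mean square of at most dl^2. *)
Lemma L1_lim h (a1 a2 : R) : continuous h -> (forall s : R, 0 <= h s) -> forall e : R, 0 < e ->
  exists y0, forall y, (y0 <= y)%N ->
  P.-integrable [set: T] (EFin \o (fun w => XD h a1 a2 y w - XM h a1 a2 w)) /\
  \int[P]_w `|XD h a1 a2 y w - XM h a1 a2 w| <= e.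
Proof.
move=> ch h0 e e0; pose dl := e / 2; have dl0 : 0 < dl by rewrite divr_gt0.
have dl2 : 0 < dl ^+ 2 by rewrite exprn_gt0.
have [y0 H] := L2_lim_R a1 a2 ch h0 dl2; exists y0 => y /H[i2 le2].
pose G w := dl + dl^-1 * (XD h a1 a2 y w - XM h a1 a2 w) ^+ 2.
have iG2 : P.-integrable [set: T] (EFin \o (fun w => dl^-1 * (XD h a1 a2 y w - XM h a1 a2 w) ^+ 2)).
  rewrite (_ : EFin \o _ = (fun w => dl^-1%:E * ((XD h a1 a2 y w - XM h a1 a2 w) ^+ 2)%:E)%E); last first.
    by apply/funext => w; rewrite /= EFinM.
  exact: integrableZl.
have iG : P.-integrable [set: T] (EFin \o G).
  rewrite (_ : EFin \o G = (EFin \o (fun=> dl)) \+ (EFin \o (fun w => (dl^-1 * (XD h a1 a2 y w - XM h a1 a2 w) ^+ 2)%R)))%E; last first.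
    by apply/funext => w; rewrite /= EFinD.
  by apply: integrableD => //; exact: bmeas_integrable (bmeas_cst dl).
have DG w : `|D h a1 a2 y w| <= G w.
  rewrite /G -/(D h a1 a2 y w) -[D h a1 a2 y w ^+ 2]real_normK ?num_real//.
  have := sqr_ge0 (`|D h a1 a2 y w| - dl); move: `|D _ _ _ _ _| (normr_ge0 (D h a1 a2 y w)) => z z0 hz.
  rewrite -(ler_pM2l dl0) mulrDr mulVKf ?gt_eqF//; move: hz; rewrite sqrrB -mulr_natl; nra.
have iD : P.-integrable [set: T] (EFin \o (D h a1 a2 y)).
  apply: le_integrable iG => //; first by apply/measurable_EFinP; exact: D_meas.
  by move=> w _; rewrite /= lee_fin (le_trans (DG w))// ler_norm.
split=> //; apply: (@le_trans _ _ (\int[P]_w G w)).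
  by apply: le_mean => //; exact: (integrable_norm iD).
rewrite /G meanD//; last exact: bmeas_integrable (bmeas_cst dl).
rewrite mean_cst RintegralZl// -[e](_ : dl + dl = e); last by rewrite /dl; field.
rewrite lerD2l ler_pdivrMl// -expr2//.
Qed.

Lemma XM_integrable h (a1 a2 : R) : continuous h -> (forall s : R, 0 <= h s) ->
  P.-integrable [set: T] (EFin \o XM h a1 a2).
Proof.
move=> ch h0; have [y0 H] := L1_lim a1 a2 ch h0 ltr01; have [iD _] := H y0 (leqnn _).
rewrite (_ : EFin \o _ = (EFin \o XD h a1 a2 y0) \- (EFin \o (fun w => XD h a1 a2 y0 w - XM h a1 a2 w)%R))%E.
  by apply: integrableB => //; exact/bmeas_integrable/XD_bmeas.
by apply/funext => w; rewrite /= -EFinB; congr (_%:E); ring.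
Qed.

Lemma XM_mean h (a1 a2 : R) : continuous h -> (forall s : R, 0 <= h s) ->
  \int[P]_w XM h a1 a2 w = \int[mu]_(s in `[a1, a2]) h s.
Proof.
move=> ch h0; apply/eqP; rewrite -subr_eq0 -normr_le0; apply/ler_addgt0Pl => e e0; rewrite addr0.
have [y0 H] := L1_lim a1 a2 ch h0 e0; have [iD le] := H y0 (leqnn _).
apply: le_trans le; rewrite -(XD_mean a1 a2 y0 ch) -normrN opprB.
rewrite -RintegralB//; [exact: norm_mean | exact/bmeas_integrable/XD_bmeas | exact: XM_integrable].
Qed.

Lemma sum_subs_mono (F : seq nat -> R) N N' : (N <= N')%N -> (forall K, 0 <= F K) ->
  \sum_(K <- subs (pr N)) F K <= \sum_(K <- subs (pr N')) F K.
Proof.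
move=> + F0; elim: N' => [|N' IH]; first by rewrite leqn0 => /eqP->.
rewrite leq_eqVlt => /orP[/eqP->//|]; rewrite ltnS => /IH/le_trans; apply => /=.
by case: ifP => // _; rewrite sum_subs_cons lerDl sumr_ge0.
Qed.

(** Convergence in L^2 keeps the second moments of the tested masses bounded in y. By Parseval these
    are sums of squared coefficients, which dominate those of V. *)
Lemma vK_sqr_bound : exists Q, forall N, \sum_(K <- subs (pr N)) vK f K ^+ 2 <= Q.
Proof.
pose h (s : R) := (1 - s) ^+ 2.
have ch : continuous h by move=> s; apply: cvgM; apply: cvgB; [exact: cvg_cst|exact: cvg_id|exact: cvg_cst|exact: cvg_id].
have h0 s : 0 <= h s by exact: sqr_ge0.
have [y0 H] := L2_lim_R 0 1 ch h0 ltr01; have [i0 l0] := H y0 (leqnn _).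
pose X := XD h 0 1; pose E0 := \int[P]_w (X y0 w ^+ 2).
(* From p^2 <= 2 (p - q)^2 + 4 (q - r)^2 + 4 r^2, with p and r the masses at levels y and y0 and q
   the limit; both mean squares of the differences are at most 1. *)
exists (64 * (6 + 4 * E0)) => N; pose y := maxn y0 N.
have [i1 l1] := H y (leq_maxl _ _).
apply: (le_trans (sum_subs_mono (leqW (leq_maxr y0 N)) (fun K => sqr_ge0 (vK f K)))).
rewrite -/y; apply: (@le_trans _ _ (64 * \sum_(K <- subs (pr y.+1)) trans f `[0, 1] h K ^+ 2)).
  rewrite mulr_sumr big_seq [leRHS]big_seq; apply: ler_sum => K KN; apply: trans_parabola.
  by move=> p /(subs_sub KN)/pr_prime/prime_gt0.
rewrite ler_wpM2l// -XD_sqr// -/X.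
have X2 z : bmeas (fun w => X z w ^+ 2).
  by rewrite (_ : (fun _ => _) = (fun w => X z w * X z w)) //; apply: bmeasM; exact: XD_bmeas.
pose G1 w := 2 * (X y w - XM h 0 1 w) ^+ 2; pose G2 w := 4 * (X y0 w - XM h 0 1 w) ^+ 2; pose G3 w := 4 * X y0 w ^+ 2.
have iZ c (F : T -> R) : P.-integrable [set: T] (EFin \o F) -> P.-integrable [set: T] (EFin \o (fun w => c * F w)).
  move=> iF; rewrite (_ : EFin \o _ = (fun w => c%:E * (F w)%:E)%E); last by apply/funext => w; rewrite /= EFinM.
  exact: integrableZl.
have iD (F F' : T -> R) : P.-integrable [set: T] (EFin \o F) -> P.-integrable [set: T] (EFin \o F') ->
   P.-integrable [set: T] (EFin \o (fun w => F w + F' w)).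
  move=> iF iF'; rewrite (_ : EFin \o _ = (fun w => (F w)%:E + (F' w)%:E)%E); last by apply/funext => w; rewrite /= EFinD.
  exact: integrableD.
have j1 := iZ 2 _ i1; have j2 := iZ 4 _ i0; have j3 := iZ 4 _ (bmeas_integrable P (X2 y0)).
have j12 := iD _ _ j1 j2.
apply: (@le_trans _ _ (\int[P]_w (G1 w + G2 w + G3 w))).
  apply: le_mean; [exact: bmeas_integrable (X2 y) | exact: iD j12 j3 |] => w.
  rewrite /G1 /G2 /G3; move: (X y w) (XM h 0 1 w) (X y0 w) => p q r.
  by have := sqr_ge0 (p - q - q); have := sqr_ge0 (q - r - r); lra.
rewrite (meanD j12 j3) (meanD j1 j2) !RintegralZl//; last exact: bmeas_integrable (X2 y0).
rewrite -/E0; move: E0 l0 l1 => E0 l0 l1.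
have := ler_wpM2l (ler0n R 2) l1; have := ler_wpM2l (ler0n R 4) l0.
move: (\int[P]_w _) (\int[P]_w _) => u v; lra.
Qed.

End chaos_limit.

(** * Finiteness of V and its approximation at finite level *)

Section total_mass.
Context {R : realType} {d : measure_display} {T : measurableType d} (P : probability T R).
Notation mu := (@lebesgue_measure R).
Variables (b : nat -> T -> R) (f : nat -> R) (m : T -> {measure set R -> \bar R}).
Hypothesis hb : rademacher_family P b.
Hypothesis mm : forall A : set R, measurable A -> measurable_fun [set: T] (fun w : T => (m w A : \bar R)).
Hypothesis mfin : forall w (a1 a2 : R), (m w `[a1, a2]%classic < +oo)%E.
Hypothesis mlim : forall (a1 a2 : R) (h : R -> R), {within `[a1, a2], continuous h} ->
     (fun y : nat =>
        (\int[P]_w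
           ((\int[lebesgue_measure]_(s in `[a1, a2]) (h s * m_density f b y w s)
             - \int[m w]_(s in `[a1, a2]) h s) ^+ 2)%:E)%E)
     @ \oo --> 0%:E.
Implicit Types (n y : nat) (w : T).

Lemma ge0_window (nu : {measure set R -> \bar R}) (g : R -> R) : continuous g -> (forall s : R, 0 <= g s) ->
  (fun n : nat => (\int[nu]_(s in `[(- n%:R)%R, n%:R]) (g s)%:E)%E) @ \oo --> (\int[nu]_s (g s)%:E)%E.
Proof.
move=> cg g0; pose g' n := ((EFin \o g) \_ `[(- n%:R : R)%R, n%:R]).
have mg : measurable_fun [set: R] (EFin \o g).
  by apply/measurable_EFinP; exact: continuous_measurable_fun.
have mg' n : measurable_fun [set: R] (g' n).
  by apply/(measurable_restrictT _ _).1 => //; exact: measurable_funTS.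
have g'0 n x : [set: R] x -> (0 <= g' n x)%E.
  by move=> _; rewrite /g' /restrict; case: ifP => //= _; rewrite lee_fin.
have nd x : [set: R] x -> {homo g' ^~ x : i j / (i <= j)%N >-> (i <= j)%E}.
  move=> _ i j ij; rewrite /g' /restrict; case: ifPn => iI; last first.
    by case: ifP => //= _; rewrite lee_fin.
  rewrite ifT//; move: iI; rewrite !inE /= !in_itv /= => /andP[h1 h2].
  have : i%:R <= j%:R :> R by rewrite ler_nat.
  by move=> h3; apply/andP; split; lra.
have := cvg_monotone_convergence measurableT mg' g'0 nd (mu := nu).
have -> : (\int[nu]_x (fun x0 => limn (g' ^~ x0)) x)%E = (\int[nu]_s (g s)%:E)%E.
  apply: eq_integral => x _; apply/cvg_lim => //.
  apply: cvg_near_cst; exists (truncn `|x|).+1 => // n /= xn.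
  rewrite /g' /restrict; case: ifPn => //; rewrite notin_setE /= in_itv /= => h; exfalso; apply: h.
  have : `|x| <= n%:R by rewrite ltW// (lt_le_trans (truncnS_gt _))// ler_nat.
  by rewrite ler_norml.
apply: cvg_trans; apply: near_eq_cvg; apply: nearW => n /=.
by rewrite [RHS]integral_mkcond.
Qed.

Local Notation cw := (@cauchy_w R).
Let cw_cont : continuous cw. Proof. exact: continuous_w. Qed.
Let cw0 (s : R) : 0 <= cw s. Proof. by rewrite ltW// cauchy_w_gt0. Qed.

Let tp : R := (2 * pi)^-1.
Let tp0 : 0 < tp. Proof. by rewrite invr_gt0 mulr_gt0// pi_gt0. Qed.

Definition kap n : R := tp * \int[mu]_(s in `[(- n%:R)%R, n%:R]) cw s.
Definition Vn n w : R := tp * XM m cw (- n%:R) n%:R w.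
(** Where V is infinite, [fine] returns 0; [V_fin] makes this a null event. *)
Definition vv w : R := fine (V_infty m w).

Lemma kap_cvg : kap @ \oo --> (1 : R).
Proof.
have -> : (1 : R) = tp * (2 * pi) by rewrite mulVf// lt0r_neq0// mulr_gt0// pi_gt0.
apply: cvgM; first exact: cvg_cst.
rewrite -int_cauchy_w; apply: Rintegral_window; exact: integrable_w.
Qed.

Let VnE n w : (Vn n w)%:E = (tp%:E * \int[m w]_(s in `[(- n%:R)%R, n%:R]) (cw s)%:E)%E.
Proof.
rewrite EFinM; congr (_ * _)%E; rewrite fineK//.
exact: (integrable_fin_num _ (XM_int mfin (- n%:R) n%:R w cw_cont)).
Qed.

Lemma Vn_ge0 n w : 0 <= Vn n w.
Proof. by rewrite mulr_ge0 ?(ltW tp0)// Rintegral_ge0// => s _. Qed.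

Let Vn_nd w : {homo (fun n => (Vn n w)%:E) : i j / (i <= j)%N >-> (i <= j)%E}.
Proof.
move=> i j ij; rewrite !VnE lee_pmul2l ?lte_fin//.
apply: ge0_subset_integral => //.
- by apply: measurable_funTS; apply/measurable_EFinP; exact: continuous_measurable_fun.
- by move=> x _; rewrite lee_fin.
move=> x /=; rewrite !in_itv /= => /andP[h1 h2].
have : i%:R <= j%:R :> R by rewrite ler_nat.
by move=> h3; apply/andP; split; lra.
Qed.

Lemma Vn_cvg w : (fun n => (Vn n w)%:E) @ \oo --> V_infty m w.
Proof.
have h := @ge0_window (m w) cw cw_cont cw0.
have -> : (fun n => (Vn n w)%:E) = (fun n => (tp%:E * \int[m w]_(s in `[(- n%:R)%R, n%:R]) (cw s)%:E)%E).
  by apply/funext => n; exact: VnE.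
by apply: cvgeZl.
Qed.

Lemma Vn_le_V n w : ((Vn n w)%:E <= V_infty m w)%E.
Proof.
rewrite -(cvg_lim _ (@Vn_cvg w))//; apply: lime_ge; first exact: cvgP (@Vn_cvg w).
by exists n => // k /= nk; exact: Vn_nd.
Qed.

Lemma V_ge0 w : (0 <= V_infty m w)%E.
Proof. by apply: le_trans (Vn_le_V 0 w); rewrite lee_fin Vn_ge0. Qed.

Lemma Vn_meas n : measurable_fun [set: T] (Vn n).
Proof. by apply: measurable_funM => //; exact: XM_meas. Qed.

Lemma V_meas : measurable_fun [set: T] (V_infty m).
Proof.
apply: (emeasurable_fun_cvg (fun n w => (Vn n w)%:E)); last by move=> w _; exact: Vn_cvg.
by move=> n; apply/measurable_EFinP; exact: Vn_meas.
Qed.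

Lemma Vn_int n : P.-integrable [set: T] (EFin \o Vn n).
Proof.
rewrite (_ : EFin \o _ = (fun w => tp%:E * (EFin \o XM m cw (- n%:R) n%:R) w)%E); last first.
  by apply/funext => w; rewrite /= -EFinM.
by apply: integrableZl => //; exact: (XM_integrable hb mm mlim).
Qed.

Lemma Vn_mean n : \int[P]_w Vn n w = kap n.
Proof.
rewrite /Vn RintegralZl//; last exact: (XM_integrable hb mm mlim).
by rewrite (XM_mean hb mm mlim).
Qed.

(** Monotone convergence over windows: m has Lebesgue measure as its mean, and the kernel integrates
    to 2 pi. Almost sure finiteness follows. *)
Lemma V_mean : (\int[P]_w V_infty m w = 1)%E.
Proof.
have := @cvg_monotone_convergence _ _ _ P _ measurableT (fun n w => (Vn n w)%:E)
  (fun n => (measurable_EFinP _ _).2 (Vn_meas n)) (fun n w _ => Vn_ge0 n w) (fun w _ => @Vn_nd w).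
have -> : (\int[P]_x (fun x0 => limn (fun n => (Vn n x0)%:E)) x)%E = (\int[P]_w V_infty m w)%E.
  by apply: eq_integral => w _; apply/cvg_lim => //; exact: Vn_cvg.
have -> : (fun n => \int[P]_x (Vn n x)%:E)%E = (fun n => (kap n)%:E).
  apply/funext => n; rewrite -Vn_mean fineK//; exact: (integrable_fin_num _ (Vn_int n)).
move=> h; have h2 : (fun n => (kap n)%:E) @ \oo --> 1%:E.
  by apply: cvg_EFin; [exact: nearW | exact: kap_cvg].
exact: (cvg_unique _ h h2).
Qed.

Lemma V_integrable : P.-integrable [set: T] (V_infty m).
Proof.
apply/integrableP; split; first exact: V_meas.
have -> : (\int[P]_x `|V_infty m x| = \int[P]_w V_infty m w)%E.
  by apply: eq_integral => w _; rewrite gee0_abs// V_ge0.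
by rewrite V_mean ltry.
Qed.

Lemma V_fin : {ae P, forall w, V_infty m w \is a fin_num}.
Proof.
have := integrable_ae measurableT V_integrable.
by apply: filterS => w h; exact: h.
Qed.

Lemma vv_ge0 w : 0 <= vv w. Proof. by rewrite fine_ge0// V_ge0. Qed.

Lemma vv_meas : measurable_fun [set: T] vv.
Proof. by apply: (measurableT_comp (f := fine)) => //; exact: V_meas. Qed.

Lemma vv_int : P.-integrable [set: T] (EFin \o vv).
Proof.
apply: le_integrable V_integrable => //; first by apply/measurable_EFinP; exact: vv_meas.
move=> w _; rewrite /= ger0_norm ?vv_ge0// /vv gee0_abs ?V_ge0//.
by case: (V_infty m w) (V_ge0 w) => //= _; rewrite leey.
Qed.

Lemma vv_mean : \int[P]_w vv w = 1.
Proof.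
rewrite /Rintegral (ae_eq_integral (V_infty m)) ?V_mean//.
- by apply/measurable_EFinP; exact: vv_meas.
- exact: V_meas.
- by have := V_fin; apply: filterS => w h _; rewrite /= fineK.
Qed.

Let RZ (c : R) (F : T -> R) : P.-integrable [set: T] (EFin \o F) -> P.-integrable [set: T] (EFin \o (fun w => c * F w)).
Proof.
move=> iF; rewrite (_ : EFin \o _ = (fun w => c%:E * (F w)%:E)%E); last by apply/funext => w; rewrite /= EFinM.
exact: integrableZl.
Qed.
Let RD (F F' : T -> R) : P.-integrable [set: T] (EFin \o F) -> P.-integrable [set: T] (EFin \o F') ->
   P.-integrable [set: T] (EFin \o (fun w => F w + F' w)).
Proof.
move=> iF iF'; rewrite (_ : EFin \o _ = (fun w => (F w)%:E + (F' w)%:E)%E); last by apply/funext => w; rewrite /= EFinD.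
exact: integrableD.
Qed.
Let RB (F F' : T -> R) : P.-integrable [set: T] (EFin \o F) -> P.-integrable [set: T] (EFin \o F') ->
   P.-integrable [set: T] (EFin \o (fun w => F w - F' w)).
Proof.
move=> iF iF'; rewrite (_ : EFin \o _ = (fun w => (F w)%:E - (F' w)%:E)%E); last by apply/funext => w; rewrite /= EFinB.
exact: integrableB.
Qed.

Lemma vv_Vn n : \int[P]_w `|vv w - Vn n w| = 1 - kap n.
Proof.
have iB := RB vv_int (Vn_int n).
rewrite -vv_mean -Vn_mean -RintegralB//; [|exact: vv_int|exact: Vn_int].
rewrite /Rintegral; congr fine; apply: ae_eq_integral => //.
- by apply/measurable_EFinP; apply: measurableT_comp => //; apply: measurable_funB; [exact: vv_meas | exact: Vn_meas].
- by apply/measurable_EFinP; apply: measurable_funB; [exact: vv_meas | exact: Vn_meas].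
- have := V_fin; apply: filterS => w h _; rewrite ger0_norm// subr_ge0 -lee_fin /vv fineK//.
  exact: Vn_le_V.
Qed.

Local Notation Vy y w := (VV f (pr y.+1) (b^~ w)).

Let b1 w p : prime p -> b p w = 1 \/ b p w = -1.
Proof. by move=> pp; exact: (b_pm hb). Qed.

Lemma m_density_ge0 y w s : 0 <= m_density f b y w s.
Proof.
apply: prodr_ge0 => p _; rewrite divr_ge0 ?addr_ge0 ?sqr_ge0//.
by rewrite divr_ge0 ?sqr_ge0.
Qed.

(** The truncated chaos series is V at level y. This reading shows it to be at least its integral
    over any window, which the series does not reveal. *)
Lemma VV_density y w :
  mu.-integrable [set: R] (EFin \o (fun s => cw s * m_density f b y w s)) /\
  Vy y w = tp * \int[mu]_s (cw s * m_density f b y w s).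
Proof.
have iw : mu.-integrable [set: R] (EFin \o cw) by exact: integrable_w.
have [i E] := int_density f measurableT cw_cont iw y (@b1 w); split => //.
rewrite E /VV mulr_sumr big_seq [RHS]big_seq; apply: eq_bigr => K KN.
rewrite trans_cauchy; last by move=> p /(subs_sub KN)/pr_prime/prime_gt0.
have tpK : tp * (2 * pi) = 1 by rewrite mulVf// lt0r_neq0// mulr_gt0// pi_gt0.
by rewrite -(mulrA (2 * pi)) mulrA tpK mul1r.
Qed.

Lemma VV_bmeas y : bmeas (fun w => Vy y w).
Proof.
apply: (cyl_bmeas hb (s := pr y.+1) (Phi := VV f (pr y.+1))).
- exact: pr_uniq.
- by move=> p /pr_prime.
- move=> x x' xx; rewrite /VV big_seq [RHS]big_seq; apply: eq_bigr => K KN; congr (_ * _).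
  by rewrite /pw big_seq [RHS]big_seq; apply: eq_bigr => p pK; apply/xx/(subs_sub KN).
Qed.

Lemma VV_mean y : \int[P]_w Vy y w = 1.
Proof.
rewrite (cyl_mean hb (s := pr y.+1) (Phi := VV f (pr y.+1))).
- by rewrite EE_walsh ?pr_uniq// vK_nil.
- exact: pr_uniq.
- by move=> p /pr_prime.
- move=> x x' xx; rewrite /VV big_seq [RHS]big_seq; apply: eq_bigr => K KN; congr (_ * _).
  by rewrite /pw big_seq [RHS]big_seq; apply: eq_bigr => p pK; apply/xx/(subs_sub KN).
Qed.

Let Xn n y w : R := tp * XD b f cw (- n%:R) n%:R y w.

Let Xn_le n y w : Xn n y w <= Vy y w.
Proof.
have [i E] := VV_density y w; rewrite E ler_wpM2l ?(ltW tp0)//.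
rewrite /XD /Rintegral fine_le//.
- by apply: (integrable_fin_num _ _) => //; exact: (integrableS measurableT _ _ i).
- exact: (integrable_fin_num _ i).
apply: ge0_subset_integral => //; first by case/integrableP: i.
by move=> s _; rewrite lee_fin mulr_ge0// m_density_ge0.
Qed.

(** Outside a window both masses are nonnegative with mean 1 - [kap n], whatever y is. The window is
    therefore fixed before y, and inside it [L1_lim] applies. *)
Lemma V_L1 (e : R) : 0 < e -> exists y0, forall y, (y0 <= y)%N ->
  \int[P]_w `|Vy y w - vv w| <= e.
Proof.
move=> e0; have e3 : 0 < e / 3 by rewrite divr_gt0.
have [n0 _ Hn] : \forall n \near \oo, `|1 - kap n| < e / 3.
  by have /cvgrPdist_lt := kap_cvg; exact.
have kn : 1 - kap n0 <= e / 3 by have := Hn n0 (leqnn n0); rewrite /= => h; rewrite (le_trans (ler_norm _))// ltW.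
have [y0 H] := L1_lim hb mm mlim (- n0%:R) n0%:R cw_cont cw0 e3.
exists y0 => y /H[iD le].
have iV : P.-integrable [set: T] (EFin \o (fun w => Vy y w)) by exact: bmeas_integrable (VV_bmeas y).
have iX : P.-integrable [set: T] (EFin \o Xn n0 y).
  by apply: RZ; exact: bmeas_integrable (XD_bmeas f hb (- n0%:R) n0%:R y cw_cont).
have i1 := RB iV iX.
have i2 : P.-integrable [set: T] (EFin \o (fun w => tp * `|XD b f cw (- n0%:R) n0%:R y w - XM m cw (- n0%:R) n0%:R w|)).
  by apply: RZ; exact: (integrable_norm iD).
have i3 : P.-integrable [set: T] (EFin \o (fun w => `|vv w - Vn n0 w|)).
  exact: (integrable_norm (RB vv_int (Vn_int n0))).
have i12 := RD i1 i2.
apply: (@le_trans _ _ (\int[P]_w (Vy y w - Xn n0 y w + tp * `|XD b f cw (- n0%:R) n0%:R y w - XM m cw (- n0%:R) n0%:R w| + `|vv w - Vn n0 w|))).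
  apply: le_mean; [exact: (integrable_norm (RB iV vv_int)) | exact: RD i12 i3 |] => w.
  have -> : Vy y w - vv w = (Vy y w - Xn n0 y w) + (tp * (XD b f cw (- n0%:R) n0%:R y w - XM m cw (- n0%:R) n0%:R w)) - (vv w - Vn n0 w).
    by rewrite /Xn /Vn; ring.
  apply: (le_trans (ler_normB _ _)); rewrite lerD2r; apply: (le_trans (ler_normD _ _)).
  by rewrite normrM (gtr0_norm tp0) lerD2r ger0_norm// subr_ge0 Xn_le.
rewrite (meanD i12 i3) (meanD i1 i2) RintegralB// VV_mean vv_Vn.
have -> : \int[P]_w Xn n0 y w = kap n0.
  rewrite /Xn RintegralZl//; last exact: bmeas_integrable (XD_bmeas f hb (- n0%:R) n0%:R y cw_cont).
  by rewrite (XD_mean f hb).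
rewrite RintegralZl//; last exact: (integrable_norm iD).
have tp1 : tp <= 1.
  by rewrite invf_le1 ?mulr_gt0 ?pi_gt0//; have := @pi_ge2 R; lra.
have : tp * \int[P]_w `|XD b f cw (- n0%:R) n0%:R y w - XM m cw (- n0%:R) n0%:R w| <= e / 3.
  apply: le_trans le; rewrite ler_piMl// Rintegral_ge0//.
move: (tp * _) => z; lra.
Qed.

End total_mass.

(** * Masses under a change of finitely many signs *)

Section cube_products.
Context {R : realType}.
Implicit Types (Phi Psi : (nat -> R) -> R) (u v s : seq nat).

Lemma deps_indep s Phi p : deps s Phi -> p \notin s -> indep p Phi.
Proof.
move=> dP ps e x; apply: dP => q qs; rewrite /upd; case: eqP => // qp.
by rewrite qp (negbTE ps) in qs.
Qed.

Lemma EE_prod u v Phi Psi : uniq (u ++ v) -> deps v Phi -> deps u Psi ->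
  EE (u ++ v) (fun x => Phi x * Psi x) = EE v Phi * EE u Psi.
Proof.
elim: u Psi => [|p u IH] Psi /=.
  move=> _ _ dPsi; rewrite EE_nil mulrC -EEZ; apply: eq_EE => x _.
  by rewrite mulrC; congr (_ * _); apply: dPsi.
move=> /andP[puv uv] dPhi dPsi; have pu : p \notin u by move: puv; rewrite mem_cat negb_or => /andP[].
have pv : p \notin v by move: puv; rewrite mem_cat negb_or => /andP[].
have iP := deps_indep dPhi pv.
rewrite EE_cons// EE_cons//.
have step (e : R) : EE (u ++ v) (fun x => Phi (upd p e x) * Psi (upd p e x)) = EE v Phi * EE u (fun x => Psi (upd p e x)).
  rewrite -IH//; last first.
    move=> x y xy; apply: dPsi => q; rewrite inE /upd; case: eqP => //= _ qu; exact: xy.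
  by apply: eq_EE => x _; rewrite iP.
by rewrite (step 1) (step (-1)); ring.
Qed.

Lemma EE_deps u v Phi : uniq (u ++ v) -> deps v Phi -> EE (u ++ v) Phi = EE v Phi.
Proof.
move=> uv dP; apply: EE_cat => // p pu; apply: (deps_indep dP).
by move: uv; rewrite cat_uniq => /and3P[_ /hasPn h _]; apply/negP => /h; rewrite /= pu.
Qed.

Variables (D : set R) (o : R -> nat -> R) (L : nat -> R).
Notation mu := (@lebesgue_measure R).
Hypothesis mD : measurable D.
Hypothesis fD : (mu D < +oo)%E.
Hypothesis mo : forall p, continuous (o ^~ p).
Hypothesis L0 : forall p, prime p -> 0 < L p.
Hypothesis oL : forall p t, prime p -> D t -> `|o t p| <= 1 - L p.

Definition prodo s (x : nat -> R) (t : R) : R := \prod_(p <- s) (1 + x p * o t p).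
Definition massI s x : R := \int[mu]_(t in D) prodo s x t.

Let factor p x t : prime p -> x p ^+ 2 = 1 -> D t -> L p <= 1 + x p * o t p <= 2.
Proof.
move=> pp x1 Dt; have h := oL pp Dt; have l0 := L0 pp.
have : `|x p * o t p| <= 1 - L p.
  rewrite normrM; suff -> : `|x p| = 1 by rewrite mul1r.
  by apply/eqP; rewrite -(@eqrXn2 _ 2)// expr1n real_normK ?num_real// x1.
by rewrite ler_norml => /andP[h1 h2]; apply/andP; split; lra.
Qed.

Lemma prodo_bounds s x t : (forall p, p \in s -> prime p) -> (forall p, x p ^+ 2 = 1) -> D t ->
  \prod_(p <- s) L p <= prodo s x t <= 2 ^+ size s.
Proof.
move=> ps x1 Dt; rewrite /prodo; elim: s ps => [|p s IH] ps.
  by rewrite !big_nil expr0 lexx.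
have ps' q : q \in s -> prime q by move=> qs; apply: ps; rewrite inE qs orbT.
have pp : prime p by apply: ps; rewrite mem_head.
have /andP[h1 h2] := factor pp (x1 p) Dt; have /andP[h3 h4] := IH ps'.
have P0 : 0 <= \prod_(j <- s) L j by rewrite big_seq; apply: prodr_ge0 => q /ps' /L0/ltW.
have l0 := L0 pp.
rewrite !big_cons exprS; apply/andP; split; apply: ler_pM => //.
- exact: ltW.
- exact: le_trans (ltW l0) h1.
- exact: le_trans P0 h3.
Qed.

Lemma Lprod_gt0 s : (forall p, p \in s -> prime p) -> 0 < \prod_(p <- s) L p.
Proof. by move=> ps; rewrite big_seq; apply: prodr_gt0 => p /ps/L0. Qed.

Lemma prodo_cont s x : continuous (prodo s x).
Proof.
elim: s => [|p s IH].
  rewrite (_ : prodo [::] x = cst 1); first by move=> t; exact: cvg_cst.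
  by apply/funext => t; rewrite /prodo big_nil.
rewrite (_ : prodo (p :: s) x = (fun t => (1 + x p * o t p) * prodo s x t)).
  move=> t; apply: cvgM; last exact: IH.
  by apply: cvgD; [exact: cvg_cst | apply: cvgM; [exact: cvg_cst | exact: mo]].
by apply/funext => t; rewrite /prodo big_cons.
Qed.

Lemma prodo_int s x : (forall p, p \in s -> prime p) -> (forall p, x p ^+ 2 = 1) ->
  mu.-integrable D (EFin \o prodo s x).
Proof.
move=> ps x1; apply: measurable_bounded_integrable => //.
  by apply: measurable_funTS; apply: continuous_measurable_fun; exact: prodo_cont.
exists (2 ^+ size s); split; first exact: num_real.
move=> M MM t Dt /=; have /andP[h1 h2] := prodo_bounds ps x1 Dt.
rewrite ger0_norm; first by rewrite (le_trans h2)// ltW.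
by apply: le_trans h1; rewrite ltW// Lprod_gt0.
Qed.

Lemma massI_cat u v x : (forall p, p \in u ++ v -> prime p) -> (forall p, x p ^+ 2 = 1) ->
  (\prod_(p <- v) L p) * massI u x <= massI (u ++ v) x <= 2 ^+ size v * massI u x.
Proof.
move=> ps x1; have pu p : p \in u -> prime p by move=> pu; apply: ps; rewrite mem_cat pu.
have pv p : p \in v -> prime p by move=> pv; apply: ps; rewrite mem_cat pv orbT.
have iu := prodo_int pu x1; have iuv := prodo_int ps x1.
have E t : prodo (u ++ v) x t = prodo v x t * prodo u x t by rewrite /prodo big_cat mulrC.
have iZ (c : R) : mu.-integrable D (EFin \o (fun t => c * prodo u x t)).
  rewrite (_ : EFin \o _ = (fun t => c%:E * (prodo u x t)%:E)%E); last by apply/funext => t; rewrite /= EFinM.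
  exact: integrableZl.
have u0 t : D t -> 0 <= prodo u x t.
  by move=> Dt; have /andP[h _] := prodo_bounds pu x1 Dt; rewrite (le_trans _ h)// ltW// Lprod_gt0.
rewrite /massI -!RintegralZl//; apply/andP; split; apply: le_Rintegral => // t Dt;
  have /andP[h1 h2] := prodo_bounds pv x1 Dt; rewrite E ler_wpM2r ?u0//.
Qed.

Lemma deps_massI s : deps s (massI s).
Proof.
move=> x y xy; apply: eq_Rintegral => t _; rewrite /prodo big_seq [RHS]big_seq.
by apply: eq_bigr => p ps; rewrite xy.
Qed.

(* Conditioning on the small primes only changes the mass by a bounded factor. *)
Lemma laplace_compare u v Phi (lam : R) : uniq (u ++ v) -> (forall p, p \in u ++ v -> prime p) ->
  deps v Phi -> (forall x, (forall p, x p ^+ 2 = 1) -> 0 <= Phi x) -> 0 <= lam ->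
  EE (u ++ v) (fun x => Phi x * expR (- (lam * massI (u ++ v) x))) <=
  EE (u ++ v) Phi * EE (u ++ v) (fun x => expR (- (lam * ((\prod_(p <- v) L p) / 2 ^+ size v) * massI (u ++ v) x))).
Proof.
move=> uuv ps dP P0 l0; set c := \prod_(p <- v) L p.
have pv p : p \in v -> prime p by move=> pv; apply: ps; rewrite mem_cat pv orbT.
have c0 : 0 < c by exact: Lprod_gt0.
pose Psi x := expR (- (lam * c * massI u x)).
have dPsi : deps u Psi by move=> x y xy; rewrite /Psi (deps_massI xy).
(* The lower bound on the factors of v replaces the mass by one that does not involve the signs of
   Phi. Once the expectation has been factored, the upper bound brings the full mass back. *)
apply: (@le_trans _ _ (EE (u ++ v) (fun x => Phi x * Psi x))).
  apply: le_EE => x x1; rewrite ler_wpM2l ?P0// ler_expR lerN2 -mulrA ler_wpM2l//.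
  by have /andP[] := massI_cat ps x1.
rewrite EE_prod// -(EE_deps uuv dP) ler_wpM2l//; first exact: EE_ge0.
have d1 : deps v (fun=> 1 : R) by [].
have -> : EE u Psi = EE (u ++ v) Psi.
  have := EE_prod uuv d1 dPsi; rewrite EE_cst mul1r => <-.
  by apply: eq_EE => x _; rewrite mul1r.
apply: le_EE => x x1; rewrite ler_expR lerN2 -!mulrA ler_wpM2l// ler_wpM2l ?(ltW c0)//.
by rewrite ler_pdivrMl ?exprn_gt0//; have /andP[] := massI_cat ps x1.
Qed.

End cube_products.

(** * An interval on which no factor of the density vanishes *)

Section oscillation.
Context {R : realType}.
Variables (f : nat -> R) (c K1 : R).
Hypothesis c0 : 0 < c.
Hypothesis ampb : forall p, prime p -> (`|f p| / Num.sqrt p%:R) ^+ 3 * expR (c * ln p%:R) <= K1.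

(** A factor can vanish only if |f(p)| = sqrt p, and then [ampb] forces ln p <= |K1|/c. With this
    value, t ln p lies in (0, 1] for such p and t in [dlt, 2 dlt]. *)
Definition dlt : R := (2 * (1 + `|K1| / c))^-1.
(* A lower bound for 1 - |osc t p| on [dlt, 2 dlt]: if |amp p| = 1, it comes
   from t ln p staying away from the multiples of pi. *)
Definition lowf (p : nat) : R :=
  if `|amp f p| == 1 then 1 - cos (dlt * ln 2) else (1 - `|amp f p|) ^+ 2 / (1 + `|amp f p| ^+ 2).

Lemma dlt_gt0 : 0 < dlt.
Proof. by rewrite invr_gt0 mulr_gt0// ltr_pwDl// divr_ge0// ltW. Qed.

Let dlt_le : dlt <= 2^-1.
Proof.
rewrite lef_pV2 ?posrE//; last by rewrite mulr_gt0// ltr_pwDl// divr_ge0// ltW.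
by rewrite ler_peMr// lerDl divr_ge0// ltW.
Qed.

Let ln2 : (0 < ln 2 :> R) && (ln 2 <= 1 :> R).
Proof.
rewrite ln_gt0 ?ltr1n//=; have := @le_ln1Dx R 1; rewrite -[1 + 1]/(2 : R); apply; lra.
Qed.

Lemma lowf_gt0 p : 0 < lowf p.
Proof.
rewrite /lowf; case: eqP => h; last first.
  apply: divr_gt0; last by rewrite ltr_pwDl// sqr_ge0.
  by rewrite exprn_even_gt0//= subr_eq0 eq_sym; apply/eqP.
have /andP[l1 l2] := ln2; have d0 := dlt_gt0.
have dl := mulr_gt0 d0 l1; have pi2 := @pi_ge2 R.
have dl1 := ler_pM (ltW d0) (ltW l1) dlt_le l2.
have : cos (dlt * ln 2) < cos 0 by rewrite ltr_cos ?in_itv //=; apply/andP; split; lra.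
by rewrite cos0 subr_gt0.
Qed.

(** If |a| differs from 1, then 2 |a|/(1 + a^2) is below 1 and the cosine may be ignored. If |a| =
    1, the angle is at least dlt ln 2 and cosine decreases on [0, pi]. *)
Lemma osc_lowf p t : prime p -> dlt <= t <= 2 * dlt -> `|osc f t p| <= 1 - lowf p.
Proof.
move=> pp /andP[t1 t2]; have d0 := dlt_gt0.
have H : osc f t p = 2 * amp f p * cos (t * ln p%:R) / (1 + `|amp f p| ^+ 2).
  by rewrite /osc -amp_sqr// real_normK ?num_real.
have a0 := normr_ge0 (amp f p).
have D0 : 0 < 1 + `|amp f p| ^+ 2 by rewrite ltr_pwDl// sqr_ge0.
rewrite H normrM normfV (ger0_norm (ltW D0)) 2!normrM (ger0_norm (ler0n R 2)) /lowf.
case: eqP => h; last first.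
  have -> : 1 - (1 - `|amp f p|) ^+ 2 / (1 + `|amp f p| ^+ 2) = 2 * `|amp f p| / (1 + `|amp f p| ^+ 2).
    by field; rewrite gt_eqF.
  by rewrite ler_wpM2r ?invr_ge0 ?(ltW D0)// ler_piMr ?cos_max// mulr_ge0.
rewrite h expr1n mulr1 -[1 + 1]/(2 : R) mulrAC mulfV ?mul1r// subKr.
have p2 : ln 2 <= ln p%:R :> R by rewrite ler_ln ?posrE ?ler_nat ?prime_gt1 ?ltr0n ?prime_gt0.
have /andP[l1 l2] := ln2.
have lp : ln p%:R <= `|K1| / c.
  have := ampb pp; have -> : `|f p| / Num.sqrt p%:R = 1.
    by move: h; rewrite /amp normrM normfV (ger0_norm (sqrtr_ge0 _)).
  rewrite expr1n mul1r => E; have := expR_ge1Dx (c * ln p%:R).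
  by move=> h2; rewrite ler_pdivlMr// mulrC; have := ler_norm K1; lra.
have lp0 : 0 <= ln p%:R :> R by lra.
have up : t * ln p%:R <= 1.
  have k0 : 0 <= `|K1| / c by rewrite divr_ge0// ltW.
  have h2 : 2 * dlt * ln p%:R <= 1.
    rewrite /dlt invfM mulrA mulfV ?mul1r// mulrC ler_pdivrMr ?mul1r; last by rewrite ltr_pwDl.
    by lra.
  by apply: le_trans h2; rewrite ler_wpM2r.
have lo : dlt * ln 2 <= t * ln p%:R by apply: ler_pM => //; rewrite ltW.
have pi2 := @pi_ge2 R.
have dl2 : 0 <= dlt * ln 2 by rewrite mulr_ge0// ltW.
rewrite ger0_norm.
  rewrite leNgt ltr_cos ?in_itv //=; first by rewrite -leNgt.
  - by apply/andP; split; lra.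
  - by apply/andP; split; lra.
by apply: cos_ge0_pihalf; apply/andP; split; lra.
Qed.

Lemma osc_cont p : continuous ((osc f) ^~ p).
Proof.
move=> t; rewrite /osc; apply: cvgM; last exact: cvg_cst.
apply: cvgM; first exact: cvg_cst.
by apply: continuous_comp; [exact: mulrr_continuous | exact: continuous_cos].
Qed.

End oscillation.

Lemma laplace_arith {R : realType} (a1 a2 u1 u2 E0 z t e : R) : 0 <= E0 -> - z <= a1 - a2 ->
  a1 <= E0 * u1 -> u1 - u2 <= t -> z + E0 * t <= e -> a2 <= e + E0 * u2.
Proof. by move=> E00 h1 h2 h3 h4; have := ler_wpM2l E00 h3; lra. Qed.

Lemma frac_bound {R : realType} (C e : R) : 1 <= C -> 0 < e -> (C - 1) * (e / C) <= e.
Proof. by move=> C1 e0; rewrite mulrA ler_pdivrMr; nra. Qed.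

(** * Almost sure positivity of V *)

Section positivity.
Context {R : realType} {d : measure_display} {T : measurableType d} (P : probability T R).
Notation mu := (@lebesgue_measure R).
Variables (b : nat -> T -> R) (f : nat -> R) (m : T -> {measure set R -> \bar R}).
Hypothesis hb : rademacher_family P b.
Hypothesis mm : forall A : set R, measurable A -> measurable_fun [set: T] (fun w : T => (m w A : \bar R)).
Hypothesis mfin : forall w (a1 a2 : R), (m w `[a1, a2]%classic < +oo)%E.
Hypothesis mlim : forall (a1 a2 : R) (h : R -> R), {within `[a1, a2], continuous h} ->
     (fun y : nat =>
        (\int[P]_w
           ((\int[lebesgue_measure]_(s in `[a1, a2]) (h s * m_density f b y w s)
             - \int[m w]_(s in `[a1, a2]) h s) ^+ 2)%:E)%E)
     @ \oo --> 0%:E.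
Variables (c K1 : R).
Hypothesis c0 : 0 < c.
Hypothesis ampb : forall p, prime p -> (`|f p| / Num.sqrt p%:R) ^+ 3 * expR (c * ln p%:R) <= K1.
Implicit Types (n y N : nat) (w : T).

Let dl := dlt c K1.
Let d0 : 0 < dl. Proof. exact: dlt_gt0. Qed.
Let D : set R := `[dl, 2 * dl]%classic.
Let MI s x := massI D (osc f) s x.
Let low := lowf f c K1.
Let one : R -> R := fun=> 1.
Let one_c : continuous one. Proof. by move=> s; exact: cvg_cst. Qed.
Let one0 s : 0 <= one s. Proof. exact: ler01. Qed.
Let X w := XM m one dl (2 * dl) w.
Let Xy y w := XD b f one dl (2 * dl) y w.

Let mDm : measurable D. Proof. exact: measurable_itv. Qed.
Let fDm : (mu D < +oo)%E.
Proof. by rewrite lebesgue_measure_itv /=; case: ifP => // _; rewrite -EFinB ltry. Qed.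
Let low0 p : prime p -> 0 < low p. Proof. by move=> _; exact: lowf_gt0. Qed.
Let oscL p t : prime p -> D t -> `|osc f t p| <= 1 - low p.
Proof. by move=> pp; rewrite /D /= in_itv /= => h; apply: osc_lowf. Qed.
Let oscC p : continuous ((osc f) ^~ p). Proof. exact: osc_cont. Qed.

Let XyE y w : Xy y w = MI (pr y.+1) (b^~ w).
Proof.
apply: eq_Rintegral => t _; rewrite mul1r m_densityE// => p pp; exact: (b_pm hb).
Qed.

Let prP N p : p \in pr N -> prime p. Proof. exact: pr_prime. Qed.

Let Xy_ge0 y w : 0 <= Xy y w.
Proof. by apply: Rintegral_ge0 => t _; rewrite mul1r m_density_ge0. Qed.

Let X_ge0 w : 0 <= X w.
Proof. by apply: Rintegral_ge0. Qed.

Let cylM y Phi : deps (pr y.+1) Phi -> \int[P]_w Phi (b^~ w) = EE (pr y.+1) Phi.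
Proof. by apply: (cyl_mean hb); [exact: pr_uniq | exact: prP]. Qed.

Let depsS N N' (Phi : (nat -> R) -> R) : (N <= N')%N -> deps (pr N) Phi -> deps (pr N') Phi.
Proof.
move=> NN' dP x x' xx; apply: dP => p; rewrite mem_pr => /andP[pp pN].
by apply: xx; rewrite mem_pr pp (leq_trans pN).
Qed.

Let lap_meas (Y : T -> R) lam : measurable_fun [set: T] Y -> (forall w, 0 <= Y w) -> 0 <= lam ->
  bmeas (fun w => expR (- (lam * Y w))).
Proof.
move=> mY Y0 l0; split.
  apply: (measurableT_comp (f := @expR R)); first exact: measurable_expR.
  by apply: measurableT_comp => //; apply: measurable_funM.
exists 1 => w; rewrite ger0_norm ?expR_ge0// -[leRHS]expR0 ler_expR oppr_le0.
by rewrite mulr_ge0.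
Qed.

Let X_meas : measurable_fun [set: T] X.
Proof. exact: XM_meas. Qed.

Let compare_y N Phi : deps (pr N) Phi -> (forall x, (forall p, x p ^+ 2 = 1) -> 0 <= Phi x) ->
  exists2 rho : R, 0 < rho & forall lam y, 0 <= lam -> (N <= y.+1)%N ->
  \int[P]_w (Phi (b^~ w) * expR (- (lam * Xy y w))) <=
  \int[P]_w (Phi (b^~ w)) * \int[P]_w (expR (- (lam * rho * Xy y w))).
Proof.
move=> dP P0; exists ((\prod_(p <- pr N) low p) / 2 ^+ size (pr N)).
  by rewrite divr_gt0 ?exprn_gt0//; apply: (Lprod_gt0 low0); exact: prP.
move=> lam y l0 Ny; set rho := _ / _.
have E : pr y.+1 = [seq p <- pr y.+1 | ~~ (p < N)%N] ++ pr N.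
  rewrite -{1}(pr_restrict Ny); apply: (pr_cat (a := fun p => (p < N)%N)) => p q.
  exact: leq_ltn_trans.
set u := [seq p <- pr y.+1 | ~~ (p < N)%N] in E.
have dM : deps (pr y.+1) (fun x => Phi x * expR (- (lam * MI (pr y.+1) x))).
  by move=> x x' xx; rewrite (depsS Ny dP xx) /MI (deps_massI D (osc f) xx).
have dE : deps (pr y.+1) (fun x => expR (- (lam * rho * MI (pr y.+1) x))).
  by move=> x x' xx; rewrite /MI (deps_massI D (osc f) xx).
have -> : \int[P]_w (Phi (b^~ w) * expR (- (lam * Xy y w))) =
   \int[P]_w (Phi (b^~ w) * expR (- (lam * MI (pr y.+1) (b^~ w)))).
  by apply: eq_Rintegral => w _; rewrite XyE.
have -> : \int[P]_w (expR (- (lam * rho * Xy y w))) = \int[P]_w (expR (- (lam * rho * MI (pr y.+1) (b^~ w)))).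
  by apply: eq_Rintegral => w _; rewrite XyE.
rewrite (cylM dM) (cylM dE) (cylM (depsS Ny dP)) /MI E.
apply: (laplace_compare mDm fDm oscC low0 oscL) => //; rewrite -?E; first exact: pr_uniq.
exact: prP.
Qed.

Let lip_mean (Phi : (nat -> R) -> R) M lam y e : 0 <= lam -> bmeas (fun w => Phi (b^~ w)) ->
  (forall w, `|Phi (b^~ w)| <= M) ->
  P.-integrable [set: T] (EFin \o (fun w => Xy y w - X w)) -> \int[P]_w `|Xy y w - X w| <= e ->
  `|\int[P]_w (Phi (b^~ w) * expR (- (lam * Xy y w))) - \int[P]_w (Phi (b^~ w) * expR (- (lam * X w)))| <= M * lam * e.
Proof.
move=> l0 bP PM iD le.
have M0 : 0 <= M.
  have := le_mean (bmeas_integrable P (bmeas_norm bP)) (bmeas_integrable P (bmeas_cst M)) PM.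
  by rewrite mean_cst => h; apply: le_trans h; apply: Rintegral_ge0.
have b1 : bmeas (fun w => Phi (b^~ w) * expR (- (lam * Xy y w))).
  by apply: bmeasM => //; apply: lap_meas => //; case: (XD_bmeas f hb dl (2 * dl) y one_c).
have b2 : bmeas (fun w => Phi (b^~ w) * expR (- (lam * X w))).
  by apply: bmeasM => //; apply: lap_meas.
rewrite -RintegralB//; try exact: bmeas_integrable.
apply: (le_trans (norm_mean (bmeas_integrable P (bmeasB b1 b2)))).
have iN := integrable_norm iD.
have iR : P.-integrable [set: T] (EFin \o (fun w => M * lam * `|Xy y w - X w|)).
  rewrite (_ : EFin \o _ = (fun w => (M * lam)%:E * (`|Xy y w - X w|)%:E)%E); last first.
    by apply/funext => w; rewrite /= -EFinM.
  exact: integrableZl.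
apply: (@le_trans _ _ (\int[P]_w (M * lam * `|Xy y w - X w|))); last first.
  by rewrite RintegralZl// ler_wpM2l// mulr_ge0.
apply: le_mean => //; first exact: bmeas_integrable (bmeas_norm (bmeasB b1 b2)).
move=> w; rewrite -mulrBr normrM -mulrA; apply: ler_pM => //.
have lx := mulr_ge0 l0 (Xy_ge0 y w); have lX := mulr_ge0 l0 (X_ge0 w).
have -> : lam * `|Xy y w - X w| = `|lam * Xy y w - lam * X w|.
  by rewrite -mulrBr normrM (ger0_norm l0).
have [h|/ltW h] := leP (lam * Xy y w) (lam * X w).
  have /andP[h1 h2] := expRN_lip lx h; rewrite ger0_norm//.
  by rewrite -normrN opprB ger0_norm// subr_ge0.
have /andP[h1 h2] := expRN_lip lX h.
by rewrite -normrN opprB ger0_norm// ger0_norm// subr_ge0.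
Qed.

(** The indicator of X = 0 is not continuous in X, so it cannot be followed as y tends to infinity.
    The comparison is made for Laplace transforms, which are Lipschitz in X, with a loss rho that
    depends on Phi but not on y or k. *)
Let compare_lim N Phi : deps (pr N) Phi -> (forall x, (forall p, x p ^+ 2 = 1) -> 0 <= Phi x) ->
  exists2 rho : R, 0 < rho & forall k : R, 0 <= k ->
  \int[P]_w (Phi (b^~ w) * expR (- (k * X w))) <=
  \int[P]_w (Phi (b^~ w)) * \int[P]_w (expR (- (k * rho * X w))).
Proof.
move=> dP P0; have [rho r0 H] := compare_y dP P0; exists rho => // k k0.
have bP : bmeas (fun w => Phi (b^~ w)) by apply: (cyl_bmeas hb (pr_uniq N)) => //; exact: prP.
have [_ [M PM]] := bP.
have kr : 0 <= k * rho by exact: mulr_ge0 k0 (ltW r0).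
have M0 : 0 <= M.
  have := le_mean (bmeas_integrable P (bmeas_norm bP)) (bmeas_integrable P (bmeas_cst M)) PM.
  by rewrite mean_cst => h; apply: le_trans h; apply: Rintegral_ge0.
set E0 := \int[P]_w (Phi (b^~ w)).
have E00 : 0 <= E0.
  by rewrite /E0 (cyl_mean hb (pr_uniq N) _ dP) ?EE_ge0//; exact: prP.
(* One plus the Lipschitz constants of both sides, so that an L^1 error of e/C costs at most e. *)
pose C := 1 + M * k + E0 * (k * rho).
have C1 : 1 <= C by rewrite /C; have := mulr_ge0 M0 k0; have := mulr_ge0 E00 kr; lra.
apply/ler_addgt0Pl => e e0; have eC : 0 < e / C by rewrite divr_gt0//; lra.
have [y0 Hy] := L1_lim hb mm mlim dl (2 * dl) one_c one0 eC.
pose y := maxn y0 N; have [iD le] := Hy y (leq_maxl _ _).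
have Ny : (N <= y.+1)%N by rewrite (leq_trans (leq_maxr y0 N)).
have h1 := lip_mean k0 bP PM iD le.
have b1 : bmeas (fun w => (fun=> 1 : R) (b^~ w)) by exact: bmeas_cst.
have n1 w : `|(fun _ : nat -> R => 1 : R) (b^~ w)| <= 1 by rewrite normr1.
have h2 := @lip_mean (fun=> 1) 1 (k * rho) y (e / C) kr b1 n1 iD le.
have h3 := H k y k0 Ny.
set a1 := \int[P]_w (Phi _ * expR (- (k * Xy y w))) in h1 h3.
set a2 := \int[P]_w (Phi _ * expR (- (k * X w))) in h1 *.
have F (Z : T -> R) : \int[P]_w (1 * Z w) = \int[P]_w Z w by apply: eq_Rintegral => w _; rewrite mul1r.
rewrite !F in h2; set u1 := \int[P]_w expR (- (k * rho * Xy y w)) in h2 h3.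
set u2 := \int[P]_w expR (- (k * rho * X w)) in h2 *.
move: h1 h2; rewrite !ler_norml mul1r => /andP[h1 _] /andP[_ h2].

have h5 : M * k * (e / C) + E0 * (k * rho * (e / C)) <= e.
  have -> : M * k * (e / C) + E0 * (k * rho * (e / C)) = (C - 1) * (e / C) by rewrite /C; ring.
  exact: frac_bound.
exact: laplace_arith E00 h1 h3 h2 h5.
Qed.

Let iA w : R := (X w == 0)%:R.
Let iA_bmeas : bmeas iA.
Proof.
rewrite (_ : iA = \1_(X @^-1` [set 0])); last first.
  apply/funext => w; rewrite /iA indicE; case: eqP => h; first by rewrite mem_set.
  by rewrite memNset.
split; first by apply: measurable_indic; rewrite -[_ @^-1` _]setTI; exact: X_meas.
by exists 1 => w; rewrite indicE; case: (_ \in _); rewrite ?normr1 ?normr0.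
Qed.

(** The limit is the probability of X = 0 for every rho > 0; the loss in the comparison of Laplace
    transforms thus disappears. *)
Let lap_cvg (rho : R) : 0 < rho ->
  (fun n : nat => \int[P]_w (expR (- (n%:R * rho * X w)))) @ \oo --> \int[P]_w iA w.
Proof.
move=> r0; pose F (n : nat) w := (expR (- (n%:R * rho * X w)))%:E.
have Fb n : bmeas (fun w => expR (- (n%:R * rho * X w))).
  by apply: lap_meas => //; exact: mulr_ge0 (ler0n R n) (ltW r0).
have mF n : measurable_fun [set: T] (F n) by apply/measurable_EFinP; case: (Fb n).
have miA : measurable_fun [set: T] (EFin \o iA) by apply/measurable_EFinP; case: iA_bmeas.
have cv : {ae P, forall w, [set: T] w -> F ^~ w @ \oo --> (EFin \o iA) w}.
  apply: aeW => w _; rewrite /F /=; apply: cvg_EFin; first exact: nearW.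
  rewrite /iA; case: eqP => h.
    by apply: cvg_near_cst; apply: nearW => n; rewrite /= h mulr0 oppr0 expR0.
  have X0 : 0 < X w by rewrite lt_neqAle X_ge0 andbT eq_sym; apply/eqP.
  have rX : 0 < rho * X w by rewrite mulr_gt0.
  pose q := Num.min 1 (rho * X w); have q0 : 0 < q by rewrite lt_min ltr01.
  apply: (@cvg0_inv_dom _ _ q^-1) => n /=; rewrite ger0_norm ?expR_ge0//.
  rewrite expRN -invfM lef_pV2 ?posrE ?expR_gt0 ?mulr_gt0 ?ltr0n//.
  apply: le_trans (expR_ge1Dx _); rewrite -(natr1 n) mulrDr mulr1 addrC.
  have q1 : q <= 1 by rewrite ge_min lexx.
  have q2 : q <= rho * X w by rewrite ge_min lexx orbT.
  by rewrite lerD// mulrC -mulrA ler_wpM2l.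
pose u1 w : R := 1.
have i1 : P.-integrable [set: T] (EFin \o u1) by exact: bmeas_integrable (bmeas_cst _).
have dom : {ae P, forall w n, [set: T] w -> (`|F n w| <= (EFin \o u1) w)%E}.
  apply: aeW => w n _; rewrite /F /= lee_fin ger0_norm ?expR_ge0// -[leRHS]expR0 ler_expR oppr_le0.
  by rewrite mulr_ge0// mulr_ge0// ltW.
have [_ _ h] := dominated_convergence measurableT mF miA cv i1 dom.
have fin : (\int[P]_w ((EFin \o iA) w))%E \is a fin_num.
  by apply: integrable_fin_num => //; exact: bmeas_integrable.
apply: fine_cvg; rewrite fineK//.
Qed.

Let A_indep N Phi : deps (pr N) Phi -> (forall x, (forall p, x p ^+ 2 = 1) -> 0 <= Phi x) ->
  \int[P]_w (Phi (b^~ w) * iA w) <= \int[P]_w (Phi (b^~ w)) * \int[P]_w iA w.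
Proof.
move=> dP P0; have [rho r0 H] := compare_lim dP P0.
have bP : bmeas (fun w => Phi (b^~ w)) by apply: (cyl_bmeas hb (pr_uniq N)) => //; exact: prP.
have cv : (fun n : nat => \int[P]_w (Phi (b^~ w)) * \int[P]_w (expR (- (n%:R * rho * X w)))) @ \oo -->
   \int[P]_w (Phi (b^~ w)) * \int[P]_w iA w.
  by apply: cvgM; [exact: cvg_cst | exact: lap_cvg].
apply/ler_addgt0Pl => e e0; have /cvgrPdist_lt/(_ e e0) [n _ Hn] := cv.
have := Hn n (leqnn n); rewrite /= ltr_norml => /andP[h1 h2].
have h3 := H n%:R (ler0n R n).
suff : \int[P]_w (Phi (b^~ w) * iA w) <= \int[P]_w (Phi (b^~ w) * expR (- (n%:R * X w))) by lra.
apply: le_mean.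
- exact: bmeas_integrable (bmeasM bP iA_bmeas).
- by apply: bmeas_integrable; apply: bmeasM => //; apply: lap_meas.
move=> w; have Pw : 0 <= Phi (b^~ w).
  pose x p := if prime p then b p w else 1.
  have -> : Phi (b^~ w) = Phi x.
    by apply: dP => p; rewrite mem_pr => /andP[pp _]; rewrite /x pp.
  apply: P0 => p; rewrite /x; case: ifP => pp; last by rewrite expr1n.
  by have [->|->] := b_pm hb pp w; rewrite ?sqrrN expr1n.
rewrite ler_wpM2l// /iA; case: eqP => h; last exact: expR_ge0.
by rewrite h mulr0 oppr0 expR0.
Qed.

Let A_null : \int[P]_w iA w = 0.
Proof.
set a := \int[P]_w iA w.
have a0 : 0 <= a by apply: Rintegral_ge0 => w _; rewrite /iA; case: eqP.
apply/eqP; rewrite eq_le a0 andbT -(ler_pM2l d0) mulr0; apply/ler_addgt0Pl => e e0; rewrite addr0.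
have [y Hy] := L1_lim hb mm mlim dl (2 * dl) one_c one0 e0.
have [iD le] := Hy y (leqnn _).
have bX : bmeas (Xy y) by exact: (XD_bmeas f hb dl (2 * dl) y one_c).
(* Each factor of the density is at most 2 and the interval has length [dl], so this bounds the mass
   at level y and makes [Phi] nonnegative. *)
pose C := 2 ^+ size (pr y.+1) * dl.
pose Phi x := C - MI (pr y.+1) x.
have dP : deps (pr y.+1) Phi by move=> x x' xx; rewrite /Phi /MI (deps_massI D (osc f) xx).
have dlE : \int[mu]_(s in D) 1 = dl.
  have l2 : dl <= 2 * dl by have := d0; lra.
  rewrite (@FTC_is_derive R id (fun=> 1) dl (2 * dl) l2 (fun x => is_derive_id x 1) one_c); ring.
have P0 x : (forall p, x p ^+ 2 = 1) -> 0 <= Phi x.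
  move=> x1; rewrite subr_ge0 /C -dlE -RintegralZl//; last first.
    by apply: integrable_h; exact: one_c.
  apply: le_Rintegral => //.
  - by apply: (prodo_int mDm fDm oscC low0 oscL) => //; exact: prP.
  - by apply: integrable_h => s; exact: cvg_cst.
  - by move=> t Dt; rewrite mulr1; have /andP[] := prodo_bounds low0 oscL (@prP y.+1) x1 Dt.
have h := A_indep dP P0.
have E1 : \int[P]_w Phi (b^~ w) = C - dl.
  transitivity (\int[P]_w (C - Xy y w)); first by apply: eq_Rintegral => w _; rewrite XyE.
  rewrite RintegralB//; [|exact: bmeas_integrable (bmeas_cst C)|exact: bmeas_integrable].
  by rewrite mean_cst (XD_mean f hb) ?dlE.
have E2 : \int[P]_w (Phi (b^~ w) * iA w) = C * a - \int[P]_w (Xy y w * iA w).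
  transitivity (\int[P]_w (C * iA w - Xy y w * iA w)).
    by apply: eq_Rintegral => w _; rewrite XyE /Phi mulrBl.
  rewrite RintegralB//; last 2 first.
  - exact/bmeas_integrable/bmeasZ.
  - exact/bmeas_integrable/bmeasM.
  by rewrite RintegralZl//; exact: bmeas_integrable.
have h2 : \int[P]_w (Xy y w * iA w) <= e.
  apply: le_trans le; apply: le_mean; [exact/bmeas_integrable/bmeasM | exact: (integrable_norm iD) |] => w.
  rewrite /iA -/(X w); case: eqP => Xw; last by rewrite mulr0.
  by rewrite /Xy -/(X w) Xw mulr1 subr0 ler_norm.
rewrite E1 E2 in h; move: h h2; rewrite -/a; move: (\int[P]_w _) => z; lra.
Qed.

(** On [dl, 2 dl] the Cauchy kernel is at least its value at the right end, so V is at least a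
    positive constant times X, and X vanishes only on a null set. *)
Lemma V_pos : {ae P, forall w, (0 < V_infty m w)%E}.
Proof.
pose Z := X @^-1` [set 0]; have mZ : measurable Z by rewrite /Z -[_ @^-1` _]setTI; exact: X_meas.
have PZ : P Z = 0.
  have := A_null; rewrite (_ : \int[P]_w iA w = \int[P]_w (\1_Z w)); last first.
    apply: eq_Rintegral => w _; rewrite /iA indicE; case: eqP => h; first by rewrite mem_set.
    by rewrite memNset.
  rewrite /Rintegral integral_indic// setIT => h.
  by rewrite -(fineK (fin_num_measure P _ mZ)) h.
exists Z; split => // w /= h; apply: contrapT => Zw; apply: h.
have X0 : 0 < X w by rewrite lt_neqAle X_ge0 andbT eq_sym; apply/eqP.
pose k0 : R := (4^-1 + (2 * dl) ^+ 2)^-1.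
have k00 : 0 < k0 by rewrite invr_gt0 ltr_wpDr// sqr_ge0.
have tp0 : 0 < (2 * pi)^-1 :> R by rewrite invr_gt0 mulr_gt0// pi_gt0.
apply: (@lt_le_trans _ _ ((2 * pi)^-1 * (k0 * X w))%:E).
  by rewrite lte_fin; apply: mulr_gt0 => //; exact: mulr_gt0.
rewrite /V_infty EFinM lee_pmul2l ?lte_fin//.
have iX := XM_int mfin dl (2 * dl) w one_c.
rewrite /X /XM -RintegralZl//.
have ik : (m w).-integrable `[dl, (2 * dl)] (EFin \o (fun x => k0 * one x)).
  rewrite (_ : EFin \o _ = (fun x => k0%:E * (EFin \o one) x)%E); last by apply/funext => x; rewrite /= -EFinM.
  exact: integrableZl.
rewrite fineK; last exact: (integrable_fin_num _ ik).
have mw : measurable_fun [set: R] (fun s : R => ((@cauchy_w R s)%:E)).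
  by apply/measurable_EFinP; apply: continuous_measurable_fun; exact: continuous_w.
apply: (@le_trans _ _ (\int[m w]_(s in `[dl, (2 * dl)%R]) (@cauchy_w R s)%:E)%E).
  apply: ge0_le_integral => //.
  - by move=> x _; rewrite lee_fin /one mulr1 ltW.
  - by case/integrableP: ik.
  - by apply: measurable_funTS.
  - move=> x; rewrite /= in_itv /= => /andP[x1 x2]; rewrite lee_fin /one mulr1 /k0 /cauchy_w.
    have x0 : 0 <= x by apply: le_trans x1; exact: ltW.
    rewrite lef_pV2 ?posrE ?lerD2l ?cauchy_den_gt0//; rewrite lerXn2r ?nnegrE//.
    exact: le_trans x2.
apply: ge0_subset_integral => //.
by move=> x _; rewrite lee_fin ltW// invr_gt0 cauchy_den_gt0.
Qed.

End positivity.

(** * Approximation of F_infty-measurable variables by cylinder functions *)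

Section cylinder_density.
Context {R : realType} {d : measure_display} {T : measurableType d} (P : probability T R).
Variable b : nat -> T -> R.
Hypothesis hb : rademacher_family P b.
Implicit Types (Phi Psi : (nat -> R) -> R) (Y Z : T -> R) (N : nat).

Lemma depsS N N' Phi : (N <= N')%N -> deps (pr N) Phi -> deps (pr N') Phi.
Proof.
move=> NN' dP x x' xx; apply: dP => p; rewrite mem_pr => /andP[pp pN].
by apply: xx; rewrite mem_pr pp (leq_trans pN).
Qed.

Lemma cyl_bmeas_pr N Phi : deps (pr N) Phi -> bmeas (fun w => Phi (b^~ w)).
Proof. by move=> dP; apply: (cyl_bmeas hb (pr_uniq N)) => // p /pr_prime. Qed.

Lemma meanZ (c : R) Y : P.-integrable [set: T] (EFin \o Y) -> \int[P]_w (c * Y w) = c * \int[P]_w Y w.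
Proof. by move=> iY; rewrite RintegralZl. Qed.

Lemma mean0 Y : (forall w, Y w = 0) -> \int[P]_w Y w = 0.
Proof. by move=> Y0; rewrite -[RHS](mean_cst P); apply: eq_Rintegral => w _; exact: Y0. Qed.

Definition approximable Y := bmeas Y /\ forall e : R, 0 < e -> exists N Phi, exists M : R,
  [/\ deps (pr N) Phi, forall x, `|Phi x| <= M & \int[P]_w `|Y w - Phi (b^~ w)| <= e].

(** Keeping approximants in [0, 1] makes the class stable under complements and unions, through 1 -
    Phi and 1 - (1 - Phi)(1 - Psi). *)
Definition approx_set (A : set T) := measurable A /\ forall e : R, 0 < e -> exists N Phi,
  [/\ deps (pr N) Phi, forall x, 0 <= Phi x <= 1 & \int[P]_w `|\1_A w - Phi (b^~ w)| <= e].

Let bmeas_indic (A : set T) : measurable A -> bmeas (\1_A : T -> R).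
Proof.
move=> mA; split; first exact: measurable_indic.
by exists 1 => w; rewrite indicE; case: (_ \in _); rewrite ?normr1 ?normr0.
Qed.

Lemma approx_setP A : approx_set A -> approximable (\1_A).
Proof.
move=> [mA H]; split; first exact: bmeas_indic.
move=> e /H[N [Phi [dP bP le]]]; exists N, Phi, 1; split=> // x.
by have /andP[h1 h2] := bP x; rewrite ger0_norm.
Qed.

Let mean_le2 Y Z1 Z2 (e1 e2 : R) : bmeas Y -> bmeas Z1 -> bmeas Z2 -> (forall w, `|Y w| <= `|Z1 w| + `|Z2 w|) ->
  \int[P]_w `|Z1 w| <= e1 -> \int[P]_w `|Z2 w| <= e2 -> \int[P]_w `|Y w| <= e1 + e2.
Proof.
move=> bY b1 b2 H h1 h2; apply: le_trans (lerD h1 h2).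
rewrite -meanD; try exact: bmeas_integrable (bmeas_norm _).
by apply: le_mean => //; apply: bmeas_integrable; [exact: bmeas_norm | exact: bmeasD (bmeas_norm b1) (bmeas_norm b2)].
Qed.

Lemma approx_setU A B : approx_set A -> approx_set B -> approx_set (A `|` B).
Proof.
move=> [mA HA] [mB HB]; split; first exact: measurableU.
move=> e e0; have e2 : 0 < e / 2 by rewrite divr_gt0.
have [N [Phi [dP bP lP]]] := HA _ e2; have [N' [Psi [dQ bQ lQ]]] := HB _ e2.
have dP' := depsS (leq_maxl N N') dP; have dQ' := depsS (leq_maxr N N') dQ.
exists (maxn N N'), (fun x => 1 - (1 - Phi x) * (1 - Psi x)); split.
- by move=> x x' xx; rewrite (dP' _ _ xx) (dQ' _ _ xx).
- move=> x; have /andP[p0 p1] := bP x; have /andP[q0 q1] := bQ x.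
  have h : 0 <= (1 - Phi x) * (1 - Psi x) by apply: mulr_ge0; rewrite subr_ge0.
  have h' : (1 - Phi x) * (1 - Psi x) <= 1 by rewrite mulr_ile1// ?subr_ge0// gerBl.
  by rewrite subr_ge0 h' gerBl h.
rewrite (splitr e); apply: mean_le2 lP lQ.
- apply: bmeasB; first exact: bmeas_indic (measurableU _ _ mA mB).
  apply: bmeasB (bmeas_cst _) _.
  apply: bmeasM; apply: bmeasB (bmeas_cst _) _; first exact: cyl_bmeas_pr dP.
  exact: cyl_bmeas_pr dQ.
- by apply: bmeasB; [exact: bmeas_indic | exact: cyl_bmeas_pr dP].
- by apply: bmeasB; [exact: bmeas_indic | exact: cyl_bmeas_pr dQ].
move=> w; have /andP[p0 p1] := bP (b^~ w); have /andP[q0 q1] := bQ (b^~ w).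
have E : \1_(A `|` B) w = 1 - (1 - \1_A w) * (1 - \1_B w) :> R.
  rewrite !indicE in_setU; case: (w \in A); case: (w \in B) => /=; ring.
have b01 : 0 <= (\1_B w : R) <= 1 by rewrite indicE; case: (w \in B); rewrite ?ler01 ?lexx.
move: b01 p0 p1; rewrite E; move: (\1_A w) (\1_B w) (Phi _) (Psi _) => a a' p q /andP[b0 b1] p0 p1.
have -> : 1 - (1 - a) * (1 - a') - (1 - (1 - p) * (1 - q)) = (a - p) * (1 - a') + (a' - q) * (1 - p) by ring.
apply: (le_trans (ler_normD _ _)); rewrite !normrM; apply: lerD; apply: ler_piMr => //.
  by rewrite ger0_norm; lra.
by rewrite ger0_norm; lra.
Qed.

Let approx0 : approx_set set0.
Proof.
split=> // e e0; exists 0%N, (fun=> 0); split => //.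
- by move=> x; rewrite lexx ler01.
by rewrite mean0 ?ltW// => w; rewrite indic0 subrr normr0.
Qed.

(** A countable union is exhausted in probability by finite ones, which are approximable by
    induction. *)
Lemma approx_sigma : sigma_algebra setT approx_set.
Proof.
split => [||A_ HA]; first exact: approx0.
- move=> A [mA HA]; split; first exact: measurableD.
  move=> e /HA[N [Phi [dP bP le]]]; exists N, (fun x => 1 - Phi x); split.
  + by move=> x x' xx; rewrite (dP _ _ xx).
  + by move=> x; have /andP[h1 h2] := bP x; apply/andP; split; lra.
  apply: le_trans le; rewrite le_eqVlt; apply/orP; left; apply/eqP; apply: eq_Rintegral => w _.
  have -> : \1_([set: T] `\` A) w = 1 - \1_A w :> R.
    by rewrite !indicE in_setD in_setT; case: (w \in A); rewrite ?subr0 ?subrr.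
  by move: (\1_A w) (Phi _) => a p; rewrite -[RHS]normrN; congr `|_|; ring.
have mU : measurable (\bigcup_k A_ k) by apply: bigcup_measurable => k _; case: (HA k).
split=> // e e0; have e2 : 0 < e / 2 by rewrite divr_gt0.
pose F n := \big[setU/set0]_(i < n.+1) A_ i.
have HF n : approx_set (F n).
  rewrite /F; elim: n.+1 => [|k IH]; first by rewrite big_ord0.
  by rewrite big_ord_recr /=; exact: approx_setU.
have mF n : measurable (F n) by case: (HF n).
have UF : \bigcup_n F n = \bigcup_k A_ k by exact: bigcup_bigsetU_bigcup.
have cv : P \o F @ \oo --> P (\bigcup_k A_ k).
  rewrite -UF; apply: nondecreasing_cvg_mu => //; first by rewrite UF.
  by move=> i j ij; apply/subsetPset; exact: subset_bigsetU.
have [n Pn] : exists n, fine (P (\bigcup_k A_ k)) - fine (P (F n)) <= e / 2.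
  have fU : P (\bigcup_k A_ k) \is a fin_num by exact: fin_num_measure.
  move: cv; rewrite -(fineK fU) => /fine_cvgP[_] /cvgrPdist_lt/(_ _ e2)[n _ /(_ n (leqnn n)) /= h].
  by exists n; rewrite (le_trans (ler_norm _))// ltW.
have [_ /(_ _ e2)[N [Phi [dP bP le]]]] := HF n.
exists N, Phi; split=> //.
have FU : F n `<=` \bigcup_k A_ k by rewrite -UF; exact: bigcup_sup.
have b1 := bmeas_indic mU; have b2 := bmeas_indic (mF n).
rewrite (splitr e); apply: (@mean_le2 _ (fun w => \1_(\bigcup_k A_ k) w - \1_(F n) w) (fun w => \1_(F n) w - Phi (b^~ w))) le.
- by apply: bmeasB => //; exact: cyl_bmeas_pr dP.
- exact: bmeasB.
- by apply: bmeasB => //; exact: cyl_bmeas_pr dP.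
- move=> w; rewrite (_ : _ - Phi _ = (\1_(\bigcup_k A_ k) w - \1_(F n) w) + (\1_(F n) w - Phi (b^~ w))); last by ring.
  exact: ler_normD.
rewrite (_ : \int[P]_w _ = \int[P]_w (\1_(\bigcup_k A_ k) w - \1_(F n) w)); last first.
  apply: eq_Rintegral => w _; rewrite ger0_norm// !indicE; case: (boolP (w \in F n)) => wF.
    by rewrite (_ : w \in _ = true) ?subrr//; apply/mem_set/FU; rewrite inE in wF.
  by rewrite subr0.
rewrite RintegralB//; try exact: bmeas_integrable.
by rewrite /Rintegral !integral_indic// !setIT.
Qed.

Lemma F_infty_approx A : F_infty b A -> approx_set A.
Proof.
apply: (smallest_sub approx_sigma) => _ [p [B [pp mB ->]]].
have mA : measurable (b p @^-1` B).
  by case: hb => mb _ _ _; rewrite -[_ @^-1` _]setTI; apply: mb.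
split=> // e e0; exists p.+1, (fun x => \1_B (x p)); split.
- by move=> x x' xx; rewrite xx// mem_pr pp /=.
- by move=> x; rewrite indicE; case: (_ \in _); rewrite ?ler01 ?lexx.
by rewrite mean0 ?ltW// => w; rewrite (_ : \1_(b p @^-1` B) w = \1_B (b p w)) ?subrr ?normr0.
Qed.

Lemma approximableD Y Z : approximable Y -> approximable Z -> approximable (fun w => Y w + Z w).
Proof.
move=> [bY HY] [bZ HZ]; split; first exact: bmeasD.
move=> e e0; have e2 : 0 < e / 2 by rewrite divr_gt0.
have [N [Phi [M [dP bP lP]]]] := HY _ e2; have [N' [Psi [M' [dQ bQ lQ]]]] := HZ _ e2.
have dP' := depsS (leq_maxl N N') dP; have dQ' := depsS (leq_maxr N N') dQ.
exists (maxn N N'), (fun x => Phi x + Psi x), (M + M'); split.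
- by move=> x x' xx; rewrite (dP' _ _ xx) (dQ' _ _ xx).
- by move=> x; apply: le_trans (ler_normD _ _) _; exact: lerD.
rewrite (splitr e); apply: mean_le2 lP lQ.
- apply: bmeasB; apply: bmeasD => //; [exact: cyl_bmeas_pr dP | exact: cyl_bmeas_pr dQ].
- by apply: bmeasB => //; exact: cyl_bmeas_pr dP.
- by apply: bmeasB => //; exact: cyl_bmeas_pr dQ.
by move=> w; rewrite opprD addrACA; exact: ler_normD.
Qed.

Lemma approximable_cst (k : R) : approximable (fun=> k).
Proof.
split; first exact: bmeas_cst.
move=> e e0; exists 0%N, (fun=> k), `|k|; split => //.
by rewrite mean0 ?ltW// => w; rewrite subrr normr0.
Qed.

Lemma approximableZ (k : R) Y : approximable Y -> approximable (fun w => k * Y w).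
Proof.
move=> [bY HY]; split; first exact: bmeasZ.
move=> e e0; have k1 : 0 < `|k| + 1 by rewrite ltr_wpDl.
have ek : 0 < e / (`|k| + 1) by rewrite divr_gt0.
have [N [Phi [M [dP bP lP]]]] := HY _ ek.
exists N, (fun x => k * Phi x), (`|k| * M); split.
- by move=> x x' xx; rewrite (dP _ _ xx).
- by move=> x; rewrite normrM ler_wpM2l.
have bD : bmeas (fun w => `|Y w - Phi (b^~ w)|).
  by apply/bmeas_norm/bmeasB => //; exact: cyl_bmeas_pr dP.
rewrite (_ : \int[P]_w _ = `|k| * \int[P]_w `|Y w - Phi (b^~ w)|); last first.
  rewrite -meanZ; last exact: bmeas_integrable.
  by apply: eq_Rintegral => w _; rewrite -normrM mulrBr.
move: lP; rewrite ler_pdivlMr// => lP; apply: le_trans lP; rewrite [leRHS]mulrC ler_wpM2r//.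
  exact: Rintegral_ge0.
by rewrite lerDl.
Qed.

Lemma approximable_lim Y : bmeas Y -> (forall e : R, 0 < e -> exists2 Z, approximable Z & forall w, `|Y w - Z w| <= e) ->
  approximable Y.
Proof.
move=> bY H; split=> // e e0; have e2 : 0 < e / 2 by rewrite divr_gt0.
have [Z [bZ HZ] YZ] := H _ e2; have [N [Phi [M [dP bP lP]]]] := HZ _ e2.
exists N, Phi, M; split=> //; rewrite (splitr e).
apply: (@mean_le2 _ (fun w => Y w - Z w)) lP.
- by apply: bmeasB => //; exact: cyl_bmeas_pr dP.
- exact: bmeasB.
- by apply: bmeasB => //; exact: cyl_bmeas_pr dP.
- move=> w; rewrite (_ : _ - Phi _ = (Y w - Z w) + (Z w - Phi (b^~ w))); last by ring.
  exact: ler_normD.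
rewrite -[leRHS](mean_cst P); apply: le_mean => //; apply: bmeas_integrable; last exact: bmeas_cst.
exact/bmeas_norm/bmeasB.
Qed.

(** Y is peeled in layers of height del: induction applies to (Y - del)_+, and the indicator of Y >=
    del supplies the bottom layer. The claim 0 <= Z is carried along because it forces the inductive
    part to vanish where Y < del. *)
Let layers (del : R) k : 0 < del -> forall Y, (forall B : set R, measurable B -> F_infty b (Y @^-1` B)) ->
  (forall w, 0 <= Y w <= k%:R * del) ->
  exists2 Z, approximable Z & forall w, 0 <= Z w /\ 0 <= Y w - Z w <= del.
Proof.
move=> d0; elim: k => [|k IH] Y FY bY.
  exists (fun=> 0); first exact: approximable_cst.
  by move=> w; have := bY w; rewrite mul0r => /andP[h1 h2]; rewrite subr0 h1 (le_trans h2)// ltW.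
pose g (x : R) : R := Num.max (x - del) 0.
have mg : measurable_fun [set: R] g.
  by apply: measurable_maxr => //; exact: measurable_funB.
have [||Z aZ HZ] := IH (g \o Y).
- move=> B mB; rewrite comp_preimage; apply: FY; rewrite -[_ @^-1` _]setTI; exact: mg.
- move=> w; have := bY w; rewrite -natr1 mulrDl mul1r /g /= le_max lexx orbT ge_max /= => /andP[h1 h2].
  by rewrite lerBlDr h2 mulr_ge0// ltW.
have mI : measurable (`[del, +oo[%classic : set R) by exact: measurable_itv.
have aA := F_infty_approx (FY _ mI).
exists (fun w => del * \1_(Y @^-1` `[del, +oo[%classic) w + Z w).
  by apply: approximableD => //; apply: approximableZ; exact: approx_setP.
move=> w; have [Z0 /andP[]] := HZ w; have /andP[Y0 _] := bY w.
rewrite /g /= indicE; case: (leP del (Y w)) => h.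
  rewrite mem_set /=; last by rewrite in_itv /= h.
  rewrite max_l ?subr_ge0// mulr1 => h1 h2; split; first by rewrite addr_ge0// ltW.
  by apply/andP; split; lra.
rewrite memNset /=; last by rewrite in_itv /= andbT; apply/negP; rewrite -ltNge.
rewrite max_r ?subr_le0 ?(ltW h)// mulr0 => h1 h2; split; first by lra.
by apply/andP; split; lra.
Qed.

Lemma F_infty_approximable Y : (forall B : set R, measurable B -> F_infty b (Y @^-1` B)) ->
  bounded_realfun Y -> approximable Y.
Proof.
move=> FY [M YM].
have bY : bmeas Y.
  split; last by exists M.
  by move=> _ B mB; rewrite setTI; case: (F_infty_approx (FY B mB)).
apply: approximable_lim => // e e0.
pose k := (truncn ((M + M) / e)).+1.
have FY' (B : set R) : measurable B -> F_infty b ((fun w => Y w + M) @^-1` B).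
  move=> mB; have -> : (fun w => Y w + M) @^-1` B = Y @^-1` ((fun x : R => x + M) @^-1` B) by [].
  apply: FY; rewrite -[_ @^-1` _]setTI.
  have mg : measurable_fun [set: R] (fun x : R => x + M) by exact: measurable_funD.
  exact: mg.
have kb w : 0 <= Y w + M <= k%:R * e.
  have := YM w; rewrite ler_norml => /andP[h1 h2]; apply/andP; split; first by lra.
  rewrite -ler_pdivrMr// ltW// (le_lt_trans _ (truncnS_gt _))// ler_pM2r ?invr_gt0//; lra.
have [Z aZ HZ] := layers e0 FY' kb.
exists (fun w => Z w + - M); first exact: approximableD (approximable_cst _).
move=> w; have [_ /andP[h1 h2]] := HZ w; rewrite ger0_norm; lra.
Qed.

End cylinder_density.

(** * Gaussian means with a given variance *)

Section gaussian_mixture.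
Context {R : realType}.
Notation mu := (@lebesgue_measure R).
Notation N := (normal_prob (0 : R) 1).
Implicit Types (h f : R -> R) (a t phi M : R).

Lemma bmeas_continuous h M : continuous h -> (forall x : R, `|h x| <= M) -> bmeas h.
Proof. by move=> ch hM; split; [exact: continuous_measurable_fun | exists M]. Qed.

Lemma normal_mean h : bmeas h -> \int[N]_g h g = \int[mu]_g (h g * normal_pdf 0 1 g).
Proof.
move=> bh; have /integrableP[mh fh] := bmeas_integrable N bh.
by rewrite /Rintegral (integral_normal01 mh fh).
Qed.

Definition gm h a := \int[N]_g h (Num.sqrt a * g).

Let scale_cont h a : continuous h -> continuous (fun g : R => h (a * g)).
Proof.
move=> ch x; apply: (@continuous_comp _ _ _ (fun g : R => a * g) h); last exact: ch.
exact: mulrl_continuous.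
Qed.

Lemma gm_bmeas h a M : continuous h -> (forall x : R, `|h x| <= M) ->
  bmeas (fun g : R => h (Num.sqrt a * g)).
Proof. by move=> ch hM; apply: (@bmeas_continuous _ M) => //; exact: scale_cont. Qed.

Let cos_lin_cont t phi : continuous (fun x : R => cos (t * x + phi)).
Proof.
move=> x; apply: (@continuous_comp _ _ _ (fun g : R => t * g + phi) cos); last exact: continuous_cos.
by apply: cvgD; [exact: mulrl_continuous | exact: cvg_cst].
Qed.

Let cosb t phi a : bmeas (fun g : R => cos (t * (Num.sqrt a * g) + phi)).
Proof.
apply: (@gm_bmeas (fun x => cos (t * x + phi)) a 1); first exact: cos_lin_cont.
by move=> x; exact: cos_max.
Qed.

(** Expanding the cosine of the sum leaves the Gaussian characteristic function at t sqrt a and a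
    sine transform that vanishes. *)
Lemma gm_cos t phi a : 0 <= a -> gm (fun x => cos (t * x + phi)) a = cos phi * expR (- (t ^+ 2 / 2 * a)).
Proof.
move=> a0; rewrite /gm (normal_mean (cosb t phi a)).
pose s := t * Num.sqrt a.
have iZ (c : R) (F : R -> R) : mu.-integrable [set: R] (EFin \o F) -> mu.-integrable [set: R] (EFin \o (fun g => c * F g)).
  move=> iF; rewrite (_ : EFin \o _ = (fun g => c%:E * (EFin \o F) g)%E); first exact: integrableZl.
  by apply/funext => g; rewrite /= -EFinM.
have i1 := iZ (cos phi) _ (integrable_cosp s).
have i2' : mu.-integrable [set: R] (EFin \o (fun g : R => sin (s * g) * normal_pdf 0 1 g)).
  by apply: integrable_sin_mul; [exact: continuous_p | exact: integrable_p | move=> x; rewrite ger0_norm// normal_pdf_ge0].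
have i2 := iZ (sin phi) _ i2'.
transitivity (\int[mu]_g (cos phi * (cos (s * g) * normal_pdf 0 1 g) - sin phi * (sin (s * g) * normal_pdf 0 1 g))).
  apply: eq_Rintegral => g _; rewrite (_ : t * (Num.sqrt a * g) = s * g); last by rewrite mulrA.
  by rewrite cosD; move: (cos _) (sin _) (cos _) (sin _) (normal_pdf _ _ _) => x1 x2 x3 x4 x5; ring.
rewrite RintegralB// RintegralZl//; last exact: integrable_cosp.
rewrite RintegralZl// gauss_charfun sin_gauss_charfun mulr0 subr0; congr (_ * expR (- _)).
by rewrite /s exprMn sqr_sqrtr//; ring.
Qed.

Let cosZ_bmeas a (c t phi : R) : bmeas (fun g : R => c * cos (t * (Num.sqrt a * g) + phi)).
Proof. by apply: bmeasZ; exact: cosb. Qed.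

Lemma gm_trig (s : seq (R * R * R)) a : 0 <= a ->
  gm (fun x => \sum_(i <- s) i.1.1 * cos (i.1.2 * x + i.2)) a =
  \sum_(i <- s) i.1.1 * (cos i.2 * expR (- (i.1.2 ^+ 2 / 2 * a))).
Proof.
move=> a0; rewrite /gm (mean_sum N) => [|i]; last exact: cosZ_bmeas.
apply: eq_bigr => i _; rewrite -gm_cos// /gm RintegralZl//; apply: bmeas_integrable.
exact: cosb.
Qed.

Lemma gm_norm h a M : continuous h -> (forall x : R, `|h x| <= M) -> `|gm h a| <= M.
Proof.
move=> ch hM; have bh := gm_bmeas a ch hM.
apply: (le_trans (norm_mean (bmeas_integrable N bh))); rewrite -[leRHS](mean_cst N).
apply: le_mean => //; apply: bmeas_integrable; last exact: bmeas_cst.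
exact: bmeas_norm.
Qed.

(** A first absolute moment bound; the truncation at 1 keeps the integrand bounded, hence
    integrable. *)
Lemma normal_tail : exists2 C : R, 0 <= C & forall k : R, 0 <= k -> \int[N]_g (Num.min 1 (k * `|g|)) <= k * C.
Proof.
set G := (fun x : R => normal_peak 1 / normal_peak (Num.sqrt 2) * normal_pdf 0 (Num.sqrt 2) x : R).
have iG : mu.-integrable [set: R] (EFin \o G) by exact: integrable_G.
have G0 x : 0 <= G x by rewrite /G mulr_ge0 ?normal_pdf_ge0// divr_ge0// normal_peak_ge0.
exists (\int[mu]_x G x); first exact: Rintegral_ge0.
move=> k k0; pose q (g : R) : R := Num.min 1 (k * `|g|).
have q0 g : 0 <= q g by rewrite le_min ler01 mulr_ge0.
have bq : bmeas q.
  split; last by exists 1 => g; rewrite ger0_norm// ge_min lexx.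
  apply: measurable_minr => //; apply: measurable_funM => //; exact: measurableT_comp.
rewrite (normal_mean bq) -RintegralZl//.
have iq : mu.-integrable [set: R] (EFin \o (fun g => q g * normal_pdf 0 1 g)).
  apply: (le_integrable measurableT _ _ (@integrable_p R)).
    apply/measurable_EFinP; apply: measurable_funM; first by case: bq.
    exact: measurable_normal_pdf.
  move=> g _ /=; rewrite lee_fin normrM ler_piMl//.
  by rewrite ger0_norm// ge_min lexx.
apply: le_Rintegral => //.
  rewrite (_ : EFin \o _ = (fun x => k%:E * (EFin \o G) x)%E); last by apply/funext => x; rewrite /= -EFinM.
  exact: integrableZl.
move=> g _; apply: (@le_trans _ _ (k * `|g| * normal_pdf 0 1 g)).
  by rewrite ler_wpM2r ?normal_pdf_ge0// ge_min lexx orbT.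
rewrite -mulrA ler_wpM2l//; apply: le_trans (xpdf_le g).
by rewrite normrM (ger0_norm (normal_pdf_ge0 _ _ _)).
Qed.

Lemma trunc_bound h f M L e : (forall x : R, `|h x| <= M) -> (forall x : R, `|f x| <= M) -> 0 < L -> 0 <= e ->
  (forall x : R, `|x| <= L -> `|h x - f x| <= e) -> forall x : R, `|h x - f x| <= e + 2 * M * Num.min 1 (`|x| / L).
Proof.
move=> hM fM L0 e0 H x; have M0 : 0 <= M := le_trans (normr_ge0 _) (hM 0).
have m0 : 0 <= Num.min 1 (`|x| / L) by rewrite le_min ler01 divr_ge0// ltW.
case: (leP `|x| L) => xL.
  apply: (le_trans (H x xL)); rewrite lerDl; apply: mulr_ge0 => //; exact: mulr_ge0.
rewrite min_l; last by rewrite ler_pdivlMr// mul1r ltW.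
apply: (le_trans (ler_normB _ _)); have := hM x; have := fM x; lra.
Qed.

(** The tail beyond L costs sqrt a / L uniformly in a; as sqrt a <= 1 + a, this can be averaged over
    a random variance of finite mean. *)
Lemma gm_dist : exists2 C : R, 0 <= C & forall h f M L e, continuous h -> continuous f ->
  (forall x : R, `|h x| <= M) -> (forall x : R, `|f x| <= M) -> 0 < L -> 0 <= e ->
  (forall x : R, `|x| <= L -> `|h x - f x| <= e) ->
  forall a, `|gm h a - gm f a| <= e + 2 * M * (Num.sqrt a / L * C).
Proof.
have [C C0 HC] := normal_tail; exists C => // h f M L e ch cf hM fM L0 e0 H a.
have b1 := gm_bmeas a ch hM; have b2 := gm_bmeas a cf fM.
have M0 : 0 <= M := le_trans (normr_ge0 _) (hM 0).
rewrite /gm -RintegralB//; try exact: bmeas_integrable.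
apply: (le_trans (norm_mean (bmeas_integrable N (bmeasB b1 b2)))).
pose k := Num.sqrt a / L; have k0 : 0 <= k by rewrite divr_ge0 ?sqrtr_ge0// ltW.
have bq : bmeas (fun g : R => Num.min 1 (k * `|g|)).
  split; last first.
    by exists 1 => g; rewrite ger0_norm ?ge_min ?lexx// le_min ler01 mulr_ge0.
  apply: measurable_minr => //; apply: measurable_funM => //; exact: measurableT_comp.
apply: (@le_trans _ _ (\int[N]_g (e + 2 * M * Num.min 1 (k * `|g|)))).
  apply: le_mean; first exact/bmeas_integrable/bmeas_norm/bmeasB.
    exact/bmeas_integrable/bmeasD/bmeasZ/bq/bmeas_cst.
  move=> g; have := trunc_bound hM fM L0 e0 H (Num.sqrt a * g).
  have -> : `|Num.sqrt a * g| / L = k * `|g| by rewrite normrM (ger0_norm (sqrtr_ge0 a)) /k mulrAC.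
  by [].
rewrite meanD; last 2 first.
- exact/bmeas_integrable/bmeas_cst.
- exact/bmeas_integrable/bmeasZ.
rewrite mean_cst lerD2l RintegralZl//; last exact: bmeas_integrable.
by rewrite ler_wpM2l ?mulr_ge0//; exact: HC.
Qed.

Lemma trigp_continuous f : trigp f -> continuous f.
Proof.
move=> [s fE]; have -> : f = (fun x => \sum_(i <- s) i.1.1 * cos (i.1.2 * x + i.2)) by apply/funext.
move=> x; elim: s {fE} => [|i s IH].
  by rewrite (_ : (fun _ => _) = (fun=> 0)); [exact: cvg_cst | apply/funext => z; rewrite big_nil].
rewrite (_ : (fun _ => _) = (fun x => i.1.1 * cos (i.1.2 * x + i.2) + \sum_(j <- s) j.1.1 * cos (j.1.2 * x + j.2))).
  by apply: cvgD => //; apply: cvgM; [exact: cvg_cst | exact: cos_lin_cont].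
by apply/funext => z; rewrite big_cons.
Qed.

End gaussian_mixture.

Lemma sqrt_le1D {R : realType} (a : R) : 0 <= a -> Num.sqrt a <= 1 + a.
Proof.
move=> a0; rewrite -{2}(sqr_sqrtr a0); have := sqrtr_ge0 a; move: (Num.sqrt a) => s s0; nra.
Qed.

Lemma dist3 {R : realType} (a b a' b' u e : R) : u <= e / 3 -> `|a - b| <= u -> `|a' - b'| <= u ->
  `|b - b'| <= e / 3 -> `|a - a'| <= e.
Proof.
by rewrite !ler_norml => ? /andP[? ?] /andP[? ?] /andP[? ?]; apply/andP; split; lra.
Qed.

(** * From characteristic functions to stable convergence *)

Section stable_limit.
Context {R : realType} {d : measure_display} {T : measurableType d} (P : probability T R).
Variables (S : nat -> T -> R) (v : T -> R).
Hypothesis Sb : forall n, bmeas (S n).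
Hypothesis S2 : forall n, \int[P]_w (S n w ^+ 2) <= 1.
Hypothesis v0 : forall w, 0 <= v w.
Hypothesis mv : measurable_fun [set: T] v.
Hypothesis iv : P.-integrable [set: T] (EFin \o v).
Implicit Types (Y Z : T -> R) (h : R -> R) (n : nat).

(** The limit is the mean of Y cos (t sqrt v G + phi) with G integrated out, by [gm_cos]; the phase
    spares a second statement for sines. *)
Definition charlim Y := forall t phi : R,
  (fun n => \int[P]_w (Y w * cos (t * S n w + phi))) @ \oo -->
  \int[P]_w (Y w * (cos phi * expR (- (t ^+ 2 / 2 * v w)))).

Let contS h M n : continuous h -> (forall x : R, `|h x| <= M) -> bmeas (fun w => h (S n w)).
Proof.
move=> ch hM; split; last by exists M.
by apply: measurableT_comp; [exact: continuous_measurable_fun | case: (Sb n)].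
Qed.

Let cos_lin_cont (t phi : R) : continuous (fun x : R => cos (t * x + phi)).
Proof.
move=> x; apply: (@continuous_comp _ _ _ (fun g : R => t * g + phi) cos); last exact: continuous_cos.
by apply: cvgD; [exact: mulrl_continuous | exact: cvg_cst].
Qed.

Let cosS n (t phi : R) : bmeas (fun w => cos (t * S n w + phi)).
Proof.
apply: (@contS (fun x => cos (t * x + phi)) 1); first exact: cos_lin_cont.
by move=> x; exact: cos_max.
Qed.

Let tv0 (t : R) w : 0 <= t ^+ 2 / 2 * v w.
Proof. by rewrite mulr_ge0// divr_ge0// sqr_ge0. Qed.

Let expv01 (t : R) w : 0 <= expR (- (t ^+ 2 / 2 * v w)) <= 1.
Proof. by rewrite expR_ge0 -[leRHS]expR0 ler_expR oppr_le0 tv0. Qed.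

Let expv (t : R) : bmeas (fun w => expR (- (t ^+ 2 / 2 * v w))).
Proof.
split; last first.
  by exists 1 => w; have /andP[h1 h2] := expv01 t w; rewrite ger0_norm.
apply: (measurableT_comp (f := @expR R)); first exact: measurable_expR.
by apply: measurableT_comp => //; apply: measurable_funM.
Qed.

Let cosexpv (t phi : R) : bmeas (fun w => cos phi * expR (- (t ^+ 2 / 2 * v w))).
Proof. exact: bmeasZ. Qed.

Lemma mean_mul_dist Y Z X (M e : R) : bmeas Y -> bmeas Z -> bmeas X -> (forall w, `|X w| <= M) ->
  \int[P]_w `|Y w - Z w| <= e -> `|\int[P]_w (Y w * X w) - \int[P]_w (Z w * X w)| <= M * e.
Proof.
move=> bY bZ bX XM le; have bD := bmeasB bY bZ.
have b1 := bmeasM bY bX; have b2 := bmeasM bZ bX.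
rewrite -RintegralB//; try exact: bmeas_integrable.
apply: (le_trans (norm_mean (bmeas_integrable P (bmeasB b1 b2)))).
have M0 : 0 <= M.
  have := le_mean (bmeas_integrable P (bmeas_norm bX)) (bmeas_integrable P (bmeas_cst M)) XM.
  by rewrite mean_cst => h; apply: le_trans h; apply: Rintegral_ge0.
apply: (@le_trans _ _ (\int[P]_w (M * `|Y w - Z w|))); last first.
  by rewrite meanZ ?ler_wpM2l//; exact/bmeas_integrable/bmeas_norm.
apply: le_mean; [exact/bmeas_integrable/bmeas_norm/bmeasB | exact/bmeas_integrable/bmeasZ/bmeas_norm |] => w.
by rewrite -mulrBl normrM mulrC ler_wpM2r.
Qed.

(** Both sides are Lipschitz in Y for the L^1 norm, uniformly in n, because the functions
    multiplying Y are bounded by 1. *)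
Lemma charlim_approx Y : bmeas Y ->
  (forall e : R, 0 < e -> exists Z, [/\ bmeas Z, charlim Z & \int[P]_w `|Y w - Z w| <= e]) -> charlim Y.
Proof.
move=> bY H t phi; apply: cvgn_eps => e e0; have e3 : 0 < e / 3 by rewrite divr_gt0.
have [Z [bZ cZ YZ]] := H _ e3; have [n0 Hn] := cvgn_epsP (cZ t phi) e3.
exists n0 => n nn; have h1 := Hn n nn.
have h2 := mean_mul_dist bY bZ (cosS n t phi) (fun w => cos_max _) YZ.
have ce w : `|cos phi * expR (- (t ^+ 2 / 2 * v w))| <= 1.
  have /andP[x0 x1] := expv01 t w; rewrite normrM (ger0_norm x0) mulr_ile1//; exact: cos_max.
have h3 := mean_mul_dist bY bZ (cosexpv t phi) ce YZ.
by rewrite !mul1r in h2 h3; exact: dist3 (lexx _) h2 h3 h1.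
Qed.

Let trig_meas f : trigp f -> measurable_fun [set: T] (fun w => gm f (v w)).
Proof.
move=> [s fE]; have -> : (fun w => gm f (v w)) =
    (fun w => \sum_(i <- s) i.1.1 * (cos i.2 * expR (- (i.1.2 ^+ 2 / 2 * v w)))).
  by apply/funext => w; rewrite -gm_trig//; congr (gm _ _); apply/funext.
by apply: (proj1 (bmeas_sum s _)) => i; exact: bmeasZ.
Qed.

(** For a trigonometric polynomial the mixture is an explicit function of v; a general h is a
    pointwise limit, taking L = n + 1 and e = 1/(n + 1) in [trigp_approx]. *)
Lemma gm_meas h (M : R) : continuous h -> (forall x : R, `|h x| <= M) -> measurable_fun [set: T] (fun w => gm h (v w)).
Proof.
move=> ch hM; have [C C0 HC] := @gm_dist R.
have n0 (n : nat) : 0 < n.+1%:R :> R by rewrite ltr0n.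
have ni (n : nat) : 0 < n.+1%:R^-1 :> R by rewrite invr_gt0.
have [f Hf] := choice (fun n : nat => trigp_approx ch hM (n0 n) (ni n)).
apply: (@measurable_fun_cvg _ _ _ _ (fun n w => gm (f n) (v w))) => [n|w _].
  by have [tf _ _] := Hf n; exact: trig_meas.
have M0 : 0 <= M := le_trans (normr_ge0 _) (hM 0).
pose D : R := 1 + 2 * M * (Num.sqrt (v w) * C).
apply/cvgrPdist_le => e e0.
exists (truncn (D / e)).+1 => // n /= nn.
have [tf fM fh] := Hf n.
apply: le_trans (HC h (f n) M n.+1%:R n.+1%:R^-1 ch (trigp_continuous tf) hM fM (n0 n) (ltW (ni n)) fh (v w)) _.
have -> : n.+1%:R^-1 + 2 * M * (Num.sqrt (v w) / n.+1%:R * C) = D / n.+1%:R by rewrite /D; ring.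
rewrite ler_pdivrMr// [leRHS]mulrC -ler_pdivrMr// ltW// (lt_le_trans (truncnS_gt _))// ler_nat.
exact: leqW.
Qed.

Lemma gm_bmeas_comp h (M : R) : continuous h -> (forall x : R, `|h x| <= M) -> bmeas (fun w => gm h (v w)).
Proof.
by move=> ch hM; split; [exact: gm_meas ch hM | exists M => w; exact: gm_norm].
Qed.

Let trig_limit Y f : bmeas Y -> charlim Y -> trigp f ->
  (fun n => \int[P]_w (Y w * f (S n w))) @ \oo --> \int[P]_w (Y w * gm f (v w)).
Proof.
move=> bY cY [s fE].
have E1 n : \int[P]_w (Y w * f (S n w)) = \sum_(i <- s) i.1.1 * \int[P]_w (Y w * cos (i.1.2 * S n w + i.2)).
  transitivity (\int[P]_w (\sum_(i <- s) i.1.1 * (Y w * cos (i.1.2 * S n w + i.2)))).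
    by apply: eq_Rintegral => w _; rewrite fE mulr_sumr; apply: eq_bigr => i _; rewrite mulrCA.
  rewrite (mean_sum P) => [|i]; last exact/bmeasZ/bmeasM.
  by apply: eq_bigr => i _; rewrite meanZ//; exact/bmeas_integrable/bmeasM.
have E2 : \int[P]_w (Y w * gm f (v w)) =
    \sum_(i <- s) i.1.1 * \int[P]_w (Y w * (cos i.2 * expR (- (i.1.2 ^+ 2 / 2 * v w)))).
  transitivity (\int[P]_w (\sum_(i <- s) i.1.1 * (Y w * (cos i.2 * expR (- (i.1.2 ^+ 2 / 2 * v w)))))).
    apply: eq_Rintegral => w _; have -> : f = (fun x => \sum_(i <- s) i.1.1 * cos (i.1.2 * x + i.2)) by apply/funext.
    by rewrite gm_trig// mulr_sumr; apply: eq_bigr => i _; rewrite mulrCA.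
  rewrite (mean_sum P) => [|i]; last exact/bmeasZ/bmeasM.
  by apply: eq_bigr => i _; rewrite meanZ//; exact/bmeas_integrable/bmeasM.
rewrite E2 (_ : (fun n => _) = (fun n => \sum_(i <- s) i.1.1 * \int[P]_w (Y w * cos (i.1.2 * S n w + i.2)))); last first.
  by apply/funext => n.
elim: s {fE E1 E2} => [|i s IH].
  by rewrite big_nil (_ : (fun _ => _) = (fun=> 0)); [exact: cvg_cst | apply/funext => n; rewrite big_nil].
rewrite big_cons (_ : (fun _ => _) = (fun n => i.1.1 * \int[P]_w (Y w * cos (i.1.2 * S n w + i.2)) +
   \sum_(i <- s) i.1.1 * \int[P]_w (Y w * cos (i.1.2 * S n w + i.2)))); last by apply/funext => n; rewrite big_cons.
by apply: cvgD => //; apply: cvgM; [exact: cvg_cst | exact: cY].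
Qed.

Let mean_mul_le Y X (M e : R) : bmeas Y -> bmeas X -> (forall w, `|Y w| <= M) -> 0 <= M ->
  \int[P]_w `|X w| <= e -> `|\int[P]_w (Y w * X w)| <= M * e.
Proof.
move=> bY bX YM M0 le; apply: (le_trans (norm_mean (bmeas_integrable P (bmeasM bY bX)))).
apply: (@le_trans _ _ (\int[P]_w (M * `|X w|))); last first.
  by rewrite meanZ ?ler_wpM2l//; exact/bmeas_integrable/bmeas_norm.
apply: le_mean; [exact/bmeas_integrable/bmeas_norm/bmeasM | exact/bmeas_integrable/bmeasZ/bmeas_norm |] => w.
by rewrite normrM ler_wpM2r.
Qed.

(** Tightness from the second moment: |S|/L is at most (1 + S^2)/(2 L), whose mean is at most
    1/L. *)
Let S_dist h f (M L e : R) n : continuous h -> continuous f ->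
  (forall x : R, `|h x| <= M) -> (forall x : R, `|f x| <= M) -> 0 < L -> 0 <= e ->
  (forall x : R, `|x| <= L -> `|h x - f x| <= e) ->
  \int[P]_w `|h (S n w) - f (S n w)| <= e + 2 * M / L.
Proof.
move=> ch cf hM fM L0 e0 H; have M0 : 0 <= M := le_trans (normr_ge0 _) (hM 0).
have b1 := contS n ch hM; have b2 := contS n cf fM.
have bS : bmeas (fun w => S n w ^+ 2) by rewrite (_ : (fun _ => _) = (fun w => S n w * S n w)); [exact: bmeasM | apply/funext].
have ML : 0 <= 2 * M / L by rewrite divr_ge0 ?mulr_ge0// ltW.
apply: (@le_trans _ _ (\int[P]_w (e + 2 * M / L * (2^-1 + 2^-1 * S n w ^+ 2)))).
  apply: le_mean; first exact/bmeas_integrable/bmeas_norm/bmeasB.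
    apply/bmeas_integrable/bmeasD; first exact: bmeas_cst.
    by apply/bmeasZ/bmeasD; [exact: bmeas_cst | exact: bmeasZ].
  move=> w; apply: (le_trans (trunc_bound hM fM L0 e0 H _)); rewrite lerD2l.
  apply: (@le_trans _ _ (2 * M / L * `|S n w|)).
    rewrite -[leRHS]mulrA [_^-1 * _]mulrC; apply: ler_wpM2l; first exact: mulr_ge0.
    by rewrite ge_min lexx orbT.
  rewrite ler_wpM2l// -(real_normK (num_real (S n w))); move: (`|S n w|) => z.
  by have := sqr_ge0 (z - 1); rewrite sqrrB; lra.
rewrite meanD; last 2 first.
- exact/bmeas_integrable/bmeas_cst.
- by apply/bmeas_integrable/bmeasZ/bmeasD; [exact: bmeas_cst | exact: bmeasZ].
rewrite mean_cst lerD2l meanZ; last first.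
  by apply/bmeas_integrable/bmeasD; [exact: bmeas_cst | exact: bmeasZ].
apply: ler_piMr => //; rewrite meanD; last 2 first.
- exact/bmeas_integrable/bmeas_cst.
- exact/bmeas_integrable/bmeasZ.
rewrite mean_cst meanZ; last exact: bmeas_integrable.
by have := S2 n; move: (\int[P]_w _) => z; lra.
Qed.

Let gm_dist_mean : exists2 K : R, 0 <= K & forall h f (M L e : R), continuous h -> continuous f ->
  (forall x : R, `|h x| <= M) -> (forall x : R, `|f x| <= M) -> 0 < L -> 0 <= e ->
  (forall x : R, `|x| <= L -> `|h x - f x| <= e) ->
  \int[P]_w `|gm h (v w) - gm f (v w)| <= e + 2 * M / L * K.
Proof.
have [C C0 HC] := @gm_dist R.
have iv2 : P.-integrable [set: T] (EFin \o (fun w => 1 + v w)).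
  rewrite (_ : EFin \o _ = ((EFin \o (fun=> 1%R)) \+ (EFin \o v))%E); last by apply/funext => w; rewrite /= EFinD.
  by apply: integrableD => //; exact/bmeas_integrable/bmeas_cst.
have K0 : 0 <= C * \int[P]_w (1 + v w).
  by apply: mulr_ge0 => //; apply: Rintegral_ge0 => w _; rewrite addr_ge0.
exists (C * \int[P]_w (1 + v w)) => // h f M L e ch cf hM fM L0 e0 H.
have M0 : 0 <= M := le_trans (normr_ge0 _) (hM 0).
have ML : 0 <= 2 * M / L by rewrite divr_ge0 ?mulr_ge0// ltW.
have b1 := gm_bmeas_comp ch hM; have b2 := gm_bmeas_comp cf fM.
have iZ : P.-integrable [set: T] (EFin \o (fun w => 2 * M / L * C * (1 + v w))).
  rewrite (_ : EFin \o _ = (fun w => (2 * M / L * C)%:E * (EFin \o (fun w => (1 + v w)%R)) w)%E).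
    exact: integrableZl.
  by apply/funext => w; rewrite /= -EFinM.
apply: (@le_trans _ _ (\int[P]_w (e + 2 * M / L * C * (1 + v w)))).
  apply: le_mean; first exact/bmeas_integrable/bmeas_norm/bmeasB.
    rewrite (_ : EFin \o _ = ((EFin \o (fun=> e)) \+ (EFin \o (fun w => (2 * M / L * C * (1 + v w))%R)))%E).
      by apply: integrableD => //; exact/bmeas_integrable/bmeas_cst.
    by apply/funext => w; rewrite /= EFinD.
  move=> w; apply: (le_trans (HC h f M L e ch cf hM fM L0 e0 H (v w))); rewrite lerD2l.
  have -> : 2 * M * (Num.sqrt (v w) / L * C) = 2 * M / L * C * Num.sqrt (v w) by ring.
  rewrite ler_wpM2l ?(mulr_ge0 ML C0)//.
  exact: sqrt_le1D.
rewrite meanD//; last exact/bmeas_integrable/bmeas_cst.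
by rewrite mean_cst lerD2l meanZ// -mulrA.
Qed.

(** h is replaced by a trigonometric polynomial with the same global bound. Beyond L the error is
    controlled uniformly in n, by the second moments of S on one side and the mean of v on the
    other. *)
Theorem stable_limit_of_charlim Y h : bmeas Y -> charlim Y -> continuous h -> bounded_realfun h ->
  (fun n => \int[P]_w (Y w * h (S n w))) @ \oo --> \int[P]_w (Y w * gm h (v w)).
Proof.
move=> bY cY ch [M hM]; apply: cvgn_eps => e e0.
have M0 : 0 <= M := le_trans (normr_ge0 _) (hM 0).
have [_ [MY0 YM0]] := bY; pose MY := Num.max MY0 0.
have YM w : `|Y w| <= MY by rewrite (le_trans (YM0 w))// le_max lexx.
have MYge0 : 0 <= MY by rewrite le_max lexx orbT.
have [K K0 HK] := gm_dist_mean.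
(* Two thirds of e pay for replacing h on both sides, each at most MY times 2 q: one q for the error
   on [-L, L], one for the tail, which L is chosen to bound by q. *)
pose q : R := e / (6 * (MY + 1)).
have q0 : 0 < q by rewrite divr_gt0 ?mulr_gt0// ltr_wpDl.
pose L : R := (2 * M * (1 + K) + 1) / q.
have L0 : 0 < L by rewrite divr_gt0// ltr_wpDl// mulr_ge0 ?mulr_ge0// addr_ge0.
have [f [tf fM fh]] := trigp_approx ch hM L0 q0.
have cf := trigp_continuous tf.
have MLK : 2 * M / L * (1 + K) <= q.
  rewrite mulrAC ler_pdivrMr// /L mulrCA mulfV ?mulr1 ?gt_eqF//; lra.
have ML0 : 0 <= 2 * M / L := divr_ge0 (mulr_ge0 (ler0n R 2) M0) (ltW L0).
have MLK0 := mulr_ge0 ML0 K0.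
have MYq : MY * (2 * q) <= e / 3.
  have -> : e / 3 = (MY + 1) * (2 * q).
    by rewrite /q; field; rewrite gt_eqF// ltr_wpDl.
  by rewrite ler_wpM2r ?lerDl// mulr_ge0// ltW.
have h1 : \int[P]_w `|gm h (v w) - gm f (v w)| <= 2 * q.
  apply: (le_trans (HK h f M L q ch cf hM fM L0 (ltW q0) fh)); lra.
have e3 : 0 < e / 3 by rewrite divr_gt0.
have [n0 Hn] := cvgn_epsP (trig_limit bY cY tf) e3.
exists n0 => n nn; have h2 := Hn n nn.
have h3 : \int[P]_w `|h (S n w) - f (S n w)| <= 2 * q.
  apply: (le_trans (S_dist n ch cf hM fM L0 (ltW q0) fh)); lra.
have bh := contS n ch hM; have bf := contS n cf fM.
have gh := gm_bmeas_comp ch hM; have gf := gm_bmeas_comp cf fM.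
have d1 := mean_mul_le bY (bmeasB bh bf) YM MYge0 h3.
have d2 := mean_mul_le bY (bmeasB gh gf) YM MYge0 h1.
have E1 : \int[P]_w (Y w * (h (S n w) - f (S n w))) = \int[P]_w (Y w * h (S n w)) - \int[P]_w (Y w * f (S n w)).
  rewrite -RintegralB//; try exact/bmeas_integrable/bmeasM.
  by apply: eq_Rintegral => w _; rewrite mulrBr.
have E2 : \int[P]_w (Y w * (gm h (v w) - gm f (v w))) = \int[P]_w (Y w * gm h (v w)) - \int[P]_w (Y w * gm f (v w)).
  rewrite -RintegralB//; try exact/bmeas_integrable/bmeasM.
  by apply: eq_Rintegral => w _; rewrite mulrBr.
rewrite E1 in d1; rewrite E2 in d2; exact: dist3 MYq d1 d2 h2.
Qed.

End stable_limit.

(** * Stable convergence of the normalised sums *)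

Section rademacher_stable.
Context {R : realType} {d : measure_display} {T : measurableType d} (P : probability T R).
Notation mu := (@lebesgue_measure R).
Variables (b : nat -> T -> R) (f : nat -> R) (m : T -> {measure set R -> \bar R}).
Variables (theta c4 K4 Q : R).
Hypothesis hb : rademacher_family P b.
Hypothesis fM : multiplicative_arith f.
Hypothesis fS : supported_on_squarefree f.
Hypothesis theta0 : 0 < theta.
Hypothesis psi_asymp : forall e : R, 0 < e -> exists C : R, forall n,
  `|psi (fun p => f p ^+ 2) (pr n.+1) n - theta * n%:R| <= e * n%:R + C.
Hypothesis c40 : 0 < c4.
Hypothesis fourth : forall N, \sum_(p <- pr N) f p ^+ 4 / p%:R ^+ 2 * expR (c4 * ln p%:R) <= K4.
Hypothesis Qbound : forall N, \sum_(K <- subs (pr N)) vK f K ^+ 2 <= Q.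
Hypothesis mm : forall A : set R, measurable A -> measurable_fun [set: T] (fun w : T => (m w A : \bar R)).
Hypothesis mfin : forall w (a1 a2 : R), (m w `[a1, a2]%classic < +oo)%E.
Hypothesis mlim : forall (a1 a2 : R) (h : R -> R), {within `[a1, a2], continuous h} ->
     (fun y : nat =>
        (\int[P]_w
           ((\int[lebesgue_measure]_(s in `[a1, a2]) (h s * m_density f b y w s)
             - \int[m w]_(s in `[a1, a2]) h s) ^+ 2)%:E)%E)
     @ \oo --> 0%:E.
Implicit Types (n y N : nat) (w : T) (Phi : (nat -> R) -> R).

Local Notation SX n := (fun x => kk f n * XX f n (pr n.+1) x).

Lemma deps_sum s (c : seq nat -> R) : deps s (fun x => \sum_(A <- subs s) c A * pw x A).
Proof.
move=> x x' xx; rewrite big_seq [RHS]big_seq; apply: eq_bigr => K KN; congr (_ * _).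
by rewrite /pw big_seq [RHS]big_seq; apply: eq_bigr => p pK; apply/xx/(subs_sub KN).
Qed.

Lemma deps_SX n : deps (pr n.+1) (SX n).
Proof.
move=> x x' xx; congr (_ * _).
have E z : XX f n (pr n.+1) z = \sum_(A <- subs (pr n.+1)) (pw f A * (nn A <= n)%:R) * pw z A.
  by apply: eq_bigr => A _; rewrite mulrAC.
by rewrite !E; exact: deps_sum.
Qed.

Lemma SE n w : S_beta f b n w = SX n (b^~ w). Proof. exact: S_betaE. Qed.

Lemma S_bmeas n : bmeas (S_beta f b n).
Proof.
rewrite (_ : S_beta f b n = (fun w => SX n (b^~ w))); last by apply/funext => w; exact: SE.
exact: (cyl_bmeas_pr hb (@deps_SX n)).
Qed.

Let cylM N Phi : deps (pr N) Phi -> \int[P]_w Phi (b^~ w) = EE (pr N) Phi.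
Proof. by apply: (cyl_mean hb); [exact: pr_uniq | move=> p /pr_prime]. Qed.

(** Parseval gives B/B = 1. Where B = 0, as for n = 0, the normalisation is the inverse of 0, that
    is 0. *)
Lemma S_sqr n : \int[P]_w (S_beta f b n w ^+ 2) <= 1.
Proof.
pose Phi x := SX n x ^+ 2.
have dP : deps (pr n.+1) Phi by move=> x x' xx; rewrite /Phi (@deps_SX n _ _ xx).
rewrite (_ : \int[P]_w _ = \int[P]_w (Phi (b^~ w))); last first.
  by apply: eq_Rintegral => w _; rewrite SE.
rewrite (cylM dP).
rewrite (@eq_EE _ _ _ (fun x => kk f n ^+ 2 *
  (\sum_(A <- subs (pr n.+1)) (pw f A * (nn A <= n)%:R) * pw x A) ^+ 2)); last first.
  by move=> x _; rewrite /Phi exprMn; congr (_ * _ ^+ 2); apply: eq_bigr => K _; ring.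
rewrite EEZ parseval ?pr_uniq//.
have -> : \sum_(A <- subs (pr n.+1)) (pw f A * (nn A <= n)%:R) ^+ 2 = BB f n.
  apply: eq_bigr => A _; rewrite exprMn pw_sqr.
  by case: (_ <= _)%N; rewrite ?expr1n ?expr0n.
have B0 : 0 <= BB f n by apply: Bs_ge0 => p; exact: sqr_ge0.
rewrite /kk exprVn sqr_sqrtr//; have [->|Bn] := eqVneq (BB f n) 0; first by rewrite mulr0.
by rewrite mulVf.
Qed.

Let v := vv m.
Let V_ge0' w : 0 <= v w. Proof. exact: vv_ge0. Qed.
Let v_meas : measurable_fun [set: T] v. Proof. exact: (vv_meas mm). Qed.
Let v_int : P.-integrable [set: T] (EFin \o v). Proof. exact: (vv_int hb mm mfin mlim). Qed.

Let Vy_ge0 y w : 0 <= VV f (pr y.+1) (b^~ w).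
Proof.
have [_ ->] := VV_density f hb y w; rewrite mulr_ge0//.
  by rewrite invr_ge0 mulr_ge0// pi_ge0.
by apply: Rintegral_ge0 => s _; rewrite mulr_ge0 ?m_density_ge0// ltW// cauchy_w_gt0.
Qed.

Let exp_meas (k : R) (Z : T -> R) : 0 <= k -> (forall w, 0 <= Z w) -> measurable_fun [set: T] Z ->
  bmeas (fun w => expR (- (k * Z w))).
Proof.
move=> k0 Z0 mZ; split.
  apply: (measurableT_comp (f := @expR R)); first exact: measurable_expR.
  by apply: measurableT_comp => //; apply: measurable_funM.
exists 1 => w; rewrite ger0_norm ?expR_ge0// -[leRHS]expR0 ler_expR oppr_le0.
by rewrite mulr_ge0.
Qed.

Let exp_lip (k x y : R) : 0 <= k -> 0 <= x -> 0 <= y -> `|expR (- (k * x)) - expR (- (k * y))| <= k * `|x - y|.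
Proof.
move=> k0; wlog xy : x y / x <= y.
  move=> H x0 y0; case: (leP x y) => [/H|/ltW/H]; first exact.
  by rewrite distrC (distrC x); exact.
move=> x0 y0; have /andP[h1 h2] := expRN_lip (mulr_ge0 k0 x0) (ler_wpM2l k0 xy).
rewrite ger0_norm// (le_trans h2)// distrC ger0_norm ?subr_ge0//; lra.
Qed.

(** The order of limits: y is fixed so that [clt_cube] applies and the truncated variance is
    L^1-close to V, and n grows afterwards. The exponential is Lipschitz in the variance, so the
    second half of the error is uniform in n. *)
Lemma cylinder_charlim N Phi (M : R) : deps (pr N) Phi -> (forall x, `|Phi x| <= M) ->
  charlim P (S_beta f b) v (fun w => Phi (b^~ w)).
Proof.
move=> dP PM t phi; apply: cvgn_eps => e e0.
have M0 : 0 <= M := le_trans (normr_ge0 _) (PM (fun=> 0)).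
pose k : R := t ^+ 2 / 2; have k0 : 0 <= k by rewrite divr_ge0// sqr_ge0.
have e2 : 0 < e / 2 by rewrite divr_gt0.
have iP p : (N <= p)%N -> indep p Phi.
  by move=> Np; apply: (deps_indep dP); rewrite mem_pr ltnNge Np andbF.
have [y0 Hy] := clt_cube theta0 psi_asymp c40 fourth Qbound t phi iP (fun x _ => PM x) e2.
have MK : 0 < M * k + 1 by rewrite ltr_wpDl// mulr_ge0.
have eM : 0 < e / 2 / (M * k + 1) by rewrite divr_gt0.
have [y1 Hv] := V_L1 hb mm mfin mlim eM.
have [y [y0y y1y]] : exists y, (y0 <= y)%N /\ (y1 <= y)%N.
  by exists (maxn y0 y1); rewrite leq_maxl leq_maxr.
have [x0 Hx] := Hy y y0y; have {}Hv := Hv y y1y.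
exists (maxn x0 (maxn N y)) => n; rewrite !geq_max => /and3P[nx nN ny].
have dP' := depsS (leqW nN) dP; have Vd := @deps_sum (pr y.+1) (vK f).
have Vd' : deps (pr n.+1) (VV f (pr y.+1)) by apply: depsS Vd; rewrite ltnS.
have dE1 : deps (pr n.+1) (fun x => Phi x * cos (t * SX n x + phi)).
  by move=> x x' xx; rewrite (dP' _ _ xx) (@deps_SX n _ _ xx).
have dE2 : deps (pr n.+1) (fun x => Phi x * cos phi * expR (- (t ^+ 2 / 2 * VV f (pr y.+1) x))).
  by move=> x x' xx; rewrite (dP' _ _ xx) (Vd' _ _ xx).
have h1 := Hx n nx; rewrite -(cylM dE1) -(cylM dE2) in h1.
have E1 : \int[P]_w (Phi (b^~ w) * cos (t * S_beta f b n w + phi)) =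
    \int[P]_w ((fun x => Phi x * cos (t * SX n x + phi)) (b^~ w)).
  by apply: eq_Rintegral => w _; rewrite SE.
have bP : bmeas (fun w => Phi (b^~ w) * cos phi).
  apply: bmeasM; last exact: bmeas_cst.
  exact: (cyl_bmeas_pr hb dP).
have bV := VV_bmeas f hb y.
have bx1 := exp_meas k0 (Vy_ge0 y) (proj1 bV); have bx2 := exp_meas k0 V_ge0' v_meas.
have h2 : `|\int[P]_w (Phi (b^~ w) * cos phi * expR (- (k * VV f (pr y.+1) (b^~ w)))) -
   \int[P]_w (Phi (b^~ w) * (cos phi * expR (- (k * v w))))| <= e / 2.
  rewrite -RintegralB//; last 2 first.
  - exact/bmeas_integrable/bmeasM.
  - rewrite (_ : (fun w => _) = (fun w => Phi (b^~ w) * cos phi * expR (- (k * v w)))).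
      exact/bmeas_integrable/bmeasM.
    by apply/funext => w; rewrite mulrA.
  rewrite (_ : \int[P]_w _ = \int[P]_w (Phi (b^~ w) * cos phi * (expR (- (k * VV f (pr y.+1) (b^~ w))) - expR (- (k * v w))))); last first.
    by apply: eq_Rintegral => w _; rewrite mulrBr mulrA.
  have bD := bmeasM bP (bmeasB bx1 bx2).
  apply: (le_trans (norm_mean (bmeas_integrable P bD))).
  have iD : P.-integrable [set: T] (EFin \o (fun w => VV f (pr y.+1) (b^~ w) - v w)).
    rewrite (_ : EFin \o _ = (EFin \o (fun w => VV f (pr y.+1) (b^~ w))) \- (EFin \o v))%E.
      by apply: integrableB => //; exact: bmeas_integrable.
    by apply/funext => w; rewrite /= EFinB.
  have iN := integrable_norm iD.
  have iZ : P.-integrable [set: T] (EFin \o (fun w => M * k * `|VV f (pr y.+1) (b^~ w) - v w|)).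
    rewrite (_ : EFin \o _ = (fun w => (M * k)%:E * (EFin \o (fun w => `|(VV f (pr y.+1) (b^~ w) - v w)%R|%R)) w)%E).
      exact: integrableZl.
    by apply/funext => w; rewrite /= -EFinM.
  apply: (@le_trans _ _ (\int[P]_w (M * k * `|VV f (pr y.+1) (b^~ w) - v w|))).
    apply: le_mean => //; first exact/bmeas_integrable/bmeas_norm.
    move=> w; rewrite normrM -mulrA ler_pM//; last exact: exp_lip.
    by rewrite normrM -[leRHS]mulr1 ler_pM// cos_max.
  rewrite meanZ//; apply: (@le_trans _ _ (M * k * (e / 2 / (M * k + 1)))).
    exact: ler_wpM2l (mulr_ge0 M0 k0) _ _ Hv.
  by rewrite mulrA ler_pdivrMr// mulrC ler_wpM2l ?lerDl// ltW.
rewrite E1 (splitr e); apply: le_trans (lerD h1 h2).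
exact: ler_distD.
Qed.

Lemma F_infty_charlim Y : (forall B : set R, measurable B -> F_infty b (Y @^-1` B)) -> bounded_realfun Y ->
  bmeas Y /\ charlim P (S_beta f b) v Y.
Proof.
move=> FY bY; have [mY H] := F_infty_approximable hb FY bY; split=> //.
apply: charlim_approx => //.
- exact: S_bmeas.
- move=> e e0; have [N [Phi [M [dP PM le]]]] := H e e0.
  exists (fun w => Phi (b^~ w)); split => //; last exact: cylinder_charlim dP PM.
  exact: (cyl_bmeas_pr hb dP).
Qed.

Lemma stable_convergence Y (h : R -> R) : (forall B : set R, measurable B -> F_infty b (Y @^-1` B)) ->
  bounded_realfun Y -> continuous h -> bounded_realfun h ->
  (fun x : nat => (\int[P]_w (Y w * h (S_beta f b x w))%:E)%E) @ \oo -->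
  (\int[P]_w (\int[normal_prob 0 1]_g (Y w * h (Num.sqrt (fine (V_infty m w)) * g))%:E))%E.
Proof.
move=> FY YB ch hB; have [bY cY] := F_infty_charlim FY YB.
have lim := stable_limit_of_charlim S_bmeas S_sqr V_ge0' v_meas v_int bY cY ch hB.
have [M hM] := hB.
have E1 n : (\int[P]_w (Y w * h (S_beta f b n w))%:E)%E = (\int[P]_w (Y w * h (S_beta f b n w)))%:E.
  rewrite /Rintegral fineK//; apply: integrable_fin_num => //.
  apply: bmeas_integrable; apply: bmeasM => //; split; last by exists M.
  by apply: measurableT_comp; [exact: continuous_measurable_fun | case: (S_bmeas n)].
have E2 : (\int[P]_w (\int[normal_prob 0 1]_g (Y w * h (Num.sqrt (fine (V_infty m w)) * g))%:E))%E =
    (\int[P]_w (Y w * gm h (v w)))%:E.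
  rewrite /Rintegral fineK; last first.
    apply: integrable_fin_num => //; apply: bmeas_integrable; apply: bmeasM => //.
    exact: gm_bmeas_comp ch hM.
  apply: eq_integral => w _; rewrite -RintegralZl//; last first.
    exact/bmeas_integrable/(gm_bmeas _ ch hM).
  rewrite /Rintegral fineK//; apply: integrable_fin_num => //.
  by apply: bmeas_integrable; apply: bmeasZ; exact: gm_bmeas ch hM.
rewrite E2 (_ : (fun x => _) = (fun x => (\int[P]_w (Y w * h (S_beta f b x w)))%:E)); last first.
  by apply/funext => n; exact: E1.
by apply: cvg_EFin => //; exact: nearW.
Qed.

End rademacher_stable.

Theorem theorem1p3
  (R : realType) (d : measure_display) (T : measurableType d)
  (P : probability T R) (b : nat -> T -> R)
  (f : nat -> R) (theta c : R)
  (m : T -> {measure set R -> \bar R}) :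
  (* beta is a Rademacher random multiplicative function on (T, P) *)
  rademacher_family P b ->
  (* f multiplicative, supported on squarefree integers *)
  multiplicative_arith f -> supported_on_squarefree f ->
  (* (a) *)
  0 < theta < 2^-1 -> classP (fun n => f n ^+ 2) theta ->
  (* (b) *)
  0 < c ->
  cvgn (series (fun p : nat =>
         if prime p then `|f p| ^+ 3 / (p%:R `^ (3 / 2 - c)) else 0)) ->
  (* m is a random Radon measure, limit of m^beta_{y,infty} as in the context *)
  (forall A : set R, measurable A -> measurable_fun [set: T] (fun w : T => (m w A : \bar R))) ->
  (forall w (a1 a2 : R), (m w `[a1, a2]%classic < +oo)%E) ->
  (forall (a1 a2 : R) (h : R -> R), {within `[a1, a2], continuous h} ->
     (fun y : nat =>
        (\int[P]_w
           ((\int[lebesgue_measure]_(s in `[a1, a2]) (h s * m_density f b y w s)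
             - \int[m w]_(s in `[a1, a2]) h s) ^+ 2)%:E)%E)
     @ \oo --> 0%:E) ->
  [/\
   (* V^beta_infty is a.s. finite and strictly positive *)
   {ae P, forall w, (0%:E < V_infty m w < +oo)%E},
   (* S^beta_x --> sqrt(V) G in distribution, G ~ N(0,1) independent of V *)
   (forall h : R -> R, continuous h -> bounded_realfun h ->
      (fun x : nat => (\int[P]_w (h (S_beta f b x w))%:E)%E) @ \oo -->
      (\int[P]_w (\int[normal_prob 0 1]_g
                    (h (Num.sqrt (fine (V_infty m w)) * g))%:E))%E)
   &
   (* stable convergence *)
   (forall (Y : T -> R) (h : R -> R),
      (forall B : set R, measurable B -> F_infty b (Y @^-1` B)) -> bounded_realfun Y ->
      continuous h -> bounded_realfun h ->
      (fun x : nat => (\int[P]_w (Y w * h (S_beta f b x w))%:E)%E) @ \oo -->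
      (\int[P]_w (\int[normal_prob 0 1]_g
                    (Y w * h (Num.sqrt (fine (V_infty m w)) * g))%:E))%E)].
Proof.
move=> hb fM fS /andP[th0 th1] [hP _] c0 cvg3 mm mfin mlim.
have u0 (p : nat) : 0 <= `|f p| ^+ 3 / (p%:R `^ (3 / 2 - c)) by rewrite divr_ge0 ?exprn_ge0// powR_ge0.
have [K1 HK1] := series_pr_bound u0 cvg3.
have [ampb fourth] := fourth_moment c0 HK1.
have th1' : 0 < theta <= 1 by apply/andP; split=> //; lra.
have psi_asymp := chebyshev_psi (fun p => sqr_ge0 (f p)) th1' hP.
have [Q HQ] := vK_sqr_bound hb mm mlim.
have stable := stable_convergence hb fM fS th0 psi_asymp c0 fourth HQ mm mfin mlim.
split=> //.
- have fin := V_fin hb mm mfin mlim; have pos := V_pos hb mm mfin mlim c0 ampb.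
  by apply: filterS2 fin pos => w h1 h2; rewrite h2 /= -ge0_fin_numE// V_ge0.
(* Convergence in distribution is the stable statement with Y = 1, a constant being measurable for
   every sigma-algebra. *)
- move=> h ch hB.
  have F1 (B : set R) : measurable B -> F_infty b ((fun=> 1 : R) @^-1` B).
    move=> _; rewrite /F_infty; have [s0 sC _] := smallest_sigma_algebra setT
      [set A | exists p (B : set R), [/\ prime p, measurable B & A = b p @^-1` B]].
    have [B1|B1] := pselect (B 1).
      rewrite (_ : _ @^-1` B = setT `\` set0); first exact: sC.
      by rewrite setD0; apply/seteqP; split.
    by rewrite (_ : _ @^-1` B = set0)//; apply/seteqP; split.
  have B1 : bounded_realfun (fun _ : T => 1 : R) by exists 1 => w; rewrite normr1.
  have := stable (fun=> 1) h F1 B1 ch hB.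
  have E (x : nat) : (\int[P]_w (1 * h (S_beta f b x w))%:E)%E = (\int[P]_w (h (S_beta f b x w))%:E)%E.
    by apply: eq_integral => w _; rewrite mul1r.
  have E' : (\int[P]_w (\int[normal_prob 0 1]_g (1 * h (Num.sqrt (fine (V_infty m w)) * g))%:E))%E =
      (\int[P]_w (\int[normal_prob 0 1]_g (h (Num.sqrt (fine (V_infty m w)) * g))%:E))%E.
    by apply: eq_integral => w _; apply: eq_integral => g _; rewrite mul1r.
  by rewrite E' (_ : (fun x => _) = (fun x => (\int[P]_w (h (S_beta f b x w))%:E)%E)); last exact/funext.
Qed.
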